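(* Let $l\ge3$ be an even integer and let $u_0\in H^l(\mathbb{R}^3)$ be a vector field with $\operatorname{div}u_0=0$. Let $T_l=T(\|u_0\|_{H^l})>0$ and let $u\in L^\infty([0,T_l];H^l(\mathbb{R}^3))\cap L^2([0,T_l];H^{l+1}(\mathbb{R}^3))$ be the unique local solution of $$u_t-\nabla\cdot\big(G[|Du|^2]Du\big)+(u\cdot\nabla)u+\nabla p=0,\qquad \operatorname{div}u=0\quad\text{in }\mathbb{R}^3\times(0,T_l),\qquad u(\cdot,0)=u_0 .$$ Then $u\in C_x^{l-2,\frac12}C_t^{\frac{l-2}{2},\frac14}(\mathbb{R}^3\times(0,T_l))$.
   Context: The unknowns are $u:\mathbb{R}^3\times(0,T)\to\mathbb{R}^3$ (velocity) and $p:\mathbb{R}^3\times(0,T)\to\mathbb{R}$ (pressure). $Du$ is the symmetric gradient, $D_{ij}u=\frac12\big(\frac{\partial u_i}{\partial x_j}+\frac{\partial u_j}{\partial x_i}\big)$, and $|Du|^2=\sum_{i,j}(D_{ij}u)^2$. Standing assumption on $G$: $G:[0,\infty)\to[0,\infty)$ is infinitely differentiable and there are positive constants $m_0$ and $C_k$ ($k\ge1$) such that for every $s\in[0,\infty)$: $G[s]\ge m_0>0$; $G[s]+2G'[s]s\ge m_0>0$; and $|G^{(k)}[s]s^\alpha|\le C_k|G^{(k-1)}[s]|$ for $\alpha\in\{0,1\}$ and all integers $k\ge1$, where $G^{(k)}$ is the $k$-th derivative of $G$. For every integer $l\ge3$ and divergence-free $u_0\in H^l(\mathbb{R}^3)$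 there is a time $T_l>0$, depending on $\|u_0\|_{H^l}$ (and on $l$, $G$), such that this Cauchy problem has a unique solution $u$ in $L^\infty([0,T_l];H^l)\cap L^2([0,T_l];H^{l+1})$; this is the solution referred to. (A solution is a divergence-free $u$ in this class which, with some pressure $p$, satisfies the equation in the sense of distributions and attains the initial value $u_0$ at $t=0$.) Hölder spaces: for $\alpha\in(0,1)$, $C^\alpha_xC^{\alpha/2}_t$ is the space of functions Hölder continuous with exponent $\alpha$ in $x$ and $\alpha/2$ in $t$. For an integer $k\ge0$, $C_x^{2k,\alpha}C_t^{k,\alpha/2}$ is the space of functions $u$ such that $\nabla_x^{2(i-j)}\partial_t^ju\in C^\alpha_xC^{\alpha/2}_t$ for all integers $i,j$ with $0\le j\le i\le k$. Here $k=\frac{l-2}{2}$ and $\alpha=\frac12$. *)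

(* Defs.v *)
From HB Require Import structures.
From mathcomp Require Import all_boot all_order all_algebra.
From mathcomp Require Import all_classical all_reals all_analysis.
Set Implicit Arguments.
Unset Strict Implicit.
Unset Printing Implicit Defensive.
Import Order.TTheory GRing.Theory Num.Theory.
Import numFieldNormedType.Exports.
Local Open Scope classical_set_scope.
Local Open Scope ring_scope.

(* Derivatives on [0, +oo[: for 0 <= s the increment h ranges over
   s + h >= 0, so the derivative is one-sided at s = 0 and only values on
   [0, +oo[ are used. *)
Definition nonneg_quotient (R : realType) (f : R -> R) (s : R) : set_system R :=
  (fun h => h^-1 * (f (s + h) - f s)) @ within [set h | 0 <= s + h] 0^'.

Definition nonneg_derive (R : realType) (f : R -> R) (s : R) : R :=
  lim (nonneg_quotient f s).

Definition nonneg_derive_n (R : realType) (k : nat) (f : R -> R) : R -> R :=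
  iter k (@nonneg_derive R) f.

Definition admissible_viscosity (R : realType) (G : R -> R) : Prop :=
  [/\ forall s : R, 0 <= s -> 0 <= G s,
      forall (k : nat) (s : R), 0 <= s ->
        cvg (nonneg_quotient (nonneg_derive_n k G) s)
    & exists (m0 : R) (C : nat -> R),
      [/\ 0 < m0, forall k : nat, (1 <= k)%N -> 0 < C k
        & forall s : R, 0 <= s ->
          [/\ m0 <= G s,
              m0 <= G s + 2 * nonneg_derive G s * s
            & forall k alpha : nat, (1 <= k)%N -> (alpha <= 1)%N ->
              `|nonneg_derive_n k G s * s ^+ alpha|
                <= C k * `|nonneg_derive_n k.-1 G s| ]]].

(* Iterated classical directional derivatives; the last direction of the list
   is differentiated first. *)
Fixpoint pderiv (R : realType) (V : normedModType R) (vs : seq V)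
    (f : V -> R) : V -> R :=
  if vs is v :: vs' then fun x => 'D_v (pderiv vs' f : V -> R^o) x else f.

Fixpoint pderivable_on (R : realType) (V : normedModType R) (U : set V)
    (vs : seq V) (f : V -> R) : Prop :=
  if vs is v :: vs' then
    pderivable_on U vs' f /\
    (forall x, U x -> derivable (pderiv vs' f : V -> R^o) x v)
  else True.

Definition smooth (R : realType) (V : normedModType R) (f : V -> R) : Prop :=
  forall (vs : seq V) (x : V), differentiable (pderiv vs f : V -> R^o) x.

Definition test_function (R : realType) (V : normedModType R) (U : set V)
    (phi : V -> R) : Prop :=
  smooth phi /\
  exists K : set V,
    [/\ compact K, K `<=` U & forall x, ~ K x -> phi x = 0].

(* The norm of these product types is the max norm, which is equivalent to the
   Euclidean one. *)
Notation E3 R := (R * R * R)%type.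
Notation E3t R := (R * R * R * R)%type.

Definition leb3 (R : realType) :
    {measure set (E3 (measurableTypeR R)) -> \bar R} :=
  (@lebesgue_measure R \x @lebesgue_measure R \x @lebesgue_measure R)%E.

Definition leb4 (R : realType) :
    {measure set (E3t (measurableTypeR R)) -> \bar R} :=
  (leb3 R \x @lebesgue_measure R)%E.

Definition slab (R : realType) (T : R) : set (E3t R) :=
  [set z | 0 < z.2 < T].

Definition basis3 (R : realType) (i : 'I_3) : E3 R :=
  ((i == 0 :> nat)%:R, (i == 1 :> nat)%:R, (i == 2 :> nat)%:R).

Definition dir_x (R : realType) (i : 'I_3) : E3t R := (basis3 R i, 0).
Definition dir_t (R : realType) : E3t R := (0, 1).

Definition locally_integrable3 (R : realType) (f : E3 R -> R) : Prop :=
  forall K : set (E3 R), compact K -> (leb3 R).-integrable K (EFin \o f).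

(* A list s = [:: i1; ...; ik] stands for the derivative d_{i1} ... d_{ik}. *)
Definition is_weak_deriv (R : realType) (s : seq 'I_3) (f g : E3 R -> R) :
    Prop :=
  [/\ locally_integrable3 f, locally_integrable3 g
    & forall phi : E3 R -> R, test_function [set: E3 R] phi ->
        \int[leb3 R]_x (f x * pderiv (map (basis3 R) s) phi x)
        = (-1) ^+ size s * \int[leb3 R]_x (g x * phi x)].

(* A representative of the weak derivative (0 if there is none); it is
   determined up to a null set. *)
Definition weak_deriv (R : realType) (s : seq 'I_3) (f : E3 R -> R) :
    E3 R -> R :=
  xget (fun=> 0) [set g | is_weak_deriv s f g].

Definition sobolev (R : realType) (l : nat) : set (E3 R -> R) :=
  [set f | measurable_fun [set: E3 R] f /\
    forall s : seq 'I_3, (size s <= l)%N ->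
      is_weak_deriv s f (weak_deriv s f) /\
      (\int[leb3 R]_x ((weak_deriv s f x) ^+ 2)%:E < +oo)%E].

(* \sum_{k <= l} |nabla^k f|^2_{L^2} *)
Definition sobolev_sqnorm (R : realType) (l : nat) (f : E3 R -> R) :
    \bar R :=
  (\sum_(k < l.+1) \sum_(s : k.-tuple 'I_3)
    \int[leb3 R]_x ((weak_deriv s f x) ^+ 2)%:E)%E.

Definition sobolev_field (R : realType) (l : nat) (w : 'I_3 -> E3 R -> R) :
    Prop :=
  forall i, sobolev l (w i).

Definition sobolev_field_sqnorm (R : realType) (l : nat)
    (w : 'I_3 -> E3 R -> R) : \bar R :=
  (\sum_i sobolev_sqnorm l (w i))%E.

Definition divergence_free (R : realType) (w : 'I_3 -> E3 R -> R) : Prop :=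
  {ae leb3 R, forall x, \sum_i weak_deriv [:: i] (w i) x = 0}.

Definition sym_grad (R : realType) (w : 'I_3 -> E3 R -> R) (i j : 'I_3)
    (x : E3 R) : R :=
  2^-1 * (weak_deriv [:: j] (w i) x + weak_deriv [:: i] (w j) x).

Definition sym_grad_sq (R : realType) (w : 'I_3 -> E3 R -> R)
    (x : E3 R) : R :=
  \sum_i \sum_j sym_grad w i j x ^+ 2.

Definition at_time (R : realType) (u : 'I_3 -> E3t R -> R) (t : R) :
    'I_3 -> E3 R -> R :=
  fun i x => u i (x, t).

(* L^oo([0,T]; H^l) and L^2([0,T]; H^l): by Pettis' theorem, as H^l is
   separable, strong measurability in t amounts to joint measurability. *)
Definition Linfty_sobolev (R : realType) (T : R) (l : nat)
    (u : 'I_3 -> E3t R -> R) : Prop :=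
  (forall i, measurable_fun (slab T) (u i)) /\
  exists M : R, {ae @lebesgue_measure R, forall t, 0 < t < T ->
    sobolev_field l (at_time u t) /\
    (sobolev_field_sqnorm l (at_time u t) <= M%:E)%E}.

Definition L2_sobolev (R : realType) (T : R) (l : nat)
    (u : 'I_3 -> E3t R -> R) : Prop :=
  [/\ forall i, measurable_fun (slab T) (u i),
      {ae @lebesgue_measure R, forall t, 0 < t < T ->
        sobolev_field l (at_time u t)}
    & (\int[@lebesgue_measure R]_(t in `]0%R, T[)
        sobolev_field_sqnorm l (at_time u t) < +oo)%E].

Definition pressure_function (R : realType) (T : R) (p : E3t R -> R) :
    Prop :=
  forall K : set (E3t R), compact K -> K `<=` slab T ->
    (leb4 R).-integrable K (EFin \o p).

(* u_t - div (G[|Du|^2] Du) + (u . nabla) u + nabla p = 0 tested against phi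
   in each component; the derivatives of the second and fourth terms fall on
   phi. *)
Definition momentum_equation (R : realType) (G : R -> R) (T : R)
    (u : 'I_3 -> E3t R -> R) (p : E3t R -> R) : Prop :=
  forall (i : 'I_3) (phi : E3t R -> R), test_function (slab T) phi ->
    \int[@lebesgue_measure R]_(t in `]0, T[) \int[leb3 R]_x
      (- (u i (x, t) * pderiv [:: dir_t R] phi (x, t))
       + \sum_j G (sym_grad_sq (at_time u t) x) * sym_grad (at_time u t) i j x
                * pderiv [:: dir_x R j] phi (x, t)
       + \sum_j u j (x, t) * weak_deriv [:: j] (at_time u t i) x * phi (x, t)
       - p (x, t) * pderiv [:: dir_x R i] phi (x, t)) = 0.

(* u(t) -> u0 in L^2 as t -> 0+, u being defined for a.e. t only *)
Definition attains_initial (R : realType) (T : R) (u0 : 'I_3 -> E3 R -> R)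
    (u : 'I_3 -> E3t R -> R) : Prop :=
  forall eps : R, 0 < eps -> exists2 delta : R, 0 < delta &
    {ae @lebesgue_measure R, forall t, 0 < t < T -> t < delta ->
      (\sum_i \int[leb3 R]_x ((u i (x, t) - u0 i x) ^+ 2)%:E <= eps%:E)%E}.

Record cauchy_solution (R : realType) (G : R -> R) (l : nat) (T : R)
    (u0 : 'I_3 -> E3 R -> R) (u : 'I_3 -> E3t R -> R) : Prop := {
  solution_Linfty : Linfty_sobolev T l u;
  solution_L2 : L2_sobolev T l.+1 u;
  solution_div : {ae @lebesgue_measure R, forall t, 0 < t < T ->
    divergence_free (at_time u t)};
  solution_momentum : exists2 p : E3t R -> R,
    pressure_function T p & momentum_equation G T u p;
  solution_initial : attains_initial T u0 u }.

Definition hoelder_xt (R : realType) (alpha T : R) (f : E3t R -> R) :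
    Prop :=
  exists C : R,
    (forall z, slab T z -> `|f z| <= C) /\
    (forall z w, slab T z -> slab T w ->
      `|f z - f w| <=
        C * (`|z.1 - w.1| `^ alpha + `|z.2 - w.2| `^ (alpha / 2))).

(* C_x^{2k,alpha} C_t^{k,alpha/2} on R^3 x (0,T) *)
Definition parabolic_hoelder (R : realType) (k : nat) (alpha T : R)
    (f : E3t R -> R) : Prop :=
  forall i j : nat, (j <= i <= k)%N ->
    forall s : (2 * (i - j)).-tuple 'I_3,
      let vs := map (dir_x R) s ++ nseq j (dir_t R) in
      pderivable_on (slab T) vs f /\ hoelder_xt alpha T (pderiv vs f).

(* Membership of a class of functions modulo null sets. *)
Definition field_in_parabolic_hoelder (R : realType) (k : nat) (alpha T : R)
    (u : 'I_3 -> E3t R -> R) : Prop :=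
  exists v : 'I_3 -> E3t R -> R,
    forall i, {ae leb4 R, forall z, slab T z -> u i z = v i z} /\
              parabolic_hoelder k alpha T (v i).

(* Main.v *)
(** After removal of a null set of times, almost every slice of u has l weak derivatives in L^2, bounded
    uniformly in t. In dimension three, two derivatives in L^2 control the sup norm and the Hoelder-1/2
    seminorm (both follow from Hardy's inequality), so u and its gradient have bounded, jointly
    measurable representatives. Mollify u in space and time. The mollified equation reads
    d_t u + grad p = F with F = div (G[|Du|^2] Du) - (u . grad) u. A gradient is L^2-orthogonal to
    d_t u, which is divergence free, so the norm of d_t u is at most that of F; this uses only that
    F - d_t u has zero curl, never the regularity of the pressure. Since F costs two space derivatives,
    induction on j bounds all derivatives nabla^k d_t^j of the mollified u with k + 2j <= l in L^2(dx),
    uniformly in t and in the mollification parameter, away from the end times; products and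
    compositions with G stay in this scale because at most one factor needs to be estimated in L^2.
    For k + 2j <= l - 2, two space derivatives and one time derivative are left: they give uniform
    bounds and uniform Hoelder continuity of exponent 1/2 in x and, by interpolation with the L^2 bound on the time increment, of
    exponent 1/4 in t. The limit of the mollified functions is the required representative. *)

Require Import Defs.
From HB Require Import structures.
From mathcomp Require Import all_boot all_order all_algebra.
From mathcomp Require Import all_classical all_reals all_analysis.
From mathcomp Require Import measurable_realfun lebesgue_integral_fubini.
From mathcomp Require Import zify ring lra.
Set Implicit Arguments.
Unset Strict Implicit.
Unset Printing Implicit Defensive.
Import Order.TTheory GRing.Theory Num.Theory.
Import numFieldNormedType.Exports.
Local Open Scope classical_set_scope.
Local Open Scope ring_scope.

(** * Product measures and integral inequalities *)

(** The obstacle is the nonlinear term: mollification does not commute with G[|Du|^2]Du, and the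
    solution has no classical time derivative to start from. The nonlinear expressions are therefore
    formed from mollified fields, where the chain rule is classical. Such families converge in
    L^1_loc to the true nonlinear terms, and integration by parts against the kernel carries their
    derivative bounds over to the mollified true terms, so no commutator is ever estimated. The
    pressure leaves through the choice of test function: component i tested with a kernel
    differentiated along m, and component m with one differentiated along i, contain the same
    pressure integral. A curl-free L^2 field need not have a potential in L^2, which is why
    orthogonality is proved by translating one field to infinity. The gradient has weight l - 1, and
    products of that weight stay in the scale when l - 1 >= 3; parity turns l >= 3 into l >= 4.
    Cubes have side s^2 rather than s, so that the exponents 1/2 and 1/4 appear as integer powers of
    s. *)

Section sigma_finite_product.
Context d1 d2 (T1 : measurableType d1) (T2 : measurableType d2) (R : realType)
  (m1 : {sigma_finite_measure set T1 -> \bar R})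
  (m2 : {sigma_finite_measure set T2 -> \bar R}).

(* The library's own instance on [m1 \x m2] is shadowed by the one for
   probabilities; this alias restores it. *)
Definition sprod : set (T1 * T2) -> \bar R := (m1 \x m2)%E.

HB.instance Definition _ := Measure.copy sprod (m1 \x m2)%E.

Let sprod_sigma_finite : sigma_finite setT sprod.
Proof.
have [F TF Foo] := sigma_finiteT m1; have [G TG Goo] := sigma_finiteT m2.
exists (fun n => let kl := odflt (0, 0)%N (unpickle n) in F kl.1 `*` G kl.2).
  apply/esym/seteqP; split => // -[x y] _.
  have [i _ Fx] : (\bigcup_i F i) x by rewrite -TF.
  have [j _ Gy] : (\bigcup_i G i) y by rewrite -TG.
  by exists (pickle (i, j)) => //=; rewrite pickleK.
move=> n /=; set kl := odflt _ _; have [mF Fk] := Foo kl.1.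
have [mG Gk] := Goo kl.2; split; first exact: measurableX.
rewrite /sprod product_measure1E// lte_mul_pinfty// ge0_fin_numE//.
Qed.

HB.instance Definition _ :=
  Measure_isSigmaFinite.Build _ _ _ sprod sprod_sigma_finite.

End sigma_finite_product.

(** * Changes of variables with constant Jacobian *)

Section scaling_maps.
Local Open Scope ereal_scope.
Context d (T : measurableType d) (R : realType) (m : {measure set T -> \bar R}).

(** The constant [c] is the inverse of the Jacobian of [h]. Stating the change of variables on
    nonnegative measurable integrands rather than on sets lets it compose and pass to products by
    Tonelli alone. *)
Definition scales_measure (c : R) (h : T -> T) : Prop :=
  [/\ measurable_fun setT h, (0 < c)%R &
   forall f : T -> \bar R, measurable_fun setT f -> (forall x, 0 <= f x) ->
     \int[m]_x f (h x) = c%:E * \int[m]_x f x].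

Lemma scales_measure_comp c1 c2 h1 h2 : scales_measure c1 h1 ->
  scales_measure c2 h2 -> scales_measure (c1 * c2)%R (h2 \o h1).
Proof.
move=> [mh1 c10 E1] [mh2 c20 E2]; split.
- exact: measurableT_comp.
- exact: mulr_gt0.
- move=> f mf f0; rewrite (E1 (f \o h2))//=; last exact: measurableT_comp.
  by rewrite E2// EFinM muleA.
Qed.

Lemma scales_integrable c h (f : T -> R) : scales_measure c h ->
  m.-integrable setT (EFin \o f) -> m.-integrable setT (EFin \o (f \o h)).
Proof.
move=> [mh c0 E] /integrableP[mf fi]; apply/integrableP; split.
  by apply: (@measurableT_comp _ _ _ _ _ _ (EFin \o f)) => //.
rewrite (E (fun x => `|(f x)%:E|)) //; last exact: measurableT_comp.
by rewrite lte_mul_pinfty// ?lee_fin ?ltW.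
Qed.

Lemma scales_Rintegral c h (f : T -> R) : scales_measure c h ->
  m.-integrable setT (EFin \o f) ->
  (\int[m]_x f (h x) = c * \int[m]_x f x)%R.
Proof.
move=> ch fi; have [mh c0 E] := ch; have fhi := scales_integrable ch fi.
have mf : measurable_fun setT (EFin \o f) by case/integrableP : fi.
rewrite /Rintegral -[LHS]/(fine (\int[m]_x ((EFin \o (f \o h)) x))).
rewrite -[in RHS]/(fine (\int[m]_x ((EFin \o f) x))).
rewrite integralE [in RHS]integralE.
have -> : \int[m]_x (EFin \o (f \o h))^\+ x = c%:E * \int[m]_x (EFin \o f)^\+ x.
  rewrite -(E _ (measurable_funepos mf) (funepos_ge0 _)).
  by apply: eq_integral => x _; rewrite compA funepos_comp.
have -> : \int[m]_x (EFin \o (f \o h))^\- x = c%:E * \int[m]_x (EFin \o f)^\- x.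
  rewrite -(E _ (measurable_funeneg mf) (funeneg_ge0 _)).
  by apply: eq_integral => x _; rewrite compA funeneg_comp.
have p1 : \int[m]_x (EFin \o f)^\+ x \is a fin_num.
  by apply: integrable_fin_num => //; exact: integrable_funepos.
have p2 : \int[m]_x (EFin \o f)^\- x \is a fin_num.
  by apply: integrable_fin_num => //; exact: integrable_funeneg.
by rewrite -(fineK p1) -(fineK p2) -!EFinM -!EFinB/= mulrBr.
Qed.

End scaling_maps.

Section product_integrals.
Local Open Scope ereal_scope.
Context d1 d2 (T1 : measurableType d1) (T2 : measurableType d2) (R : realType)
  (m1 : {sigma_finite_measure set T1 -> \bar R})
  (m2 : {sigma_finite_measure set T2 -> \bar R}).

Lemma sprod_tonelli1 (f : T1 * T2 -> \bar R) : measurable_fun setT f ->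
  (forall z, 0 <= f z) ->
  \int[sprod m1 m2]_z f z = \int[m1]_x \int[m2]_y f (x, y).
Proof. exact: fubini_tonelli1. Qed.

Lemma sprod_tonelli2 (f : T1 * T2 -> \bar R) : measurable_fun setT f ->
  (forall z, 0 <= f z) ->
  \int[sprod m1 m2]_z f z = \int[m2]_y \int[m1]_x f (x, y).
Proof. exact: fubini_tonelli2. Qed.

Lemma scales_sprod c1 c2 h1 h2 : scales_measure m1 c1 h1 ->
  scales_measure m2 c2 h2 ->
  scales_measure (sprod m1 m2) (c1 * c2) (fun z => (h1 z.1, h2 z.2)).
Proof.
move=> [mh1 c10 E1] [mh2 c20 E2].
have mh : measurable_fun setT (fun z : T1 * T2 => (h1 z.1, h2 z.2)).
  by apply: measurable_fun_pair; exact: measurableT_comp.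
split => //; first exact: mulr_gt0.
move=> f mf f0; rewrite sprod_tonelli1//; last exact: measurableT_comp.
rewrite [in RHS]sprod_tonelli1//=.
pose F x := \int[m2]_y f (x, y).
have mF : measurable_fun setT F.
  exact: measurable_fun_fubini_tonelli_F mf f0.
have F0 x : 0 <= F x by exact: integral_ge0.
have mFh : measurable_fun setT (F \o h1).
  exact: (measurableT_comp mF mh1).
transitivity (\int[m1]_x (c2%:E * (F \o h1) x)).
  apply: eq_integral => x _; rewrite (E2 (fun y => f (h1 x, y)))//.
  by apply: measurableT_comp => //; exact: measurable_pair1.
rewrite (ge0_integralZl m1 measurableT mFh); last 2 first.
- by move=> x _; exact: F0.
- by rewrite lee_fin ltW.
rewrite (E1 (F) mF F0).
by rewrite muleA -EFinM mulrC.
Qed.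

End product_integrals.

Section euclidean_measures.
Context (R : realType).

Definition mu1 : {sigma_finite_measure set (measurableTypeR R) -> \bar R} :=
  @lebesgue_measure R.
Definition mu3 : {sigma_finite_measure set (E3 (measurableTypeR R)) -> \bar R} :=
  sprod (sprod mu1 mu1) mu1.
Definition mu4 : {sigma_finite_measure set (E3t (measurableTypeR R)) -> \bar R} :=
  sprod mu3 mu1.

Lemma mu1E A : mu1 A = @lebesgue_measure R A. Proof. by []. Qed.
Lemma leb3E : leb3 R = mu3. Proof. by []. Qed.

(** The image of Lebesgue measure under x -> b + a x, multiplied by a, has the right mass on
    half-open intervals, and these determine Lebesgue measure. *)
Lemma scales_affine1 (a b : R) : 0 < a ->
  scales_measure mu1 a^-1 (fun x : measurableTypeR R => b + a * x).
Proof.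
move=> a0; pose h := fun x : measurableTypeR R => b + a * x : measurableTypeR R.
have mh : measurable_fun setT h.
  by apply: measurable_funD => //; exact: measurable_funM.
split => //; first by rewrite invr_gt0.
move=> f mf f0; pose aN := NngNum (ltW a0).
have muE A : measurable A -> mu1 A = mscale aN (pushforward mu1 h) A.
  move=> mA; apply: lebesgue_measure_unique => //= _ [[x y]] _ <-.
  rewrite /mscale/= /pushforward.
  have -> : h @^-1` [set` `]x, y]] = [set` `]((x - b) / a), ((y - b) / a)]].
    apply/seteqP; split => z /=; rewrite !in_itv/= /h.
      by rewrite ltr_pdivrMr// ler_pdivlMr// ltrBlDl lerBrDl mulrC.
    by rewrite ltr_pdivrMr// ler_pdivlMr// ltrBlDl lerBrDl mulrC.
  rewrite /mu1 !lebesgue_measure_itv/= !lte_fin ltr_pM2r ?invr_gt0// ltrD2r.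
  case: ifPn => xy; last by rewrite mule0.
  rewrite -!EFinB -EFinM; congr EFin; field; exact: lt0r_neq0.
have -> : (\int[mu1]_x f x = \int[mscale aN (pushforward mu1 h)]_x f x)%E.
  by move=> mh'; apply: eq_measure_integral => A mA _; exact: muE.
rewrite ge0_integral_mscale//= (ge0_integral_pushforward mh)//.
rewrite muleA -EFinM mulVf ?lt0r_neq0// mul1e; exact: eq_integral.
Qed.

Lemma scales_reflect1 (b : R) :
  scales_measure mu1 1 (fun x : measurableTypeR R => b - x).
Proof.
have -> : (fun x : measurableTypeR R => b - x) =
    (fun x : measurableTypeR R => b + 1 * x) \o (fun x : measurableTypeR R => - x).
  by apply/funext => x/=; rewrite mul1r.
rewrite -[1 in X in scales_measure _ X]mul1r -[X in _ (_ * X)]invr1.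
apply: scales_measure_comp; last exact: scales_affine1.
have mN : measurable_fun setT (fun x : measurableTypeR R => - x).
  by apply: oppr_measurable.
split => // f mf f0; rewrite mul1e.
pose h : measurableTypeR R -> measurableTypeR R := fun x => - x.
transitivity (\int[pushforward mu1 h]_x f x)%E.
  have mh : measurable_fun setT h by exact: mN.
  by rewrite (ge0_integral_pushforward mh).
by apply: eq_measure_integral => A mA _; exact: lebesgue_measureN.
Qed.

Lemma scales_affine3 (a : R) (b : E3 R) : 0 < a ->
  scales_measure mu3 (a ^- 3) (fun x : E3 (measurableTypeR R) => b + a *: x).
Proof.
move=> a0; have := scales_sprod (scales_sprod (scales_affine1 b.1.1 a0)
  (scales_affine1 b.1.2 a0)) (scales_affine1 b.2 a0).
by rewrite -!exprVn !exprS expr0 mulr1 mulrA; case: b => [[]].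
Qed.

Lemma scales_shift3 (b : E3 R) :
  scales_measure mu3 1 (fun x : E3 (measurableTypeR R) => b + x).
Proof.
have := scales_affine3 b ltr01; rewrite expr1n invr1.
by under eq_fun do rewrite scale1r.
Qed.

Lemma scales_reflect3 (b : E3 R) :
  scales_measure mu3 1 (fun x : E3 (measurableTypeR R) => b - x).
Proof.
have := scales_sprod (scales_sprod (scales_reflect1 b.1.1)
  (scales_reflect1 b.1.2)) (scales_reflect1 b.2).
by rewrite !mulr1; case: b => [[]].
Qed.

Lemma scales_shift4 (b : E3t R) :
  scales_measure mu4 1 (fun x : E3t (measurableTypeR R) => b + x).
Proof.
have := scales_sprod (scales_shift3 b.1) (scales_affine1 b.2 ltr01).
by under eq_fun do rewrite mul1r; rewrite invr1 mulr1; case: b => [[]].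
Qed.

Lemma scales_reflect4 (b : E3t R) :
  scales_measure mu4 1 (fun x : E3t (measurableTypeR R) => b - x).
Proof.
have := scales_sprod (scales_reflect3 b.1) (scales_reflect1 b.2).
by rewrite !mulr1; case: b => [[]].
Qed.

End euclidean_measures.

(** * Joint measurability of continuous functions on products *)

Section caratheodory_functions.
Local Open Scope classical_set_scope.
Context d (T : measurableType d) (R : realType).

(** Replacing t by the grid point of mesh 1/(n+1) just below it gives functions that are measurable
    strip by strip, with countably many strips, and continuity in t makes them converge pointwise to
    f. Applied to one coordinate at a time, this relates continuity on [E3] and [E3t] to their
    product sigma-algebras. *)
Lemma measurable_fun_sepcont (f : T * measurableTypeR R -> R) :
  (forall t : R, measurable_fun setT (fun x => f (x, t))) ->
  (forall x, continuous (fun t : R => f (x, t))) ->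
  measurable_fun setT f.
Proof.
move=> mf cf.
pose g (n : nat) (t : R) : R := (Num.floor (n.+1%:R * t))%:~R / n.+1%:R.
have gt (t : R) : (fun n => g n t) @ \oo --> t.
  have h0 (n : nat) : (0 : R) < n.+1%:R by rewrite ltr0n.
  apply: (@squeeze_cvgr _ _ _ _ (fun n => t - n.+1%:R^-1) (fun n => t)).
  - apply: nearW => n; rewrite /g; apply/andP; split.
      rewrite ler_pdivlMr// mulrBl mulVf ?lt0r_neq0// lerBlDr mulrC.
      by rewrite -[X in _ + X]/(1%:~R) -intrD ltW// lt_succ_floor.
    by rewrite ler_pdivrMr// mulrC floor_le_tmp.
  - rewrite -[X in _ --> X]subr0; apply: cvgB; first exact: cvg_cst.
    exact: cvg_harmonic.
  - exact: cvg_cst.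
apply: (@measurable_fun_cvg _ _ _ setT (fun (n : nat) (z : T * measurableTypeR R) => f (z.1, g n z.2)) f) => //.
  move=> n _ A mA; rewrite setTI.
  have -> : (fun z => f (z.1, g n z.2)) @^-1` A =
      \bigcup_(k : int) (((fun x => f (x, k%:~R / n.+1%:R)) @^-1` A) `*`
        [set t : R | Num.floor (n.+1%:R * t) = k]).
    apply/seteqP; split => [[x t] /= Axt|[x t] [k _ /= [Ax kE]]];
      last by rewrite /preimage/= /g kE.
    by exists (Num.floor (n.+1%:R * t)).
  apply: countable_bigcupT_measurable => // k; apply: measurableX.
    by rewrite -[X in measurable X]setTI; exact: mf.
  have -> : [set t : R | Num.floor (n.+1%:R * t) = k] =
      `[k%:~R / n.+1%:R, (k + 1)%:~R / n.+1%:R[%classic.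
    apply/seteqP; split => t /=; rewrite in_itv/=.
      move=> <-; rewrite ler_pdivrMr ?ltr_pdivlMr ?ltr0n// !(mulrC t).
      by rewrite floor_le_tmp lt_succ_floor.
    rewrite ler_pdivrMr ?ltr_pdivlMr ?ltr0n// !(mulrC t) => /andP[h1 h2].
    by apply/eqP; rewrite floor_eq h1 h2.
  exact: measurable_itv.
move=> [x t] _ /=.
exact: (@cvg_comp _ _ _ (g ^~ t) (fun s : R => f (x, s)) \oo (nbhs t) (nbhs (f (x, t))) (gt t) (cf x t)).
Qed.

End caratheodory_functions.

Lemma continuous_pair (T U V : topologicalType) (f : T -> U) (g : T -> V) :
  continuous f -> continuous g -> continuous (fun x => (f x, g x)).
Proof.
move=> cf cg x.
exact: (@cvg_pair _ _ _ (nbhs x) (nbhs (f x)) (nbhs (g x)) _ _ _ _ _ (cf x) (cg x)).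
Qed.

Lemma continuous_compT (T U V : topologicalType) (f : T -> U) (g : U -> V) :
  continuous f -> continuous g -> continuous (fun x => g (f x)).
Proof. by move=> cf cg x; apply: continuous_comp; [exact: cf|exact: cg]. Qed.

Section continuous_measurable.
Context (R : realType).

Lemma continuous_measurable1 (f : R -> R) : continuous f ->
  measurable_fun (setT : set (measurableTypeR R)) f.
Proof. exact: continuous_measurable_fun. Qed.

Lemma continuous_measurable3 (f : E3 R -> R) : continuous f ->
  measurable_fun (setT : set (E3 (measurableTypeR R))) f.
Proof.
move=> cf; have cid' (U : topologicalType) : continuous (fun x : U => x).
  by move=> x; exact: cvg_id.
have cc (U V : topologicalType) (a : V) : continuous (fun _ : U => a).
  by move=> x; exact: cvg_cst.
apply: measurable_fun_sepcont => [t|x].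
  apply: measurable_fun_sepcont => [s|x].
    apply: continuous_measurable1.
    exact: (continuous_compT (continuous_pair (continuous_pair (cid' _) (cc _ _ s)) (cc _ _ t)) cf).
  exact: (continuous_compT (continuous_pair (continuous_pair (cc _ _ x) (cid' _)) (cc _ _ t)) cf).
exact: (continuous_compT (continuous_pair (cc _ _ x) (cid' _)) cf).
Qed.

Lemma continuous_measurable4 (f : E3t R -> R) : continuous f ->
  measurable_fun (setT : set (E3t (measurableTypeR R))) f.
Proof.
move=> cf; have cid' (U : topologicalType) : continuous (fun x : U => x).
  by move=> x; exact: cvg_id.
have cc (U V : topologicalType) (a : V) : continuous (fun _ : U => a).
  by move=> x; exact: cvg_cst.
apply: measurable_fun_sepcont => [t|x].
  apply: continuous_measurable3.
  exact: (continuous_compT (continuous_pair (cid' _) (cc _ _ t)) cf).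
exact: (continuous_compT (continuous_pair (cc _ _ x) (cid' _)) cf).
Qed.

End continuous_measurable.

(** * Cauchy-Schwarz from weighted arithmetic means *)

Section real_inequalities.
Context (R : realFieldType).

(** The optimal weight is k = x / A. If A = 0, the large weight k = (B + 1) / x forces x = 0.
    Together with [gm_le_am] this replaces a product of integrals by a family of linear bounds. *)
Lemma sqr_le_gm (x A B : R) : 0 <= x -> 0 <= A -> 0 <= B ->
  (forall k, 0 < k -> x <= (k * A + k^-1 * B) / 2) -> x ^+ 2 <= A * B.
Proof.
move=> x0 A0 B0 H; have [->|xn0] := eqVneq x 0.
  by rewrite expr0n/= mulr_ge0.
have xp : 0 < x by rewrite lt0r xn0.
have [A1|An0] := eqVneq A 0.
  have k0 : 0 < (B + 1) / x by rewrite divr_gt0// ltr_pwDr.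
  have := H _ k0; rewrite A1 mulr0 add0r invf_div -mulrA.
  rewrite -[X in X <= _]mulr1 -mulrA ler_pM2l// => h.
  have B1 : 0 < B + 1 by rewrite ltr_pwDr.
  suff : 1 < (1 : R) by rewrite ltxx.
  apply: (le_lt_trans h); rewrite mulrC ltr_pdivrMr// mul1r.
  by rewrite ltr_pdivrMr//; lra.
have Ap : 0 < A by rewrite lt0r An0.
have k0 : 0 < x / A by rewrite divr_gt0.
have := H _ k0; rewrite divfK// invf_div ler_pdivlMr// mulr_natr mulr2n lerD2l.
by rewrite mulrAC ler_pdivlMr// expr2.
Qed.

Lemma gm_le_am (u a b k : R) : 0 < k -> 0 <= a -> 0 <= b ->
  u ^+ 2 <= a * b -> `|u| <= (k * a + k^-1 * b) / 2.
Proof.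
move=> k0 a0 b0 uab; have kn0 := lt0r_neq0 k0.
have s0 : 0 <= (k * a + k^-1 * b) / 2.
  by rewrite divr_ge0// addr_ge0// mulr_ge0// ?invr_ge0 ltW.
rewrite -ler_sqr ?nnegrE// real_normK ?num_real//.
apply: (le_trans uab); rewrite -subr_ge0.
have -> : ((k * a + k^-1 * b) / 2) ^+ 2 - a * b = ((k * a - k^-1 * b) / 2) ^+ 2.
  by field.
exact: sqr_ge0.
Qed.

End real_inequalities.

Section integral_basics.
Context d (T : measurableType d) (R : realType) (m : {measure set T -> \bar R}).

Lemma integral_le_integrable (f : T -> R) (A : R) : measurable_fun setT f ->
  (forall x, 0 <= f x) -> (\int[m]_x (f x)%:E <= A%:E)%E ->
  m.-integrable setT (EFin \o f).
Proof.
move=> mf f0 fA; apply/integrableP; split; first exact/measurable_EFinP.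
under eq_integral do rewrite /= ger0_norm//.
by rewrite (le_lt_trans fA)// ltry.
Qed.

Lemma EFin_Rintegral (f : T -> R) : m.-integrable setT (EFin \o f) ->
  (\int[m]_x f x)%:E = (\int[m]_x (f x)%:E)%E.
Proof. by move=> fi; rewrite fineK//; exact: integrable_fin_num. Qed.

Lemma le_integrable_fun (f g : T -> R) : measurable_fun setT f ->
  (forall x, `|f x| <= g x) -> m.-integrable setT (EFin \o g) ->
  m.-integrable setT (EFin \o f).
Proof.
move=> mf fg; apply: le_integrable => //; first exact/measurable_EFinP.
by move=> x _ /=; rewrite lee_fin (le_trans (fg x))// ler_norm.
Qed.

Lemma integrableDfun (f g : T -> R) : m.-integrable setT (EFin \o f) ->
  m.-integrable setT (EFin \o g) ->
  m.-integrable setT (EFin \o (fun x => f x + g x)).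
Proof. by move=> fi gi; apply: (integrableD measurableT fi gi). Qed.

Lemma integrableBfun (f g : T -> R) : m.-integrable setT (EFin \o f) ->
  m.-integrable setT (EFin \o g) ->
  m.-integrable setT (EFin \o (fun x => f x - g x)).
Proof. by move=> fi gi; apply: (integrableB measurableT fi gi). Qed.

Lemma integrableZfun (k : R) (f : T -> R) : m.-integrable setT (EFin \o f) ->
  m.-integrable setT (EFin \o (fun x => k * f x)).
Proof. by move=> fi; apply: (integrableZl measurableT k fi). Qed.

(** Cauchy-Schwarz with the optimisation postponed: |u| <= (k a + b / k) / 2 holds pointwise for
    every k > 0, is integrated by linearity, and k is chosen only afterwards. The hypothesis u^2 <=
    a b leaves the splitting of a weight between the two factors free. *)
Lemma Rintegral_gm (u a b : T -> R) (A B : R) :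
  measurable_fun setT u -> measurable_fun setT a -> measurable_fun setT b ->
  (forall x, 0 <= a x) -> (forall x, 0 <= b x) ->
  (forall x, u x ^+ 2 <= a x * b x) ->
  (\int[m]_x (a x)%:E <= A%:E)%E -> (\int[m]_x (b x)%:E <= B%:E)%E ->
  m.-integrable setT (EFin \o u) /\ (\int[m]_x `|u x|) ^+ 2 <= A * B.
Proof.
move=> mu' ma mb a0 b0 uab aA bB.
have ia := integral_le_integrable ma a0 aA.
have ib := integral_le_integrable mb b0 bB.
have ik k := integrableZfun 2^-1 (integrableDfun (integrableZfun k ia) (integrableZfun k^-1 ib)).
have ule k x : 0 < k -> `|u x| <= 2^-1 * (k * a x + k^-1 * b x).
  by move=> k0; rewrite mulrC; exact: gm_le_am.
have ui : m.-integrable setT (EFin \o u).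
  by apply: (le_integrable_fun mu' _ (ik 1)) => x; exact: ule.
split => //.
have uni : m.-integrable setT (EFin \o (fun x => `|u x|)).
  exact: (integrable_norm ui).
have A0 : 0 <= A by rewrite -lee_fin (le_trans _ aA)// integral_ge0// => x _; rewrite lee_fin.
have B0 : 0 <= B by rewrite -lee_fin (le_trans _ bB)// integral_ge0// => x _; rewrite lee_fin.
apply: sqr_le_gm => //; first exact: Rintegral_ge0.
move=> k k0; apply: (@le_trans _ _ (\int[m]_x (2^-1 * (k * a x + k^-1 * b x)))).
  by apply: le_Rintegral => // x _; exact: ule.
rewrite RintegralZl//; last exact: (integrableDfun (integrableZfun k ia) (integrableZfun k^-1 ib)).
rewrite RintegralD//; [|exact: integrableZfun..].
rewrite !RintegralZl// mulrC ler_pM2r ?invr_gt0//.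
apply: lerD; apply: ler_wpM2l; rewrite ?invr_ge0 ?(ltW k0)//.
  by rewrite -lee_fin EFin_Rintegral.
by rewrite -lee_fin EFin_Rintegral.
Qed.

Definition sqnorm (f : T -> R) : \bar R := (\int[m]_x ((f x) ^+ 2)%:E)%E.

Lemma sqnorm_ge0 f : (0 <= sqnorm f)%E.
Proof. by apply: integral_ge0 => x _; rewrite lee_fin sqr_ge0. Qed.

Lemma L2_mul (f g : T -> R) (A B : R) :
  measurable_fun setT f -> measurable_fun setT g ->
  (sqnorm f <= A%:E)%E -> (sqnorm g <= B%:E)%E ->
  m.-integrable setT (EFin \o (fun x => f x * g x)) /\
  (\int[m]_x `|f x * g x|) ^+ 2 <= A * B.
Proof.
move=> mf mg fA gB; apply: (Rintegral_gm _ _ _ _ _ _ fA gB).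
- exact: measurable_funM.
- exact: measurable_funX.
- exact: measurable_funX.
- by move=> x; exact: sqr_ge0.
- by move=> x; exact: sqr_ge0.
- by move=> x; rewrite exprMn.
Qed.

Lemma sqnormD_le (f g : T -> R) : measurable_fun setT f -> measurable_fun setT g ->
  (sqnorm (fun x => f x + g x)%R <= 2%:E * (sqnorm f + sqnorm g))%E.
Proof.
move=> mf mg; rewrite /sqnorm -ge0_integralD//; last 4 first.
- by move=> x _; rewrite lee_fin sqr_ge0.
- by apply/measurable_EFinP; exact: measurable_funX.
- by move=> x _; rewrite lee_fin sqr_ge0.
- by apply/measurable_EFinP; exact: measurable_funX.
rewrite -ge0_integralZl//=; last 2 first.
- by apply/measurable_EFinP; apply: measurable_funD; exact: measurable_funX.
- by move=> x _; rewrite lee_fin addr_ge0// sqr_ge0.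
apply: ge0_le_integral => //.
- by move=> x _; rewrite lee_fin sqr_ge0.
- by apply/measurable_EFinP; apply: measurable_funX; exact: measurable_funD.
- by apply/measurable_EFinP; apply: measurable_funM => //; apply: measurable_funD; exact: measurable_funX.
move=> x _; rewrite lee_fin -subr_ge0.
have -> : 2 * (f x ^+ 2 + g x ^+ 2) - (f x + g x) ^+ 2 = (f x - g x) ^+ 2 by ring.
exact: sqr_ge0.
Qed.

Lemma sqnorm_mulr_le (f g : T -> R) (M : R) : measurable_fun setT f ->
  measurable_fun setT g -> (forall x, `|g x| <= M) ->
  (sqnorm (fun x => f x * g x)%R <= (M ^+ 2)%:E * sqnorm f)%E.
Proof.
move=> mf mg gM; rewrite /sqnorm -ge0_integralZl//=; last 3 first.
- by apply/measurable_EFinP; exact: measurable_funX.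
- by move=> x _; rewrite lee_fin sqr_ge0.
- by rewrite lee_fin sqr_ge0.
apply: ge0_le_integral => //.
- by move=> x _; rewrite lee_fin sqr_ge0.
- by apply/measurable_EFinP; apply: measurable_funX; exact: measurable_funM.
- by apply/measurable_EFinP; apply: measurable_funM => //; exact: measurable_funX.
move=> x _; rewrite lee_fin exprMn mulrC ler_wpM2r ?sqr_ge0//.
by rewrite -(real_normK (num_real (g x))) lerXn2r ?nnegrE// (le_trans _ (gM x)).
Qed.

End integral_basics.

(** * The fundamental theorem of calculus and integration along flows *)

Section ftc.
Context (R : realType).

Lemma ftc_Rintegral (f f' : R -> R) (a b : R) : a <= b ->
  (forall x : R, is_derive x (1 : R) f (f' x)) -> continuous f' ->
  \int[@lebesgue_measure R]_(x in `[a, b]) f' x = f b - f a.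
Proof.
move=> ab df cf'; move: ab; rewrite le_eqVlt => /predU1P[->|ab].
  by rewrite set_itv1 Rintegral_set1 subrr.
rewrite /Rintegral (@continuous_FTC2 _ f' f) //.
- by apply: continuous_subspaceT.
- split.
  + by move=> x _; have := df x => dfx; exact: ex_derive.
  + apply: cvg_at_right_filter; apply: differentiable_continuous.
    by apply/derivable1_diffP; have := df a => dfa; exact: ex_derive.
  + apply: cvg_at_left_filter; apply: differentiable_continuous.
    by apply/derivable1_diffP; have := df b => dfb; exact: ex_derive.
- by move=> x _; rewrite derive1E; have := df x => dfx; exact: derive_val.
Qed.

End ftc.

Section flow_integration_by_parts.
Context d (T : measurableType d) (R : realType)
  (m : {sigma_finite_measure set T -> \bar R}).
Local Notation mu := (@lebesgue_measure R).

(* The integral of [h] along a measure-preserving flow is constant in time. *)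
Lemma flow_Rintegral0 (theta : R -> T -> T) (h g : T -> R) :
  (forall w, theta 0 w = w) ->
  (forall tau, scales_measure m 1 (theta tau)) ->
  measurable_fun setT (fun z : T * measurableTypeR R => theta z.2 z.1) ->
  m.-integrable setT (EFin \o h) -> m.-integrable setT (EFin \o g) ->
  (forall w (tau : R), is_derive tau (1 : R) (fun s => h (theta s w)) (g (theta tau w))) ->
  (forall w, continuous (fun tau => g (theta tau w))) ->
  \int[m]_w g w = 0.
Proof.
move=> th0 thm mth hi gi dh cg.
pose I := `[0 : R, 1]%classic; have mI : measurable (I : set (measurableTypeR R)) by exact: measurable_itv.
pose F (z : T * measurableTypeR R) := (g (theta z.2 z.1) * \1_I z.2)%R.
have mg : measurable_fun setT g by apply/measurable_EFinP; case/integrableP : gi.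
have mF : measurable_fun setT F.
  apply: measurable_funM; first exact: measurableT_comp.
  by apply: measurableT_comp => //; exact: measurable_indic.
have muI : (\int[mu1 R]_x (\1_I x)%:E = 1)%E.
  rewrite integral_indic// setIT; transitivity (@lebesgue_measure R I) => //.
  by rewrite lebesgue_measure_itv/= lte_fin ltr01 oppr0 adde0.
have Fi : (sprod m (mu1 R)).-integrable setT (EFin \o F).
  apply/integrableP; split; first exact/measurable_EFinP.
  rewrite sprod_tonelli2//; last by apply: measurableT_comp => //; exact/measurable_EFinP.
  have E y : (\int[m]_x `|(EFin \o F) (x, y)|)%E = ((\int[m]_x `|(g x)%:E|) * (\1_I y)%:E)%E.
    rewrite /F/=; under eq_integral do rewrite normrM EFinM.
    rewrite ge0_integralZr//; last first.
      apply/measurable_EFinP; apply: measurableT_comp => //.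
      by apply: measurableT_comp mg _; case: (thm y).
    rewrite ger0_norm//; congr (_ * _)%E.
    have [_ _ E1] := thm y; rewrite (E1 (fun x => `|g x|%:E)) ?mul1e//.
    by apply/measurable_EFinP; exact: measurableT_comp.
  under eq_integral do rewrite E.
  rewrite ge0_integralZl//; last 2 first.
  - by apply/measurable_EFinP; exact: measurable_indic.
  - exact: integral_ge0.
  rewrite muI mule1.
  by case/integrableP : gi.
(* Space first: by invariance of the measure every time slice contributes the integral of [g], and
   the times fill an interval of length 1. *)
have F1 : (\int[sprod m (mu1 R)]_z (EFin \o F) z = \int[m]_w (EFin \o g) w)%E.
  rewrite -(integral21_prod_meas1 Fi)/=.
  transitivity (\int[mu1 R]_y ((\int[m]_x g x)%R%:E * (\1_I y)%:E))%E.
    apply: eq_integral => y _; rewrite /fubini_G /F/=.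
    under eq_integral do rewrite EFinM.
    have gti := scales_integrable (thm y) gi.
    rewrite integralZr//; congr (_ * _)%E.
    rewrite -(EFin_Rintegral gti).
    by rewrite -[in RHS](mul1r (\int[m]_x g x)) -(scales_Rintegral (thm y) gi).
  rewrite integralZl//; last first.
    apply/integrableP; split; first by apply/measurable_EFinP; exact: measurable_indic.
    under eq_integral do rewrite /= ger0_norm//.
    by rewrite muI ltry.
  by rewrite muI mule1 EFin_Rintegral.
(* Time first: the orbit of w contributes h(theta 1 w) - h(w), and these two terms have the same
   integral. *)
have F2 : (\int[sprod m (mu1 R)]_z (EFin \o F) z = 0)%E.
  rewrite -(integral12_prod_meas1 Fi)/=.
  have hti := scales_integrable (thm 1) hi.
  transitivity (\int[m]_w (h (theta 1 w) - h w)%:E)%E.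
    apply: eq_integral => w _; rewrite /fubini_F /F/=.
    have := ftc_Rintegral ler01 (dh w) (cg w); rewrite /= th0 => <-.
    rewrite fineK; last first.
      apply: integrable_fin_num => //; apply: continuous_compact_integrable.
        exact: segment_compact.
      by apply: continuous_subspaceT; exact: cg.
    rewrite [RHS]integral_mkcond; apply: eq_integral => y _.
    by rewrite patchE indicE; case: ifPn => _; rewrite ?mulr1 ?mulr0.
  rewrite -(EFin_Rintegral (integrableBfun hti hi)) RintegralB//.
  by rewrite (scales_Rintegral (thm 1) hi) mul1r subrr.
by apply: EFin_inj; rewrite EFin_Rintegral// -F1 F2.
Qed.

End flow_integration_by_parts.

(** * Averages and the L^2 norm *)

Section mixing.
Context d1 d2 (T1 : measurableType d1) (T2 : measurableType d2) (R : realType)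
  (m1 : {sigma_finite_measure set T1 -> \bar R})
  (m2 : {sigma_finite_measure set T2 -> \bar R}).

Lemma measurable_integral1 (f : T1 * T2 -> \bar R) : measurable_fun setT f ->
  (forall z, (0 <= f z)%E) -> measurable_fun setT (fun x => \int[m2]_y f (x, y))%E.
Proof. exact: measurable_fun_fubini_tonelli_F. Qed.

Lemma measurable_integral2 (f : T1 * T2 -> \bar R) : measurable_fun setT f ->
  (forall z, (0 <= f z)%E) -> measurable_fun setT (fun y => \int[m1]_x f (x, y))%E.
Proof. exact: measurable_fun_fubini_tonelli_G. Qed.

Lemma measurable_Rintegral (F : T1 * T2 -> R) : measurable_fun setT F ->
  measurable_fun setT (fun x => \int[m2]_w F (x, w)).
Proof.
move=> mF; have mEF : measurable_fun setT (EFin \o F) by exact/measurable_EFinP.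
rewrite (_ : (fun x => _) = fine \o (fun x => (\int[m2]_w ((EFin \o F)^\+ (x, w)) -
    \int[m2]_w ((EFin \o F)^\- (x, w)))%E)); last first.
  apply/funext => x; rewrite /Rintegral /= integralE; congr (fine (_ - _)%E).
    apply: eq_integral => w _.
    by rewrite -[RHS]/(((EFin \o F)^\+ \o (fun w => (x, w))) w)%E -funepos_comp.
  apply: eq_integral => w _.
  by rewrite -[RHS]/(((EFin \o F)^\- \o (fun w => (x, w))) w)%E -funeneg_comp.
apply: measurableT_comp => //; apply: emeasurable_funB.
  apply: (measurable_integral1 (f := (EFin \o F)^\+%E)) => //.
  exact: measurable_funepos.
apply: (measurable_integral1 (f := (EFin \o F)^\-%E)) => //.
exact: measurable_funeneg.
Qed.

(* Jensen's inequality and Tonelli's theorem: averaging does not increase the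
   [L2] norm. *)
Lemma mixing_sqnorm (H : T1 * T2 -> R) (k : T2 -> R) (C M : R) :
  measurable_fun setT H -> measurable_fun setT k ->
  (\int[m2]_w `|k w|%:E <= C%:E)%E -> 0 < C -> 0 <= M ->
  (forall w, k w != 0 -> (sqnorm m1 (fun x => H (x, w)) <= M%:E)%E) ->
  (sqnorm m1 (fun x => \int[m2]_w (H (x, w) * k w))%R <= (C ^+ 2 * M)%:E)%E.
Proof.
move=> mH mk kC Cp M0 HM; have C0 := ltW Cp.
pose A (z : T1 * T2) : R := H z ^+ 2 * `|k z.2|.
have mak : measurable_fun setT (fun w => `|k w|) by exact: measurableT_comp.
have mA : measurable_fun setT A.
  apply: measurable_funM; first exact: measurable_funX.
  exact: (measurableT_comp mak).
have A0 z : 0 <= A z by rewrite mulr_ge0// sqr_ge0.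
have mAx x : measurable_fun setT (fun w => A (x, w)).
  by apply: measurableT_comp => //; exact: measurable_pair1.
have mHx x : measurable_fun setT (fun w => H (x, w)).
  by apply: measurableT_comp => //; exact: measurable_pair1.
have mEA : measurable_fun setT (EFin \o A) by exact/measurable_EFinP.
have mI : measurable_fun setT (fun x => \int[m2]_w (A (x, w))%:E)%E.
  by apply: (measurable_integral1 (f := EFin \o A)) => // z; rewrite lee_fin.
have C20 : (0 <= C%:E)%E by rewrite lee_fin.
apply: (@le_trans _ _ (\int[m1]_x (C%:E * \int[m2]_w (A (x, w))%:E))%E).
  apply: ge0_le_integral => //.
  - by move=> x _; rewrite lee_fin sqr_ge0.
  - apply/measurable_EFinP; apply: measurable_funX.
    apply: (measurable_Rintegral (F := fun z => H z * k z.2)).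
    by apply: measurable_funM => //; exact: (measurableT_comp mk).
  - by apply: emeasurable_funM.
  move=> x _; have I0 : (0 <= \int[m2]_w (A (x, w))%:E)%E.
    by apply: integral_ge0 => w _; rewrite lee_fin.
  (* Where the inner integral is infinite the right-hand side is infinite as well; this is where
     [0 < C] enters. *)
  have [Afin|] := boolP (\int[m2]_w (A (x, w))%:E \is a fin_num)%E; last first.
    rewrite ge0_fin_numE// -leNgt leye_eq => /eqP Ay; rewrite Ay.
    by rewrite gt0_muley ?leey.
  have Ale : (\int[m2]_w (A (x, w))%:E <= (fine (\int[m2]_w (A (x, w))%:E))%:E)%E.
    by rewrite fineK.
  have mHk : measurable_fun setT (fun w => H (x, w) * k w) by exact: measurable_funM.
  have [w|iu gm] := Rintegral_gm mHk (mAx x) mak (fun w => A0 _) (fun w => normr_ge0 _) _ Ale kC.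
    by rewrite /A/= exprMn -mulrA -expr2 real_normK ?num_real.
  rewrite -(fineK Afin) lee_fin mulrC (le_trans _ gm)//.
  rewrite -(real_normK (num_real (\int[m2]_w _))) lerXn2r ?nnegrE//.
    by apply: Rintegral_ge0 => w _.
  exact: le_normr_Rintegral.
rewrite ge0_integralZl//; last by move=> x _; apply: integral_ge0 => w _; rewrite lee_fin.
rewrite expr2 -mulrA EFinM lee_wpmul2l//.
have EA0 z : (0 <= (EFin \o A) z)%E by rewrite lee_fin.
rewrite -[X in (X <= _)%E](sprod_tonelli1 m1 m2 mEA EA0) (sprod_tonelli2 m1 m2 mEA EA0).
apply: (@le_trans _ _ (\int[m2]_w (M%:E * `|k w|%:E))%E).
  apply: ge0_le_integral => //.
  - by move=> w _; apply: integral_ge0 => x _; rewrite lee_fin.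
  - exact: (measurable_integral2 (f := EFin \o A)).
  - by apply/measurable_EFinP; exact: measurable_funM.
  move=> w _; rewrite /A/=.
  under eq_integral do rewrite EFinM.
  rewrite ge0_integralZr//; last 2 first.
  - apply/measurable_EFinP; apply: measurable_funX.
    by apply: measurableT_comp => //; exact: measurable_pair2.
  - by move=> x _; rewrite lee_fin sqr_ge0.
  have [->|kw] := eqVneq (k w) 0; first by rewrite normr0 !mule0.
  by rewrite lee_wpmul2r ?lee_fin//; exact: HM.
rewrite ge0_integralZl//; last exact/measurable_EFinP.
by rewrite muleC EFinM lee_wpmul2r ?lee_fin.
Qed.

End mixing.

Section derivative_under_integral.
Context d (T : measurableType d) (R : realType) (m : {measure set T -> \bar R}).

Lemma is_derive_Rintegral (f f' : R -> T -> R) (G : T -> R) (a : R) :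
  (forall t, m.-integrable setT (EFin \o f t)) ->
  (forall t y, is_derive t (1 : R) (f ^~ y) (f' t y)) ->
  m.-integrable setT (EFin \o G) ->
  (forall t y, `|t - a| < 1 -> `|f' t y| <= G y) ->
  is_derive a (1 : R) (fun t => \int[m]_y f t y) (\int[m]_y f' a y).
Proof.
move=> fi df Gi fG.
have aI : `]a - 1, a + 1[%classic a by rewrite /= in_itv/=; apply/andP; split; lra.
have G0 y : 0 <= G y by rewrite (le_trans _ (fG a y _))// subrr normr0.
have fi' x : `]a - 1, a + 1[%classic x -> m.-integrable setT (EFin \o f x) by [].
have df' x y : `]a - 1, a + 1[%classic x -> setT y -> derivable (f ^~ y) x 1.
  by move=> _ _; have := df x y => dfx; exact: ex_derive.
have p1 x y : partial1of2 f x y = f' x y.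
  by rewrite /partial1of2 derive1E; have := df x y => dfx; exact: derive_val.
have fG' x y : `]a - 1, a + 1[%classic x -> setT y -> `|partial1of2 f x y| <= G y.
  rewrite /= in_itv/= => /andP[h1 h2] _; rewrite p1; apply: fG.
  by rewrite ltr_norml; apply/andP; split; lra.
have mT : d.-measurable [set: T] by exact: measurableT.
have D := derivable_under_integral mT aI fi' df' G0 Gi fG'.
have V := differentiation_under_integral mT aI fi' df' G0 Gi fG'.
apply: DeriveDef => //; rewrite -derive1E V.
by apply: eq_Rintegral => y _; rewrite p1.
Qed.

End derivative_under_integral.

(** * Continuity of translations in L^1 *)

Section L1_continuity.
Local Open Scope ereal_scope.

Definition L1dist d (T : measurableType d) (R : realType)
  (m : {measure set T -> \bar R}) (f g : T -> R) : \bar R :=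
  \int[m]_x `|f x - g x|%:E.

Definition L1cont_at d (T : measurableType d) (R : realType)
  (m : {measure set T -> \bar R}) (th : nat -> T -> T) (f : T -> R) : Prop :=
  L1dist m (f \o th n) f @[n --> \oo] --> 0.

Definition L1cont d (T : measurableType d) (R : realType)
    (m : {measure set T -> \bar R}) (th : nat -> T -> T) : Prop :=
  forall f : T -> R, m.-integrable setT (EFin \o f) -> L1cont_at m th f.

Section generic.
Context d (T : measurableType d) (R : realType) (m : {measure set T -> \bar R}).

Lemma measurable_L1 (f g : T -> R) : measurable_fun setT f -> measurable_fun setT g ->
  measurable_fun setT (fun x => `|f x - g x|%R%:E).
Proof.
move=> mf mg; apply/measurable_EFinP; apply: measurableT_comp => //.
exact: measurable_funB.
Qed.

Lemma L1dist_ge0 (f g : T -> R) : 0 <= L1dist m f g.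
Proof. by apply: integral_ge0 => x _; rewrite lee_fin. Qed.

Lemma L1dist_triangle (f g h : T -> R) : measurable_fun setT f ->
  measurable_fun setT g -> measurable_fun setT h ->
  L1dist m f h <= L1dist m f g + L1dist m g h.
Proof.
move=> mf mg mh; rewrite /L1dist -ge0_integralD//; last 2 first.
- exact: measurable_L1.
- exact: measurable_L1.
apply: ge0_le_integral => //.
- exact: measurable_L1.
- by apply: emeasurable_funD; exact: measurable_L1.
by move=> x _; rewrite -EFinD lee_fin ler_distD.
Qed.

Lemma L1distC (f g : T -> R) : L1dist m f g = L1dist m g f.
Proof. by apply: eq_integral => x _; rewrite distrC. Qed.

Lemma L1dist_scales (h : T -> T) (f g : T -> R) : scales_measure m 1 h ->
  measurable_fun setT f -> measurable_fun setT g ->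
  L1dist m (f \o h) (g \o h) = L1dist m f g.
Proof.
move=> [mh _ E] mf mg; rewrite /L1dist.
by rewrite (E (fun x => `|f x - g x|%R%:E)) ?mul1e//; exact: measurable_L1.
Qed.

Lemma ereal_cvg0_squeeze (a b : nat -> \bar R) : (forall n, 0 <= a n) ->
  (forall n, a n <= b n) -> b n @[n --> \oo] --> 0 -> a n @[n --> \oo] --> 0.
Proof.
move=> a0 ab b0; apply: (@squeeze_cvge _ _ _ _ (fun=> 0) a b) => //.
  by apply: nearW => n; rewrite a0 ab.
exact: cvg_cst.
Qed.

Lemma ereal_cvg0P (a : nat -> \bar R) : (forall n, 0 <= a n) ->
  (forall e : R, (0 < e)%R -> \forall n \near \oo, a n <= e%:E) ->
  a n @[n --> \oo] --> 0.
Proof.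
move=> a0 H; apply/fine_cvgP; split.
  have := H 1%R ltr01; apply: filterS => n an.
  by rewrite ge0_fin_numE// (le_lt_trans an)// ltry.
apply/cvgrPdist_le => /= e e0; have := H e e0; apply: filterS => n an.
rewrite sub0r normrN ger0_norm ?fine_ge0// -lee_fin fineK//.
by rewrite ge0_fin_numE// (le_lt_trans an)// ltry.
Qed.

(** A three-epsilon argument: as the maps preserve the measure, f o th_n and h o th_n are exactly as
    close as f and h. *)
Lemma L1cont_approx (th : nat -> T -> T) (f : T -> R) :
  (forall n, scales_measure m 1 (th n)) -> measurable_fun setT f ->
  (forall e : R, (0 < e)%R -> exists h : T -> R,
     [/\ measurable_fun setT h, L1dist m f h <= e%:E & L1cont_at m th h]) ->
  L1cont_at m th f.
Proof.
move=> sc mf H; apply: ereal_cvg0P => [n|e e0]; first exact: L1dist_ge0.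
have e30 : (0 < e / 3)%R by rewrite divr_gt0.
have [h [mh fh ch]] := H _ e30.
have : \forall n \near \oo, L1dist m (h \o th n) h <= (e / 3)%:E.
  have /fine_cvgP[fin /cvgrPdist_le/(_ _ e30) cf] := ch.
  apply: filterS2 fin cf => n fn /=; rewrite sub0r normrN => h1.
  by rewrite -(fineK fn) lee_fin (le_trans _ h1)// ler_norm.
apply: filterS => n hn.
have mth : measurable_fun setT (th n) by case: (sc n).
have mft := measurableT_comp mf mth; have mht := measurableT_comp mh mth.
apply: (le_trans (L1dist_triangle mft mht mf)).
apply: (@le_trans _ _ ((e / 3)%:E + ((e / 3)%:E + (e / 3)%:E))).
  apply: leeD; first by rewrite L1dist_scales.
  by apply: (le_trans (L1dist_triangle mht mh mf)); apply: leeD => //; rewrite L1distC.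
rewrite -!EFinD lee_fin; lra.
Qed.

End generic.

Section iterated.
Context d1 d2 (T1 : measurableType d1) (T2 : measurableType d2) (R : realType)
  (m1 : {sigma_finite_measure set T1 -> \bar R})
  (m2 : {sigma_finite_measure set T2 -> \bar R}).

(** For almost every y the slice is integrable, so the inner integral tends to 0. It is at most
    twice the L^1 norm of the slice by invariance, and that majorant is integrable in y, so
    dominated convergence applies. *)
Lemma L1cont_iterated (th1 : nat -> T1 -> T1) (f : T1 * T2 -> R) :
  (forall n, scales_measure m1 1 (th1 n)) -> L1cont m1 th1 ->
  measurable_fun setT f -> \int[m2]_y \int[m1]_x `|f (x, y)|%:E < +oo ->
  {ae m2, forall y, m1.-integrable setT (fun x => (f (x, y))%:E)} ->
  \int[m2]_y (\int[m1]_x `|f (th1 n x, y) - f (x, y)|%R%:E) @[n --> \oo] --> 0.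
Proof.
move=> s1 c1 mf fi a2.
have mt1 n : measurable_fun setT (th1 n) by case: (s1 n).
have mp1 n : measurable_fun setT (fun z : T1 * T2 => (th1 n z.1, z.2)).
  by apply: measurable_fun_pair; [exact: measurableT_comp|].
pose A n (z : T1 * T2) := `|f (th1 n z.1, z.2) - f z|%R%:E.
have mft n := measurableT_comp mf (mp1 n).
have mA n : measurable_fun setT (A n) := measurable_L1 (mft n) mf.
have A0 n z : 0 <= A n z by rewrite lee_fin.
have maf : measurable_fun setT (fun z => `|f z|%:E).
  by apply/measurable_EFinP; exact: measurableT_comp.
have mfy y : measurable_fun setT (fun x => f (x, y)).
  by apply: measurableT_comp => //; exact: measurable_pair2.
have mafy : measurable_fun setT (fun y => \int[m1]_x `|f (x, y)|%:E).
  by apply: (measurable_integral2 m1 maf) => z; rewrite lee_fin.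
have Afin y n : \int[m1]_x A n (x, y) <= 2%:E * \int[m1]_x `|f (x, y)|%:E.
  apply: (@le_trans _ _ (\int[m1]_x (`|f (th1 n x, y)|%:E + `|f (x, y)|%:E))).
    apply: ge0_le_integral => //.
    - by apply: measurableT_comp => //; exact: measurable_pair2.
    - apply: emeasurable_funD; apply/measurable_EFinP; apply: measurableT_comp => //.
      exact: (measurableT_comp (mfy y)).
    - by move=> x _; rewrite -EFinD lee_fin ler_normB.
  rewrite ge0_integralD//; last 2 first.
  - by apply/measurable_EFinP; apply: measurableT_comp => //; exact: (measurableT_comp (mfy y)).
  - by apply/measurable_EFinP; exact: measurableT_comp.
  have [_ _ E] := s1 n; rewrite (E (fun x => `|f (x, y)|%:E))//; last first.
    by apply/measurable_EFinP; exact: measurableT_comp.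
  by rewrite mul1e -mule2n mule_natl.
rewrite -[X in _ --> X](@integral0 _ _ _ m2 setT).
have [] // := @dominated_convergence _ _ _ m2 setT measurableT
  (fun n y => \int[m1]_x A n (x, y)) (cst 0)
  (fun y => 2%:E * \int[m1]_x `|f (x, y)|%:E).
- by move=> n; exact: (measurable_integral2 m1 (mA n) (A0 n)).
- by apply: filterS a2 => y fy _; exact: (c1 _ fy).
- apply/integrableP; split; first exact: emeasurable_funM.
  under eq_integral => y _.
    rewrite gee0_abs; last by rewrite mule_ge0// integral_ge0// => x _; rewrite lee_fin.
    over.
  rewrite ge0_integralZl//; last by move=> y _; apply: integral_ge0 => x _; rewrite lee_fin.
  by rewrite lte_mul_pinfty.
- apply: nearW => y n _; rewrite gee0_abs; first exact: Afin.
  by apply: integral_ge0 => x _; exact: A0.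
Qed.

End iterated.

Section product.
Context d1 d2 (T1 : measurableType d1) (T2 : measurableType d2) (R : realType)
  (m1 : {sigma_finite_measure set T1 -> \bar R})
  (m2 : {sigma_finite_measure set T2 -> \bar R}).

(** The two factors are moved separately, through the intermediate function f(x, th2 y); invariance
    under th2 removes th2 from the first of the two distances. Thus continuous functions have to be
    shown dense on the line only, and dimensions three and four follow. *)
Lemma L1cont_sprod (th1 : nat -> T1 -> T1) (th2 : nat -> T2 -> T2) :
  (forall n, scales_measure m1 1 (th1 n)) -> (forall n, scales_measure m2 1 (th2 n)) ->
  L1cont m1 th1 -> L1cont m2 th2 ->
  L1cont (sprod m1 m2) (fun n z => (th1 n z.1, th2 n z.2)).
Proof.
move=> s1 s2 c1 c2 f fi.
have mf : measurable_fun setT f by apply/measurable_EFinP; case/integrableP : fi.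
have mt1 n : measurable_fun setT (th1 n) by case: (s1 n).
have mt2 n : measurable_fun setT (th2 n) by case: (s2 n).
have mp n : measurable_fun setT (fun z : T1 * T2 => (th1 n z.1, th2 n z.2)).
  by apply: measurable_fun_pair; exact: measurableT_comp.
have mp1 n : measurable_fun setT (fun z : T1 * T2 => (th1 n z.1, z.2)).
  by apply: measurable_fun_pair; [exact: measurableT_comp|].
have mp2 n : measurable_fun setT (fun z : T1 * T2 => (z.1, th2 n z.2)).
  by apply: measurable_fun_pair; [|exact: measurableT_comp].
have absf : \int[sprod m1 m2]_z `|f z|%:E < +oo by case/integrableP : fi.
have mabsf : measurable_fun setT (fun z => `|f z|%:E) by apply/measurable_EFinP; exact: measurableT_comp.
have a1 : {ae m1, forall x, m2.-integrable setT (fun y => (f (x, y))%:E)} := ae_integrable1 fi.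
have a2 : {ae m2, forall y, m1.-integrable setT (fun x => (f (x, y))%:E)} := ae_integrable2 fi.
have cA := L1cont_iterated s1 c1 mf.
have cB := L1cont_iterated (m2 := m1) (f := fun z => f (z.2, z.1)) s2 c2.
apply: (@ereal_cvg0_squeeze _ _ (fun n => \int[m2]_y (\int[m1]_x `|f (th1 n x, y) - f (x, y)|%R%:E) +
   \int[m1]_x (\int[m2]_y `|f (x, th2 n y) - f (x, y)|%R%:E))).
- by move=> n; exact: L1dist_ge0.
- move=> n; have mft := measurableT_comp mf (mp n).
  have mft2 := measurableT_comp mf (mp2 n).
  have mft1 := measurableT_comp mf (mp1 n).
  apply: (le_trans (L1dist_triangle _ mft mft2 mf)); apply: leeD.
    rewrite /L1dist sprod_tonelli2//; last exact: measurable_L1.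
    have [_ _ E2] := s2 n.
    rewrite (E2 (fun y => \int[m1]_x `|f (th1 n x, y) - f (x, y)|%R%:E)).
    + by rewrite mul1e.
    + by apply: (measurable_integral2 m1 (measurable_L1 mft1 mf)) => z; rewrite lee_fin.
    + by move=> y; apply: integral_ge0 => x _; rewrite lee_fin.
  by rewrite /L1dist sprod_tonelli1//; exact: measurable_L1.
rewrite -[X in _ --> X]adde0; apply: cvgeD => //.
  by apply: cA a2; rewrite -(sprod_tonelli2 m1 m2 (f := fun z => `|f z|%:E)) // => z; rewrite lee_fin.
apply: cB => //.
  by apply: measurableT_comp => //; apply: measurable_fun_pair.
by rewrite -(sprod_tonelli1 m1 m2 (f := fun z => `|f z|%:E)) // => z; rewrite lee_fin.
Qed.

End product.

End L1_continuity.

Section line.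
Context (R : realType).
Local Notation mu := (mu1 R).

Lemma L1_tail (f : R -> R) (e : R) : mu.-integrable setT (EFin \o f) -> 0 < e ->
  exists N : nat, (L1dist mu f (fun x => f x * \1_(`[- N%:R, N%:R]%classic : set R) x)%R <= e%:E)%E.
Proof.
move=> fi e0.
have mf : measurable_fun (setT : set (measurableTypeR R)) f by apply/measurable_EFinP; case/integrableP : fi.
pose I (N : nat) : set R := `[- N%:R, N%:R]%classic.
have mI N : measurable (I N : set (measurableTypeR R)) by exact: measurable_itv.
have mfI N : measurable_fun (setT : set (measurableTypeR R)) (fun x => f x * \1_(I N) x).
  by apply: measurable_funM => //; exact: measurable_indic.
have [] // := @dominated_convergence _ _ _ mu setT measurableT
  (fun N x => `|f x - f x * \1_(I N) x|%:E) (cst 0%E) (fun x => `|f x|%:E).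
- by move=> N; exact: measurable_L1.
- apply: nearW => x _ /=; apply: cvg_near_cst.
  near=> N; rewrite indicE mem_set ?mulr1 ?subrr ?normr0//.
  rewrite /I/= in_itv/= -ler_norml.
  by near: N; exact: nbhs_infty_ger.
- exact: integrable_norm fi.
- apply: nearW => x N _; rewrite /= lee_fin normr_id indicE.
  by case: (_ \in _); rewrite ?mulr1 ?subrr ?normr0// mulr0 subr0.
move=> _ _; rewrite integral0 => /fine_cvgP[fin /cvgrPdist_le/(_ _ e0) H].
have [N _ /(_ N (leqnn N)) /= [fN HN]] : \forall N \near \oo,
    ((\int[mu]_x (`|f x - f x * \1_(I N) x|)%:E)%E \is a fin_num) /\
    `|0 - fine (\int[mu]_x (`|f x - f x * \1_(I N) x|)%:E)%E| <= e.
  by apply: filterS2 fin H => N /= h1 h2; split.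
exists N; rewrite /L1dist -(fineK fN) lee_fin; apply: le_trans HN.
by rewrite sub0r normrN ler_norm.
Unshelve. all: end_near. Qed.

Lemma L1cont_shift_csupp (a : nat -> R) (h : R -> R) (r : R) :
  a n @[n --> \oo] --> (0 : R) -> continuous h -> (forall x, r < `|x| -> h x = 0) ->
  L1cont_at mu (fun n (x : measurableTypeR R) => (a n + x) : measurableTypeR R) h.
Proof.
move=> a0 ch hr.
have mh : measurable_fun (setT : set (measurableTypeR R)) h by exact: continuous_measurable1.
have [M [M0 hM]] : exists M, 0 <= M /\ forall x, `|h x| <= M.
  have cK : compact (`[- r, r]%classic : set R) by exact: segment_compact.
  have /compact_bounded[M [_ mrt]] := continuous_compact (continuous_subspaceT ch) cK.
  exists (`|M| + 1); split; first by rewrite addr_ge0.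
  move=> x; have [xr|rx] := leP `|x| r; last by rewrite hr// normr0 addr_ge0.
  apply: (mrt (`|M| + 1)); first by rewrite (le_lt_trans (ler_norm _))// ltrDl.
  by exists x => //; rewrite /= in_itv/= -ler_norml.
have [A aA] : exists A, forall n, `|a n| <= A.
  have /cvg_seq_bounded[A [_ HA]] : cvgn a by apply/cvg_ex; exists 0.
  by exists (`|A| + 1) => n; apply: HA => //; rewrite (le_lt_trans (ler_norm _))// ltrDl.
pose J : set R := `[- (r + A), r + A]%classic.
have mJ : measurable (J : set (measurableTypeR R)) by exact: measurable_itv.
have msh n : measurable_fun (setT : set (measurableTypeR R)) (fun x : measurableTypeR R => a n + x : measurableTypeR R).
  exact: measurable_funD.
rewrite /L1cont_at; rewrite -[X in _ --> X](@integral0 _ _ _ mu setT).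
have [] // := @dominated_convergence _ _ _ mu setT measurableT
  (fun n x => `|h (a n + x) - h x|%:E) (cst 0%E) (fun x => (2 * M * \1_J x)%:E).
- by move=> n; apply: measurable_L1 => //; exact: (measurableT_comp mh (msh n)).
- apply: nearW => x _; apply: cvg_EFin; first exact: nearW.
  rewrite -(normr0 R) /=; apply: cvg_norm; rewrite -(subrr (h x)).
  apply: cvgB; last exact: cvg_cst.
  apply: (@cvg_comp _ _ _ (fun n => a n + x) h \oo (nbhs x)); last exact: ch.
  have : (fun n => a n + x) @ \oo --> 0 + x by apply: cvgD => //; exact: cvg_cst.
  by rewrite add0r.
- apply/integrableP; split.
    by apply/measurable_EFinP; apply: measurable_funM => //; exact: measurable_indic.
  under eq_integral do rewrite gee0_abs ?lee_fin ?mulr_ge0// EFinM.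
  rewrite ge0_integralZl//; last 2 first.
  - by apply/measurable_EFinP; exact: measurable_indic.
  - by rewrite lee_fin mulr_ge0.
  rewrite integral_indic// setIT lte_mul_pinfty// ?lee_fin ?mulr_ge0//.
  have cJ : compact J by exact: segment_compact.
  exact: compact_finite_measure cJ.
- apply: nearW => x n _; rewrite /= lee_fin normr_id indicE.
  have [xJ|/negP xJ] := boolP (x \in J).
    by rewrite mulr1 (le_trans (ler_normB _ _))// mulr_natl mulr2n lerD.
  have xrA : r + A < `|x|.
    rewrite ltNge; apply/negP => xle; apply: xJ; rewrite inE /J/= in_itv/=.
    by rewrite -ler_norml.
  rewrite !hr ?subrr ?normr0 ?mulr0//.
    by rewrite (le_lt_trans _ xrA)// lerDl (le_trans _ (aA 0%N)).
  have := lerB_dist x (- a n); rewrite opprK normrN (addrC x) => h1.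
  by apply: lt_le_trans h1; rewrite ltrBrDr (le_lt_trans _ xrA)// lerD2l.
Qed.

Lemma L1cont_shift1 (a : nat -> R) : a n @[n --> \oo] --> (0 : R) ->
  L1cont mu (fun n (x : measurableTypeR R) => (a n + x) : measurableTypeR R).
Proof.
move=> a0 f fi.
have mf : measurable_fun setT f by apply/measurable_EFinP; case/integrableP : fi.
have sc n : scales_measure mu 1 (fun x : measurableTypeR R => (a n + x) : measurableTypeR R).
  have := scales_affine1 (a n) (@ltr01 R); rewrite invr1.
  by under eq_fun do rewrite mul1r.
apply: L1cont_approx => // e e0; have e20 : 0 < e / 2 by rewrite divr_gt0.
have [N fN] := L1_tail fi e20.
pose I (N : nat) : set R := `[- N%:R, N%:R]%classic.
have mI k : measurable (I k : set (measurableTypeR R)) by exact: measurable_itv.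
have cK : compact (I N.+1 : set R) by exact: segment_compact.
have fK : mu.-integrable (I N.+1) (EFin \o f) by apply: integrableS fi.
have muK : (mu (I N.+1) < +oo)%E by exact: compact_finite_measure cK.
have [g [cg gi gcv]] := approximation_continuous_integrable (mI N.+1) muK fK.
have mg n : measurable_fun (setT : set (measurableTypeR R)) (g n) by exact: continuous_measurable1.
have [n gn] : exists n, (\int[mu]_(z in I N.+1) `|(f z - g n z)%:E| <= (e / 2)%:E)%E.
  move: gcv => /fine_cvgP[fin /cvgrPdist_le/(_ _ e20) H].
  have [n _ /(_ n (leqnn n)) /= [fn Hn]] : \forall n \near \oo,
      ((\int[mu]_(z in I N.+1) `|(f z - g n z)%:E|)%E \is a fin_num) /\
      `|0 - fine (\int[mu]_(z in I N.+1) `|(f z - g n z)%:E|)%E| <= e / 2.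
    by apply: filterS2 fin H => n /= h1 h2.
  exists n; rewrite -(fineK fn) lee_fin; apply: le_trans Hn.
  by rewrite sub0r normrN ler_norm.
(* [clamp] is the truncation to [0, 1] in closed form. It makes [chi] a trapezoidal cutoff, equal to
   1 on [I N] and to 0 outside [I N.+1]. *)
pose clamp (t : R) : R := (`|t| - `|t - 1| + 1) / 2.
have clamp0 t : t <= 0 -> clamp t = 0.
  by move=> t0; rewrite /clamp !ler0_norm; lra.
have clamp1 t : 1 <= t -> clamp t = 1.
  by move=> t0; rewrite /clamp !ger0_norm; lra.
have clamp01 t : 0 <= clamp t <= 1.
  have [/clamp0 ->|t0] := leP t 0; first by rewrite lexx ler01.
  have [/clamp1 ->|t1] := leP 1 t; first by rewrite lexx ler01.
  by rewrite /clamp (gtr0_norm t0) ltr0_norm ?subr_lt0//; apply/andP; split; lra.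
pose chi (x : R) := clamp (N.+1%:R - `|x|).
have cchi : continuous chi.
  have cN : continuous (fun x : R => N.+1%:R - `|x|).
    by move=> x; apply: cvgB; [exact: cvg_cst|apply: cvg_norm; exact: cvg_id].
  move=> x; rewrite /chi /clamp; apply: cvgM; last exact: cvg_cst.
  apply: cvgD; last exact: cvg_cst.
  apply: cvgB; first by apply: cvg_norm; exact: cN.
  by apply: cvg_norm; apply: cvgB; [exact: cN|exact: cvg_cst].
have chi01 x : 0 <= chi x <= 1 by exact: clamp01.
pose h x := g n x * chi x.
have ch : continuous h by move=> x; apply: cvgM; [exact: cg|exact: cchi].
have mh : measurable_fun (setT : set (measurableTypeR R)) h by exact: continuous_measurable1.
exists h; split => //; last first.
  apply: (@L1cont_shift_csupp _ _ N.+1%:R) => // x xN.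
  by rewrite /h /chi clamp0 ?mulr0// subr_le0 ltW.
apply: (@le_trans _ _ ((e / 2)%:E + (e / 2)%:E)%E); last by rewrite -EFinD -splitr.
apply: le_trans (leeD fN gn).
rewrite [X in (_ <= _ + X)%E]integral_mkcond /L1dist.
have mfI : measurable_fun (setT : set (measurableTypeR R)) (fun x => f x * \1_(I N) x).
  by apply: measurable_funM => //; exact: measurable_indic.
have mfg : measurable_fun setT ((fun z => `|(f z - g n z)%:E|%E) \_ (I N.+1)).
  apply/(measurable_restrictT _ (mI N.+1)); apply: measurable_funTS.
  by apply: measurableT_comp => //; apply/measurable_EFinP; exact: measurable_funB.
rewrite -ge0_integralD//; last 2 first.
- exact: measurable_L1.
- by move=> x _; rewrite patchE; case: ifP.
apply: ge0_le_integral => //.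
- exact: measurable_L1.
- by apply: emeasurable_funD => //; exact: measurable_L1.
move=> x _; rewrite patchE indicE; have /andP[c0 c1] := chi01 x.
have [xN|/negP xN] := boolP (x \in I N).
  have xlN : `|x| <= N%:R by move: xN; rewrite inE /I/= in_itv/= -ler_norml.
  have -> : x \in I N.+1.
    by rewrite inE /I/= in_itv/= -ler_norml (le_trans xlN)// ler_nat.
  have -> : h x = g n x.
    by rewrite /h /chi clamp1 ?mulr1// lerBrDr -natr1 addrC lerD2r.
  by rewrite mulr1 subrr normr0 add0e.
rewrite mulr0 subr0; have [xN1|/negP xN1] := boolP (x \in I N.+1).
  rewrite -EFinD lee_fin.
  (* In the collar between [I N] and [I N.+1] the first term is paid for by the tail of f and the
     second by the approximation on [I N.+1]; this is why the approximation is made on the larger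
     interval. *)
  have -> : f x - h x = f x * (1 - chi x) + (f x - g n x) * chi x by rewrite /h; ring.
  rewrite (le_trans (ler_normD _ _))// lerD// normrM.
    by rewrite ler_piMr// ger0_norm; lra.
  by rewrite ler_piMr// ger0_norm.
rewrite adde0 lee_fin /h /chi clamp0 ?mulr0 ?subr0// subr_le0 leNgt.
by apply/negP => xl; apply: xN1; rewrite inE /I/= in_itv/= -ler_norml ltW.
Qed.

Lemma cvg_fst_pair (U V : normedModType R) (b : nat -> U * V) :
  b n @[n --> \oo] --> (0 : U * V) -> (b n).1 @[n --> \oo] --> (0 : U).
Proof.
move=> /cvgr0Pnorm_le b0; apply/cvgr0Pnorm_le => e e0.
apply: filterS (b0 e e0) => n; apply: le_trans.
by rewrite [leRHS]prod_normE le_max lexx.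
Qed.

Lemma cvg_snd_pair (U V : normedModType R) (b : nat -> U * V) :
  b n @[n --> \oo] --> (0 : U * V) -> (b n).2 @[n --> \oo] --> (0 : V).
Proof.
move=> /cvgr0Pnorm_le b0; apply/cvgr0Pnorm_le => e e0.
apply: filterS (b0 e e0) => n; apply: le_trans.
by rewrite [leRHS]prod_normE le_max lexx orbT.
Qed.

Lemma scales_shift1 (a : R) :
  scales_measure mu 1 (fun x : measurableTypeR R => (a + x) : measurableTypeR R).
Proof.
have := scales_affine1 a (@ltr01 R); rewrite invr1.
by under eq_fun do rewrite mul1r.
Qed.

Lemma scales_shift2 (a : R * R) :
  scales_measure (sprod mu mu) 1 (fun x : measurableTypeR R * measurableTypeR R => (a.1 + x.1, a.2 + x.2)).
Proof. by rewrite -[1]mulr1; apply: scales_sprod; exact: scales_shift1. Qed.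

Lemma L1cont_shift3 (b : nat -> E3 R) : b n @[n --> \oo] --> (0 : E3 R) ->
  L1cont (mu3 R) (fun n (x : E3 (measurableTypeR R)) => b n + x : E3 (measurableTypeR R)).
Proof.
move=> b0; have b1 := cvg_fst_pair b0; have b2 := cvg_snd_pair b0.
have b11 := cvg_fst_pair b1; have b12 := cvg_snd_pair b1.
have H := L1cont_sprod (fun n => scales_shift2 (b n).1) (fun n => scales_shift1 (b n).2)
  (L1cont_sprod (fun n => scales_shift1 (b n).1.1) (fun n => scales_shift1 (b n).1.2)
    (L1cont_shift1 b11) (L1cont_shift1 b12)) (L1cont_shift1 b2).
exact: H.
Qed.

Lemma L1cont_shift4 (b : nat -> E3t R) : b n @[n --> \oo] --> (0 : E3t R) ->
  L1cont (mu4 R) (fun n (x : E3t (measurableTypeR R)) => b n + x : E3t (measurableTypeR R)).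
Proof.
move=> b0; have b1 := cvg_fst_pair b0; have b2 := cvg_snd_pair b0.
have H := L1cont_sprod (fun n => scales_shift3 (b n).1) (fun n => scales_shift1 (b n).2)
  (L1cont_shift3 b1) (L1cont_shift1 b2).
exact: H.
Qed.

(** Dominated convergence speaks of sequences of shifts. If no radius worked, counterexamples of
    norm at most 1/(n+1) would form a sequence tending to 0. *)
Lemma seq_to_small (V : normedModType R) (P : V -> Prop) :
  (forall b : nat -> V, b n @[n --> \oo] --> (0 : V) -> exists n, P (b n)) ->
  exists2 d : R, 0 < d & forall b, `|b| <= d -> P b.
Proof.
move=> H; apply: contrapT => /forall2NP nd.
have bn (n : nat) : exists b : V, `|b| <= n.+1%:R^-1 /\ ~ P b.
  have [hn|hn] := nd n.+1%:R^-1; first by case: hn; rewrite invr_gt0 ltr0n.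
  by move/existsNP : hn => [b /not_implyP hb]; exists b.
have [b hb] := choice bn.
have [n Pn] : exists n, P (b n).
  apply: H; apply/cvgr0Pnorm_le => e e0.
  have /cvgr0Pnorm_le/(_ e e0) := @cvg_harmonic R.
  by apply: filterS => n; rewrite ger0_norm//; exact: le_trans (hb n).1.
by have := (hb n).2.
Unshelve. all: end_near. Qed.

Lemma L1_shift_small3 (f : E3 R -> R) (e : R) : (mu3 R).-integrable setT (EFin \o f) ->
  0 < e -> exists2 d : R, 0 < d &
  forall b : E3 R, `|b| <= d -> (L1dist (mu3 R) (fun x => f (b + x)%R) f <= e%:E)%E.
Proof.
move=> fi e0; apply: seq_to_small => b b0.
have /fine_cvgP[fin /cvgrPdist_le/(_ _ e0) H] := L1cont_shift3 b0 fi.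
have [n _ /(_ n (leqnn n)) h] := filterI fin H; exists n.
have [/= h1 h2] := h; rewrite -(fineK h1) lee_fin; apply: le_trans h2.
by rewrite sub0r normrN ler_norm.
Qed.

Lemma L1_shift_small4 (f : E3t R -> R) (e : R) : (mu4 R).-integrable setT (EFin \o f) ->
  0 < e -> exists2 d : R, 0 < d &
  forall b : E3t R, `|b| <= d -> (L1dist (mu4 R) (fun x => f (b + x)%R) f <= e%:E)%E.
Proof.
move=> fi e0; apply: seq_to_small => b b0.
have /fine_cvgP[fin /cvgrPdist_le/(_ _ e0) H] := L1cont_shift4 b0 fi.
have [n _ /(_ n (leqnn n)) h] := filterI fin H; exists n.
have [/= h1 h2] := h; rewrite -(fineK h1) lee_fin; apply: le_trans h2.
by rewrite sub0r normrN ler_norm.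
Qed.

End line.

(** * Directional derivatives and bump functions *)

Section derivative_criteria.
Context (R : realType).

Section criteria.
Variable V : normedModType R.
Implicit Types (f : V -> R) (x v : V).

Lemma is_derive_of_cvg f x v (d : R) :
  h^-1 * (f (x + h *: v) - f x) @[h --> (0 : R)^'] --> d ->
  is_derive x v (f : V -> R^o) d.
Proof.
move=> H; have E : (fun h : R => h^-1 *: (((f : V -> R^o) \o shift x) (h *: v) - f x)) =
    (fun h => h^-1 * (f (x + h *: v) - f x)).
  by apply/funext => h; rewrite /= [h *: v + x]addrC.
apply: DeriveDef; first by rewrite /derivable E; apply/cvg_ex; exists d.
by rewrite /derive E; exact: cvg_lim.
Qed.

Lemma is_derive_cvg f x v (d : R) : is_derive x v (f : V -> R^o) d ->
  h^-1 * (f (x + h *: v) - f x) @[h --> (0 : R)^'] --> d.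
Proof.
move=> [df <-]; have E : (fun h : R => h^-1 *: (((f : V -> R^o) \o shift x) (h *: v) - f x)) =
    (fun h => h^-1 * (f (x + h *: v) - f x)).
  by apply/funext => h; rewrite /= [h *: v + x]addrC.
by move: df; rewrite /derivable /derive E.
Qed.

Lemma is_derive_eps f x v (d : R) :
  (forall e : R, 0 < e -> exists2 r : R, 0 < r & forall h, h != 0 -> `|h| < r ->
     `|f (x + h *: v) - f x - h * d| <= e * `|h|) ->
  is_derive x v (f : V -> R^o) d.
Proof.
move=> H; apply: is_derive_of_cvg; apply/cvgrPdist_le => e e0.
have [r r0 hr] := H e e0; near=> h.
have h0 : h != 0 by near: h; exact: nbhs_dnbhs_neq.
have hlr : `|h| < r.
  by near: h; apply: dnbhs0_lt.
rewrite distrC -(ler_pM2r (_ : 0 < `|h|)) ?normr_gt0// -normrM.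
have -> : (h^-1 * (f (x + h *: v) - f x) - d) * h = f (x + h *: v) - f x - h * d.
  by field.
exact: hr.
Unshelve. all: end_near. Qed.

End criteria.

Section line.
Variable V : normedModType R.
Implicit Types (f g : V -> R) (x v : V).

Lemma is_derive_line f x v (t d : R) : is_derive (x + t *: v) v (f : V -> R^o) d <->
  is_derive t (1 : R) (fun s : R => f (x + s *: v) : R^o) d.
Proof.
have E : (fun h => h^-1 * (f (x + t *: v + h *: v) - f (x + t *: v))) =
    (fun h => h^-1 * ((fun s : R => f (x + s *: v)) (t + h *: (1 : R)) - f (x + t *: v))).
  by apply/funext => h; rewrite /= -addrA -scalerDl [h *: (1 : R)]mulr1.
split => H.
  by apply: (@is_derive_of_cvg R^o (fun s : R => f (x + s *: v)) t 1); rewrite -E; exact: is_derive_cvg.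
by apply: is_derive_of_cvg; rewrite E; exact: (@is_derive_cvg R^o (fun s : R => f (x + s *: v)) t 1).
Qed.

Lemma is_deriveM' f g x v (a b c : R) : is_derive x v (f : V -> R^o) a ->
  is_derive x v (g : V -> R^o) b -> c = a * g x + f x * b ->
  is_derive x v (fun y => f y * g y : R^o) c.
Proof.
move=> df dg ->; have := is_deriveM df dg.
by rewrite addrC [g x *: a]mulrC.
Qed.

Lemma is_deriveD' f g x v (a b c : R) : is_derive x v (f : V -> R^o) a ->
  is_derive x v (g : V -> R^o) b -> c = a + b ->
  is_derive x v (fun y => f y + g y : R^o) c.
Proof. by move=> df dg ->; exact: is_deriveD. Qed.

Lemma is_deriveB' f g x v (a b c : R) : is_derive x v (f : V -> R^o) a ->
  is_derive x v (g : V -> R^o) b -> c = a - b ->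
  is_derive x v (fun y => f y - g y : R^o) c.
Proof. by move=> df dg ->; exact: is_deriveB. Qed.

Lemma is_deriveN' f x v (a c : R) : is_derive x v (f : V -> R^o) a -> c = - a ->
  is_derive x v (fun y => - f y : R^o) c.
Proof. by move=> df ->; exact: is_deriveN. Qed.

Lemma is_derive_cst' x v (a : R) : is_derive x v (fun=> a : R^o) 0.
Proof. exact: is_derive_cst. Qed.

Lemma is_deriveZ' f x v (k a c : R) : is_derive x v (f : V -> R^o) a ->
  c = k * a -> is_derive x v (fun y => k * f y : R^o) c.
Proof.
move=> df ->; apply: (is_deriveM' (is_derive_cst' x v k) df).
by rewrite mul0r add0r.
Qed.

Lemma is_derive_sum' n (F : 'I_n -> V -> R) (D : 'I_n -> R) x v :
  (forall i, is_derive x v (F i : V -> R^o) (D i)) ->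
  is_derive x v (fun y => \sum_i F i y : R^o) (\sum_i D i).
Proof.
move=> H; have -> : (fun y => \sum_i F i y : R^o) = \sum_i (F i : V -> R^o).
  by apply/funext => y; rewrite fct_sumE.
exact: is_derive_sum.
Qed.

Lemma is_derive_comp' (F : R -> R) f x v (a b c : R) :
  is_derive (f x) (1 : R) (F : R -> R^o) a -> is_derive x v (f : V -> R^o) b ->
  c = a * b -> is_derive x v (fun y => F (f y) : R^o) c.
Proof.
move=> dF df ->.
have := (is_derive_line (fun y => F (f y)) x v 0 (a * b)).
rewrite scale0r addr0 => -[_]; apply.
have := (is_derive_line f x v 0 b); rewrite scale0r addr0 => -[/(_ df) df0 _].
apply: (@is_derive1_comp R F (fun s : R => f (x + s *: v)) 0 a b).
by rewrite scale0r addr0.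
Qed.

Lemma near_eq_is_derive' f g x v (a : R) : (\near x, f x = g x) ->
  is_derive x v (f : V -> R^o) a -> is_derive x v (g : V -> R^o) a.
Proof. exact: near_eq_is_derive. Qed.

End line.
End derivative_criteria.

(** * A smooth bump together with all its derivatives *)

Section smooth_bump.
Context (R : realType).
Implicit Types (p : {poly R}) (x : R).

(** The functions p(1/x) e^(-1/x), extended by 0. Differentiation keeps this form and replaces p by
    X^2 (p - p'), so all derivatives are handled at once. *)
Definition flat p x : R := if 0 < x then p.[x^-1] * expR (- x^-1) else 0.

Lemma flat_bound p m : exists2 C : R, 0 <= C &
  forall x, 0 < x <= 1 -> `|flat p x| <= C * x ^+ m.
Proof.
(* With y = 1/x >= 1, the bound e^y >= y^(n+1) / (n+1)! >= y^n / (n+1)! absorbs the powers of y in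
   p, at most [size p] of them, and leaves x^m. *)
pose n := (size p + m)%N.
exists ((\sum_(i < size p) `|p`_i|) * n.+1`!%:R).
  by rewrite mulr_ge0// sumr_ge0.
move=> x /andP[x0 x1]; rewrite /flat x0 normrM (ger0_norm (expR_ge0 _)).
have y1 : 1 <= x^-1 by rewrite invf_ge1.
have y0 : 0 < x^-1 by rewrite invr_gt0.
have pb : `|p.[x^-1]| <= (\sum_(i < size p) `|p`_i|) * x^-1 ^+ size p.
  rewrite horner_coef (le_trans (ler_norm_sum _ _ _))// mulr_suml.
  apply: ler_sum => i _; rewrite normrM ler_wpM2l// ger0_norm ?exprn_ge0 ?(ltW y0)//.
  by apply: ler_weXn2l => //; exact: ltnW.
have eb : expR (- x^-1) <= n.+1`!%:R * x ^+ n.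
  rewrite expRN invf_ple ?posrE ?expR_gt0//; last first.
    by rewrite mulr_gt0 ?exprn_gt0// ltr0n fact_gt0.
  apply: le_trans (expR_ge1Dxn n (ltW y0)); rewrite invfM.
  apply: (@le_trans _ _ (x^-1 ^+ n.+1 / n.+1`!%:R)); last by rewrite lerDr.
  by rewrite mulrC ler_pM2r ?invr_gt0 ?ltr0n ?fact_gt0// -exprVn ler_weXn2l.
apply: (le_trans (ler_pM (normr_ge0 _) (expR_ge0 _) pb eb)).
have -> : x ^+ n = x ^+ size p * x ^+ m by rewrite /n exprD.
have -> : x^-1 ^+ size p = (x ^+ size p)^-1 by rewrite exprVn.
have xs : x ^+ size p != 0 by rewrite expf_neq0// lt0r_neq0.
by rewrite le_eqVlt; apply/orP; left; apply/eqP; field.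
Qed.

Lemma is_derive_inv x : x != 0 -> is_derive x (1 : R) (fun y : R => y^-1 : R^o) (- x ^- 2).
Proof.
move=> x0; apply: DeriveDef; first exact: (derivableV (f := id)).
by rewrite (deriveV (f := id))// derive_id scaler1.
Qed.

Lemma flat_derive p x : is_derive x (1 : R) (flat p : R -> R^o) (flat ('X^2 * (p - p^`())) x).
Proof.
have [x0|x0|->] := ltgtP x 0.
- have -> : flat ('X^2 * (p - p^`())) x = 0 by rewrite /flat ltNge ltW.
  apply: (@near_eq_is_derive' R R^o (fun=> 0)).
  near=> y; rewrite /flat ltNge /cst ltW//.
  by near: y; exact: lt_nbhsl.
- apply: (@near_eq_is_derive' R R^o (fun y => p.[y^-1] * expR (- y^-1))).
    near=> y; rewrite /flat ifT//.
    by near: y; exact: lt_nbhsr.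
  have xn0 := lt0r_neq0 x0.
  have dV := is_derive_inv xn0.
  have d1 := is_derive_comp' (V := R^o) (f := fun y : R => y^-1) (F := horner p) (is_derive_poly p x^-1) dV erefl.
  have dN : is_derive x (1 : R) (fun y : R => - y^-1 : R^o) (- - x ^- 2) by exact: is_deriveN'.
  have d2 := is_derive_comp' (V := R^o) (f := fun y : R => - y^-1) (F := expR) (is_derive_expR (- x^-1)) dN erefl.
  apply: (is_deriveM' d1 d2); rewrite /flat x0 !hornerE /=.
  by field.
- have -> : flat ('X^2 * (p - p^`())) 0 = 0 by rewrite /flat ltxx.
  (* Quadratic decay at 0 from the right gives the derivative 0 there. *)
  have [C C0 hC] := flat_bound p 2.
  apply: is_derive_eps => e e0; exists (Num.min 1 (e / (C + 1))).
    by rewrite lt_min ltr01 divr_gt0// ltr_wpDl.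
  move=> h h0; rewrite lt_min => /andP[h1 he].
  rewrite add0r mulr0 subr0 [X in _ - X]/flat ltxx subr0 [h *: 1]mulr1.
  have [hp|hn] := ltP 0 h; last by rewrite /flat ltNge hn normr0 mulr_ge0// ltW.
  move: h1 he; rewrite (gtr0_norm hp) => h1 he.
  apply: (le_trans (hC h _)); first by rewrite hp ltW.
  rewrite expr2 mulrA ler_pM2r//.
  rewrite ltr_pdivlMr ?ltr_wpDl// in he.
  apply: le_trans (ltW he); rewrite mulrC ler_pM2l//; lra.
Unshelve. all: end_near. Qed.

(* [flat p (1 + x) * flat q (1 - x)] is supported in [-1, 1]; the derivatives of
   the bump are finite sums of such functions. *)
Inductive bump_span : (R -> R) -> Prop :=
| bump_gen p q : bump_span (fun x => flat p (1 + x) * flat q (1 - x))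
| bump_add f g : bump_span f -> bump_span g -> bump_span (fun x => f x + g x)
| bump_opp f : bump_span f -> bump_span (fun x => - f x).

Lemma bump_span_derive f : bump_span f -> exists2 g, bump_span g &
  forall x, is_derive x (1 : R) (f : R -> R^o) (g x).
Proof.
elim=> [p q|{}f g _ [f' sf' df] _ [g' sg' dg]|{}f _ [f' sf' df]].
- exists (fun x => flat ('X^2 * (p - p^`())) (1 + x) * flat q (1 - x) +
     - (flat p (1 + x) * flat ('X^2 * (q - q^`())) (1 - x))).
    by apply: bump_add; [|apply: bump_opp]; exact: bump_gen.
  move=> x.
  have e1 : is_derive x (1 : R) (fun y : R => 1 + y : R^o) 1.
    by apply: (is_deriveD' (is_derive_cst' _ _ _) (is_derive_id _ _)); rewrite add0r.
  have e2 : is_derive x (1 : R) (fun y : R => 1 - y : R^o) (- 1).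
    by apply: (is_deriveB' (is_derive_cst' _ _ _) (is_derive_id _ _)); rewrite sub0r.
  have d1 := is_derive_comp' (V := R^o) (f := fun y : R => 1 + y) (flat_derive p (1 + x)) e1 erefl.
  have d2 := is_derive_comp' (V := R^o) (f := fun y : R => 1 - y) (flat_derive q (1 - x)) e2 erefl.
  by apply: (is_deriveM' d1 d2); ring.
- exists (fun x => f' x + g' x); first exact: bump_add.
  by move=> x; exact: is_deriveD'.
- exists (fun x => - f' x); first exact: bump_opp.
  by move=> x; exact: is_deriveN'.
Qed.

Lemma bump_span_supp f x : bump_span f -> 1 <= `|x| -> f x = 0.
Proof.
move=> sf; rewrite ler_normr => x1.
elim: sf => [p q|{}f g _ -> _ ->|{}f _ ->]; rewrite ?addr0 ?oppr0//.
case/orP: x1 => x1; rewrite /flat.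
  by rewrite [X in _ * X]ifF ?mulr0//; apply/negbTE; rewrite -leNgt subr_le0.
by rewrite ifF ?mul0r//; apply/negbTE; rewrite -leNgt; lra.
Qed.

(** Closure of the span under differentiation is iterated into a sequence of successive derivatives.
    It starts from e^(-1/(1+x)) e^(-1/(1-x)), the generator with p = q = 1, and every member
    inherits the support [-1, 1]. *)
Lemma bump_sequence : exists g : nat -> R -> R,
  [/\ forall k x, is_derive x (1 : R) (g k : R -> R^o) (g k.+1 x),
      forall k x, 1 <= `|x| -> g k x = 0,
      forall x, 0 <= g 0%N x & 0 < g 0%N 0].
Proof.
have H (f : {f : R -> R | bump_span f}) : {g : {f : R -> R | bump_span f} |
    forall x, is_derive x (1 : R) (sval f : R -> R^o) (sval g x)}.
  apply: cid; have [g sg dg] := bump_span_derive (svalP f).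
  by exists (exist _ g sg).
pose g0 := exist bump_span _ (bump_gen 1 1).
pose g k := iter k (fun f => sval (H f)) g0.
exists (fun k => sval (g k)); split.
- by move=> k x; exact: (svalP (H (g k))).
- by move=> k x; exact: bump_span_supp (svalP (g k)).
- move=> x; change (0 <= flat 1 (1 + x) * flat 1 (1 - x)).
  by rewrite /flat !hornerE; do 2 case: ifP => _; rewrite ?mulr0 ?mul0r// mulr_ge0 ?expR_ge0 ?mul1r.
- change (0 < flat 1 (1 + 0) * flat 1 (1 - 0)).
  by rewrite /flat addr0 subr0 ltr01 -polyC1 !hornerC !mul1r mulr_gt0 ?expR_gt0.
Qed.

End smooth_bump.

(** * One-dimensional mollifying kernels *)

Section kernels.
Context (R : realType).
Local Notation mu := (@lebesgue_measure R).

Lemma derive_continuous (f f' : R -> R) :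
  (forall x, is_derive x (1 : R) (f : R -> R^o) (f' x)) -> continuous f.
Proof.
move=> df x; apply: differentiable_continuous; apply/derivable1_diffP.
by have := df x => dfx; exact: ex_derive.
Qed.

Lemma compact_support_bounded (h : R -> R) (r : R) : continuous h ->
  (forall x, r <= `|x| -> h x = 0) -> exists2 M : R, 0 < M & forall x, `|h x| <= M.
Proof.
move=> ch hr; have cK : compact (`[- r, r]%classic : set R) by exact: segment_compact.
have /compact_bounded[M [_ mrt]] := continuous_compact (continuous_subspaceT ch) cK.
exists (`|M| + 1); first by rewrite ltr_wpDl.
move=> x; have [rx|xr] := leP r `|x|; first by rewrite hr// normr0 addr_ge0.
apply: (mrt (`|M| + 1)); first by rewrite (le_lt_trans (ler_norm _))// ltrDl.
by exists x => //; rewrite /= in_itv/= -ler_norml ltW.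
Qed.

Lemma compact_support_integrable (h : R -> R) (r : R) : continuous h ->
  (forall x, r <= `|x| -> h x = 0) -> (mu1 R).-integrable setT (EFin \o h).
Proof.
move=> ch hr.
have E : h = h \_ (`[- r, r]%classic : set R).
  apply/funext => x; rewrite patchE; case: ifPn => // /negP xr.
  rewrite hr// leNgt; apply/negP => xl; apply: xr.
  by rewrite inE/= in_itv/= -ler_norml ltW.
have mJ : measurable (`[- r, r]%classic : set (measurableTypeR R)) by exact: measurable_itv.
rewrite E -restrict_EFin; apply/(integrable_mkcond _ mJ).
have cK : compact (`[- r, r]%classic : set R) by exact: segment_compact.
exact: continuous_compact_integrable cK (continuous_subspaceT ch).
Qed.

Lemma mollifier_exists : exists g : nat -> R -> R,
  [/\ forall k x, is_derive x (1 : R) (g k : R -> R^o) (g k.+1 x),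
      forall k x, 1 <= `|x| -> g k x = 0,
      forall x, 0 <= g 0%N x & \int[mu1 R]_x g 0%N x = 1].
Proof.
have [g [dg sg g0 gp]] := bump_sequence R.
have cg k : continuous (g k) by exact: derive_continuous (dg k).
have ig k := compact_support_integrable (cg k) (sg k).
pose c := \int[mu1 R]_x g 0%N x.
(* By continuity the bump stays above half of its value at 0 on an interval of length 2r, which
   bounds its integral from below. *)
have c0 : 0 < c.
  have [r r0 gr] : exists2 r : R, 0 < r & forall x, `|x| <= r -> g 0%N 0 / 2 <= g 0%N x.
    have /cvgrPdist_le/(_ (g 0%N 0 / 2) _) := cg 0%N 0.
    rewrite divr_gt0// => /(_ isT)/nbhs_ballP[r/= r0 hr].
    exists (r / 2); first by rewrite divr_gt0.
    move=> x xr; have := hr x; rewrite /ball/= sub0r normrN.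
    have xr' : `|x| < r by rewrite (le_lt_trans xr)// ltr_pdivrMr// ltr_pMr// ltr1n.
    by move=> /(_ xr'); rewrite ler_norml => /andP[_]; lra.
  pose J : set R := `[- r, r]%classic.
  have mJ : measurable (J : set (measurableTypeR R)) by exact: measurable_itv.
  have muJ : (mu1 R J = (r *+ 2)%:E)%E.
    rewrite mu1E lebesgue_measure_itv/= lte_fin gtrN// -EFinB opprK.
    by rewrite mulr2n.
  rewrite -lte_fin /c EFin_Rintegral//.
  apply: (@lt_le_trans _ _ (\int[mu1 R]_(x in J) (g 0%N 0 / 2)%:E)%E).
    rewrite integral_cst// [X in (_ * X)%E](_ : _ = (r *+ 2)%:E) //.
    by rewrite -EFinM lte_fin mulr_gt0// ?divr_gt0// mulrn_wgt0.
  rewrite [leLHS]integral_mkcond; apply: ge0_le_integral => //.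
  - by move=> x _; rewrite patchE; case: ifP => // _; rewrite lee_fin divr_ge0// ltW.
  - by apply/(measurable_restrictT _ mJ); exact: measurable_cst.
  - by apply/measurable_EFinP; exact: continuous_measurable1 (cg 0%N).
  - move=> x _; rewrite patchE; case: ifPn; rewrite ?lee_fin// inE /J/= in_itv/= -ler_norml.
    exact: gr.
exists (fun k x => c^-1 * g k x); split.
- by move=> k x; exact: (is_deriveZ' (V := R^o) (k := c^-1) (dg k x) erefl).
- by move=> k x x1; rewrite sg// mulr0.
- by move=> x; rewrite mulr_ge0// invr_ge0 ltW.
- by rewrite RintegralZl// mulVf// lt0r_neq0.
Qed.

Definition bump_deriv : nat -> R -> R := projT1 (cid mollifier_exists).

(** The k-th derivative of the rescaled mollifier e^(-1) b(x / e): one factor 1/e normalises the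
    mass, and each derivative adds another. *)
Definition kern (e : R) (k : nat) (x : R) : R := e^-1 ^+ k.+1 * bump_deriv k (e^-1 * x).

Section properties.
Variable e : R.
Hypothesis e0 : 0 < e.

Lemma kern_derive k x : is_derive x (1 : R) (kern e k : R -> R^o) (kern e k.+1 x).
Proof.
rewrite /kern /bump_deriv; case: cid => g [/= dg _ _ _].
have d1 : is_derive x (1 : R) (fun y : R => e^-1 * y : R^o) e^-1.
  by apply: (is_deriveZ' (V := R^o) (f := fun y => y) (k := e^-1) (is_derive_id _ _)); rewrite mulr1.
have d2 := is_derive_comp' (V := R^o) (f := fun y : R => e^-1 * y) (dg k (e^-1 * x)) d1 erefl.
apply: (is_deriveZ' (V := R^o) d2); rewrite [in LHS]exprS; ring.
Qed.

Lemma kern_supp k x : e <= `|x| -> kern e k x = 0.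
Proof.
move=> ex; rewrite /kern /bump_deriv; case: cid => g [/= _ sg _ _].
by rewrite sg ?mulr0// normrM gtr0_norm ?invr_gt0// mulrC ler_pdivlMr// mul1r.
Qed.

Lemma kern_continuous k : continuous (kern e k).
Proof. exact: derive_continuous (kern_derive k). Qed.

Lemma kern_ge0 x : 0 <= kern e 0 x.
Proof.
rewrite /kern /bump_deriv; case: cid => g [/= _ _ g0 _].
by rewrite mulr_ge0// exprn_ge0// invr_ge0 ltW.
Qed.

Lemma kern_bounded k : exists2 M : R, 0 < M & forall x, `|kern e k x| <= M.
Proof. by apply: (@compact_support_bounded _ e); [exact: kern_continuous|exact: kern_supp]. Qed.

Lemma kern_integrable k : (mu1 R).-integrable setT (EFin \o kern e k).
Proof. by apply: (@compact_support_integrable _ e); [exact: kern_continuous|exact: kern_supp]. Qed.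

Lemma kern_integral1 : \int[mu1 R]_x kern e 0 x = 1.
Proof.
have cb : continuous (bump_deriv 0).
  by rewrite /bump_deriv; case: cid => g [/= dg _ _ _]; exact: derive_continuous (dg 0%N).
have sb x : 1 <= `|x| -> bump_deriv 0 x = 0.
  by rewrite /bump_deriv; case: cid => g [/= _ sg _ _]; exact: sg.
have ib := compact_support_integrable cb sb.
have ei : 0 < e^-1 by rewrite invr_gt0.
have sc := scales_affine1 0 ei; rewrite invrK in sc.
have := scales_Rintegral sc ib; under eq_Rintegral do rewrite add0r.
move=> E; rewrite /kern RintegralZl//; last first.
  have := scales_integrable sc ib; apply: eq_integrable => // x _.
  by rewrite /= add0r.
rewrite E expr1 mulrA mulVf ?lt0r_neq0// mul1r.
by rewrite /bump_deriv; case: cid => g [/= _ _ _].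
Qed.

End properties.
End kernels.

(** * Hardy's inequality and pointwise Sobolev estimates in dimension three *)

Section coordinates.
Context (R : realType).

Definition coord (i : 'I_3) (x : E3 R) : R :=
  if i == 0 :> nat then x.1.1 else if i == 1 :> nat then x.1.2 else x.2.

Lemma ord3P (P : 'I_3 -> Prop) : P (inord 0) -> P (inord 1) -> P (inord 2) ->
  forall i, P i.
Proof.
move=> P0 P1 P2 i; rewrite -(inord_val i).
by case: i => -[|[|[|]]].
Qed.

Lemma sum3E (F : 'I_3 -> R) : \sum_i F i = F (inord 0) + F (inord 1) + F (inord 2).
Proof.
rewrite !big_ord_recl big_ord0 addr0 addrA.
by congr (F _ + F _ + F _); apply/val_inj; rewrite /= inordK.
Qed.

Lemma coord_basis i j : coord i (basis3 R j) = (i == j)%:R.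
Proof.
by move: i j; do 2 (apply: ord3P); rewrite /coord /basis3 /= !inordK//= -(inj_eq val_inj) /= !inordK.
Qed.

Lemma coord_line i x y (t : R) : coord i (x + t *: y) = coord i x + t * coord i y.
Proof. by rewrite /coord; do 2 case: ifP => //. Qed.

Lemma coordB i x y : coord i (x - y) = coord i x - coord i y.
Proof. by rewrite /coord; do 2 case: ifP => //. Qed.

Lemma coord_norm i x : `|coord i x| <= `|x|.
Proof.
have h1 : `|x.1| <= `|x| by rewrite [leRHS]prod_normE le_max lexx.
have h2 : `|x.2| <= `|x| by rewrite [leRHS]prod_normE le_max lexx orbT.
rewrite /coord; case: ifP => _; first by rewrite (le_trans _ h1)// [leRHS]prod_normE le_max lexx.
by case: ifP => _ //; rewrite (le_trans _ h1)// [leRHS]prod_normE le_max lexx orbT.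
Qed.

Lemma coord_continuous i : continuous (coord i).
Proof.
move=> x; apply/cvgrPdist_le => e e0.
have /cvgrPdist_le/(_ e e0) := @cvg_id _ (nbhs x); apply: filterS => y.
by apply: le_trans; rewrite -coordB; exact: coord_norm.
Qed.

Lemma coord_is_derive i j x :
  is_derive x (basis3 R j) (coord i : E3 R -> R^o) (i == j)%:R.
Proof.
apply: is_derive_eps => e e0; exists 1 => // h h0 _.
rewrite coord_line coord_basis [X in `|X|](_ : _ = 0); first by rewrite normr0 mulr_ge0// ltW.
by ring.
Qed.

Lemma measurable_flow3 (v : E3 R) :
  measurable_fun setT (fun z : E3 (measurableTypeR R) * measurableTypeR R =>
    (z.1 + z.2 *: v : E3 (measurableTypeR R))).
Proof.
have m1 : measurable_fun setT (fun z : E3 (measurableTypeR R) * measurableTypeR R => z.1.1.1).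
  by apply: measurableT_comp => //; apply: measurableT_comp.
have m2 : measurable_fun setT (fun z : E3 (measurableTypeR R) * measurableTypeR R => z.1.1.2).
  by apply: measurableT_comp => //; apply: measurableT_comp.
have m3 : measurable_fun setT (fun z : E3 (measurableTypeR R) * measurableTypeR R => z.1.2).
  by apply: measurableT_comp.
have mt (a : R) : measurable_fun setT (fun z : E3 (measurableTypeR R) * measurableTypeR R => z.2 * a).
  exact: measurable_funM.
have H := measurable_fun_pair (measurable_fun_pair (measurable_funD m1 (mt v.1.1))
  (measurable_funD m2 (mt v.1.2))) (measurable_funD m3 (mt v.2)).
exact: H.
Qed.

Lemma measurable_flow4 (v : E3t R) :
  measurable_fun setT (fun z : E3t (measurableTypeR R) * measurableTypeR R =>
    (z.1 + z.2 *: v : E3t (measurableTypeR R))).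
Proof.
have m1 : measurable_fun setT (fun z : E3t (measurableTypeR R) * measurableTypeR R => (z.1.1, z.2)).
  by apply: measurable_fun_pair => //; apply: measurableT_comp.
have m3 : measurable_fun setT (fun z : E3t (measurableTypeR R) * measurableTypeR R => z.1.2).
  by apply: measurableT_comp.
have mt : measurable_fun setT (fun z : E3t (measurableTypeR R) * measurableTypeR R => z.2 * v.2).
  exact: measurable_funM.
have H := measurable_fun_pair (measurableT_comp (measurable_flow3 v.1) m1) (measurable_funD m3 mt).
exact: H.
Qed.

Lemma scales_shift3r (b : E3 R) :
  scales_measure (mu3 R) 1 (fun x : E3 (measurableTypeR R) => x + b).
Proof. by have := scales_shift3 b; under eq_fun do rewrite addrC. Qed.

Lemma scales_shift4r (b : E3t R) :
  scales_measure (mu4 R) 1 (fun x : E3t (measurableTypeR R) => x + b).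
Proof. by have := scales_shift4 b; under eq_fun do rewrite addrC. Qed.

Lemma Rintegral_derive3 (v : E3 R) (h g : E3 R -> R) :
  (forall x, is_derive x v (h : E3 R -> R^o) (g x)) ->
  (forall x, continuous (fun t : R => g (x + t *: v))) ->
  (mu3 R).-integrable setT (EFin \o h) -> (mu3 R).-integrable setT (EFin \o g) ->
  \int[mu3 R]_x g x = 0.
Proof.
move=> dh cg hi gi.
apply: (@flow_Rintegral0 _ (E3 (measurableTypeR R)) R (mu3 R) (fun t x => x + t *: v) h g) => //.
- by move=> w; rewrite scale0r addr0.
- by move=> t; exact: scales_shift3r.
- exact: measurable_flow3.
- by move=> w t; have [+ _] := is_derive_line h w v t (g (w + t *: v)); apply.
Qed.

Lemma Rintegral_derive4 (v : E3t R) (h g : E3t R -> R) :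
  (forall x, is_derive x v (h : E3t R -> R^o) (g x)) ->
  (forall x, continuous (fun t : R => g (x + t *: v))) ->
  (mu4 R).-integrable setT (EFin \o h) -> (mu4 R).-integrable setT (EFin \o g) ->
  \int[mu4 R]_x g x = 0.
Proof.
move=> dh cg hi gi.
apply: (@flow_Rintegral0 _ (E3t (measurableTypeR R)) R (mu4 R) (fun t x => x + t *: v) h g) => //.
- by move=> w; rewrite scale0r addr0.
- by move=> t; exact: scales_shift4r.
- exact: measurable_flow4.
- by move=> w t; have [+ _] := is_derive_line h w v t (g (w + t *: v)); apply.
Qed.

Lemma line_continuous (V : normedModType R) (x v : V) : continuous (fun t : R => x + t *: v).
Proof.
move=> t; apply: cvgD; first exact: cvg_cst.
by apply: cvgZ; [exact: cvg_id|exact: cvg_cst].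
Qed.

Lemma MVT_bound (f f' : R -> R) (a b e : R) :
  (forall x, is_derive x (1 : R) (f : R -> R^o) (f' x)) ->
  (forall x, `|x - a| <= `|b - a| -> `|f' x| <= e) -> `|f b - f a| <= e * `|b - a|.
Proof.
move=> df fe; have cf := derive_continuous df.
have [ab|ba] := leP a b.
  have [c + ->] := MVT_segment ab (fun x _ => df x) (continuous_subspaceT cf).
  rewrite in_itv/= => /andP[ac cb]; rewrite normrM ler_wpM2r//; apply: fe.
  by rewrite !ger0_norm ?subr_ge0// lerD2r.
have [c + E] := MVT_segment (ltW ba) (fun x _ => df x) (continuous_subspaceT cf).
rewrite distrC E in_itv/= => /andP[bc ca]; rewrite normrM (distrC b) ler_wpM2r//; apply: fe.
by rewrite distrC (distrC b) !ger0_norm ?subr_ge0// ?(ltW ba)// lerB.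
Qed.

Lemma is_derive_epsP (V : normedModType R) (f : V -> R) (x v : V) (d e : R) :
  is_derive x v (f : V -> R^o) d -> 0 < e ->
  exists2 r : R, 0 < r & forall h, `|h| < r -> `|f (x + h *: v) - f x - h * d| <= e * `|h|.
Proof.
move=> /is_derive_cvg /cvgrPdist_le H e0.
have /nbhs_ballP[r /= r0 hr] := H e e0; exists r => // h hlr.
have [->|h0] := eqVneq h 0; first by rewrite scale0r addr0 subrr mul0r subr0 !normr0 mulr0.
have := hr h; rewrite /ball/= sub0r normrN => /(_ hlr h0).
rewrite distrC -(ler_pM2r (_ : 0 < `|h|)) ?normr_gt0// -normrM.
suff -> : (h^-1 * (f (x + h *: v) - f x) - d) * h = f (x + h *: v) - f x - h * d by [].
by field.
Qed.

(** A chain rule that adds one coordinate to a curve. With u(s) held fixed, the mean value theorem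
    in the last slot and continuity of g at (u t, w t) give the new term g w'; the remaining
    difference is the derivative A of the curve whose last slot is frozen at w(t). *)
Lemma is_derive_pair (V : normedModType R) (f g : V * R -> R)
    (u : R -> V) (w : R -> R) (t A w' : R) :
  (forall z, is_derive z ((0, 1) : V * R) (f : V * R -> R^o) (g z)) ->
  continuous g -> {for t, continuous u} ->
  is_derive t (1 : R) (w : R -> R^o) w' ->
  is_derive t (1 : R) (fun s => f (u s, w t) : R^o) A ->
  is_derive t (1 : R) (fun s => f (u s, w s) : R^o) (A + g (u t, w t) * w').
Proof.
move=> df cg cu dw dA; pose g0 := g (u t, w t).
have d1 x (s : R) : is_derive s (1 : R) (fun s => f (x, s) : R^o) (g (x, s)).
  have := is_derive_line f (x, 0) (0, 1) s (g (x, s)).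
  have E (a : R) : (x, 0) + a *: ((0, 1) : V * R) = (x, a).
    by congr (_, _); rewrite /= ?scaler0 ?addr0// add0r [a *: _]mulr1.
  rewrite E => -[/(_ (df _)) + _]; under eq_fun do rewrite E.
  by [].
apply: (@is_derive_eps R R^o) => e e0.
(* The tolerances make each of the three errors at most e/3 |h|. Differentiability of w with
   tolerance 1 gives |w(s) - w(t)| <= (|w'| + 1) |h|, whence the denominator of [e1]. *)
pose e1 := e / (3 * (`|w'| + 1)); have e10 : 0 < e1 by rewrite divr_gt0// mulr_gt0// ltr_wpDl.
pose e2 := e / (3 * (`|g0| + 1)); have e20 : 0 < e2 by rewrite divr_gt0// mulr_gt0// ltr_wpDl.
have e30 : 0 < e / 3 by rewrite divr_gt0.
have /cvgrPdist_le/(_ e1 e10)/nbhs_ballP[rho /= rho0 hrho] := cg (u t, w t).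
have [r1 r10 h1] := is_derive_epsP (V := R^o) dw ltr01.
have [r2 r20 h2] := is_derive_epsP (V := R^o) dw e20.
have [r3 r30 h3] := is_derive_epsP (V := R^o) dA e30.
have /cvgrPdist_lt/(_ rho rho0)/nbhs_ballP[r4 /= r40 h4] := cu.
pose r5 := rho / (`|w'| + 1); have r50 : 0 < r5 by rewrite divr_gt0// ltr_wpDl.
exists (Num.min r1 (Num.min r2 (Num.min r3 (Num.min r4 r5)))).
  by rewrite !lt_min r10 r20 r30 r40 r50.
move=> h h0; rewrite !lt_min => /and5P[hr1 hr2 hr3 hr4 hr5].
have {}h1 := h1 h hr1; have {}h2 := h2 h hr2; have {}h3 := h3 h hr3.
have {}h4 : `|u t - u (t + h *: 1)| < rho.
  by apply: h4; rewrite /ball/= [h *: _]mulr1 opprD addrA subrr sub0r normrN.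
set s := t + h *: 1 in h1 h2 h3 h4 *.
have ws : `|w s - w t| <= (`|w'| + 1) * `|h|.
  rewrite -[w s - w t](subrK (h * w')) (le_trans (ler_normD _ _))//.
  by rewrite addrC mulrDl normrM mulrC mul1r lerD2l// -[leRHS]mul1r.
have wr : `|w s - w t| < rho.
  by rewrite (le_lt_trans ws)// mulrC -ltr_pdivlMr// ltr_wpDl.
have key : `|f (u s, w s) - f (u s, w t) - g0 * (w s - w t)| <= e1 * `|w s - w t|.
  have := @MVT_bound (fun y => f (u s, y) - g0 * y) (fun y => g (u s, y) - g0) (w t) (w s) e1.
  set D := (X in `|X| <= _); have -> : D = f (u s, w s) - f (u s, w t) - g0 * (w s - w t).
    by rewrite /D; ring.
  apply.
    move=> x; have dz : is_derive x (1 : R) (fun y : R => g0 * y : R^o) g0.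
      by apply: (is_deriveZ' (V := R^o) (f := fun y => y) (k := g0) (is_derive_id _ _)); rewrite mulr1.
    exact: (is_deriveB' (V := R^o) (d1 (u s) x) dz erefl).
  move=> x xw; rewrite distrC; apply: hrho; rewrite -ball_normE /=.
  rewrite [ltLHS]prod_normE /= gt_max h4 distrC; exact: le_lt_trans wr.
have -> : f (u s, w s) - f (u t, w t) - h * (A + g (u t, w t) * w') =
   (f (u s, w s) - f (u s, w t) - g0 * (w s - w t)) + g0 * (w s - w t - h * w') +
   (f (u s, w t) - f (u t, w t) - h * A).
  by rewrite -/g0; ring.
apply: (@le_trans _ _ (e1 * ((`|w'| + 1) * `|h|) + `|g0| * (e2 * `|h|) + e / 3 * `|h|)).
  apply: (le_trans (ler_normD _ _)); apply: lerD => //.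
  apply: (le_trans (ler_normD _ _)); apply: lerD.
    by apply: (le_trans key); rewrite ler_wpM2l// ltW.
  by rewrite normrM ler_wpM2l.
have W0 : `|w'| + 1 != 0 by rewrite lt0r_neq0// ltr_wpDl.
have G0 : `|g0| + 1 != 0 by rewrite lt0r_neq0// ltr_wpDl.
have -> : e1 * ((`|w'| + 1) * `|h|) = e / 3 * `|h| by rewrite /e1; field.
have : `|g0| * (e2 * `|h|) <= e / 3 * `|h|.
  rewrite mulrA ler_wpM2r// /e2 mulrCA ler_pM2l// ler_pdivrMr ?mulr_gt0// ?ltr_wpDl//.
  by have := normr_ge0 g0; lra.
by lra.
Qed.

Definition grad_cont (f : E3 R -> R) (F : 'I_3 -> E3 R -> R) : Prop :=
  (forall i, continuous (F i)) /\
  forall i x, is_derive x (basis3 R i) (f : E3 R -> R^o) (F i x).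

(** The coordinates are released one at a time: the first by the chain rule on the line, the other
    two by [is_derive_pair]. Continuous partial derivatives are enough. *)
Lemma is_derive_curve (f : E3 R -> R) (F : 'I_3 -> E3 R -> R) (p : R -> E3 R)
    (p' : 'I_3 -> R) (t : R) : grad_cont f F -> {for t, continuous p} ->
  (forall i, is_derive t (1 : R) (fun s => coord i (p s) : R^o) (p' i)) ->
  is_derive t (1 : R) (fun s => f (p s) : R^o) (\sum_i F i (p t) * p' i).
Proof.
move=> [cF dF] cp dp.
have b0 : basis3 R (inord 0) = (1, 0, 0) by rewrite /basis3 inordK.
have b1 : basis3 R (inord 1) = (0, 1, 0) by rewrite /basis3 inordK.
have b2 : basis3 R (inord 2) = (0, 0, 1) by rewrite /basis3 inordK.
have d0 := dp (inord 0); have d1 := dp (inord 1); have d2 := dp (inord 2).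
rewrite /coord !inordK//= in d0 d1 d2.
have c1 : {for t, continuous (fun s => (p s).1)}.
  apply/cvgrPdist_lt => e e0; have /cvgrPdist_lt/(_ e e0) := cp.
  by apply: filterS => s; apply: le_lt_trans; rewrite [leRHS]prod_normE le_max lexx.
have c11 : {for t, continuous (fun s => (p s).1.1)}.
  apply/cvgrPdist_lt => e e0; have /cvgrPdist_lt/(_ e e0) := c1.
  by apply: filterS => s; apply: le_lt_trans; rewrite [leRHS]prod_normE le_max lexx.
have E s : p s = ((p s).1.1, (p s).1.2, (p s).2) by case: (p s) => [[]].
have H0 : is_derive t (1 : R) (fun s => f ((p s).1.1, (p t).1.2, (p t).2) : R^o)
    (F (inord 0) (p t) * p' (inord 0)).
  have h (y : R) : is_derive y (1 : R) (fun y : R => f (y, (p t).1.2, (p t).2) : R^o)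
      (F (inord 0) (y, (p t).1.2, (p t).2)).
    have := is_derive_line f (0, (p t).1.2, (p t).2) (1, 0, 0) y (F (inord 0) (y, (p t).1.2, (p t).2)).
    have L (a : R) : (0, (p t).1.2, (p t).2) + a *: ((1, 0, 0) : E3 R) = (a, (p t).1.2, (p t).2).
      by congr (_, _, _); rewrite /= ?add0r ?[a *: _]mulr1// [a *: _]mulr0 addr0.
    rewrite L -b0 => -[/(_ (dF _ _)) + _]; rewrite b0; under eq_fun do rewrite L.
    by [].
  by apply: (is_derive_comp' (V := R^o) (f := fun s => (p s).1.1) (h _) d0); rewrite -E.
have H1 : is_derive t (1 : R) (fun s => f ((p s).1.1, (p s).1.2, (p t).2) : R^o)
    (F (inord 0) (p t) * p' (inord 0) + F (inord 1) (p t) * p' (inord 1)).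
  have HP := @is_derive_pair _ (fun z : R * R => f (z.1, z.2, (p t).2))
    (fun z => F (inord 1) (z.1, z.2, (p t).2)) (fun s => (p s).1.1) (fun s => (p s).1.2) t _ _ _ _ c11 d1 H0.
  rewrite [X in F (inord 1) X]E; apply: HP.
    move=> [a b]; apply: (@is_derive_of_cvg R (R * R)%type).
    have := is_derive_cvg (dF (inord 1) (a, b, (p t).2)).
    have L (h : R) : (((a, b) + h *: ((0, 1) : R * R)).1, ((a, b) + h *: ((0, 1) : R * R)).2, (p t).2)
        = (a, b, (p t).2) + h *: basis3 R (inord 1).
      by rewrite b1; congr (_, _, _); rewrite /= ?[h *: 0]mulr0 ?addr0.
    by under eq_fun do rewrite -L.
  move=> z; apply: (@continuous_comp _ _ _ (fun z : R * R => (z.1, z.2, (p t).2)) (F (inord 1))); last exact: cF.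
  apply: (@continuous_pair (R * R)%type (R * R)%type R (fun z => (z.1, z.2)) (fun=> (p t).2)).
    by under eq_fun do rewrite -surjective_pairing; move=> y; exact: cvg_id.
  by move=> y; exact: cvg_cst.
have EE : (fun s => f (p s)) = (fun s => f ((p s).1, (p s).2)).
  by apply/funext => s; rewrite -surjective_pairing.
have ET (G : E3 R -> R) : G (p t) = G ((p t).1, (p t).2) by rewrite -surjective_pairing.
have H2 := @is_derive_pair _ f (F (inord 2)) (fun s => (p s).1) (fun s => (p s).2) t _ _ _ (cF _) c1 d2.
rewrite sum3E EE [F (inord 2) _]ET; apply: H2.
  by move=> z; have := dF (inord 2) z; rewrite b2.
move: H1; congr (is_derive _ _ _ _); apply/funext => s; congr (f (_, _)).
by rewrite -surjective_pairing.
Qed.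

Lemma is_derive_val (V : normedModType R) (f : V -> R) x v (a b : R) :
  is_derive x v (f : V -> R^o) a -> a = b -> is_derive x v (f : V -> R^o) b.
Proof. by move=> ? <-. Qed.

Lemma integrable_ext d (T : measurableType d) (m : {measure set T -> \bar R}) (f g : T -> R) :
  f =1 g -> m.-integrable setT (EFin \o f) -> m.-integrable setT (EFin \o g).
Proof. by move=> /funext ->. Qed.

Lemma integrable_mul_bounded d (T : measurableType d) (m : {measure set T -> \bar R})
    (f b : T -> R) (M : R) : m.-integrable setT (EFin \o f) -> measurable_fun setT b ->
  (forall x, `|b x| <= M) -> m.-integrable setT (EFin \o (fun x => f x * b x)).
Proof.
move=> fi mb bM.
have mf : measurable_fun setT f by apply/measurable_EFinP; case/integrableP : fi.
apply: (@le_integrable_fun _ _ _ _ _ (fun x => M * `|f x|)).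
- exact: measurable_funM.
- by move=> x; rewrite normrM mulrC ler_wpM2r.
- by apply: integrableZfun; exact: integrable_norm fi.
Qed.

Lemma Rintegral_sum3 d (T : measurableType d) (m : {measure set T -> \bar R}) (F : 'I_3 -> T -> R) :
  (forall i, m.-integrable setT (EFin \o F i)) ->
  m.-integrable setT (EFin \o (fun x => \sum_i F i x)) /\
  \int[m]_x (\sum_i F i x) = \sum_i \int[m]_x F i x.
Proof.
move=> Fi.
have E : (fun x => \sum_i F i x) = (fun x => F (inord 0) x + F (inord 1) x + F (inord 2) x).
  by apply/funext => x; rewrite sum3E.
rewrite sum3E E; split; first by do 2 apply: integrableDfun => //.
by rewrite RintegralD ?RintegralD//; exact: integrableDfun.
Qed.

Lemma le_sum3 (a b : 'I_3 -> R) : (forall i, a i <= b i) -> \sum_i a i <= \sum_i b i.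
Proof. by move=> ab; exact: ler_sum. Qed.

(* Hardy's inequality with the weight [1 / (|x - c|^2 + r^2)] instead of
   [1 / |x|^2]: integrate the divergence of [g^2 (x - c) / (|x - c|^2 + r^2)]. *)
Section hardy.
Variables (c : E3 R) (r : R).
Hypothesis r0 : 0 < r.

Definition qweight (x : E3 R) : R := \sum_i (coord i x - coord i c) ^+ 2 + r ^+ 2.

Lemma qweight_gt0 x : 0 < qweight x.
Proof.
rewrite /qweight ltr_wpDl ?exprn_gt0//.
by apply: sumr_ge0 => i _; exact: sqr_ge0.
Qed.

Lemma cvg_sum_ord (T : topologicalType) n (F : 'I_n -> T -> R) :
  (forall i, continuous (F i)) -> continuous (fun x => \sum_i F i x).
Proof.
move=> cF x; elim: n F cF => [|n IH] F cF.
  by under eq_fun do rewrite big_ord0; exact: cvg_cst.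
have -> : (fun x => \sum_i F i x) = (fun x => F ord0 x + \sum_i F (lift ord0 i) x).
  by apply/funext => y; rewrite big_ord_recl.
by apply: cvgD; [exact: cF|apply: (IH (fun i => F (lift ord0 i)))].
Qed.

Lemma qweight_continuous : continuous qweight.
Proof.
move=> x; apply: cvgD; last exact: cvg_cst.
apply: (@cvg_sum_ord _ _ (fun i x => (coord i x - coord i c) ^+ 2)) => i y.
apply: (@continuous_comp _ _ _ (fun y => coord i y - coord i c) (fun a => a ^+ 2)); last exact: exprn_continuous.
by apply: cvgB; [exact: coord_continuous|exact: cvg_cst].
Qed.

Lemma qweight_derive i x :
  is_derive x (basis3 R i) (qweight : E3 R -> R^o) (2 * (coord i x - coord i c)).
Proof.
have d j : is_derive x (basis3 R i) (fun x => (coord j x - coord j c) ^+ 2 : R^o)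
    (2 * (coord j x - coord j c) * (j == i)%:R).
  have dj : is_derive x (basis3 R i) (fun x => coord j x - coord j c : R^o) (j == i)%:R.
    by apply: (is_deriveB' (coord_is_derive j i x) (is_derive_cst' x (basis3 R i) _)); rewrite subr0.
  by apply: (is_deriveM' dj dj); ring.
have H := is_derive_sum' d.
apply: (is_deriveD' H (is_derive_cst' x (basis3 R i) (r ^+ 2))); rewrite addr0.
rewrite (bigD1 i)//= eqxx mulr1 big1 ?addr0// => j ji.
by rewrite (negPf ji) mulr0.
Qed.

Definition hfield (g : E3 R -> R) i x := g x ^+ 2 * ((coord i x - coord i c) / qweight x).

Definition hdiv (g : E3 R -> R) (G : 'I_3 -> E3 R -> R) i x :=
  2 * g x * G i x * ((coord i x - coord i c) / qweight x) +
  g x ^+ 2 * ((qweight x)^-1 - 2 * (coord i x - coord i c) ^+ 2 / qweight x ^+ 2).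

Lemma hfield_derive (g : E3 R -> R) G i x : grad_cont g G ->
  is_derive x (basis3 R i) (hfield g i : E3 R -> R^o) (hdiv g G i x).
Proof.
move=> [cG dG]; have q0 := lt0r_neq0 (qweight_gt0 x).
have dc : is_derive x (basis3 R i) (fun x => coord i x - coord i c : R^o) 1.
  apply: (is_deriveB' (coord_is_derive i i x) (is_derive_cst' x (basis3 R i) _)).
  by rewrite eqxx subr0.
have dV := is_derive_comp' (is_derive_inv q0) (qweight_derive i x) erefl.
have d1 := is_deriveM' dc dV erefl.
have d2 := is_deriveM' (dG i x) (dG i x) erefl.
have := is_deriveM' d2 d1 erefl.
rewrite /hfield /hdiv; under eq_fun do rewrite -expr2.
by move=> D; apply: (is_derive_val D); field.
Qed.

(** Write y = x - c and q = |y|^2 + r^2. In dimension three the divergence contains g^2 (3/q - 2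
    |y|^2 / q^2). Completing the square in G + g y / (2q) leaves 5/2 (g/q)^2 (q - |y|^2), which is
    nonnegative because q - |y|^2 = r^2. *)
Lemma hardy_pointwise (g : E3 R -> R) G x :
  2^-1 * (g x ^+ 2 / qweight x) <= \sum_i hdiv g G i x + 2 * \sum_i G i x ^+ 2.
Proof.
have q0 := qweight_gt0 x; pose y i := coord i x - coord i c.
have E : \sum_i y i ^+ 2 = qweight x - r ^+ 2 by rewrite /qweight addrK.
rewrite !sum3E /hdiv in E *; set a := G _ x; set b := G _ x; set d := G _ x.
rewrite -!/(y _); move: (y (inord 0)) (y (inord 1)) (y (inord 2)) E => y0 y1 y2 E.
have E2 : r ^+ 2 = qweight x - (y0 ^+ 2 + y1 ^+ 2 + y2 ^+ 2) by rewrite E; ring.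
have r20 : 0 <= r ^+ 2 by exact: sqr_ge0.
rewrite E2 in r20; set q := qweight x in q0 r20 *; have qn0 := lt0r_neq0 q0.
rewrite -subr_ge0; set u := g x.
have -> : 2 * u * a * (y0 / q) + u ^+ 2 * (q^-1 - 2 * y0 ^+ 2 / q ^+ 2) +
   (2 * u * b * (y1 / q) + u ^+ 2 * (q^-1 - 2 * y1 ^+ 2 / q ^+ 2)) +
   (2 * u * d * (y2 / q) + u ^+ 2 * (q^-1 - 2 * y2 ^+ 2 / q ^+ 2)) +
   2 * (a ^+ 2 + b ^+ 2 + d ^+ 2) - 2^-1 * (u ^+ 2 / q) =
   2 * ((a + u * y0 / (2 * q)) ^+ 2 + (b + u * y1 / (2 * q)) ^+ 2 + (d + u * y2 / (2 * q)) ^+ 2) +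
   5 / 2 * (u / q) ^+ 2 * (q - (y0 ^+ 2 + y1 ^+ 2 + y2 ^+ 2)).
  by field.
by rewrite addr_ge0// mulr_ge0// ?addr_ge0 ?sqr_ge0// mulr_ge0 ?sqr_ge0.
Qed.

(** The term r^2 in the weight keeps the coefficients bounded, so the vector field and its
    divergence are integrable and no boundary term has to be discussed. The final constant does not
    depend on r. *)
Lemma hardy_coef_bound i x : `|(coord i x - coord i c) / qweight x| <= r^-1 /\
  `|(qweight x)^-1 - 2 * (coord i x - coord i c) ^+ 2 / qweight x ^+ 2| <= 3 * r ^- 2.
Proof.
set y := coord i x - coord i c; have q0 := qweight_gt0 x.
have yq : y ^+ 2 + r ^+ 2 <= qweight x.
  rewrite /qweight lerD2r (bigD1 i)//= lerDl.
  by apply: sumr_ge0 => j _; exact: sqr_ge0.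
have rq : r ^+ 2 <= qweight x by rewrite (le_trans _ yq)// lerDr sqr_ge0.
have y2q : y ^+ 2 <= qweight x by rewrite (le_trans _ yq)// lerDl sqr_ge0.
have qV : (qweight x)^-1 <= r ^- 2 by rewrite lef_pV2 ?posrE// exprn_gt0.
split.
  rewrite normrM normfV (gtr0_norm q0) ler_pdivrMr// -(ler_pM2l r0) mulrA mulfV ?lt0r_neq0// mul1r.
  apply: le_trans yq; have := sqr_ge0 (`|y| - r); rewrite -(real_normK (num_real y)).
  by have := mulr_ge0 (normr_ge0 y) (ltW r0); rewrite !expr2; nra.
have qn0 := lt0r_neq0 q0.
apply: (@le_trans _ _ (3 * (qweight x)^-1)); last by rewrite ler_pM2l.
have h1 : 0 <= y ^+ 2 / qweight x ^+ 2 by rewrite divr_ge0// sqr_ge0.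
have h2 : y ^+ 2 / qweight x ^+ 2 <= (qweight x)^-1.
  by rewrite expr2 invfM mulrA ler_pdivrMr// mulVf// ler_pdivrMr// mul1r.
have h3 : 0 <= (qweight x)^-1 by rewrite invr_ge0 ltW.
by rewrite -mulrA ler_norml; apply/andP; split; lra.
Qed.

Lemma hardy_coef_continuous i :
  continuous (fun x => (coord i x - coord i c) / qweight x) /\
  continuous (fun x => (qweight x)^-1 - 2 * (coord i x - coord i c) ^+ 2 / qweight x ^+ 2).
Proof.
have cy : continuous (fun x => coord i x - coord i c).
  by move=> x; apply: cvgB; [exact: coord_continuous|exact: cvg_cst].
have cV : continuous (fun x => (qweight x)^-1).
  by move=> x; apply: cvgV; [exact/lt0r_neq0/qweight_gt0|exact: qweight_continuous].
split; first by move=> x; apply: cvgM; [exact: cy|exact: cV].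
have -> : (fun x => (qweight x)^-1 - 2 * (coord i x - coord i c) ^+ 2 / qweight x ^+ 2) =
  (fun x => (qweight x)^-1 - 2 * ((coord i x - coord i c) * (coord i x - coord i c)) * ((qweight x)^-1 * (qweight x)^-1)).
  by apply/funext => x; rewrite !expr2 invfM.
move=> x; apply: cvgB; first exact: cV.
apply: cvgM; last by apply: cvgM; exact: cV.
by apply: cvgM; [exact: cvg_cst|apply: cvgM; exact: cy].
Qed.

Lemma sqnorm_integrable d (T : measurableType d) (m : {measure set T -> \bar R}) (f : T -> R) (K : R) :
  measurable_fun setT f -> (sqnorm m f <= K%:E)%E ->
  m.-integrable setT (EFin \o (fun x => f x ^+ 2)) /\ \int[m]_x (f x ^+ 2) <= K.
Proof.
move=> mf fK; have i : m.-integrable setT (EFin \o (fun x => f x ^+ 2)).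
  by apply: (integral_le_integrable _ _ fK); [exact: measurable_funX|move=> x; exact: sqr_ge0].
by split => //; rewrite -lee_fin EFin_Rintegral.
Qed.

Lemma hardy (g : E3 R -> R) G (K0 K : R) : continuous g -> grad_cont g G ->
  (sqnorm (mu3 R) g <= K0%:E)%E -> (forall i, (sqnorm (mu3 R) (G i) <= K%:E)%E) ->
  (\int[mu3 R]_x (g x ^+ 2 / qweight x)%:E <= (12 * K)%:E)%E.
Proof.
move=> cg gG g2 G2; have [cG dG] := gG.
have mg := continuous_measurable3 cg; have mG i := continuous_measurable3 (cG i).
have [ig _] := sqnorm_integrable mg g2.
have iG i := sqnorm_integrable (mG i) (G2 i).
have igG i := (L2_mul mg (mG i) g2 (G2 i)).1.
have ih i : (mu3 R).-integrable setT (EFin \o hfield g i).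
  apply: (integrable_mul_bounded ig); last by move=> x; exact: (hardy_coef_bound i x).1.
  exact: continuous_measurable3 (hardy_coef_continuous i).1.
have id i : (mu3 R).-integrable setT (EFin \o hdiv g G i).
  apply: integrableDfun.
    have i2 : (mu3 R).-integrable setT (EFin \o (fun x => 2 * g x * G i x)).
      by apply: (integrable_ext _ (integrableZfun 2 (igG i))) => x; rewrite mulrA.
    apply: (integrable_mul_bounded i2); last by move=> x; exact: (hardy_coef_bound i x).1.
    exact: continuous_measurable3 (hardy_coef_continuous i).1.
  apply: (integrable_mul_bounded ig); last by move=> x; exact: (hardy_coef_bound i x).2.
  exact: continuous_measurable3 (hardy_coef_continuous i).2.
have cd i : continuous (hdiv g G i).
  move=> x; apply: cvgD; apply: cvgM.
  - apply: cvgM; last exact: cG.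
    by apply: cvgM; [exact: cvg_cst|exact: cg].
  - exact: (hardy_coef_continuous i).1.
  - by under eq_fun do rewrite expr2; rewrite expr2; apply: cvgM; exact: cg.
  - exact: (hardy_coef_continuous i).2.
have d0 i : \int[mu3 R]_x hdiv g G i x = 0.
  apply: (Rintegral_derive3 (v := basis3 R i) _ _ (ih i) (id i)).
    by move=> x; exact: hfield_derive.
  move=> x t; apply: (@continuous_comp _ _ _ (fun t : R => x + t *: basis3 R i) (hdiv g G i)).
    exact: line_continuous.
  exact: cd.
have [is1 s1] := Rintegral_sum3 id.
have [is2 s2] := Rintegral_sum3 (fun i => (iG i).1).
have mq : measurable_fun setT (fun x => g x ^+ 2 / qweight x).
  apply: measurable_funM; first exact: measurable_funX.
  apply: continuous_measurable3 => x; apply: cvgV; [exact/lt0r_neq0/qweight_gt0|exact: qweight_continuous].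
have q0 x : 0 <= g x ^+ 2 / qweight x by rewrite divr_ge0 ?sqr_ge0// ltW// qweight_gt0.
have iq : (mu3 R).-integrable setT (EFin \o (fun x => 2^-1 * (g x ^+ 2 / qweight x))).
  have mq2 : measurable_fun (setT : set (E3 (measurableTypeR R))) (fun x => 2^-1 * (g x ^+ 2 / qweight x)).
    exact: measurable_funM.
  apply: (le_integrable_fun mq2 _ (integrableDfun is1 (integrableZfun 2 is2))).
  by move=> x; rewrite ger0_norm; [exact: hardy_pointwise|rewrite mulr_ge0].
have E2 (a : R) : 2 * (2^-1 * a) = a by rewrite mulrA mulfV// mul1r.
have iq1 : (mu3 R).-integrable setT (EFin \o (fun x => g x ^+ 2 / qweight x)).
  by apply: (integrable_ext _ (integrableZfun 2 iq)) => x; rewrite E2.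
rewrite -(EFin_Rintegral iq1) lee_fin.
have H : \int[mu3 R]_x (2^-1 * (g x ^+ 2 / qweight x)) <=
   \int[mu3 R]_x (\sum_i hdiv g G i x + 2 * \sum_i G i x ^+ 2).
  apply: le_Rintegral => //; last by move=> x _; exact: hardy_pointwise.
  by apply: integrableDfun => //; exact: integrableZfun.
move: H; rewrite RintegralD//; last exact: integrableZfun.
rewrite RintegralZl// RintegralZl// s1 s2 big1 ?add0r//.
(* Three components at K each, the factor 2 on the right of the pointwise bound and the factor 1/2
   on its left give 12 K. *)
have : \sum_i \int[mu3 R]_x (G i x ^+ 2) <= \sum_(i < 3) K by apply: le_sum3 => i; exact: (iG i).2.
by rewrite sumr_const card_ord -[_ *+ 3]mulr_natl; lra.
Qed.

End hardy.

End coordinates.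

Lemma integral_tensor d1 d2 (T1 : measurableType d1) (T2 : measurableType d2) (R : realType)
    (m1 : {sigma_finite_measure set T1 -> \bar R}) (m2 : {sigma_finite_measure set T2 -> \bar R})
    (f : T1 -> R) (g : T2 -> R) (A B : R) :
  measurable_fun setT f -> measurable_fun setT g -> (forall x, 0 <= f x) -> (forall y, 0 <= g y) ->
  (\int[m1]_x (f x)%:E = A%:E)%E -> (\int[m2]_y (g y)%:E = B%:E)%E ->
  (\int[sprod m1 m2]_z (f z.1 * g z.2)%:E = (A * B)%:E)%E.
Proof.
move=> mf mg f0 g0 fA gB.
have mh : measurable_fun setT (EFin \o (fun z : T1 * T2 => f z.1 * g z.2)).
  by apply/measurable_EFinP/measurable_funM; exact: measurableT_comp.
etransitivity; first by apply: (sprod_tonelli1 m1 m2 mh) => z; rewrite lee_fin mulr_ge0.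
rewrite EFinM -fA -gB -ge0_integralZr//=; last 3 first.
- exact/measurable_EFinP.
- by move=> x _; rewrite lee_fin.
- by apply: integral_ge0 => y _; rewrite lee_fin.
apply: eq_integral => x _; under eq_integral do rewrite EFinM.
by rewrite ge0_integralZl//=; [exact/measurable_EFinP|move=> y _; rewrite lee_fin|rewrite lee_fin].
Qed.

(** * Averages over cubes: sup bound and Hoelder-1/2 bound *)

Section embedding.
Context (R : realType).
Local Notation mu := (mu1 R).

Definition unitI : set R := `[0, 1]%classic.
Definition cubeI (y : E3 R) : R := \1_unitI y.1.1 * \1_unitI y.1.2 * \1_unitI y.2.

Lemma measurable_unitI : measurable (unitI : set (measurableTypeR R)).
Proof. exact: measurable_itv. Qed.

Lemma integral_unitI : (\int[mu]_x (\1_unitI x)%:E = 1)%E.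
Proof.
rewrite integral_indic; [|by []|exact: measurable_unitI].
rewrite setIT; transitivity (@lebesgue_measure R unitI) => //.
by rewrite lebesgue_measure_itv/= lte_fin ltr01 oppr0 adde0.
Qed.

Lemma measurable_cubeI : measurable_fun (setT : set (E3 (measurableTypeR R))) cubeI.
Proof.
have mI : measurable_fun (setT : set (measurableTypeR R)) (\1_unitI : R -> R).
  exact: measurable_indic measurable_unitI.
apply: measurable_funM; last exact: measurableT_comp.
by apply: measurable_funM; apply: measurableT_comp => //; exact: measurableT_comp.
Qed.

Lemma cubeI01 y : cubeI y = 0 \/ cubeI y = 1 /\ forall i, 0 <= coord i y <= 1.
Proof.
rewrite /cubeI !indicE.
have [h1|] := boolP (y.1.1 \in unitI); last by left; rewrite !mul0r.
have [h2|] := boolP (y.1.2 \in unitI); last by left; rewrite mulr0 !mul0r.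
have [h3|] := boolP (y.2 \in unitI); last by left; rewrite mulr0.
right; rewrite !mulr1; split => // i; rewrite /coord.
move: h1 h2 h3; rewrite !inE /unitI/= !in_itv/= => h1 h2 h3.
by do 2 case: ifP => //.
Qed.

Lemma cubeI_ge0 y : 0 <= cubeI y.
Proof. by have [->|[->]] := cubeI01 y. Qed.

Lemma integral_cubeI : (\int[mu3 R]_y (cubeI y)%:E = 1)%E.
Proof.
have mI : measurable_fun (setT : set (measurableTypeR R)) (\1_unitI : R -> R).
  exact: measurable_indic measurable_unitI.
have := integral_tensor (m1 := sprod mu mu) (m2 := mu) (f := fun x => \1_unitI x.1 * \1_unitI x.2)
  (g := \1_unitI) (A := 1) (B := 1).
rewrite mulr1; apply => //.
- by apply: measurable_funM; apply: measurableT_comp.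
- have := integral_tensor (m1 := mu) (m2 := mu) (f := \1_unitI) (g := \1_unitI) (A := 1) (B := 1).
  by rewrite mulr1; apply => //; exact: integral_unitI.
- exact: integral_unitI.
Qed.

(** On the cube of side s^2 at c the Hardy weight with r = s^2 is at most 4 s^4. Rescaling costs
    s^(-6), so Hardy's inequality bounds the mean square of g by s^(-6) 4 s^4 12 M^2 = 48 M^2 / s^2.
    Cauchy-Schwarz on the unit cube gives the mean, and 48 <= 7^2. *)
Lemma cube_L1 (g : E3 R -> R) G (K0 M s : R) (c : E3 R) : continuous g -> grad_cont g G ->
  (sqnorm (mu3 R) g <= K0%:E)%E -> (forall i, (sqnorm (mu3 R) (G i) <= (M ^+ 2)%:E)%E) ->
  0 <= M -> 0 < s ->
  (\int[mu3 R]_y (`|g (c + s ^+ 2 *: y)| * cubeI y)%:E <= (7 * M / s)%:E)%E.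
Proof.
move=> cg gG g2 G2 M0 s0; have s20 : 0 < s ^+ 2 by rewrite exprn_gt0.
have sc := scales_affine3 c s20.
have H := hardy c s20 cg gG g2 G2.
have mg := continuous_measurable3 cg.
have mgc : measurable_fun setT (fun y : E3 (measurableTypeR R) => g (c + s ^+ 2 *: y)).
  by apply: (measurableT_comp mg); case: sc.
have mc := measurable_cubeI.
pose W x := 4 * s ^+ 4 * (g x ^+ 2 / qweight c (s ^+ 2) x).
have q0 x : 0 < qweight c (s ^+ 2) x by exact: qweight_gt0.
have W0 x : 0 <= W x.
  by apply: mulr_ge0; [rewrite mulr_ge0// exprn_ge0// ltW|rewrite divr_ge0 ?sqr_ge0// ltW].
have mgq : measurable_fun (setT : set (E3 (measurableTypeR R))) (fun x => g x ^+ 2 / qweight c (s ^+ 2) x).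
  apply: measurable_funM; first exact: measurable_funX.
  by apply: continuous_measurable3 => x; apply: cvgV; [exact: lt0r_neq0|exact: qweight_continuous].
have mW : measurable_fun (setT : set (E3 (measurableTypeR R))) W.
  by apply: measurable_funM.
have A : (\int[mu3 R]_y (g (c + s ^+ 2 *: y) ^+ 2 * cubeI y)%:E <= (48 * M ^+ 2 / s ^+ 2)%:E)%E.
  apply: (@le_trans _ _ (\int[mu3 R]_y (W (c + s ^+ 2 *: y))%:E)%E).
    apply: ge0_le_integral => //.
    - by move=> y _; rewrite lee_fin mulr_ge0 ?sqr_ge0 ?cubeI_ge0.
    - by apply/measurable_EFinP; apply: measurable_funM => //; exact: measurable_funX.
    - by apply/measurable_EFinP; apply: (measurableT_comp mW); case: sc.
    move=> y _; rewrite lee_fin; have [->|[-> yI]] := cubeI01 y; first by rewrite mulr0.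
    rewrite mulr1 /W mulrCA ler_peMr ?sqr_ge0// ler_pdivlMr// mul1r /qweight.
    have h i : (coord i (c + s ^+ 2 *: y) - coord i c) ^+ 2 <= s ^+ 4.
      have -> : (coord i (c + s ^+ 2 *: y) - coord i c) ^+ 2 = s ^+ 4 * coord i y ^+ 2.
        by rewrite coord_line; ring.
      have /andP[y0 y1] := yI i.
      by rewrite ler_piMr ?exprn_ge0 ?(ltW s0)// expr_le1.
    have := le_sum3 h; rewrite sumr_const card_ord -exprM -[_ *+ 3]mulr_natl.
    set a := \sum_i _; rewrite -[(2 * 2)%N]/4%N; lra.
  have [_ _ E] := sc; rewrite (E (fun x => (W x)%:E)); last 2 first.
  - exact/measurable_EFinP.
  - by move=> x; rewrite lee_fin.
  rewrite /W; under eq_integral do rewrite EFinM.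
  rewrite ge0_integralZl//=; last 3 first.
  - exact/measurable_EFinP.
  - by move=> x _; rewrite lee_fin divr_ge0 ?sqr_ge0// ltW.
  - by rewrite lee_fin mulr_ge0// exprn_ge0// ltW.
  rewrite muleA -EFinM.
  apply: (@le_trans _ _ (((s ^+ 2) ^- 3 * (4 * s ^+ 4))%:E * (12 * M ^+ 2)%:E)%E).
    apply: lee_wpmul2l; last exact: H.
    by rewrite lee_fin; apply: mulr_ge0; [rewrite invr_ge0 exprn_ge0// ltW|rewrite mulr_ge0// exprn_ge0// ltW].
  rewrite -EFinM lee_fin le_eqVlt; apply/orP; left; apply/eqP; field.
  exact: lt0r_neq0.
have iu : (\int[mu3 R]_y (cubeI y)%:E <= 1%:E)%E by rewrite integral_cubeI.
have [|ii gm] := Rintegral_gm (measurable_funM mgc mc) (measurable_funM (measurable_funX 2 mgc) mc) mc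
  (fun y => mulr_ge0 (sqr_ge0 _) (cubeI_ge0 y)) cubeI_ge0 _ A iu.
  by move=> y /=; rewrite exprMn -mulrA -expr2.
have E : (\int[mu3 R]_y (`|g (c + s ^+ 2 *: y)| * cubeI y)%:E)%E = (\int[mu3 R]_y `|g (c + s ^+ 2 *: y) * cubeI y|)%R%:E.
  rewrite EFin_Rintegral; last exact: integrable_norm ii.
  by apply: eq_integral => y _; rewrite normrM (ger0_norm (cubeI_ge0 y)).
rewrite E lee_fin -ler_sqr ?nnegrE; last 2 first.
- by apply: Rintegral_ge0 => y _.
- by rewrite divr_ge0 ?mulr_ge0// ltW.
apply: (le_trans gm); rewrite mulr1.
have -> : (7 * M / s) ^+ 2 = 49 * M ^+ 2 / s ^+ 2 by field; exact: lt0r_neq0.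
by rewrite ler_pM2r ?invr_gt0// ler_wpM2r ?sqr_ge0// ler_nat.
Qed.

Lemma ftc_indic (f f' : R -> R) (a b : R) : a <= b ->
  (forall x : R, is_derive x (1 : R) (f : R -> R^o) (f' x)) -> continuous f' ->
  mu.-integrable setT (EFin \o (fun t => f' t * \1_(`[a, b] : set R) t)) /\
  \int[mu]_t (f' t * \1_(`[a, b] : set R) t) = f b - f a.
Proof.
move=> ab df cf; pose I : set (measurableTypeR R) := `[a, b]%classic.
have mI : measurable I by exact: measurable_itv.
have iI : mu.-integrable I (EFin \o f').
  apply: continuous_compact_integrable; first exact: segment_compact.
  exact: continuous_subspaceT.
have E t : ((EFin \o f') \_ I) t = (f' t * \1_I t)%:E.
  by rewrite patchE indicE; case: ifPn => _; rewrite ?mulr1 ?mulr0.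
split.
  have := iI; rewrite integrable_mkcond//; congr (_.-integrable _ _).
  by apply/funext => t; exact: E.
rewrite -(ftc_Rintegral ab df cf) /Rintegral; congr fine.
by rewrite [RHS]integral_mkcond; apply: eq_integral => t _; rewrite E.
Qed.

Lemma ftc_norm_le (f f' : R -> R) (a b : R) : a <= b ->
  (forall x : R, is_derive x (1 : R) (f : R -> R^o) (f' x)) -> continuous f' ->
  ((`|f b - f a|)%:E <= \int[mu]_t (`|f' t| * \1_(`[a, b] : set R) t)%:E)%E.
Proof.
move=> ab df cf; have [i <-] := ftc_indic ab df cf.
have /integrable_norm i' := i.
apply: (@le_trans _ _ (\int[mu]_t `|f' t * \1_(`[a, b] : set R) t|)%R%:E).
  by rewrite lee_fin; apply: le_normr_Rintegral.
rewrite (EFin_Rintegral i'); apply: ge0_le_integral => //.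
- by move=> t _; exact: normr_ge0.
- by case/integrableP : i'.
- apply/measurable_EFinP/measurable_funM; last exact: measurable_indic.
  by apply: measurableT_comp => //; exact: continuous_measurable1.
- by move=> t _; rewrite lee_fin /= normrM (ger0_norm (_ : 0 <= \1_ _ t)).
Qed.

Lemma measurable_affine (f : E3 R -> R) (c : E3 R) (s : R) : continuous f ->
  measurable_fun (setT : set (E3 (measurableTypeR R))) (fun y : E3 R => f (c + s *: y)).
Proof.
move=> cf; apply: continuous_measurable3.
apply: (continuous_compT (f := fun y : E3 R => c + s *: y) _ cf) => y.
by apply: cvgD; [exact: cvg_cst|apply: cvgZ; [exact: cvg_cst|exact: cvg_id]].
Qed.

(** The cube at c0 of side s0^2 is deformed into the one at c0 + d of side (s0 + s1)^2, with side
    b^2, b = s0 + th s1, at time th. A point y of the unit cube moves with velocity d + 2 b s1 y, of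
    size at most k b by hypothesis; this factor b cancels the singularity 7 M / b of [cube_L1]
    applied to each of the three derivatives of f. *)
Lemma path_bound (f : E3 R -> R) F FF (K1 M : R) (c0 d : E3 R) (s0 s1 k : R) :
  continuous f -> grad_cont f F -> (forall i, grad_cont (F i) (FF i)) ->
  (forall i, (sqnorm (mu3 R) (F i) <= K1%:E)%E) ->
  (forall i j, (sqnorm (mu3 R) (FF i j) <= (M ^+ 2)%:E)%E) ->
  0 <= M -> 0 <= s0 -> 0 <= s1 -> 0 <= k ->
  (forall th, 0 <= th <= 1 ->
     `|d| + 2 * (s0 + th * s1) * s1 <= k * (s0 + th * s1)) ->
  (\int[mu3 R]_y (`|f ((c0 + d) + (s0 + s1) ^+ 2 *: y) - f (c0 + s0 ^+ 2 *: y)| * cubeI y)%:E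
     <= (21 * M * k)%:E)%E.
Proof.
move=> cf fF FFF F2 FF2 M0 s00 s10 k0 hk; have [cF dF] := fF.
pose b (th : R) := s0 + th * s1.
pose p (y : E3 R) (th : R) : E3 R := (c0 + th *: d) + (b th) ^+ 2 *: y.
pose D (y : E3 R) (th : R) := \sum_i F i (p y th) * (coord i d + 2 * b th * s1 * coord i y).
have cb : continuous b.
  by move=> t; apply: cvgD; [exact: cvg_cst|apply: cvgM; [exact: cvg_id|exact: cvg_cst]].
have cp : continuous (fun z : E3t R => p z.1 z.2).
  move=> z; have c2 : z0.2 @[z0 --> z] --> z.2 by exact: cvg_snd.
  have c1 : z0.1 @[z0 --> z] --> z.1 by exact: cvg_fst.
  have cbz : (fun z0 : E3t R => b z0.2) @ z --> b z.2.
    exact: (@continuous_comp _ _ _ (fun z0 : E3t R => z0.2) b _ c2 (cb _)).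
  apply: cvgD.
    by apply: cvgD; [exact: cvg_cst|apply: cvgZ; [exact: c2|exact: cvg_cst]].
  by apply: cvgZ; [rewrite expr2; under eq_fun do rewrite expr2; exact: cvgM|exact: c1].
have cpy y : continuous (p y).
  by apply: (continuous_compT (continuous_pair (fun x => cvg_cst y) (fun x => cvg_id)) cp).
have db th : is_derive th (1 : R) (fun t => b t : R^o) s1.
  apply: (is_deriveD' (V := R^o) (is_derive_cst' _ _ s0)
    (is_deriveM' (V := R^o) (is_derive_id _ _) (is_derive_cst' _ _ s1) erefl)).
  by rewrite add0r mulr0 addr0 mul1r.
have dp y (i : 'I_3) th : is_derive th (1 : R) (fun t => coord i (p y t) : R^o) (coord i d + 2 * b th * s1 * coord i y).
  have -> : (fun t => coord i (p y t) : R^o) = (fun t => (coord i c0 + t * coord i d) + (b t * b t) * coord i y).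
    by apply/funext => t; rewrite /p !coord_line expr2.
  apply: (is_deriveD' (V := R^o) (is_deriveD' (V := R^o) (is_derive_cst' _ _ (coord i c0))
     (is_deriveM' (V := R^o) (is_derive_id _ _) (is_derive_cst' _ _ (coord i d)) erefl) erefl)
     (is_deriveM' (V := R^o) (is_deriveM' (V := R^o) (db th) (db th) erefl) (is_derive_cst' _ _ (coord i y)) erefl)).
  ring.
have df y th : is_derive th (1 : R) (fun t => f (p y t) : R^o) (D y th).
  exact: (is_derive_curve fF (cpy y th) (fun i => dp y i th)).
have cb2 : continuous (fun z : E3t R => b z.2).
  by apply: (continuous_compT (g := b) (fun z => cvg_snd)).
have cy i : continuous (fun z : E3t R => coord i z.1).
  by apply: (continuous_compT (g := coord i) (fun z => cvg_fst)) => z; exact: coord_continuous.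
have cby i : continuous (fun z : E3t R => 2 * b z.2 * s1 * coord i z.1).
  move=> z; apply: cvgM; last exact: cy.
  apply: cvgM; last exact: cvg_cst.
  by apply: cvgM; [exact: cvg_cst|exact: cb2].
have cDz : continuous (fun z : E3t R => D z.1 z.2).
  apply: cvg_sum_ord => i z; apply: cvgM.
    exact: (continuous_compT cp (cF i)).
  apply: cvgD; first exact: cvg_cst.
  exact: cby.
have cD y : continuous (D y).
  by apply: (continuous_compT (continuous_pair (fun x => cvg_cst y) (fun x => cvg_id)) cDz).
have b_ge0 th : 0 <= th <= 1 -> 0 <= b th.
  by move=> /andP[t0 _]; rewrite addr_ge0// mulr_ge0.
pose I : set (measurableTypeR R) := `[0, 1]%classic.
have mI : measurable I by exact: measurable_itv.
have mEI : measurable_fun (setT : set (measurableTypeR R)) (EFin \o (\1_I : R -> R)).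
  by apply/measurable_EFinP; exact: measurable_indic.
pose H (z : E3t (measurableTypeR R)) := `|D z.1 z.2| * \1_I z.2 * cubeI z.1.
have mH : measurable_fun setT H.
  apply: measurable_funM; last by apply: measurableT_comp => //; exact: measurable_cubeI.
  apply: measurable_funM; first by apply: measurableT_comp => //; exact: continuous_measurable4 cDz.
  by apply: measurableT_comp => //; exact: measurable_indic.
have H0 z : 0 <= H z by rewrite mulr_ge0 ?cubeI_ge0// mulr_ge0.
have S y : ((`|f ((c0 + d) + (s0 + s1) ^+ 2 *: y) - f (c0 + s0 ^+ 2 *: y)| * cubeI y)%:E
    <= \int[mu]_th (H (y, th))%:E)%E.
  have := ftc_norm_le ler01 (df y) (cD y).
  rewrite /p /b scale1r mul1r scale0r mul0r !addr0 => h.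
  have mD : measurable_fun (setT : set (measurableTypeR R)) (fun th : R => `|D y th| * \1_I th).
    apply: measurable_funM; last exact: measurable_indic.
    by apply: measurableT_comp => //; exact: continuous_measurable1.
  have -> : (\int[mu]_th (H (y, th))%:E = \int[mu]_t (`|D y t| * \1_I t)%:E * (cubeI y)%:E)%E.
    rewrite -ge0_integralZr//=.
    - exact/measurable_EFinP.
    - by rewrite lee_fin cubeI_ge0.
  by rewrite EFinM lee_wpmul2r// lee_fin cubeI_ge0.
apply: (@le_trans _ _ (\int[mu3 R]_y \int[mu]_th (H (y, th))%:E)%E).
  apply: ge0_le_integral => //.
  - by move=> y _; rewrite lee_fin mulr_ge0 ?cubeI_ge0.
  - apply/measurable_EFinP/measurable_funM; last exact: measurable_cubeI.
    by apply: measurableT_comp => //; apply: measurable_funB; exact: measurable_affine.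
  - apply: (measurable_integral1 mu (f := EFin \o H)); first exact/measurable_EFinP.
    by move=> z; rewrite lee_fin.
rewrite -(sprod_tonelli1 (mu3 R) mu (f := EFin \o H)); last 2 first.
- exact/measurable_EFinP.
- by move=> z; rewrite lee_fin.
rewrite (sprod_tonelli2 (mu3 R) mu (f := EFin \o H)); last 2 first.
- exact/measurable_EFinP.
- by move=> z; rewrite lee_fin.
apply: (@le_trans _ _ (\int[mu]_th ((21 * M * k)%:E * (\1_I th)%:E))%E); last first.
  rewrite ge0_integralZl//=; last by rewrite lee_fin !mulr_ge0.
  by rewrite (integral_unitI) mule1.
apply: ge0_le_integral => //.
- by move=> t _; apply: integral_ge0 => y _; rewrite lee_fin.
- apply: (measurable_integral2 (mu3 R) (f := EFin \o H)); first exact/measurable_EFinP.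
  by move=> z; rewrite lee_fin.
- by apply/measurable_EFinP/measurable_funM => //; exact: measurable_indic.
move=> t _; have [tI|tI] := boolP (t \in I); last first.
  rewrite [in leRHS]indicE (negbTE tI) mule0 integral0_eq// => y _.
  by rewrite /H/= indicE (negbTE tI) mulr0 mul0r.
rewrite [in leRHS]indicE tI mule1.
have t01 : 0 <= t <= 1 by move: tI; rewrite inE /I/= in_itv.
have bt0 := b_ge0 _ t01.
have mFi i : measurable_fun (setT : set (E3 (measurableTypeR R))) (fun y => k * b t * (`|F i (p y t)| * cubeI y)).
  apply: measurable_funM => //; apply: measurable_funM; last exact: measurable_cubeI.
  by apply: measurableT_comp => //; exact: measurable_affine.
have F0 i y : 0 <= k * b t * (`|F i (p y t)| * cubeI y).
  by rewrite !mulr_ge0 ?cubeI_ge0.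
apply: (@le_trans _ _ (\int[mu3 R]_y (\sum_i (k * b t * (`|F i (p y t)| * cubeI y))%:E))%E).
  apply: ge0_le_integral => //.
  - by move=> y _; rewrite lee_fin.
  - have /measurable_EFinP mEH := mH.
    exact: (measurableT_comp mEH (measurable_pair2 t)).
  - by apply: emeasurable_sum => i; exact/measurable_EFinP.
  move=> y _; rewrite sumEFin lee_fin /H/= indicE tI mulr1 /D.
  have [->|[-> yI]] := cubeI01 y.
    by rewrite mulr0 sumr_ge0// => i _; rewrite mulr0 mulr0.
  rewrite mulr1 (le_trans (ler_norm_sum _ _ _))//; apply: ler_sum => i _.
  rewrite mulr1 normrM mulrC ler_wpM2r//.
  apply: le_trans (hk _ t01); rewrite (le_trans (ler_normD _ _))// lerD ?coord_norm//.
  have /andP[y0 y1] := yI i.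
  rewrite normrM (ger0_norm y0) ger0_norm ?mulr_ge0//.
  by rewrite ler_piMr// !mulr_ge0.
rewrite ge0_integral_sum//; last 2 first.
- by move=> i; exact/measurable_EFinP.
- by move=> i y _; rewrite lee_fin.
apply: (@le_trans _ _ (\sum_(i < 3) (k * (7 * M))%:E)%E); last first.
  rewrite sumEFin lee_fin sumr_const card_ord -[_ *+ 3]mulr_natl; lra.
apply: lee_sum => i _; under eq_integral do rewrite EFinM.
rewrite ge0_integralZl//=; last 3 first.
- apply/measurable_EFinP; have [z0|kb0] := eqVneq (k * b t) 0; last first.
    have -> : (fun y => `|F i (p y t)| * cubeI y) = (fun y => (k * b t)^-1 * (k * b t * (`|F i (p y t)| * cubeI y))).
      by apply/funext => y; rewrite mulKf.
    exact: measurable_funM.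
  apply: measurable_funM; last exact: measurable_cubeI.
  by apply: measurableT_comp => //; exact: measurable_affine.
- by move=> y _; rewrite lee_fin mulr_ge0 ?cubeI_ge0.
- by rewrite lee_fin mulr_ge0.
(* Where the cube degenerates to a point the factor [k * b t] vanishes, so [cube_L1] is called only
   for a positive side. *)
have [b0|bn0] := eqVneq (b t) 0.
  by rewrite b0 mulr0 mul0e lee_fin !mulr_ge0.
have bp : 0 < b t by rewrite lt0r bn0.
have := cube_L1 (c0 + t *: d) (cF i) (FFF i) (F2 i) (FF2 i) M0 bp.
move=> h; apply: (le_trans (lee_wpmul2l _ h)); first by rewrite lee_fin mulr_ge0.
rewrite -EFinM lee_fin le_eqVlt; apply/orP; left; apply/eqP; field => //.
Qed.

Section sobolev_hoelder.
Variables (f : E3 R -> R) (F : 'I_3 -> E3 R -> R) (FF : 'I_3 -> 'I_3 -> E3 R -> R).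
Variables (K1 M : R).
Hypotheses (cf : continuous f) (fF : grad_cont f F) (FFF : forall i, grad_cont (F i) (FF i)).
Hypothesis F2 : forall i, (sqnorm (mu3 R) (F i) <= K1%:E)%E.
Hypothesis FF2 : forall i j, (sqnorm (mu3 R) (FF i j) <= (M ^+ 2)%:E)%E.
Hypothesis Mp : 0 <= M.

Let caff c s := measurable_affine c s cf.

Let mnc (g h : E3 R -> R) : measurable_fun (setT : set (E3 (measurableTypeR R))) g ->
  measurable_fun (setT : set (E3 (measurableTypeR R))) h ->
  measurable_fun (setT : set (E3 (measurableTypeR R))) (fun y => (`|g y - h y| * cubeI y)%:E).
Proof.
move=> mg mh; apply/measurable_EFinP/measurable_funM; last exact: measurable_cubeI.
by apply: measurableT_comp => //; exact: measurable_funB.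
Qed.

Let nc0 (y : E3 R) (b : R) : (0 <= (`|b| * cubeI y)%:E)%E.
Proof. by rewrite lee_fin mulr_ge0 ?cubeI_ge0. Qed.

Let average (b : R) : (`|b|%:E = \int[mu3 R]_y (`|b| * cubeI y)%:E)%E.
Proof.
under eq_integral do rewrite EFinM.
rewrite ge0_integralZl//= ?integral_cubeI ?mule1//.
  by apply/measurable_EFinP; exact: measurable_cubeI.
by move=> y _; rewrite lee_fin cubeI_ge0.
Qed.

(** The cube grows from the point c: with s0 = 0 and d = 0 the velocity 2 th s^2 is 2 s times b = th
    s, so k = 2 s. *)
Lemma average_osc (c : E3 R) (s : R) : 0 < s ->
  (\int[mu3 R]_y (`|f (c + s ^+ 2 *: y) - f c| * cubeI y)%:E <= (42 * M * s)%:E)%E.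
Proof.
move=> s0; have := @path_bound f F FF K1 M c 0 0 s (2 * s) cf fF FFF F2 FF2 Mp (lexx 0) (ltW s0).
have -> : 21 * M * (2 * s) = 42 * M * s by ring.
rewrite addr0 add0r expr0n/=; under eq_integral do rewrite scale0r addr0.
apply; first by rewrite mulr_ge0// ltW.
by move=> th /andP[th0 _]; rewrite !add0r normr0 add0r; lra.
Qed.

(** The value at c differs from the average over the cube by the oscillation; Cauchy-Schwarz on a
    cube of volume s^6 bounds the average of |f| by M0 / s^3. The scale s is left free: s = 1 gives
    a sup bound, while balancing the two terms gives interpolation between M0 and M. *)
Lemma sobolev_sup (M0 s : R) (c : E3 R) : (sqnorm (mu3 R) f <= (M0 ^+ 2)%:E)%E ->
  0 <= M0 -> 0 < s -> `|f c| <= 42 * M * s + M0 / s ^+ 3.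
Proof.
move=> f2 M0p s0; have s20 : 0 < s ^+ 2 by rewrite exprn_gt0.
have mc := measurable_cubeI.
have A : (\int[mu3 R]_y (f (c + s ^+ 2 *: y) ^+ 2)%:E <= ((M0 / s ^+ 3) ^+ 2)%:E)%E.
  have [_ _ E] := scales_affine3 c s20; rewrite (E (fun x => (f x ^+ 2)%:E)); last 2 first.
  - by apply/measurable_EFinP/measurable_funX; exact: continuous_measurable3.
  - by move=> x; rewrite lee_fin sqr_ge0.
  apply: (@le_trans _ _ (((s ^+ 2) ^- 3)%:E * (M0 ^+ 2)%:E)%E).
    by apply: lee_wpmul2l => //; rewrite lee_fin invr_ge0 exprn_ge0// ltW.
  rewrite -EFinM lee_fin le_eqVlt; apply/orP; left; apply/eqP; field; exact: lt0r_neq0.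
have Q : (\int[mu3 R]_y (cubeI y ^+ 2)%:E <= 1%:E)%E.
  rewrite -integral_cubeI le_eqVlt; apply/orP; left; apply/eqP; apply: eq_integral => y _.
  by have [->|[-> _]] := cubeI01 y; rewrite ?expr0n ?expr1n.
have [|ii gm] := Rintegral_gm (measurable_funM (caff c (s ^+ 2)) mc) (measurable_funX 2 (caff c (s ^+ 2)))
   (measurable_funX 2 mc) (fun y => sqr_ge0 _) (fun y => sqr_ge0 _) _ A Q.
  by move=> y /=; rewrite exprMn.
have B : (\int[mu3 R]_y (`|f (c + s ^+ 2 *: y)| * cubeI y)%:E <= (M0 / s ^+ 3)%:E)%E.
  have -> : (\int[mu3 R]_y (`|f (c + s ^+ 2 *: y)| * cubeI y)%:E)%E = (\int[mu3 R]_y `|f (c + s ^+ 2 *: y) * cubeI y|)%R%:E.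
    rewrite EFin_Rintegral; last exact: integrable_norm ii.
    by apply: eq_integral => y _; rewrite normrM (ger0_norm (cubeI_ge0 y)).
  rewrite lee_fin -ler_sqr ?nnegrE; last 2 first.
  - by apply: Rintegral_ge0 => y _.
  - by rewrite divr_ge0// exprn_ge0// ltW.
  by apply: (le_trans gm); rewrite mulr1.
rewrite -lee_fin average EFinD.
apply: le_trans (leeD (average_osc c s0) B).
rewrite -ge0_integralD//; last 2 first.
- exact: (mnc (caff _ _) (measurable_cst _)).
- by apply/measurable_EFinP/measurable_funM => //; apply: measurableT_comp => //; exact: caff.
apply: ge0_le_integral => //.
- by apply/measurable_EFinP/measurable_funM => //; exact: measurable_cst.
- apply: emeasurable_funD; first exact: (mnc (caff _ _) (measurable_cst _)).
  by apply/measurable_EFinP/measurable_funM => //; apply: measurableT_comp => //; exact: caff.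
move=> y _; rewrite -EFinD lee_fin -mulrDl ler_wpM2r ?cubeI_ge0//.
by rewrite distrC -{1}(subrK (f (c + s ^+ 2 *: y)) (f c)); exact: ler_normD.
Qed.

(** With s^2 = |c - c'| there are three legs: from c to the average over its cube, from that cube to
    its translate at c', and from there to c'. They cost 42 M s, 21 M s and 42 M s. *)
Lemma sobolev_hoelder (c c' : E3 R) : `|f c - f c'| <= 105 * M * Num.sqrt `|c - c'|.
Proof.
have [->|cc'] := eqVneq c c'; first by rewrite !subrr !normr0 sqrtr0 mulr0.
set s := Num.sqrt _; have d0 : 0 < `|c - c'| by rewrite normr_gt0 subr_eq0.
have s0 : 0 < s by rewrite sqrtr_gt0.
have sE : s ^+ 2 = `|c - c'| by rewrite sqr_sqrtr// ltW.
have P : (\int[mu3 R]_y (`|f (c + s ^+ 2 *: y) - f (c' + s ^+ 2 *: y)| * cubeI y)%:E <= (21 * M * s)%:E)%E.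
  have := @path_bound f F FF K1 M c' (c - c') s 0 s cf fF FFF F2 FF2 Mp (ltW s0) (lexx 0) (ltW s0).
  rewrite addr0 (addrC c') subrK; apply => th _.
  by rewrite mulr0 addr0 mulr0 addr0 -sE expr2.
rewrite -lee_fin average.
have -> : 105 * M * s = 42 * M * s + 21 * M * s + 42 * M * s by ring.
rewrite !EFinD; apply: le_trans (leeD (leeD (average_osc c s0) P) (average_osc c' s0)).
have mk (z : E3 R) : measurable_fun (setT : set (E3 (measurableTypeR R)))
    (fun y => (`|f (z + s ^+ 2 *: y) - f z| * cubeI y)%:E).
  exact: (mnc (caff _ _) (measurable_cst _)).
have mP : measurable_fun (setT : set (E3 (measurableTypeR R)))
    (fun y => (`|f (c + s ^+ 2 *: y) - f (c' + s ^+ 2 *: y)| * cubeI y)%:E) by exact: mnc.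
rewrite -!ge0_integralD//.
all: try solve [exact: emeasurable_funD|by move=> y _; rewrite adde_ge0// nc0].
apply: ge0_le_integral => //.
- by apply/measurable_EFinP/measurable_funM => //; exact: measurable_cubeI.
- by apply: emeasurable_funD => //; exact: emeasurable_funD.
move=> y _; rewrite -!EFinD lee_fin -!mulrDl ler_wpM2r ?cubeI_ge0//.
set a := f (c + _); set b := f (c' + _).
have -> : f c - f c' = (f c - a) + (a - b) + (b - f c') by ring.
rewrite (le_trans (ler_normD _ _))// lerD//.
by rewrite (le_trans (ler_normD _ _))// distrC.
Qed.

End sobolev_hoelder.

End embedding.

(** * Mollification in space and in space-time *)

Section product_derivatives.
Context (R : realType) (V W : normedModType R).
Implicit Type z : V * W.

Lemma is_derive_fst (f : V -> R) z u (d : R) : is_derive z.1 u (f : V -> R^o) d ->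
  is_derive z ((u, 0) : V * W) (fun z => f z.1 : R^o) d.
Proof.
move=> df; apply: is_derive_eps => e e0; have [r r0 h] := is_derive_epsP df e0.
by exists r => // t _ tr; exact: h.
Qed.

Lemma is_derive_snd (g : W -> R) z w (d : R) : is_derive z.2 w (g : W -> R^o) d ->
  is_derive z ((0, w) : V * W) (fun z => g z.2 : R^o) d.
Proof.
move=> df; apply: is_derive_eps => e e0; have [r r0 h] := is_derive_epsP df e0.
by exists r => // t _ tr; exact: h.
Qed.

Lemma is_derive_fst0 (f : V -> R) z w : is_derive z ((0, w) : V * W) (fun z => f z.1 : R^o) 0.
Proof.
apply: is_derive_eps => e e0; exists 1 => // h h0 _.
by rewrite /= scaler0 addr0 subrr mulr0 subr0 normr0 mulr_ge0// ltW.
Qed.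

Lemma is_derive_snd0 (g : W -> R) z u : is_derive z ((u, 0) : V * W) (fun z => g z.2 : R^o) 0.
Proof.
apply: is_derive_eps => e e0; exists 1 => // h h0 _.
by rewrite /= scaler0 addr0 subrr mulr0 subr0 normr0 mulr_ge0// ltW.
Qed.

End product_derivatives.

(** * Smoothness of the mollifiers as test functions *)

Section smooth_span.
Context (R : realType).

Section generic.
Variable V : normedModType R.

(** A class of differentiable functions that contains the reflected mollifiers and is stable under
    every directional derivative; membership yields [smooth] by induction on the list of
    directions. *)
Inductive smooth_span : (V -> R) -> Prop :=
| span_cst (c : R) : smooth_span (fun=> c)
| span_kern (e : R) (k : nat) (l : {linear V -> R^o}) (a : R) : continuous (l : V -> R) ->
    smooth_span (fun y => kern e k (a - l y))
| span_mul f g : smooth_span f -> smooth_span g -> smooth_span (fun y => f y * g y)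
| span_add f g : smooth_span f -> smooth_span g -> smooth_span (fun y => f y + g y).

Lemma linear_is_derive (l : {linear V -> R^o}) (a : R) (x v : V) :
  is_derive x v (fun y => a - l y : R^o) (- l v).
Proof.
apply: is_derive_eps => e e0; exists 1 => // h h0 _.
rewrite linearD linearZ /= [X in `|X|](_ : _ = 0); first by rewrite normr0 mulr_ge0// ltW.
by rewrite /GRing.scale/=; ring.
Qed.

Lemma smooth_spanP f : smooth_span f -> (forall x, differentiable (f : V -> R^o) x) /\
  (forall v, exists2 g, smooth_span g & forall x, is_derive x v (f : V -> R^o) (g x)).
Proof.
elim=> [c|e k l a cl|{}f g sf [df Df] sg [dg Dg]|{}f g _ [df Df] _ [dg Dg]].
- split => [x|v]; first exact: differentiable_cst.
  by exists (fun=> 0); [exact: span_cst|move=> x; exact: is_derive_cst'].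
- split => [x|v].
    apply: (@differentiable_comp R V R^o R^o (fun y => a - l y) (kern e k : R -> R^o)).
      apply: differentiableB; first exact: differentiable_cst.
      exact: linear_differentiable.
    by apply/derivable1_diffP; have := kern_derive e k (a - l x) => ?; exact: ex_derive.
  exists (fun y => kern e k.+1 (a - l y) * - l v).
    by apply: span_mul; [exact: span_kern|exact: span_cst].
  move=> x; apply: (is_derive_comp' (F := kern e k) (f := fun y => a - l y) (kern_derive e k _)) => //.
  exact: linear_is_derive.
- split => [x|v]; first exact: (@differentiableM R V f g).
  have [f' sf' df'] := Df v; have [g' sg' dg'] := Dg v.
  exists (fun y => f' y * g y + f y * g' y).
    by apply: span_add; exact: span_mul.
  by move=> x; exact: (is_deriveM' (df' x) (dg' x)).
split => [x|v]; first exact: (@differentiableD R V R^o f g).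
have [f' sf' df'] := Df v; have [g' sg' dg'] := Dg v.
exists (fun y => f' y + g' y); first exact: span_add.
by move=> x; exact: (is_deriveD' (df' x) (dg' x)).
Qed.

Lemma smooth_span_smooth f : smooth_span f -> smooth f.
Proof.
move=> sf vs x.
suff : smooth_span (pderiv vs f) by move=> /smooth_spanP[].
elim: vs => [//|v vs IH] /=; have [_ /(_ v)[g sg dg]] := smooth_spanP IH.
rewrite (_ : (fun x => _) = g)//; apply/funext => y.
by have := dg y => dgy; exact: derive_val.
Qed.

End generic.

Lemma coord_linear (i : 'I_3) : linear (coord i : E3 R -> R^o).
Proof. by move=> a x y; rewrite [a *: x + y]addrC coord_line addrC. Qed.

HB.instance Definition _ i :=
  GRing.isLinear.Build R (E3 R) R^o _ (coord i : E3 R -> R^o) (coord_linear i).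

Definition coordx (i : 'I_3) (z : E3t R) : R^o := coord i z.1.

Lemma coordx_linear (i : 'I_3) : linear (coordx i).
Proof. by move=> a x y; exact: coord_linear. Qed.

HB.instance Definition _ i :=
  GRing.isLinear.Build R (E3t R) R^o _ (coordx i) (coordx_linear i).

Definition coordt (z : E3t R) : R^o := z.2.

Lemma coordt_linear : linear coordt.
Proof. by []. Qed.

HB.instance Definition _ := GRing.isLinear.Build R (E3t R) R^o _ coordt coordt_linear.

Lemma coordx_continuous i : continuous (coordx i).
Proof. by apply: (continuous_compT (fun z => cvg_fst)); exact: coord_continuous. Qed.

Lemma coordt_continuous : continuous coordt.
Proof. by move=> z; exact: cvg_snd. Qed.

End smooth_span.

Section lipschitz.
Context (R : realType).

Definition lipbnd (V : normedModType R) (f : V -> R) : Prop := exists C : R,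
  [/\ 0 <= C, forall x, `|f x| <= C & forall x y, `|f x - f y| <= C * `|x - y|].

Lemma lipbndM (V : normedModType R) (f g : V -> R) : lipbnd f -> lipbnd g ->
  lipbnd (fun x => f x * g x).
Proof.
move=> [A [A0 fA lA]] [B [B0 gB lB]]; exists (A * B * 2 + A * B); split.
- by rewrite addr_ge0 ?mulr_ge0.
- move=> x; rewrite normrM (le_trans (ler_pM _ _ (fA x) (gB x)))// lerDr !mulr_ge0//.
move=> x y; have -> : f x * g x - f y * g y = (f x - f y) * g x + f y * (g x - g y) by ring.
rewrite (le_trans (ler_normD _ _))// !normrM.
have h1 : `|f x - f y| * `|g x| <= A * `|x - y| * B by rewrite ler_pM.
have h2 : `|f y| * `|g x - g y| <= A * (B * `|x - y|) by rewrite ler_pM.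
rewrite (le_trans (lerD h1 h2))// -subr_ge0.
rewrite [X in 0 <= X](_ : _ = A * B * `|x - y|); first by rewrite !mulr_ge0.
ring.
Qed.

Lemma lipbnd_comp (V W : normedModType R) (f : W -> R) (p : V -> W) : lipbnd f ->
  (forall x y, `|p x - p y| <= `|x - y|) -> lipbnd (fun x => f (p x)).
Proof.
move=> [A [A0 fA lA]] hp; exists A; split => // x y.
by rewrite (le_trans (lA _ _))// ler_wpM2l.
Qed.

Lemma lipbnd_continuous (V : normedModType R) (f : V -> R) : lipbnd f -> continuous f.
Proof.
move=> [A [A0 fA lA]] x; apply/cvgrPdist_le => e e0.
have A1 : 0 < A + 1 by rewrite ltr_wpDl.
have /cvgrPdist_le/(_ _ (divr_gt0 e0 A1)) := @cvg_id _ (nbhs x); apply: filterS => y.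
rewrite ler_pdivlMr// => h; rewrite (le_trans (lA _ _))// (le_trans _ h)// mulrC.
by rewrite ler_wpM2l// lerDl.
Qed.

Lemma kern_lipbnd (e : R) (k : nat) : 0 < e -> lipbnd (kern e k).
Proof.
move=> e0; have [A A0 hA] := kern_bounded e0 k; have [B B0 hB] := kern_bounded e0 k.+1.
exists (A + B); split; first by rewrite ltW// addr_gt0.
  by move=> x; rewrite (le_trans (hA x))// lerDl ltW.
move=> x y; rewrite (le_trans (MVT_bound (kern_derive e k) (fun z _ => hB z)))//.
by rewrite ler_wpM2r// lerDr ltW.
Qed.

End lipschitz.

Section mollifiers.
Context (R : realType).

(** The derivative d^s of the tensor-product mollifier, written through the multiplicities of the
    indices in [s]. Mixed derivatives of the kernel therefore commute by construction, which is what
    removes the pressure later. *)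
Definition eta (e : R) (s : seq 'I_3) (x : E3 R) : R :=
  kern e (count_mem (inord 0) s) (coord (inord 0) x) * kern e (count_mem (inord 1) s) (coord (inord 1) x)
  * kern e (count_mem (inord 2) s) (coord (inord 2) x).

Definition phi (e : R) (s : seq 'I_3) (j : nat) (z : E3t R) : R := eta e s z.1 * kern e j z.2.

Lemma eta_perm e s s' : perm_eq s s' -> eta e s = eta e s'.
Proof. by move=> /permP ss; apply/funext => x; rewrite /eta !ss. Qed.

Lemma etaC e i m s : eta e (i :: m :: s) = eta e (m :: i :: s).
Proof. by apply: eta_perm; rewrite (perm_catCA [:: i] [:: m] s). Qed.

Section fixed_scale.
Variable e : R.
Hypothesis e0 : 0 < e.

Lemma eta_derive s i x : is_derive x (basis3 R i) (eta e s : E3 R -> R^o) (eta e (i :: s) x).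
Proof.
have d (j : 'I_3) : is_derive x (basis3 R i) (fun y => kern e (count_mem j s) (coord j y) : R^o)
    (kern e (count_mem j s).+1 (coord j x) * (j == i)%:R).
  exact: (is_derive_comp' (f := coord j) (kern_derive e _ _) (coord_is_derive _ _ _) erefl).
apply: (is_derive_val (is_deriveM' (is_deriveM' (d _) (d _) erefl) (d _) erefl)).
move: i d; apply: ord3P => d; rewrite /eta /= -!(inj_eq val_inj) /= !inordK//=; ring.
Qed.

Lemma phi_derive_x s j i z : is_derive z (dir_x R i) (phi e s j : E3t R -> R^o) (phi e (i :: s) j z).
Proof.
apply: (is_deriveM' (is_derive_fst (eta_derive s i z.1)) (is_derive_snd0 (kern e j) z (basis3 R i))).
by rewrite mulr0 addr0.
Qed.

Lemma phi_derive_t s j z : is_derive z (dir_t R) (phi e s j : E3t R -> R^o) (phi e s j.+1 z).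
Proof.
apply: (is_deriveM' (is_derive_fst0 (eta e s) z 1) (is_derive_snd (kern_derive e j z.2))).
by rewrite mul0r add0r.
Qed.

Lemma norm_max3 (x : E3 R) (r : R) : (forall i, `|coord i x| < r) -> `|x| < r.
Proof.
move=> h; rewrite [`|x|]prod_normE gt_max [`|x.1|]prod_normE gt_max.
by have := h (inord 0); have := h (inord 1); have := h (inord 2); rewrite /coord !inordK//= => -> -> ->.
Qed.

Lemma eta_supp s x : e <= `|x| -> eta e s x = 0.
Proof.
move=> ex; have [i ei] : exists i, e <= `|coord i x|.
  apply/not_existsP => h; move: ex; rewrite leNgt => /negP; apply; apply: norm_max3 => i.
  by rewrite ltNge; apply/negP; exact: h.
by move: i ei; apply: ord3P => ei; rewrite /eta (kern_supp e0 _ ei) ?mulr0 ?mul0r.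
Qed.

Lemma phi_supp s j z : e <= `|z| -> phi e s j z = 0.
Proof.
rewrite [`|z|]prod_normE le_max /phi => /orP[h|h]; first by rewrite eta_supp// mul0r.
by rewrite (kern_supp e0)// mulr0.
Qed.

Lemma eta_lipbnd s : lipbnd (eta e s).
Proof.
by apply: lipbndM; [apply: lipbndM|]; apply: (lipbnd_comp (kern_lipbnd _ e0)) => x y;
  rewrite -coordB; exact: coord_norm.
Qed.

Lemma phi_lipbnd s j : lipbnd (phi e s j).
Proof.
apply: lipbndM; first by apply: (lipbnd_comp (eta_lipbnd _)) => x y; rewrite [leRHS]prod_normE le_max lexx.
by apply: (lipbnd_comp (kern_lipbnd _ e0)) => x y; rewrite [leRHS]prod_normE le_max lexx orbT.
Qed.

Lemma eta_ge0 x : 0 <= eta e [::] x.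
Proof. by rewrite /eta; apply: mulr_ge0; [apply: mulr_ge0|]; exact: kern_ge0. Qed.

Lemma phi_ge0 z : 0 <= phi e [::] 0 z.
Proof. by rewrite mulr_ge0// ?eta_ge0// kern_ge0. Qed.

Lemma eta_integral1 : (\int[mu3 R]_x (eta e [::] x)%:E = 1)%E.
Proof.
have mk : measurable_fun (setT : set (measurableTypeR R)) (kern e 0).
  apply: continuous_measurable1; exact: kern_continuous.
have k1 : (\int[mu1 R]_x (kern e 0 x)%:E = 1%:E)%E.
  by rewrite -(EFin_Rintegral (kern_integrable e0 0)) kern_integral1.
have := integral_tensor (m1 := sprod (mu1 R) (mu1 R)) (m2 := mu1 R)
  (f := fun x => kern e 0 x.1 * kern e 0 x.2) (g := kern e 0) (A := 1) (B := 1).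
rewrite mulr1 /eta => H; under eq_integral do rewrite /coord !inordK//=.
apply: H => //.
- by apply: measurable_funM; exact: measurableT_comp.
- by move=> x; rewrite mulr_ge0// kern_ge0.
- by move=> x; exact: kern_ge0.
- have := integral_tensor (m1 := mu1 R) (m2 := mu1 R) (f := kern e 0) (g := kern e 0) (A := 1) (B := 1).
  by rewrite mulr1; apply => // x; exact: kern_ge0.
Qed.

Lemma phi_integral1 : (\int[mu4 R]_z (phi e [::] 0 z)%:E = 1)%E.
Proof.
have := integral_tensor (m1 := mu3 R) (m2 := mu1 R)
  (f := eta e [::]) (g := kern e 0) (A := 1) (B := 1).
rewrite mulr1; apply => //.
- apply: continuous_measurable3; apply: lipbnd_continuous; exact: eta_lipbnd.
- apply: continuous_measurable1; exact: kern_continuous.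
- exact: eta_ge0.
- by move=> x; exact: kern_ge0.
- exact: eta_integral1.
by rewrite -(EFin_Rintegral (kern_integrable e0 0)) kern_integral1.
Qed.

Lemma eta_reflect_smooth s (x : E3 R) : smooth (fun y => eta e s (x - y)).
Proof.
apply: smooth_span_smooth; rewrite /eta.
have h i k : smooth_span (fun y => kern e k (coord i (x - y))).
  have := span_kern e k (coord i x) (@coord_continuous R i : continuous ((coord i : {linear E3 R -> R^o}) : E3 R -> R)).
  by congr smooth_span; apply/funext => y; rewrite coordB.
by apply: span_mul; [apply: span_mul|].
Qed.

Lemma phi_reflect_smooth s j (z : E3t R) : smooth (fun w => phi e s j (z - w)).
Proof.
apply: smooth_span_smooth; rewrite /phi /eta.
have h i k : smooth_span (fun w : E3t R => kern e k (coord i (z - w).1)).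
  have := span_kern e k (coord i z.1) (@coordx_continuous R i : continuous ((coordx i : {linear E3t R -> R^o}) : E3t R -> R)).
  by congr smooth_span; apply/funext => y; rewrite /coordx -coordB.
have ht : smooth_span (fun w : E3t R => kern e j (z - w).2).
  exact: (span_kern e j z.2 (@coordt_continuous R : continuous ((@coordt R : {linear E3t R -> R^o}) : E3t R -> R))).
by apply: span_mul => //; apply: span_mul; [apply: span_mul|].
Qed.

Lemma ball3_compact (x : E3 R) (r : R) : compact [set y : E3 R | `|x - y| <= r].
Proof.
have -> : [set y : E3 R | `|x - y| <= r] =
  (`[x.1.1 - r, x.1.1 + r]%classic `*` `[x.1.2 - r, x.1.2 + r]%classic) `*` `[x.2 - r, x.2 + r]%classic.
  apply/seteqP; split => y /=; rewrite !in_itv/= [`|x - y|]prod_normE [`|(x - y).1|]prod_normE !ge_max /=.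
    by move=> /andP[/andP[]]; rewrite !ler_norml => *; do !split; lra.
  by move=> [[h1 h2] h3]; rewrite !ler_norml; apply/andP; split; [apply/andP; split|]; lra.
by do 2! [apply: compact_setX; last exact: segment_compact]; exact: segment_compact.
Qed.

Lemma ball4_compact (z : E3t R) (r : R) : compact [set w : E3t R | `|z - w| <= r].
Proof.
have -> : [set w : E3t R | `|z - w| <= r] =
  [set y : E3 R | `|z.1 - y| <= r] `*` `[z.2 - r, z.2 + r]%classic.
  apply/seteqP; split => y /=; rewrite !in_itv/= [`|z - y|]prod_normE !ge_max /=.
    by move=> /andP[h1]; rewrite (ler_norml (z.2 - y.2)) => h2; split => //; lra.
  by move=> [h1 h3]; rewrite h1/= (ler_norml (z.2 - y.2)); lra.
by apply: compact_setX; [exact: ball3_compact|exact: segment_compact].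
Qed.

Lemma eta_reflect_test s (x : E3 R) : test_function [set: E3 R] (fun y => eta e s (x - y)).
Proof.
split; first exact: eta_reflect_smooth.
exists [set y : E3 R | `|x - y| <= e]; split => //; first exact: ball3_compact.
by move=> y /= /negP; rewrite -ltNge => /ltW; exact: eta_supp.
Qed.

Lemma phi_reflect_test s j (z : E3t R) T : e < z.2 < T - e ->
  test_function (slab T) (fun w => phi e s j (z - w)).
Proof.
move=> /andP[ez zT]; split; first exact: phi_reflect_smooth.
exists [set w : E3t R | `|z - w| <= e]; split; first exact: ball4_compact.
- move=> w /= h; have : `|(z - w).2| <= e.
    by apply: le_trans h; rewrite [leRHS]prod_normE le_max lexx orbT.
  by rewrite /slab/= ler_norml => /andP[*]; apply/andP; split; lra.
- by move=> y /= /negP; rewrite -ltNge => /ltW; exact: phi_supp.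
Qed.

Lemma reflect_derive (V : normedModType R) (f f' : V -> R) (v a y : V) :
  (forall x, is_derive x v (f : V -> R^o) (f' x)) ->
  is_derive y v (fun y => f (a - y) : R^o) (- f' (a - y)).
Proof.
move=> df; apply: is_derive_eps => d d0.
have [r r0 h] := is_derive_epsP (df (a - y)) d0; exists r => // t t0 tr.
have := h (- t); rewrite normrN => /(_ tr).
by rewrite mulNr scaleNr opprD addrA mulrN.
Qed.

Lemma pderiv_eta_reflect s s' (x : E3 R) :
  pderiv (map (basis3 R) s') (fun y => eta e s (x - y)) =
  (fun y => (-1) ^+ size s' * eta e (s' ++ s) (x - y)).
Proof.
elim: s' => [|i s' IH] /=; first by apply/funext => y; rewrite mul1r.
rewrite IH; apply/funext => y.
have d := is_deriveZ' (k := (-1) ^+ size s') (reflect_derive x y (fun x => eta_derive (s' ++ s) i x)) erefl.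
by rewrite (@derive_val _ _ _ _ _ _ _ d) exprS !mulN1r mulrN mulNr.
Qed.

Lemma pderiv_phi_reflect_x s j i (z w : E3t R) :
  pderiv [:: dir_x R i] (fun w => phi e s j (z - w)) w = - phi e (i :: s) j (z - w).
Proof.
have d := reflect_derive z w (fun x => phi_derive_x s j i x).
by rewrite /= (@derive_val _ _ _ _ _ _ _ d).
Qed.

Lemma pderiv_phi_reflect_t s j (z w : E3t R) :
  pderiv [:: dir_t R] (fun w => phi e s j (z - w)) w = - phi e s j.+1 (z - w).
Proof.
have d := reflect_derive z w (fun x => phi_derive_t s j x).
by rewrite /= (@derive_val _ _ _ _ _ _ _ d).
Qed.

End fixed_scale.
End mollifiers.

Lemma ae_imp d (T : measurableType d) (R : realType) (m : {measure set T -> \bar R}) (P Q : T -> Prop) :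
  (forall x, P x -> Q x) -> {ae m, forall x, P x} -> {ae m, forall x, Q x}.
Proof. by move=> PQ; apply: filterS. Qed.

Section nonnegative_integrals.
Context d (T : measurableType d) (R : realType) (m : {measure set T -> \bar R}).
Implicit Types f g : T -> R.

Lemma int_le f g : measurable_fun setT f -> measurable_fun setT g -> (forall x, 0 <= f x) ->
  (forall x, f x <= g x) -> (\int[m]_x (f x)%:E <= \int[m]_x (g x)%:E)%E.
Proof.
move=> mf mg f0 fg; have g0 x : 0 <= g x by exact: le_trans (fg x).
apply: ge0_le_integral => //; first [exact/measurable_EFinP|by move=> x _; rewrite lee_fin].
Qed.

Lemma int_Z (k : R) f : measurable_fun setT f -> 0 <= k -> (forall x, 0 <= f x) ->
  (\int[m]_x (k * f x)%:E = k%:E * \int[m]_x (f x)%:E)%E.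
Proof.
move=> mf k0 f0; under eq_integral do rewrite EFinM.
by rewrite ge0_integralZl//=; first [exact/measurable_EFinP|by move=> x _; rewrite lee_fin].
Qed.

Lemma int_D f g : measurable_fun setT f -> measurable_fun setT g -> (forall x, 0 <= f x) ->
  (forall x, 0 <= g x) ->
  (\int[m]_x (f x + g x)%:E = \int[m]_x (f x)%:E + \int[m]_x (g x)%:E)%E.
Proof.
move=> mf mg f0 g0; under eq_integral do rewrite EFinD.
by rewrite ge0_integralD//; first [exact/measurable_EFinP|by move=> x _; rewrite lee_fin].
Qed.

Lemma fatou_le (h : nat -> T -> R) (g : T -> R) (K : R) N : (forall n, measurable_fun setT (h n)) -> (forall n x, 0 <= h n x) ->
  (forall n, (N <= n)%N -> (\int[m]_x (h n x)%:E <= K%:E)%E) ->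
  (forall x, h n x @[n --> \oo] --> g x) -> (\int[m]_x (g x)%:E <= K%:E)%E.
Proof.
move=> mh h0 hK hg; pose f n x := (h (n + N)%N x)%:E.
have f0 n x : setT x -> (0 <= f n x)%E by move=> _; rewrite lee_fin.
have mf n : measurable_fun setT (f n) by exact/measurable_EFinP.
have := fatou m measurableT mf f0.
have -> : (\int[m]_x limn_einf (f^~ x) = \int[m]_x (g x)%:E)%E.
  apply: eq_integral => x _; apply: (cvg_limn_einf_sup _).1.
  apply: cvg_EFin; first by apply: nearW.
  by have := hg x; rewrite -(cvg_shiftn N).
move=> /le_trans; apply; rewrite limn_einf_lim; apply: lime_le; first exact: is_cvg_einfs.
apply: nearW => n; apply: (@le_trans _ _ (\int[m]_x f n x)%E).
  by apply: ereal_inf_lbound; exists n => /=.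
by apply: hK; rewrite leq_addl.
Qed.

Lemma fatou0 (h : nat -> T -> R) (g : T -> R) : (forall n, measurable_fun setT (h n)) ->
  (forall n x, 0 <= h n x) ->
  (forall a : R, 0 < a -> exists N, forall n, (N <= n)%N -> (\int[m]_x (h n x)%:E <= a%:E)%E) ->
  (forall x, h n x @[n --> \oo] --> g x) -> {ae m, forall x, g x = 0}.
Proof.
move=> mh h0 ha hg; have mg : measurable_fun setT g.
  by apply: (measurable_fun_cvg mh) => x _; exact: hg.
have g0 x : 0 <= g x.
  rewrite leNgt; apply/negP => gx; have /cvgrPdist_lt/(_ (- g x)) := hg x.
  rewrite oppr_gt0 => /(_ gx)[N _ /(_ N (leqnn N))] /=; have := h0 N x.
  by rewrite distrC => hx; rewrite ger0_norm; lra.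
have I0 : (\int[m]_x `|(g x)%:E| = 0)%E.
  under eq_integral do rewrite gee0_abs ?lee_fin//.
  apply/eqP; rewrite eq_le integral_ge0 ?andbT//; last by move=> x _; rewrite lee_fin.
  apply/lee_addgt0Pr => a a0; rewrite add0e; have [N hN] := ha a a0.
  exact: (fatou_le mh h0 hN hg).
have mEg : measurable_fun setT (EFin \o g) by exact/measurable_EFinP.
have := (ae_eq_integral_abs m measurableT mEg).1 I0.
by apply: filterS => x /= hx; have [] := hx Logic.I.
Qed.

End nonnegative_integrals.

Lemma cauchy_cvgn (R : realType) (u : nat -> R) :
  (forall e : R, 0 < e -> exists c N, forall n, (N <= n)%N -> `|c - u n| <= e) -> cvgn u.
Proof.
move=> H; apply: R_complete; apply: cauchy_exP => e e0.
have [|c [N hN]] := H (e / 2); first by rewrite divr_gt0.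
exists c; exists N => // n /= Nn; rewrite /ball/= (le_lt_trans (hN n Nn))//.
by rewrite ltr_pdivrMr// ltr_pMr// ltr1n.
Qed.

(* [io] is the identity between a carrier equipped with its measurable structure and the same carrier
   as a normed space. *)
Section convolution.
Context d (T : measurableType d) (R : realType) (m : {sigma_finite_measure set T -> \bar R}).
Context (V : normedModType R) (io : T -> V).
Hypothesis mio : forall h : V -> R, continuous h -> measurable_fun setT (h \o io).
Implicit Types (f : T -> R) (K : V -> R).

Definition tball (r : R) : set T := [set w | `|io w| <= r].

Definition locL1 f : Prop := measurable_fun setT f /\
  forall r, m.-integrable setT (EFin \o (fun w => f w * \1_(tball r) w)).

Definition conv f K (z : V) : R := \int[m]_w (f w * K (z - io w)).

Lemma measurable_tball r : measurable (tball r).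
Proof.
have mn := mio (@norm_continuous _ V).
have := mn measurableT _ (measurable_itv `]-oo, r]); by rewrite setTI; congr measurable.
Qed.

Lemma measurable_reflect K (z : V) : continuous K -> measurable_fun setT (fun w => K (z - io w)).
Proof.
move=> cK; apply: (mio (h := fun y => K (z - y))).
apply: (continuous_compT (f := fun y : V => z - y)) => // y.
by apply: cvgB; [exact: cvg_cst|exact: cvg_id].
Qed.

Lemma locL1_mul f (h : T -> R) (C r : R) : locL1 f -> measurable_fun setT h ->
  (forall w, `|h w| <= C) -> (forall w, r < `|io w| -> h w = 0) ->
  m.-integrable setT (EFin \o (fun w => f w * h w)).
Proof.
move=> [mf fi] mh hC hs; apply: (integrable_ext _ (integrable_mul_bounded (fi r) mh hC)) => w.
rewrite -mulrA indicE; have [_|] := boolP (w \in _); first by rewrite mul1r.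
by rewrite notin_setE /tball/= => /negP; rewrite -ltNge => /hs ->; rewrite !mulr0.
Qed.

Lemma reflect_supp K (e : R) (z : V) w : (forall y, e <= `|y| -> K y = 0) ->
  `|z| + e < `|io w| -> K (z - io w) = 0.
Proof.
move=> Ks zw; apply: Ks; rewrite distrC; have := lerB_dist (io w) z; lra.
Qed.

Section kernel.
Variables (K : V -> R) (e : R).
Hypotheses (lK : lipbnd K) (Ks : forall y, e <= `|y| -> K y = 0).

Lemma conv_integrable f (z : V) : locL1 f -> m.-integrable setT (EFin \o (fun w => f w * K (z - io w))).
Proof.
move=> lf; have [C [C0 KC _]] := lK.
apply: (locL1_mul (C := C) (r := `|z| + e) lf).
- exact: measurable_reflect (lipbnd_continuous lK).
- by move=> w; exact: KC.
- by move=> w; exact: reflect_supp.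
Qed.

Lemma conv_continuous f : locL1 f -> continuous (conv f K).
Proof.
move=> lf z; have [C [C0 KC KL]] := lK; have [mf fi] := lf.
pose r := `|z| + 1 + e; pose A := \int[m]_w `|f w * \1_(tball r) w|.
have A0 : 0 <= A by apply: Rintegral_ge0 => w _.
have iA := integrable_norm (fi r).
have mK y : measurable_fun setT (fun w => K (y - io w)) by exact: measurable_reflect (lipbnd_continuous lK).
have L y : `|z - y| <= 1 -> `|conv f K z - conv f K y| <= C * `|z - y| * A.
  move=> zy; rewrite /conv -RintegralB//; [|exact: conv_integrable|exact: conv_integrable].
  have iB := integrableBfun (conv_integrable z lf) (conv_integrable y lf).
  apply: (le_trans (le_normr_Rintegral _ iB)) => //; rewrite -RintegralZl//.
  apply: le_Rintegral => //; first exact: integrable_norm iB.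
    exact: integrableZfun.
  move=> w _ /=; rewrite -mulrBr normrM mulrC normrM.
  rewrite indicE; have [_|] := boolP (w \in _).
    rewrite normr1 mulr1 ler_wpM2r// (le_trans (KL _ _))//.
    by rewrite opprB addrA subrK.
  rewrite notin_setE /tball/= => /negP; rewrite -ltNge => rw.
  rewrite (reflect_supp Ks) ?(reflect_supp (z := y) Ks) ?subrr ?normr0 ?mul0r ?mulr0//.
    by have := lerB_dist y z; move: rw zy; rewrite /r distrC; lra.
  by move: rw; rewrite /r; lra.
apply/cvgrPdist_le => d0 d0p; have q : 0 < C * A + 1 by rewrite ltr_wpDl// mulr_ge0.
have /cvgrPdist_le/(_ (Num.min 1 (d0 / (C * A + 1)))) := @cvg_id _ (nbhs z).
rewrite lt_min ltr01 divr_gt0// => /(_ isT); apply: filterS => y.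
rewrite le_min => /andP[y1 y2]; apply: (le_trans (L y y1)).
rewrite mulrAC; move: y2; rewrite ler_pdivlMr// mulrC => h; apply: le_trans h.
by rewrite ler_wpM2r// lerDl.
Qed.

(** Differentiation under the integral along z + t v: for |t| < 1 the translated kernels live in the
    ball of radius |z| + |v| + e, on which f is integrable. *)
Lemma conv_derive (K' : V -> R) f (z v : V) : lipbnd K' -> (forall y, e <= `|y| -> K' y = 0) ->
  (forall y, is_derive y v (K : V -> R^o) (K' y)) -> locL1 f ->
  is_derive z v (conv f K : V -> R^o) (conv f K' z).
Proof.
move=> lK' Ks' dK lf; have [C [C0 KC _]] := lK'; have [mf fi] := lf.
suff H : is_derive (0 : R) (1 : R) (fun t : R => conv f K (z + t *: v) : R^o) (conv f K' z).
  by have := (is_derive_line (conv f K) z v 0 (conv f K' z)).2 H; rewrite scale0r addr0.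
have E y w (t : R) : y + t *: v - io w = (y - io w) + t *: v by rewrite addrAC.
pose r := `|z| + `|v| + e.
have := @is_derive_Rintegral _ T R m (fun t w => f w * K (z + t *: v - io w))
  (fun t w => f w * K' (z + t *: v - io w)) (fun w => C * `|f w * \1_(tball r) w|) 0.
rewrite scale0r addr0; apply.
- by move=> t; exact: conv_integrable.
- move=> t w; apply: (is_deriveZ' (V := R^o) (k := f w) _ erefl).
  have := (is_derive_line K (z - io w) v t (K' (z + t *: v - io w))).1.
  by rewrite -E => /(_ (dK _)); under eq_fun do rewrite -E.
- exact: integrableZfun (integrable_norm (fi r)).
move=> t w; rewrite subr0 => t1; rewrite normrM mulrC indicE normrM.
have [_|] := boolP (w \in _); first by rewrite normr1 mulr1 ler_wpM2r.
rewrite notin_setE /tball/= => /negP; rewrite -ltNge => rw.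
rewrite (reflect_supp Ks') ?normr0 ?mul0r ?mulr0//.
apply: le_lt_trans rw; rewrite /r lerD2r (le_trans (ler_normD _ _))// lerD2l normrZ.
by rewrite ler_piMl// ltW.
Qed.

End kernel.

Variable sub : T -> T -> T.
Hypothesis io_sub : forall z w, io (sub z w) = io z - io w.
Hypothesis sub_K : forall z w, sub z (sub z w) = w.
Hypothesis reflect_scales : forall z, scales_measure m 1 (sub z).
Hypothesis shift_scales : forall w, scales_measure m 1 (sub ^~ w).
Hypothesis msub : measurable_fun setT (fun z : T * T => sub z.1 z.2).

Lemma conv_reflect f K z : m.-integrable setT (EFin \o (fun w => f w * K (io z - io w))) ->
  conv f K (io z) = \int[m]_w (f (sub z w) * K (io w)).
Proof.
move=> fi; have := scales_Rintegral (reflect_scales z) fi; rewrite mul1r -/(conv f K (io z)) => <-.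
by apply: eq_Rintegral => w _ /=; rewrite -io_sub sub_K.
Qed.

(** The reflection w -> z - w turns the convolution into an average of translates of f with weight K
    of mass at most 1, and translates have the same L^2 norm. *)
Lemma conv_sqnorm f K (e M : R) : lipbnd K -> (forall y, e <= `|y| -> K y = 0) ->
  (\int[m]_w `|K (io w)|%:E <= 1)%E -> locL1 f -> 0 <= M -> (sqnorm m f <= M%:E)%E ->
  (sqnorm m (fun z => conv f K (io z)) <= M%:E)%E.
Proof.
move=> lK Ks K1 lf M0 fM; have [mf fi] := lf.
have mK : measurable_fun setT (fun w => K (io w)) by exact: (mio (lipbnd_continuous lK)).
have := mixing_sqnorm (m1 := m) (m2 := m) (H := fun z => f (sub z.1 z.2)) (k := fun w => K (io w))
  (C := 1) (M := M) (measurableT_comp mf msub) mK K1 ltr01 M0.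
rewrite expr1n mul1r => H; rewrite (_ : (fun z => conv f K (io z)) = (fun z => \int[m]_w (f (sub z w) * K (io w)))).
  apply: H => w _ /=; have [_ _ E] := shift_scales w.
  rewrite /sqnorm (E (fun x => (f x ^+ 2)%:E)) ?mul1e//.
    by apply/measurable_EFinP; exact: measurable_funX.
  by move=> x; rewrite lee_fin sqr_ge0.
by apply/funext => z; apply: conv_reflect; exact: (conv_integrable lK Ks).
Qed.

Hypothesis L1_shift : forall (g : T -> R) (a : R), m.-integrable setT (EFin \o g) -> 0 < a ->
  exists2 r : R, 0 < r & forall b, `|io b| <= r -> (L1dist m (fun z => g (sub z b)) g <= a%:E)%E.

Lemma conv_L1 f (r a : R) : locL1 f -> 0 < a -> exists2 e0 : R, 0 < e0 &
  forall K (e : R), e <= e0 -> lipbnd K -> (forall y, e <= `|y| -> K y = 0) ->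
    (forall y, 0 <= K y) -> (\int[m]_w (K (io w))%:E = 1)%E ->
    (\int[m]_z (`|conv f K (io z) - f z| * \1_(tball r) z)%:E <= a%:E)%E.
Proof.
move=> lf a0; have [mf fi] := lf.
(* The kernel radius is at most 1, so on the ball of radius r only the values of f in the ball of
   radius r + 1 matter. The truncation [g] is integrable, and L^1 continuity of translations applies
   to it. *)
pose g w := f w * \1_(tball (r + 1)) w.
have mg : measurable_fun setT g by apply/measurable_EFinP; case/integrableP : (fi (r + 1)).
have [e0 e00 H] := L1_shift (fi (r + 1)) a0.
exists (Num.min 1 e0); first by rewrite lt_min ltr01.
move=> K e; rewrite le_min => /andP[e1 ee0] lK Ks K0 K1.
have mK : measurable_fun setT (fun w => K (io w)) by exact: (mio (lipbnd_continuous lK)).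
have iK : m.-integrable setT (EFin \o (fun w => K (io w))).
  by apply: (integral_le_integrable mK _ (A := 1)) => //; rewrite K1.
pose H2 (p : T * T) := `|g (sub p.1 p.2) - g p.1| * K (io p.2).
have mH2 : measurable_fun setT H2.
  apply: measurable_funM; last exact: (measurableT_comp mK measurable_snd).
  apply: measurableT_comp => //; apply: measurable_funB; first exact: (measurableT_comp mg msub).
  exact: (measurableT_comp mg measurable_fst).
have H20 p : 0 <= H2 p by rewrite mulr_ge0.
have mEH2 : measurable_fun setT (EFin \o H2) by exact/measurable_EFinP.
have S z : ((`|conv f K (io z) - f z| * \1_(tball r) z)%:E <= \int[m]_w (H2 (z, w))%:E)%E.
  rewrite indicE; have [|_] := boolP (z \in _); last first.
    by rewrite mulr0; apply: integral_ge0 => w _; rewrite lee_fin.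
  rewrite inE /tball/= mulr1 => zr.
  have ci := conv_integrable lK Ks (io z) lf.
  have gz : f z = g z by rewrite /g indicE mem_set ?mulr1//=; apply: (le_trans zr); rewrite lerDl.
  have E w : f (sub z w) * K (io w) = g (sub z w) * K (io w).
    have [we|we] := leP e `|io w|; first by rewrite Ks// !mulr0.
    rewrite /g indicE mem_set ?mulr1// /tball/= io_sub (le_trans (ler_normB _ _))//.
    by rewrite lerD// ltW// (lt_le_trans we).
  have ig : m.-integrable setT (EFin \o (fun w => g (sub z w) * K (io w))).
    have := scales_integrable (reflect_scales z) ci; apply: integrable_ext => w /=.
    by rewrite -io_sub sub_K E.
  have iz := integrableZfun (g z) iK.
  have -> : conv f K (io z) - f z = \int[m]_w (g (sub z w) * K (io w) - g z * K (io w)).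
    rewrite RintegralB// conv_reflect//; congr (_ - _).
      by apply: eq_Rintegral => w _; exact: E.
    by rewrite RintegralZl// gz /Rintegral K1 /= mulr1.
  have iB := integrableBfun ig iz.
  apply: (@le_trans _ _ (\int[m]_w `|g (sub z w) * K (io w) - g z * K (io w)|)%R%:E).
    by rewrite lee_fin; exact: le_normr_Rintegral.
  rewrite (EFin_Rintegral (integrable_norm iB)) le_eqVlt; apply/orP; left; apply/eqP.
  by apply: eq_integral => w _; rewrite /H2 /= -mulrBl normrM (ger0_norm (K0 _)).
apply: (@le_trans _ _ (\int[m]_z \int[m]_w (H2 (z, w))%:E)%E).
  apply: ge0_le_integral => //.
  - apply/measurable_EFinP/measurable_funM; last exact: measurable_indic (measurable_tball r).
    apply: measurableT_comp => //; apply: measurable_funB => //.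
    exact: (mio (conv_continuous lK Ks lf)).
  - exact: (measurable_integral1 m (f := EFin \o H2)).
rewrite -(sprod_tonelli1 m m mEH2)// (sprod_tonelli2 m m mEH2)//.
apply: (@le_trans _ _ (\int[m]_w (a%:E * (K (io w))%:E))%E); last first.
  by under eq_integral do rewrite -EFinM; rewrite int_Z ?K1 ?mule1// ltW.
apply: ge0_le_integral => //.
- by move=> w _; apply: integral_ge0 => z _; rewrite lee_fin.
- exact: (measurable_integral2 m (f := EFin \o H2)).
- by apply: measurable_funeM; exact/measurable_EFinP.
move=> w _; rewrite /H2 /=; have [we|we] := leP e `|io w|.
  by rewrite Ks// mule0 integral0_eq// => z _; rewrite mulr0.
under eq_integral do rewrite mulrC.
rewrite int_Z//; last first.
  apply: measurableT_comp => //; apply: measurable_funB => //.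
  by apply: measurableT_comp => //; case: (shift_scales w).
rewrite muleC lee_wpmul2r ?lee_fin// (le_trans _ (H w _))//.
by rewrite (le_trans (ltW we)).
Qed.

Section pointwise_limits.
Variables (F : nat -> T -> R) (f : T -> R).
Hypotheses (lF : forall n, locL1 (F n)) (lf : locL1 f).
Hypothesis Ff : forall r a : R, 0 < a -> exists N, forall n, (N <= n)%N ->
  (\int[m]_z (`|F n z - f z| * \1_(tball r) z)%:E <= a%:E)%E.

Lemma conv_L1_lim K (e : R) (z : V) : lipbnd K -> (forall y, e <= `|y| -> K y = 0) ->
  conv (F n) K z @[n --> \oo] --> conv f K z.
Proof.
move=> lK Ks; have [C [C0 hC _]] := lK.
have C1 : 0 < C + 1 by rewrite ltr_wpDl.
apply/cvgrPdist_le => a a0; have [N hN] := Ff (`|z| + e) (divr_gt0 a0 C1).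
exists N => // n /= Nn; have i1 := conv_integrable lK Ks z (lF n); have i2 := conv_integrable lK Ks z lf.
rewrite distrC /conv -RintegralB//; have iB := integrableBfun i1 i2.
rewrite (le_trans (le_normr_Rintegral _ iB))// -lee_fin (EFin_Rintegral (integrable_norm iB)).
have mB : measurable_fun setT (fun w => `|F n w - f w| * \1_(tball (`|z| + e)) w).
  apply: measurable_funM; last exact: measurable_indic (measurable_tball _).
  by apply: measurableT_comp => //; apply: measurable_funB; [case: (lF n)|case: lf].
have B0 w : 0 <= `|F n w - f w| * (\1_(tball (`|z| + e)) w : R) by rewrite mulr_ge0// indicE.
apply: (@le_trans _ _ (\int[m]_w ((C + 1) * (`|F n w - f w| * \1_(tball (`|z| + e)) w))%:E)%E).
  apply: int_le => //.
  - by case/integrableP : (integrable_norm iB) => /measurable_EFinP.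
  - exact: measurable_funM.
  - by move=> w /=.
  move=> w /=; rewrite -mulrBl normrM mulrC indicE; have [_|] := boolP (w \in _).
    by rewrite mulr1 ler_wpM2r// (le_trans (hC _))// lerDl.
  rewrite notin_setE /tball/= => /negP; rewrite -ltNge => zw.
  by rewrite (reflect_supp Ks zw) normr0 mul0r mulr0 mulr0.
rewrite int_Z//; last exact: ltW.
apply: (le_trans (lee_wpmul2l _ (hN n Nn))); first by rewrite lee_fin ltW.
by rewrite -EFinM mulrC divfK//; exact: lt0r_neq0.
Qed.

(* [F n x] is uniformly close to its average against a kernel concentrated near [x], and these
   averages converge. *)
Lemma pointwise_limit x : (forall e : R, 0 < e -> exists K, [/\ lipbnd K, forall y, e <= `|y| -> K y = 0,
    forall y, 0 <= K y & (\int[m]_w (K (io w))%:E = 1)%E]) ->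
  (forall a : R, 0 < a -> exists2 r : R, 0 < r & exists N, forall n w, (N <= n)%N ->
     `|io x - io w| <= r -> `|F n w - F n x| <= a) -> cvgn (fun n => F n x).
Proof.
move=> HK Fx; apply: cauchy_cvgn => e e0.
have e2 : 0 < e / 2 by rewrite divr_gt0.
have [r r0 [N1 H1]] := Fx _ e2; have [K [lK Ks K0 K1]] := HK r r0.
exists (conv f K (io x)).
have /cvgrPdist_le/(_ _ e2)[N2 _ H2] := conv_L1_lim (z := io x) lK Ks.
exists (maxn N1 N2) => n; rewrite geq_max => /andP[n1 n2].
have -> : conv f K (io x) - F n x = (conv f K (io x) - conv (F n) K (io x)) + (conv (F n) K (io x) - F n x).
  by rewrite addrA subrK.
rewrite (le_trans (ler_normD _ _))// (splitr e) lerD//; first exact: H2.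
have mKx : measurable_fun setT (fun w => K (io x - io w)) by exact: measurable_reflect (lipbnd_continuous lK).
have Kx : (\int[m]_w (K (io x - io w))%:E = 1)%E.
  have [_ _ E] := reflect_scales x; have := E (fun w => (K (io w))%:E).
  under eq_integral do rewrite io_sub; rewrite K1 mule1; apply; last by move=> w; rewrite lee_fin.
  by apply/measurable_EFinP; exact: (mio (lipbnd_continuous lK)).
have iK : m.-integrable setT (EFin \o (fun w => K (io x - io w))).
  by apply: (integral_le_integrable mKx _ (A := 1)) => //; rewrite Kx.
have Kr : \int[m]_w K (io x - io w) = 1 by rewrite /Rintegral Kx.
have i1 := conv_integrable lK Ks (io x) (lF n); have i2 := integrableZfun (F n x) iK.
have -> : conv (F n) K (io x) - F n x = \int[m]_w (F n w * K (io x - io w) - F n x * K (io x - io w)).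
  by rewrite RintegralB// RintegralZl// Kr mulr1.
have iB := integrableBfun i1 i2.
rewrite (le_trans (le_normr_Rintegral _ iB))//.
have -> : e / 2 = \int[m]_w (e / 2 * K (io x - io w)) by rewrite RintegralZl// Kr mulr1.
apply: le_Rintegral => //; [exact: integrable_norm iB|exact: integrableZfun|].
move=> w _ /=; rewrite -mulrBl normrM (ger0_norm (K0 _)).
have [rw|rw] := leP r `|io x - io w|; first by rewrite Ks// !mulr0.
by rewrite ler_wpM2r//; apply: H1 => //; exact: ltW.
Qed.

End pointwise_limits.

(** On each ball of integer radius Fatou's lemma makes |h - f| vanish almost everywhere in U, and
    countably many balls exhaust the space. *)
Lemma ae_limit (F : nat -> T -> R) (f h : T -> R) (U : set T) : (forall n, measurable_fun setT (F n)) ->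
  measurable_fun setT f -> measurable U ->
  (forall r a : R, 0 < a -> exists N, forall n, (N <= n)%N ->
    (\int[m]_z (`|F n z - f z| * \1_(tball r) z)%:E <= a%:E)%E) ->
  (forall z, U z -> F n z @[n --> \oo] --> h z) -> {ae m, forall z, U z -> h z = f z}.
Proof.
move=> mF mf mU Ff Fh.
have mI (A : set T) : measurable A -> measurable_fun setT (\1_A : T -> R) by exact: measurable_indic.
have H k : {ae m, forall z, `|h z - f z| * (\1_(tball k%:R) z * \1_U z) = 0}.
  apply: (fatou0 (h := fun n z => `|F n z - f z| * (\1_(tball k%:R) z * \1_U z))).
  - move=> n; apply: measurable_funM; last by apply: measurable_funM; apply: mI => //; exact: measurable_tball.
    by apply: measurableT_comp => //; exact: measurable_funB.
  - by move=> n z; rewrite !indicE !mulr_ge0.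
  - move=> a a0; have [N hN] := Ff k%:R a a0; exists N => n Nn; apply: le_trans (hN n Nn).
    apply: int_le.
    + apply: measurable_funM; last by apply: measurable_funM; apply: mI => //; exact: measurable_tball.
      by apply: measurableT_comp => //; exact: measurable_funB.
    + apply: measurable_funM; last by apply: mI; exact: measurable_tball.
      by apply: measurableT_comp => //; exact: measurable_funB.
    + by move=> z; rewrite !indicE !mulr_ge0.
    by move=> z; rewrite ler_wpM2l// !indicE; case: (z \in tball _); case: (z \in U); rewrite /= ?mulr1 ?mulr0.
  move=> z; have [Uz|Uz] := pselect (U z).
    by apply: cvgM; [apply: cvg_norm; apply: cvgB; [exact: Fh|exact: cvg_cst]|exact: cvg_cst].
  under eq_fun do rewrite [\1_U z]indicE memNset// !mulr0.
  by rewrite [\1_U z]indicE memNset// !mulr0; exact: cvg_cst.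
have := ae_foralln H; apply: filterS => z Hz Uz.
have := Hz (Num.bound `|io z|); rewrite !indicE (mem_set Uz) mem_set/=; last first.
  by rewrite /tball/= ltW// archi_boundP.
by rewrite !mulr1 => /eqP; rewrite normr_eq0 subr_eq0 => /eqP.
Qed.

End convolution.

Section tensor_indicator.
Context (R : realType).

Definition segI (r : R) : R -> R := \1_(`[- r, r]%classic : set R).

Lemma segI_ge0 r x : 0 <= segI r x. Proof. by rewrite /segI indicE. Qed.

Lemma measurable_segI (r : R) : measurable_fun (setT : set (measurableTypeR R)) (segI r).
Proof. by apply: measurable_indic; exact: measurable_itv. Qed.

Lemma integral_segI (r : R) : 0 <= r -> (\int[mu1 R]_x (segI r x)%:E = (2 * r)%:E)%E.
Proof.
move=> r0; rewrite integral_indic; [|by []|exact: measurable_itv].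
rewrite setIT; transitivity (@lebesgue_measure R `[- r, r]%classic) => //.
rewrite lebesgue_measure_itv/= lte_fin; case: ifPn => h; last first.
  by rewrite (_ : r = 0) ?mulr0//; move: h; rewrite -leNgt; lra.
by rewrite opprK -EFinD; congr EFin; ring.
Qed.

Lemma integrable_ball3 (r : R) : 0 <= r ->
  (mu3 R).-integrable setT (EFin \o (\1_[set x : E3 R | `|x| <= r] : E3 R -> R)).
Proof.
move=> r0; have mI := measurable_segI r; have I1 := integral_segI r0.
have mb : measurable ([set x : E3 R | `|x| <= r] : set (E3 (measurableTypeR R))).
  exact: (measurable_tball (io := fun x : E3 (measurableTypeR R) => (x : E3 R)) (@continuous_measurable3 R)).
have H := integral_tensor (m1 := mu1 R) (m2 := mu1 R) mI mI (segI_ge0 r) (segI_ge0 r) I1 I1.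
have mI2 : measurable_fun (setT : set (measurableTypeR R * measurableTypeR R))
    (fun z => segI r z.1 * segI r z.2).
  by apply: measurable_funM; apply: measurableT_comp.
have H3 := integral_tensor (m1 := sprod (mu1 R) (mu1 R)) (m2 := mu1 R) mI2 mI
  (fun _ => mulr_ge0 (segI_ge0 _ _) (segI_ge0 _ _)) (segI_ge0 r) H I1.
apply: (integral_le_integrable _ _ (A := 2 * r * (2 * r) * (2 * r))).
- exact: measurable_indic.
- by move=> x.
rewrite -H3; apply: int_le => //.
  apply: measurable_funM; last exact: measurableT_comp.
  exact: (measurableT_comp mI2 measurable_fst).
move=> x; rewrite indicE; have [|_] := boolP (x \in _); last by rewrite !mulr_ge0// segI_ge0.
rewrite inE /= [`|x|]prod_normE [`|x.1|]prod_normE !ge_max => /andP[/andP[h1 h2] h3].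
by rewrite /segI !indicE !mem_set ?mulr1//= in_itv/= -ler_norml.
Qed.

Lemma integrable_ball4 (r : R) : 0 <= r ->
  (mu4 R).-integrable setT (EFin \o (\1_[set x : E3t R | `|x| <= r] : E3t R -> R)).
Proof.
move=> r0; have mI := measurable_segI r; have I1 := integral_segI r0.
have mb3 : measurable ([set x : E3 R | `|x| <= r] : set (E3 (measurableTypeR R))).
  exact: (measurable_tball (io := fun x : E3 (measurableTypeR R) => (x : E3 R)) (@continuous_measurable3 R)).
have mb : measurable ([set x : E3t R | `|x| <= r] : set (E3t (measurableTypeR R))).
  exact: (measurable_tball (io := fun x : E3t (measurableTypeR R) => (x : E3t R)) (@continuous_measurable4 R)).
have mI3 : measurable_fun (setT : set (E3 (measurableTypeR R))) (\1_[set x : E3 R | `|x| <= r] : E3 R -> R).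
  exact: measurable_indic.
have I0 (x : E3 R) : 0 <= (\1_[set x : E3 R | `|x| <= r] x : R) by rewrite indicE.
have := integral_tensor (m1 := mu3 R) (m2 := mu1 R) mI3 mI I0 (segI_ge0 r) (esym (EFin_Rintegral (integrable_ball3 r0))) I1.
set A := _ * _ => H.
apply: (integral_le_integrable _ _ (A := A)).
- exact: measurable_indic.
- by move=> x.
rewrite -H; apply: int_le => //.
  by apply: measurable_funM; apply: measurableT_comp.
move=> x; rewrite indicE; have [|_] := boolP (x \in _); last by rewrite mulr_ge0// ?segI_ge0// indicE.
rewrite inE /= [`|x|]prod_normE ge_max => /andP[h1 h3].
have h1' : x.1 \in [set y : E3 R | `|y| <= r] by rewrite inE.
by rewrite /segI !indicE h1' mul1r mem_set//= in_itv/= -ler_norml.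
Qed.

End tensor_indicator.

Section convolution3.
Context (R : realType).
Local Notation M3 := (E3 (measurableTypeR R)).

Definition io3 (x : M3) : E3 R := x.
Definition sub3 (z w : M3) : M3 := z - w.
Definition loc3 := locL1 (mu3 R) io3.
Definition cv3 (e : R) (s : seq 'I_3) (f : E3 R -> R) : E3 R -> R := conv (mu3 R) io3 f (eta e s).

Lemma mio3 (h : E3 R -> R) : continuous h -> measurable_fun setT (h \o io3).
Proof. exact: continuous_measurable3. Qed.

Lemma measurable_sub3 : measurable_fun setT (fun z : M3 * M3 => sub3 z.1 z.2).
Proof.
by apply/measurable_fun_pairP; split; [apply/measurable_fun_pairP; split|];
  apply: measurable_funB; apply: measurableT_comp => //; apply: measurableT_comp => //; exact: measurableT_comp.
Qed.

Lemma sub3_K z w : sub3 z (sub3 z w) = w.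
Proof. by rewrite /sub3 opprB addrC subrK. Qed.

Lemma shift_sub3 w : scales_measure (mu3 R) 1 (sub3 ^~ w).
Proof. exact: (scales_shift3r (- w)). Qed.

Lemma L1_sub3 (g : E3 R -> R) (a : R) : (mu3 R).-integrable setT (EFin \o g) -> 0 < a ->
  exists2 r : R, 0 < r & forall b, `|io3 b| <= r -> (L1dist (mu3 R) (fun z => g (sub3 z b)) g <= a%:E)%E.
Proof.
move=> gi a0; have [r r0 h] := L1_shift_small3 gi a0; exists r => // b br.
have := h (- b); rewrite normrN => /(_ br); congr (L1dist _ _ _ <= _)%E.
by apply/funext => z; rewrite addrC.
Qed.

Lemma cv3_integrable e s f x : 0 < e -> loc3 f ->
  (mu3 R).-integrable setT (EFin \o (fun y => f y * eta e s (x - y))).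
Proof. by move=> e0; exact: (conv_integrable mio3 (eta_lipbnd e0 s) (eta_supp e0 s)). Qed.

Lemma cv3_continuous e s f : 0 < e -> loc3 f -> continuous (cv3 e s f).
Proof. by move=> e0; exact: (conv_continuous mio3 (eta_lipbnd e0 s) (eta_supp e0 s)). Qed.

Lemma cv3_derive e s f i x : 0 < e -> loc3 f ->
  is_derive x (basis3 R i) (cv3 e s f : E3 R -> R^o) (cv3 e (i :: s) f x).
Proof.
move=> e0; exact: (conv_derive mio3 (eta_lipbnd e0 s) (eta_supp e0 s) _ (eta_lipbnd e0 (i :: s))
  (eta_supp e0 (i :: s)) (fun y => eta_derive e s i y)).
Qed.

Lemma cv3_sqnorm e f (M : R) : 0 < e -> loc3 f -> 0 <= M -> (sqnorm (mu3 R) f <= M%:E)%E ->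
  (sqnorm (mu3 R) (cv3 e [::] f) <= M%:E)%E.
Proof.
move=> e0; apply: (conv_sqnorm mio3 (fun z w => erefl) sub3_K (@scales_reflect3 R) shift_sub3 measurable_sub3
  (eta_lipbnd e0 [::]) (eta_supp e0 [::])) => //.
by under eq_integral do rewrite ger0_norm ?eta_ge0//; rewrite eta_integral1.
Qed.

Lemma cv3_L1 f (r a : R) : loc3 f -> 0 < a -> exists2 e0 : R, 0 < e0 &
  forall e, 0 < e <= e0 ->
    (\int[mu3 R]_z (`|cv3 e [::] f z - f z| * \1_[set x : E3 R | `|x| <= r] z)%:E <= a%:E)%E.
Proof.
move=> lf a0; have [e0 e00 H] := conv_L1 mio3 (fun z w => erefl) sub3_K (@scales_reflect3 R) shift_sub3 measurable_sub3
  L1_sub3 r lf a0.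
exists e0 => // e /andP[ep ee0]; apply: (H (eta e [::]) e) => //.
- exact: eta_lipbnd.
- exact: eta_supp.
- exact: eta_ge0.
- exact: eta_integral1.
Qed.

Lemma loc3_sqnorm (f : E3 R -> R) (M : R) : measurable_fun (setT : set M3) f ->
  (sqnorm (mu3 R) f <= M%:E)%E -> loc3 f.
Proof.
move=> mf fM; split => // r; have mb := measurable_tball mio3 r.
have [r0|r0] := leP 0 r; last first.
  apply: (integrable_ext _ (integrable0 _ _)) => w; rewrite indicE memNset ?mulr0// /tball/=.
  by apply/negP; rewrite -ltNge (lt_le_trans r0).
have ib := integrable_ball3 r0.
have mI : measurable_fun (setT : set M3) (\1_(tball io3 r) : E3 R -> R) by exact: measurable_indic.
have I2 : (sqnorm (mu3 R) (\1_(tball io3 r) : E3 R -> R) <= (\int[mu3 R]_x (\1_[set x : E3 R | `|x| <= r] x))%:E)%E.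
  rewrite (EFin_Rintegral ib) le_eqVlt; apply/orP; left; apply/eqP; apply: eq_integral => x _.
  by rewrite indicE; case: (x \in _); rewrite ?expr0n ?expr1n.
exact: (L2_mul mf mI fM I2).1.
Qed.

Lemma Rintegral_ae d (T : measurableType d) (m : {measure set T -> \bar R}) (f g : T -> R) :
  measurable_fun setT f -> measurable_fun setT g -> {ae m, forall x, f x = g x} ->
  \int[m]_x f x = \int[m]_x g x.
Proof.
move=> mf mg fg; rewrite /Rintegral; congr fine; apply: ae_eq_integral => //.
- exact/measurable_EFinP.
- exact/measurable_EFinP.
by apply: filterS fg => x /= -> .
Qed.

Lemma measurable_cv3_integrand e s (f : E3 R -> R) x : 0 < e -> measurable_fun (setT : set M3) f ->
  measurable_fun (setT : set M3) (fun y => f y * eta e s (x - y)).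
Proof.
move=> e0 mf; apply: measurable_funM => //.
exact: (measurable_reflect mio3 x (lipbnd_continuous (eta_lipbnd e0 s))).
Qed.

Lemma cv3_ae e s (f g : E3 R -> R) x : 0 < e -> measurable_fun (setT : set M3) f ->
  measurable_fun (setT : set M3) g -> {ae mu3 R, forall y, f y = g y} -> cv3 e s f x = cv3 e s g x.
Proof.
move=> e0 mf mg fg; apply: Rintegral_ae; [exact: measurable_cv3_integrand|exact: measurable_cv3_integrand|].
by apply: ae_imp fg => y /= ->.
Qed.

End convolution3.

Section convolution4.
Context (R : realType).
Local Notation M4 := (E3t (measurableTypeR R)).

Definition io4 (x : M4) : E3t R := x.
Definition sub4 (z w : M4) : M4 := z - w.
Definition loc4 := locL1 (mu4 R) io4.
Definition cv4 (e : R) (s : seq 'I_3) (j : nat) (f : E3t R -> R) : E3t R -> R :=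
  conv (mu4 R) io4 f (phi e s j).

Lemma mio4 (h : E3t R -> R) : continuous h -> measurable_fun setT (h \o io4).
Proof. exact: continuous_measurable4. Qed.

Lemma measurable_sub4 : measurable_fun setT (fun z : M4 * M4 => sub4 z.1 z.2).
Proof.
have mp : measurable_fun setT (fun z : M4 * M4 => (z.1.1, z.2.1) : E3 (measurableTypeR R) * E3 (measurableTypeR R)).
  exact: (measurable_fun_pair (measurableT_comp measurable_fst measurable_fst) (measurableT_comp measurable_fst measurable_snd)).
apply/measurable_fun_pairP; split; first exact: (measurableT_comp (@measurable_sub3 R) mp).
by apply: measurable_funB; apply: measurableT_comp => //; exact: measurableT_comp.
Qed.

Lemma sub4_K z w : sub4 z (sub4 z w) = w.
Proof. by rewrite /sub4 opprB addrC subrK. Qed.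

Lemma shift_sub4 w : scales_measure (mu4 R) 1 (sub4 ^~ w).
Proof. exact: (scales_shift4r (- w)). Qed.

Lemma L1_sub4 (g : E3t R -> R) (a : R) : (mu4 R).-integrable setT (EFin \o g) -> 0 < a ->
  exists2 r : R, 0 < r & forall b, `|io4 b| <= r -> (L1dist (mu4 R) (fun z => g (sub4 z b)) g <= a%:E)%E.
Proof.
move=> gi a0; have [r r0 h] := L1_shift_small4 gi a0; exists r => // b br.
have := h (- b); rewrite normrN => /(_ br).
by rewrite (_ : (fun x => g (- b + x)) = (fun z => g (sub4 z b)))//; apply/funext => z; rewrite addrC.
Qed.

Lemma cv4_integrable e s j f z : 0 < e -> loc4 f ->
  (mu4 R).-integrable setT (EFin \o (fun w => f w * phi e s j (z - w))).
Proof. by move=> e0; exact: (conv_integrable mio4 (phi_lipbnd e0 s j) (phi_supp e0 s j)). Qed.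

Lemma cv4_continuous e s j f : 0 < e -> loc4 f -> continuous (cv4 e s j f).
Proof. by move=> e0; exact: (conv_continuous mio4 (phi_lipbnd e0 s j) (phi_supp e0 s j)). Qed.

Lemma cv4_derive_x e s j f i z : 0 < e -> loc4 f ->
  is_derive z (dir_x R i) (cv4 e s j f : E3t R -> R^o) (cv4 e (i :: s) j f z).
Proof.
move=> e0; exact: (conv_derive mio4 (phi_lipbnd e0 s j) (phi_supp e0 s j) _ (phi_lipbnd e0 (i :: s) j)
  (phi_supp e0 (i :: s) j) (fun y => phi_derive_x e s j i y)).
Qed.

Lemma cv4_derive_t e s j f z : 0 < e -> loc4 f ->
  is_derive z (dir_t R) (cv4 e s j f : E3t R -> R^o) (cv4 e s j.+1 f z).
Proof.
move=> e0; exact: (conv_derive mio4 (phi_lipbnd e0 s j) (phi_supp e0 s j) _ (phi_lipbnd e0 s j.+1)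
  (phi_supp e0 s j.+1) (fun y => phi_derive_t e s j y)).
Qed.

Lemma cv4_L1 f (r a : R) : loc4 f -> 0 < a -> exists2 e0 : R, 0 < e0 &
  forall e, 0 < e <= e0 ->
    (\int[mu4 R]_z (`|cv4 e [::] 0 f z - f z| * \1_[set x : E3t R | `|x| <= r] z)%:E <= a%:E)%E.
Proof.
move=> lf a0; have [e0 e00 H] := conv_L1 mio4 (fun z w => erefl) sub4_K (@scales_reflect4 R) shift_sub4
  measurable_sub4 L1_sub4 r lf a0.
exists e0 => // e /andP[ep ee0]; apply: (H (phi e [::] 0) e) => //.
- exact: phi_lipbnd.
- exact: phi_supp.
- exact: phi_ge0.
- exact: phi_integral1.
Qed.

Lemma loc4_bounded (f : E3t R -> R) (C : R) : measurable_fun (setT : set M4) f ->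
  (forall z, `|f z| <= C) -> loc4 f.
Proof.
move=> mf fC; split => // r.
have [r0|r0] := leP 0 r; last first.
  apply: (integrable_ext _ (integrable0 _ _)) => w; rewrite indicE memNset ?mulr0// /tball/=.
  by apply/negP; rewrite -ltNge (lt_le_trans r0).
by apply: (integrable_ext _ (integrable_mul_bounded (integrable_ball4 r0) mf fC)) => w; rewrite mulrC.
Qed.

Lemma loc4_continuous (f : E3t R -> R) : continuous f -> loc4 f.
Proof.
move=> cf; have mf := continuous_measurable4 cf; split => // r.
have [r0|r0] := leP 0 r; last first.
  apply: (integrable_ext _ (integrable0 _ _)) => w; rewrite indicE memNset ?mulr0// /tball/=.
  by apply/negP; rewrite -ltNge (lt_le_trans r0).
have mb := measurable_tball mio4 r.
have [C [C1 hC]] : bounded_set (f @` [set w : E3t R | `|0 - w| <= r]).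
  by apply/compact_bounded/continuous_compact; [exact: continuous_subspaceT|exact: ball4_compact].
have fC w : `|f w * \1_(tball io4 r) w| <= `|C| + 1.
  rewrite indicE; have [|_] := boolP (w \in _); last by rewrite mulr0 normr0 addr_ge0.
  rewrite inE /tball/= mulr1 => wr; apply: hC; first by rewrite ltr_pwDr// ler_norm.
  by exists w => //=; rewrite sub0r normrN.
apply: (integrable_ext _ (integrable_mul_bounded (integrable_ball4 r0) _ fC)).
  by move=> w; rewrite mulrC -mulrA -[\1_(tball io4 r) w]/(\1_[set x : E3t R | `|x| <= r] w) indicE; case: (_ \in _); rewrite ?mulr1 ?mulr0.
by apply: measurable_funM => //; exact: measurable_indic.
Qed.

(** The derivative of f phi(z - .) has integral 0. The reflection in the kernel supplies a minus
    sign, so a derivative passes between kernel and function without change of sign. *)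
Lemma cv4_parts e s s' j j' (v : E3t R) (f f' : E3t R -> R) z : 0 < e -> continuous f -> continuous f' ->
  (forall w, is_derive w v (f : E3t R -> R^o) (f' w)) ->
  (forall w, is_derive w v (phi e s j : E3t R -> R^o) (phi e s' j' w)) ->
  cv4 e s' j' f z = cv4 e s j f' z.
Proof.
move=> e0 cf cf' df dp; have lf := loc4_continuous cf; have lf' := loc4_continuous cf'.
have i1 := cv4_integrable s j z e0 lf; have i2 := cv4_integrable s j z e0 lf'.
have i3 := cv4_integrable s' j' z e0 lf.
have cp u k : continuous (fun w : E3t R => phi e u k (z - w)).
  apply: (continuous_compT (f := fun w : E3t R => z - w) _ (lipbnd_continuous (phi_lipbnd e0 u k))) => y.
  by apply: cvgB; [exact: cvg_cst|exact: cvg_id].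
have := @Rintegral_derive4 R v (fun w => f w * phi e s j (z - w))
  (fun w => f' w * phi e s j (z - w) - f w * phi e s' j' (z - w)).
rewrite RintegralB// => H; apply/eqP; rewrite eq_sym -subr_eq0; apply/eqP; apply: H => //.
- by move=> w; apply: (is_deriveM' (df w) (reflect_derive z w dp)); rewrite mulrN.
- have cG : continuous (fun w : E3t R => f' w * phi e s j (z - w) - f w * phi e s' j' (z - w)).
    by move=> y; apply: cvgB; apply: cvgM; first [exact: cf'|exact: cf|exact: cp].
  move=> w t0; apply: (@continuous_comp _ _ _ (fun t : R => w + t *: v : E3t R)
    (fun w : E3t R => f' w * phi e s j (z - w) - f w * phi e s' j' (z - w))); last exact: cG.
  exact: line_continuous.
exact: integrableBfun.
Qed.

(** The slice at time t is an average of spatial translates of slices at times within e of t, since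
    the kernel vanishes elsewhere. Bounds inside the time interval thus survive at distance e from
    its ends. *)
Lemma cv4_sqnorm (f : E3t R -> R) e s j t (M C : R) : 0 < e -> loc4 f -> 0 <= M -> 0 < C ->
  (\int[mu4 R]_w `|phi e s j w|%:E <= C%:E)%E ->
  (forall tau, `|t - tau| <= e -> (sqnorm (mu3 R) (fun x => f (x, tau)) <= M%:E)%E) ->
  (sqnorm (mu3 R) (fun x => cv4 e s j f (x, t)) <= (C ^+ 2 * M)%:E)%E.
Proof.
move=> e0 lf M0 C0 pC fM; have [mf fi] := lf.
have mp : measurable_fun (setT : set M4) (phi e s j).
  exact: continuous_measurable4 (lipbnd_continuous (phi_lipbnd e0 s j)).
rewrite (_ : (fun x => cv4 e s j f (x, t)) = (fun x => \int[mu4 R]_w (f ((x, t) - w) * phi e s j w))).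
  apply: (mixing_sqnorm (H := fun z : E3 (measurableTypeR R) * M4 => f ((z.1, t) - z.2))) => //.
    have mq : measurable_fun setT (fun z : E3 (measurableTypeR R) * M4 => ((z.1, t), z.2) : M4 * M4).
      exact: (measurable_fun_pair (measurable_fun_pair measurable_fst (measurable_cst t)) measurable_snd).
    exact: (measurableT_comp mf (measurableT_comp measurable_sub4 mq)).
  move=> w kw; have wt : `|t - (t - w.2)| <= e.
    rewrite opprB addrC subrK leNgt; apply/negP => h; move/eqP: kw; apply.
    by apply: phi_supp => //; rewrite (le_trans (ltW h))// [leRHS]prod_normE le_max lexx orbT.
  apply: le_trans (fM _ wt); have [_ _ E] := scales_shift3r (- w.1).
  have mft : measurable_fun setT (fun x : E3 (measurableTypeR R) => f (x, t - w.2)).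
    by apply: (measurableT_comp mf); exact: measurable_pair2.
  have E1 := E (fun x => (f (x, t - w.2) ^+ 2)%:E) _ _; rewrite mul1e in E1.
  rewrite le_eqVlt; apply/orP; left; apply/eqP; apply: E1; last by move=> x; rewrite lee_fin sqr_ge0.
  by apply/measurable_EFinP; exact: measurable_funX.
apply/funext => x; apply: (conv_reflect (fun z w => erefl) sub4_K (@scales_reflect4 R) (z := (x, t))).
exact: cv4_integrable.
Qed.

End convolution4.

(** * Parabolic families bounded in L^2 *)

Section slices.
Context (R : realType).

Lemma slice_derive_x (f : E3t R -> R) x t (u : E3 R) (d : R) :
  is_derive (x, t) ((u, 0) : E3t R) (f : E3t R -> R^o) d ->
  is_derive x u (fun x => f (x, t) : R^o) d.
Proof.
move=> df; apply: is_derive_eps => e e0; have [r r0 h] := is_derive_epsP df e0.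
exists r => // k _ kr; have := h k kr.
by rewrite (_ : (x, t) + k *: ((u, 0) : E3t R) = (x + k *: u, t))//; congr (_, _); rewrite /= scaler0 addr0.
Qed.

Lemma slice_derive_t (f : E3t R -> R) x t (d : R) :
  is_derive (x, t) (dir_t R) (f : E3t R -> R^o) d ->
  is_derive t (1 : R) (fun t => f (x, t) : R^o) d.
Proof.
move=> df; apply: is_derive_eps => e e0; have [r r0 h] := is_derive_epsP df e0.
exists r => // k _ kr; have := h k kr.
by rewrite (_ : (x, t) + k *: dir_t R = (x, t + k *: (1 : R)))//; congr (_, _); rewrite /= scaler0 addr0.
Qed.

Lemma slice_continuous_x (f : E3t R -> R) t : continuous f -> continuous (fun x => f (x, t)).
Proof.
by move=> cf; apply: (continuous_compT (continuous_pair (fun x : E3 R => cvg_id) (fun x => cvg_cst t)) cf).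
Qed.

Lemma slice_continuous_t (f : E3t R -> R) x : continuous f -> continuous (fun t => f (x, t)).
Proof.
by move=> cf; apply: (continuous_compT (continuous_pair (fun t : R => cvg_cst x) (fun t => cvg_id)) cf).
Qed.

Lemma slice_measurable_x (f : E3t R -> R) t : measurable_fun (setT : set (E3t (measurableTypeR R))) f ->
  measurable_fun (setT : set (E3 (measurableTypeR R))) (fun x => f (x, t)).
Proof. by move=> mf; exact: (measurableT_comp mf (measurable_pair2 t)). Qed.

End slices.

Section weighted_families.
Context (R : realType) (T : R).

Definition dl (n : nat) : R := n.+1%:R^-1.
(** The number 1/(n+1) serves both as mollification radius and as margin: at such times the n-th
    mollification sees only times in (0, T). *)
Definition inD (n : nat) (t : R) : bool := dl n < t < T - dl n.
Local Notation fam := (nat -> E3t R -> R).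

Definition fam_base (F : fam) : Prop := (forall n, continuous (F n)) /\
  exists2 M : R, 0 <= M & forall n t, inD n t -> (sqnorm (mu3 R) (fun x => F n (x, t)) <= (M ^+ 2)%:E)%E.

Definition fam_derive (v : E3t R) (F F' : fam) : Prop :=
  forall n z, is_derive z v (F n : E3t R -> R^o) (F' n z).

(* [X p J]: parabolic derivatives of weight at most [p] (a time derivative counts twice), at most [J]
   of them in time, are bounded in [L^2(dx)] uniformly in [t] and in the index of the family. *)
Fixpoint X (p J : nat) (F : fam) : Prop := fam_base F /\
  match p with 0 => True | p1.+1 =>
    (forall i, exists2 F', fam_derive (dir_x R i) F F' & X p1 J F') /\
    match p1, J with p2.+1, J1.+1 => exists2 F', fam_derive (dir_t R) F F' & X p2 J1 F' | _, _ => True end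
  end.

Lemma X_base p J F : X p J F -> fam_base F. Proof. by case: p => [|p] []. Qed.

Lemma X_dx p J F i : X p.+1 J F -> exists2 F', fam_derive (dir_x R i) F F' & X p J F'.
Proof. by move=> [_ [/(_ i)]]. Qed.

Lemma X_dt p J F : X p.+2 J.+1 F -> exists2 F', fam_derive (dir_t R) F F' & X p J F'.
Proof. by move=> [_ [_]]. Qed.

Lemma X_intro p J F : fam_base F ->
  (forall p1, p = p1.+1 -> forall i, exists2 F', fam_derive (dir_x R i) F F' & X p1 J F') ->
  (forall p2 J1, p = p2.+2 -> J = J1.+1 -> exists2 F', fam_derive (dir_t R) F F' & X p2 J1 F') ->
  X p J F.
Proof.
move=> bF; case: p => [|p] H1 H2; first by split.
split => //; split; first exact: H1.
by case: p J H1 H2 => [|p] [|J] //= H1 H2; exact: H2.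
Qed.

Lemma X_mono p J F q K : X p J F -> (q <= p)%N -> (K <= J)%N -> X q K F.
Proof.
elim/ltn_ind: p J F q K => p IH J F q K XF qp KJ.
apply: X_intro; first exact: X_base XF.
  move=> q1 qE i; case: p qp IH XF => [|p] qp IH XF; first by rewrite qE in qp.
  have [F' dF XF'] := X_dx i XF; exists F' => //; apply: IH XF' _ KJ => //.
  by rewrite -ltnS -qE.
move=> q2 K1 qE KE; case: p qp IH XF => [|[|p]] qp IH XF; rewrite qE// in qp.
case: J KJ XF => [|J] KJ XF; rewrite KE// in KJ.
by have [F' dF XF'] := X_dt XF; exists F' => //; apply: IH XF' _ _.
Qed.

Lemma fam_base_add F G : fam_base F -> fam_base G -> fam_base (fun n z => F n z + G n z).
Proof.
move=> [cF [M M0 hM]] [cG [N N0 hN]]; split.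
  by move=> n z; apply: cvgD; [exact: cF|exact: cG].
exists (Num.sqrt (2 * (M ^+ 2 + N ^+ 2))); first exact: sqrtr_ge0.
move=> n t nt; rewrite sqr_sqrtr; last by rewrite mulr_ge0// addr_ge0// sqr_ge0.
have mS (H : E3t R -> R) (cH : continuous H) := continuous_measurable3 (slice_continuous_x (t := t) cH).
apply: (le_trans (sqnormD_le (mu3 R) (mS _ (cF n)) (mS _ (cG n)))).
by apply: (le_trans (lee_wpmul2l _ (leeD (hM _ _ nt) (hN _ _ nt)))); rewrite // -EFinD -EFinM.
Qed.

Lemma X_add p J F G : X p J F -> X p J G -> X p J (fun n z => F n z + G n z).
Proof.
elim/ltn_ind: p J F G => p IH J F G XF XG.
apply: X_intro; first exact: fam_base_add (X_base XF) (X_base XG).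
  move=> p1 pE i; rewrite pE in XF XG IH; have [F' dF XF'] := X_dx i XF; have [G' dG XG'] := X_dx i XG.
  exists (fun n z => F' n z + G' n z); last exact: IH.
  by move=> n z; exact: is_deriveD' (dF n z) (dG n z) erefl.
move=> p2 J1 pE JE; rewrite pE JE in XF XG; rewrite pE in IH.
have [F' dF XF'] := X_dt XF; have [G' dG XG'] := X_dt XG.
exists (fun n z => F' n z + G' n z); last exact: IH.
by move=> n z; exact: is_deriveD' (dF n z) (dG n z) erefl.
Qed.

Lemma X_scale p J F c : X p J F -> X p J (fun n z => c * F n z).
Proof.
elim/ltn_ind: p J F => p IH J F XF; apply: X_intro.
- have [cF [M M0 hM]] := X_base XF; split.
    by move=> n z; apply: cvgM; [exact: cvg_cst|exact: cF].
  exists (`|c| * M); first by rewrite mulr_ge0.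
  move=> n t nt; have mF := continuous_measurable3 (slice_continuous_x (t := t) (cF n)).
  have := sqnorm_mulr_le (mu3 R) mF (measurable_cst c) (fun=> lexx `|c|).
  rewrite (_ : (fun x => F n (x, t) * _) = (fun x => c * F n (x, t))); last first.
    by apply/funext => x; rewrite mulrC.
  move=> h; apply: (le_trans h); apply: (le_trans (lee_wpmul2l _ (hM _ _ nt))).
    by rewrite lee_fin sqr_ge0.
  by rewrite -EFinM exprMn.
- move=> p1 pE i; rewrite pE in XF IH; have [F' dF XF'] := X_dx i XF.
  exists (fun n z => c * F' n z); last exact: IH.
  by move=> n z; exact: is_deriveZ' (dF n z) erefl.
move=> p2 J1 pE JE; rewrite pE JE in XF; rewrite pE in IH.
have [F' dF XF'] := X_dt XF; exists (fun n z => c * F' n z); last exact: IH.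
by move=> n z; exact: is_deriveZ' (dF n z) erefl.
Qed.

Lemma X_sum3 p J (F : 'I_3 -> fam) : (forall i, X p J (F i)) -> X p J (fun n z => \sum_i F i n z).
Proof.
move=> XF; have -> : (fun n z => \sum_i F i n z) = (fun n z => F (inord 0) n z + F (inord 1) n z + F (inord 2) n z).
  by apply/funext => n; apply/funext => z; rewrite sum3E.
by apply: X_add => //; exact: X_add.
Qed.

Lemma fam_grad F F' n t : (forall n, continuous (F n)) -> (forall i n, continuous (F' i n)) ->
  (forall i, fam_derive (dir_x R i) F (F' i)) ->
  grad_cont (fun x => F n (x, t)) (fun i x => F' i n (x, t)).
Proof.
move=> cF cF' dF; split; first by move=> i; exact: slice_continuous_x.
by move=> i x; apply: slice_derive_x; exact: dF.
Qed.

Lemma le_sum3_term (a : 'I_3 -> R) i : (forall i, 0 <= a i) -> a i <= \sum_i a i.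
Proof. by move=> a0; rewrite (bigD1 i)//= lerDl sumr_ge0. Qed.

Lemma X2_data J F : X 2 J F -> exists F' FF (M0 M1 M : R),
  [/\ [/\ 0 <= M0, 0 <= M1 & 0 <= M],
    forall n t, continuous (fun x => F n (x, t)) /\ grad_cont (fun x => F n (x, t)) (fun i x => F' i n (x, t)),
    forall i n t, grad_cont (fun x => F' i n (x, t)) (fun j x => FF i j n (x, t)) &
    forall n t, inD n t -> [/\ (sqnorm (mu3 R) (fun x => F n (x, t)) <= (M0 ^+ 2)%:E)%E,
       forall i, (sqnorm (mu3 R) (fun x => F' i n (x, t)) <= (M1 ^+ 2)%:E)%E &
       forall i j, (sqnorm (mu3 R) (fun x => FF i j n (x, t)) <= (M ^+ 2)%:E)%E]].
Proof.
move=> XF; have [cF [M0 M00 hM0]] := X_base XF.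
have /choice[F' hF'] : forall i, exists F', fam_derive (dir_x R i) F F' /\ X 1 J F'.
  by move=> i; have [F' ? ?] := X_dx i XF; exists F'.
have /choice[FF hFF] : forall ij : 'I_3 * 'I_3, exists FF, fam_derive (dir_x R ij.2) (F' ij.1) FF /\ X 0 J FF.
  by move=> ij; have [G ? ?] := X_dx ij.2 (hF' ij.1).2; exists G.
have /choice[M1 hM1] : forall i, exists M, 0 <= M /\
    forall n t, inD n t -> (sqnorm (mu3 R) (fun x => F' i n (x, t)) <= (M ^+ 2)%:E)%E.
  by move=> i; have [_ [M ? ?]] := X_base (hF' i).2; exists M.
have /choice[M2 hM2] : forall ij, exists M, 0 <= M /\
    forall n t, inD n t -> (sqnorm (mu3 R) (fun x => FF ij n (x, t)) <= (M ^+ 2)%:E)%E.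
  by move=> ij; have [_ [M ? ?]] := X_base (hFF ij).2; exists M.
exists F', (fun i j => FF (i, j)), M0, (\sum_i M1 i), (\sum_i \sum_j M2 (i, j)); split.
- by split => //; repeat (apply: sumr_ge0 => ? _); [exact: (hM1 _).1|exact: (hM2 _).1].
- move=> n t; split; first exact: slice_continuous_x.
  by apply: fam_grad => // i; [exact: (X_base (hF' i).2).1|exact: (hF' i).1].
- move=> i n t; apply: (fam_grad (F' := fun j => FF (i, j))); first exact: (X_base (hF' i).2).1.
    by move=> j; exact: (X_base (hFF (i, j)).2).1.
  by move=> j; exact: (hFF (i, j)).1.
move=> n t nt; split; first exact: hM0.
  move=> i; apply: (le_trans ((hM1 i).2 n t nt)).
  have h := le_sum3_term i (fun i => (hM1 i).1).
  by rewrite lee_fin ler_sqr ?nnegrE// ?(le_trans _ h)//; exact: (hM1 i).1.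
move=> i j; apply: (le_trans ((hM2 (i, j)).2 n t nt)).
have h : M2 (i, j) <= \sum_i \sum_j M2 (i, j).
  apply: (@le_trans _ _ (\sum_j M2 (i, j))).
    by apply: (le_sum3_term (a := fun j => M2 (i, j))) => k; exact: (hM2 _).1.
  by apply: (le_sum3_term (a := fun i => \sum_j M2 (i, j))) => k; apply: sumr_ge0 => j' _; exact: (hM2 _).1.
by rewrite lee_fin ler_sqr ?nnegrE// ?(le_trans _ h)//; exact: (hM2 _).1.
Qed.

Lemma X_bounded J F : X 2 J F -> exists2 C : R, 0 <= C & forall n z, inD n z.2 -> `|F n z| <= C.
Proof.
move=> /X2_data[F' [FF [M0 [M1 [M [[M00 M10 Mp] gF gF' hM]]]]]].
exists (42 * M * 1 + M0 / 1 ^+ 3).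
  by rewrite mulr1 expr1n divr1 addr_ge0// mulr_ge0.
move=> n [x t] nt; have [h0 h1 h2] := hM n t nt; have [cf gf] := gF n t.
exact: (sobolev_sup cf gf (fun i => gF' i n t) h1 h2 Mp x h0 M00 ltr01).
Qed.

Lemma X_hoelder_x J F : X 2 J F -> exists2 C : R, 0 <= C & forall n t x y, inD n t ->
  `|F n (x, t) - F n (y, t)| <= C * Num.sqrt `|x - y|.
Proof.
move=> /X2_data[F' [FF [M0 [M1 [M [[M00 M10 Mp] gF gF' hM]]]]]].
exists (105 * M); first by rewrite mulr_ge0.
move=> n t x y nt; have [h0 h1 h2] := hM n t nt; have [cf gf] := gF n t.
exact: (sobolev_hoelder cf gf (fun i => gF' i n t) h1 h2 Mp x y).
Qed.

(** The increment is the integral of f' against the indicator of [a, b], of mass b - a; the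
    averaging inequality in L^2 yields exactly this factor. *)
Lemma sqnorm_increment (f f' : E3t R -> R) (a b M : R) : a <= b -> continuous f -> continuous f' ->
  (forall z, is_derive z (dir_t R) (f : E3t R -> R^o) (f' z)) -> 0 <= M ->
  (forall t, a <= t <= b -> (sqnorm (mu3 R) (fun x => f' (x, t)) <= (M ^+ 2)%:E)%E) ->
  (sqnorm (mu3 R) (fun x => f (x, b) - f (x, a))%R <= (((b - a) * M) ^+ 2)%:E)%E.
Proof.
rewrite le_eqVlt => /predU1P[->|ab] cf cf' df M0 hM.
  rewrite /sqnorm integral0_eq ?lee_fin ?sqr_ge0// => x _; by rewrite subrr expr0n.
have mI : measurable (`[a, b]%classic : set (measurableTypeR R)) by exact: measurable_itv.
pose k : R -> R := \1_(`[a, b]%classic : set R).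
have mk : measurable_fun (setT : set (measurableTypeR R)) k by exact: measurable_indic.
have E x : f (x, b) - f (x, a) = \int[mu1 R]_t (f' (x, t) * k t).
  have dft t : is_derive t (1 : R) (fun t => f (x, t) : R^o) (f' (x, t)).
    exact: slice_derive_t (df (x, t)).
  by have [_ <-] := ftc_indic (ltW ab) dft (slice_continuous_t (x := x) cf').
rewrite (_ : (fun x => _) = (fun x => \int[mu1 R]_t (f' (x, t) * k t))); last exact/funext.
have -> : ((b - a) * M) ^+ 2 = (b - a) ^+ 2 * M ^+ 2 by ring.
have H := @mixing_sqnorm _ _ (E3 (measurableTypeR R)) (measurableTypeR R) R (mu3 R) (mu1 R) f' k (b - a) (M ^+ 2).
apply: H.
- exact: continuous_measurable4.
- exact: mk.
- under eq_integral do rewrite ger0_norm ?indicE//.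
  rewrite integral_indic//= setIT.
  apply: (@le_trans _ _ (@lebesgue_measure R `[a, b]%classic)) => //.
  by rewrite lebesgue_measure_itv/= lte_fin ab.
- by rewrite subr_gt0.
- exact: sqr_ge0.
move=> t; rewrite /k indicE; have [|_] := boolP (t \in _); last by rewrite eqxx.
by rewrite inE/= in_itv/= => /hM.
Qed.

Lemma inD_between n s t r : inD n s -> inD n t -> s <= r <= t -> inD n r.
Proof. by rewrite /inD; move=> *; lra. Qed.

Lemma X_hoelder_t J F : X 2 J.+1 F -> exists2 C : R, 0 <= C & forall n x s t, inD n s -> inD n t ->
  `|F n (x, t) - F n (x, s)| <= C * Num.sqrt (Num.sqrt `|t - s|).
Proof.
move=> XF; have [G dG XG] := X_dt XF; have [cG [L L0 hL]] := X_base XG.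
have [cF _] := X_base XF.
have [F' [FF [M0 [M1 [M [[M00 M10 Mp] gF gF' hM]]]]]] := X2_data XF.
exists (42 * (2 * M) + L); first by rewrite addr_ge0// ?mulr_ge0// mulr_ge0.
move=> n x; suff W s t : inD n s -> inD n t -> s < t ->
    `|F n (x, t) - F n (x, s)| <= (42 * (2 * M) + L) * Num.sqrt (Num.sqrt `|t - s|).
  move=> s t Ds Dt; have [st|ts|->] := ltgtP s t; first exact: W.
    by rewrite distrC (distrC t); exact: W.
  by rewrite !subrr normr0 mulr_ge0// ?sqrtr_ge0// addr_ge0// ?mulr_ge0// mulr_ge0.
(* The scale a = |t - s|^(1/4) balances the two terms of [sobolev_sup]: the oscillation 42 (2M) a,
   and the L^2 size a^4 L of the increment divided by a^3. *)
move=> Ds Dt st; set a := Num.sqrt _.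
have ts0 : 0 < `|t - s| by rewrite normr_gt0 subr_eq0 gt_eqF.
have a0 : 0 < a by rewrite !sqrtr_gt0.
have aE : a ^+ 4 = t - s.
  by rewrite (exprM a 2 2) sqr_sqrtr ?sqrtr_ge0// sqr_sqrtr// gtr0_norm// subr_gt0.
have [cfs gfs] := gF n s; have [cft gft] := gF n t.
have gradB (f g : E3 R -> R) f' g' : grad_cont f f' -> grad_cont g g' ->
    grad_cont (fun y => f y - g y) (fun i y => f' i y - g' i y).
  move=> [c1 d1] [c2 d2]; split; first by move=> i y; apply: cvgB; [exact: c1|exact: c2].
  by move=> i y; exact: is_deriveB' (d1 i y) (d2 i y) erefl.
have sqB (f g : E3 R -> R) (A : R) : continuous f -> continuous g -> (sqnorm (mu3 R) f <= (A ^+ 2)%:E)%E ->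
    (sqnorm (mu3 R) g <= (A ^+ 2)%:E)%E -> (sqnorm (mu3 R) (fun y => f y - g y)%R <= ((2 * A) ^+ 2)%:E)%E.
  move=> cf cg fA gA; have mf := continuous_measurable3 cf; have mg := continuous_measurable3 cg.
  have mNg : measurable_fun setT (fun y : E3 (measurableTypeR R) => - g y) by exact: measurable_funN.
  apply: (le_trans (sqnormD_le (mu3 R) mf mNg)).
  have -> : sqnorm (mu3 R) (fun y => - g y) = sqnorm (mu3 R) g.
    by apply: eq_integral => y _; rewrite sqrrN.
  have -> : (2 * A) ^+ 2 = 2 * (A ^+ 2 + A ^+ 2) by ring.
  by apply: (le_trans (lee_wpmul2l _ (leeD fA gA))); rewrite // -EFinD -EFinM.
have c1 i r : continuous (fun y => F' i n (y, r)) by move=> y; have [c _] := gF n r; exact: (gF n r).2.1.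
have c2 i j r : continuous (fun y => FF i j n (y, r)) by exact: (gF' i n r).1.
have [s0 s1 s2] := hM n s Ds; have [t0 t1 t2] := hM n t Dt.
have h0 : (sqnorm (mu3 R) (fun y => F n (y, t) - F n (y, s))%R <= ((a ^+ 4 * L) ^+ 2)%:E)%E.
  rewrite aE; apply: (sqnorm_increment (ltW st) (cF n) (cG n) (dG n) L0) => r rst.
  by apply: hL; exact: (inD_between Ds Dt rst).
have := @sobolev_sup R _ _ _ _ (2 * M) _ (gradB _ _ _ _ gft gfs)
  (fun i => gradB _ _ _ _ (gF' i n t) (gF' i n s)) (fun i => sqB _ _ _ (c1 i t) (c1 i s) (t1 i) (s1 i))
  (fun i j => sqB _ _ _ (c2 i j t) (c2 i j s) (t2 i j) (s2 i j)) _ _ a x h0 _ a0.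
have -> : a ^+ 4 * L / a ^+ 3 = L * a by field; exact: lt0r_neq0.
move=> H; rewrite mulrDl; apply: H.
- by move=> y; apply: cvgB; [exact: cft|exact: cfs].
- by rewrite mulr_ge0.
- by rewrite mulr_ge0// exprn_ge0// ltW.
Qed.

End weighted_families.

(** * A chain rule on the half line *)

Section one_sided_chain_rule.
Context (R : realType).

(** G is differentiable only within [0, +oo), while its argument |Du|^2 may touch 0. A linear
    approximation tested on admissible increments composes with any differentiable nonnegative
    function, at 0 as well. *)
Definition half_derive (f : R -> R) (s d : R) : Prop := forall e : R, 0 < e ->
  exists2 r : R, 0 < r & forall h, 0 <= s + h -> `|h| < r -> `|f (s + h) - f s - h * d| <= e * `|h|.

Lemma half_derive_comp (V : normedModType R) (f : R -> R) (q : V -> R) (z v : V) (d q' : R) :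
  half_derive f (q z) d -> (forall z, 0 <= q z) -> is_derive z v (q : V -> R^o) q' ->
  is_derive z v (fun z => f (q z) : R^o) (d * q').
Proof.
move=> fd q0 dq; apply: is_derive_eps => e e0.
have d1 : 0 < `|d| + 1 by rewrite ltr_wpDl.
have q1 : 0 < `|q'| + 1 by rewrite ltr_wpDl.
pose e2 := Num.min 1 (e / 2 / (`|d| + 1)); pose e1 := e / 2 / (`|q'| + 1).
have e20 : 0 < e2 by rewrite lt_min ltr01 !divr_gt0.
have e10 : 0 < e1 by rewrite !divr_gt0.
have [r1 r10 H1] := fd e1 e10; have [r2 r20 H2] := is_derive_epsP dq e20.
exists (Num.min r2 (r1 / (`|q'| + 1))); first by rewrite lt_min r20 divr_gt0.
move=> h _; rewrite lt_min => /andP[hr2]; rewrite ltr_pdivlMr// => hr1.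
have A2 := H2 h hr2; set D := q (z + h *: v) - q z.
have Dh : `|D| <= (`|q'| + 1) * `|h|.
  have -> : D = (D - h * q') + h * q' by rewrite subrK.
  rewrite (le_trans (ler_normD _ _))// mulrDl mul1r addrC lerD//.
    by rewrite normrM mulrC.
  by rewrite (le_trans A2)// -[leRHS]mul1r ler_wpM2r// /e2 ge_min lexx.
have qD : q z + D = q (z + h *: v) by rewrite addrC subrK.
have := H1 D; rewrite qD => /(_ (q0 _)).
have -> : `|D| < r1 by rewrite (le_lt_trans Dh)// mulrC.
move=> /(_ isT) A1.
have -> : f (q (z + h *: v)) - f (q z) - h * (d * q') =
  (f (q (z + h *: v)) - f (q z) - D * d) + d * (D - h * q') by ring.
have B1 : e1 * `|D| <= e / 2 * `|h|.
  have E : e1 * ((`|q'| + 1) * `|h|) = e / 2 * `|h| by rewrite /e1; field; exact: lt0r_neq0.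
  by rewrite -E ler_wpM2l// ltW.
have B2 : `|d * (D - h * q')| <= e / 2 * `|h|.
  rewrite normrM (le_trans (ler_wpM2l (normr_ge0 _) A2))// mulrA ler_wpM2r//.
  apply: (@le_trans _ _ ((`|d| + 1) * e2)); first by rewrite ler_wpM2r ?lerDl// ltW.
  rewrite (le_trans (ler_wpM2l (ltW d1) (_ : e2 <= e / 2 / (`|d| + 1))))//.
    by rewrite /e2 ge_min lexx orbT.
  by rewrite mulrC divfK//; exact: lt0r_neq0.
by rewrite (le_trans (ler_normD _ _))//; lra.
Qed.

Lemma half_derive_continuous (V : topologicalType) (f : R -> R) (q : V -> R) (d : R -> R) :
  (forall s, 0 <= s -> half_derive f s (d s)) -> (forall z, 0 <= q z) -> continuous q ->
  continuous (fun z => f (q z)).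
Proof.
move=> fd q0 cq z; apply/cvgrPdist_le => e e0; have [r r0 H] := fd _ (q0 z) 1 ltr01.
have d1 : 0 < `|d (q z)| + 1 by rewrite ltr_wpDl.
have m0 : 0 < Num.min (r / 2) (e / (`|d (q z)| + 1)) by rewrite lt_min !divr_gt0.
have /cvgrPdist_le/(_ _ m0) := cq z; apply: filterS => y.
rewrite le_min distrC => /andP[yr]; rewrite ler_pdivlMr// => ye.
have := H (q y - q z); rewrite addrC subrK => /(_ (q0 y)).
have -> : `|q y - q z| < r by rewrite (le_lt_trans yr)// ltr_pdivrMr// ltr_pMr// ltr1n.
move=> /(_ isT) A; rewrite distrC.
have -> : f (q y) - f (q z) = (f (q y) - f (q z) - (q y - q z) * d (q z)) + (q y - q z) * d (q z) by rewrite subrK.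
rewrite (le_trans (ler_normD _ _))// normrM; move: A ye; lra.
Qed.

Lemma half_derive_bounded (f : R -> R) (d : R -> R) (C : R) :
  (forall s, 0 <= s -> half_derive f s (d s)) -> exists2 M : R, 0 <= M & forall s, 0 <= s <= C -> `|f s| <= M.
Proof.
(* The even extension is continuous on the whole line, so compactness of [0, C] applies. *)
move=> fd; have cf : continuous (fun s : R => f `|s|).
  by apply: (half_derive_continuous fd) => [z|]; [exact: normr_ge0|exact: norm_continuous].
have [M [M1 hM]] : bounded_set ((fun s : R => f `|s|) @` `[0, C]%classic).
  by apply/compact_bounded/continuous_compact; [exact: continuous_subspaceT|exact: segment_compact].
exists (`|M| + 1); first by rewrite addr_ge0.
move=> s sC; apply: hM; first by rewrite ltr_pwDr// ler_norm.
by exists s; rewrite /= ?in_itv//= ger0_norm//; case/andP : sC.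
Qed.

End one_sided_chain_rule.

(** * Products and compositions in the parabolic scale *)

Section weighted_products.
Context (R : realType) (T : R).
Local Notation fam := (nat -> E3t R -> R).
Local Notation X := (X T).
Local Notation inD := (inD T).

Lemma fam_base_mul (F G : fam) (C : R) : fam_base T F -> (forall n, continuous (G n)) -> 0 <= C ->
  (forall n z, inD n z.2 -> `|G n z| <= C) -> fam_base T (fun n z => F n z * G n z).
Proof.
move=> [cF [M M0 hM]] cG C0 hC; split; first by move=> n z; apply: cvgM; [exact: cF|exact: cG].
exists (C * M) => [|n t nt]; first exact: mulr_ge0.
have mS (H : E3t R -> R) (cH : continuous H) := continuous_measurable3 (slice_continuous_x (t := t) cH).
apply: (le_trans (sqnorm_mulr_le (mu3 R) (mS _ (cF n)) (mS _ (cG n)) (fun x => hC n (x, t) nt))).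
apply: (le_trans (lee_wpmul2l _ (hM _ _ nt))); first by rewrite lee_fin sqr_ge0.
by rewrite -EFinM exprMn.
Qed.

(** As p + q >= 3, one factor has weight at least 2 and is bounded, so the other is estimated in
    L^2. By Leibniz' rule a derivative lowers r and one of p, q by the same amount, 1 in space and 2
    in time, so the three inequalities are inherited by both terms. *)
Lemma X_mul r p q J F G : X p J F -> X q J G -> (r <= p)%N -> (r <= q)%N -> (r + 3 <= p + q)%N ->
  X r J (fun n z => F n z * G n z).
Proof.
elim/ltn_ind: r p q J F G => r IH p q J F G XF XG rp rq rpq; apply: X_intro.
- have [p2|p2] := leqP 2 p.
    have [C C0 hC] := X_bounded (X_mono XF p2 (leqnn J)).
    rewrite (_ : (fun n z => _) = (fun n z => G n z * F n z)).
      exact: fam_base_mul (X_base XG) (X_base XF).1 C0 hC.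
    by apply/funext => n; apply/funext => z; rewrite mulrC.
  have q2 : (2 <= q)%N by lia.
  have [C C0 hC] := X_bounded (X_mono XG q2 (leqnn J)).
  exact: fam_base_mul (X_base XF) (X_base XG).1 C0 hC.
- move=> r1 rE i.
  case: p XF rp rpq => [|p] XF rp rpq; first by lia.
  case: q XG rq rpq => [|q] XG rq rpq; first by lia.
  have [F' dF XF'] := X_dx i XF; have [G' dG XG'] := X_dx i XG.
  exists (fun n z => F' n z * G n z + F n z * G' n z).
    by move=> n z; exact: is_deriveM' (dF n z) (dG n z) erefl.
  by apply: X_add; [apply: (IH r1 _ p q.+1)|apply: (IH r1 _ p.+1 q)] => //; lia.
move=> r2 J1 rE JE.
case: p XF rp rpq => [|[|p]] XF rp rpq; try lia.
case: q XG rq rpq => [|[|q]] XG rq rpq; try lia.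
rewrite JE in XF XG.
have [F' dF XF'] := X_dt XF; have [G' dG XG'] := X_dt XG.
exists (fun n z => F' n z * G n z + F n z * G' n z).
  by move=> n z; exact: is_deriveM' (dF n z) (dG n z) erefl.
apply: X_add; [apply: (IH r2 _ p q.+2)|apply: (IH r2 _ p.+2 q)] => //; try lia.
- exact: X_mono XG (leqnn _) (leqnSn _).
- exact: X_mono XF (leqnn _) (leqnSn _).
Qed.

(** The extra factor F closes the induction: the derivative of g_k(q) F is g_(k+1)(q) (q' F) +
    g_k(q) F', again of this form. The product q' F has the required weight by [X_mul] exactly when
    p >= 3. On the bounded range of q each g_k is bounded. *)
Lemma X_comp (g : nat -> R -> R) (q : fam) p r J k F :
  (forall k s, 0 <= s -> half_derive (g k) s (g k.+1 s)) -> (forall n z, 0 <= q n z) ->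
  (3 <= p)%N -> X p J q -> (r <= p)%N -> X r J F -> X r J (fun n z => g k (q n z) * F n z).
Proof.
move=> gd q0 p3; elim/ltn_ind: r J k F => r IH J k F Xq rp XF.
have dg k' n z v d : is_derive z v (q n : E3t R -> R^o) d ->
    is_derive z v (fun z => g k' (q n z) : R^o) (g k'.+1 (q n z) * d).
  by move=> dq; exact: half_derive_comp (gd k' _ (q0 n z)) (q0 n) dq.
apply: X_intro.
- have [C C0 hC] := X_bounded (X_mono Xq (ltnW p3) (leqnn J)).
  have [M M0 hM] := half_derive_bounded C (gd k).
  rewrite (_ : (fun n z => _) = (fun n z => F n z * g k (q n z))).
    apply: fam_base_mul (X_base XF) _ M0 _ => [n|n z nz].
      exact: half_derive_continuous (gd k) (q0 n) ((X_base Xq).1 n).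
    by apply: hM; rewrite q0/= (le_trans _ (hC n z nz))// ler_norm.
  by apply/funext => n; apply/funext => z; rewrite mulrC.
- move=> r1 rE i; have [p1 pE] : exists p1, p = p1.+1 by exists p.-1; lia.
  rewrite rE in XF; have [F' dF XF'] := X_dx i XF.
  have [q' dq Xq'] : exists2 F', fam_derive (dir_x R i) q F' & X p1 J F' by apply: X_dx; rewrite -pE.
  exists (fun n z => g k.+1 (q n z) * (q' n z * F n z) + g k (q n z) * F' n z).
    by move=> n z; apply: is_deriveM' (dg k n z _ _ (dq n z)) (dF n z) _; rewrite mulrA.
  apply: X_add; apply: IH => //; try lia.
  by apply: (X_mul Xq' XF); lia.
move=> r2 J1 rE JE; have [p2 pE] : exists p2, p = p2.+2 by exists p.-2; lia.
rewrite rE JE in XF; rewrite JE in Xq; have [F' dF XF'] := X_dt XF.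
have [q' dq Xq'] : exists2 F', fam_derive (dir_t R) q F' & X p2 J1 F' by apply: X_dt; rewrite -pE.
exists (fun n z => g k.+1 (q n z) * (q' n z * F n z) + g k (q n z) * F' n z).
  by move=> n z; apply: is_deriveM' (dg k n z _ _ (dq n z)) (dF n z) _; rewrite mulrA.
have Xq1 := X_mono Xq (leqnn _) (leqnSn J1).
apply: X_add; apply: IH => //; try lia.
by apply: (X_mul Xq' (X_mono XF (leqnn _) (leqnSn J1))); lia.
Qed.

End weighted_products.

(** * Derivative bounds for mollified limits *)

Section transfer.
Context (R : realType) (T : R).
Local Notation fam := (nat -> E3t R -> R).
Local Notation X := (X T).
Local Notation inD := (inD T).
Local Notation M3 := (E3 (measurableTypeR R)).
Local Notation M4 := (E3t (measurableTypeR R)).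

Definition L1_lim (F : fam) (f : E3t R -> R) : Prop := forall r a : R, 0 < a -> exists N, forall n, (N <= n)%N ->
  (\int[mu4 R]_z (`|F n z - f z| * \1_[set x : E3t R | `|x| <= r] z)%:E <= a%:E)%E.

Lemma X_kernel s j p J F : X p J F -> (size s + 2 * j <= p)%N -> (j <= J)%N ->
  exists2 G, X 0 0 G & forall n e z, 0 < e -> cv4 e s j (F n) z = cv4 e [::] 0 (G n) z.
Proof.
elim: s p J F => [|i s IH] p J F.
  elim: j p J F => [|j IH] p J F XF jp jJ; first by exists F => //; exact: X_mono XF _ _.
  case: p XF jp => [|[|p]] XF jp; try lia.
  case: J XF jJ => [|J] XF jJ; first by lia.
  have [F' dF XF'] := X_dt XF; have [||G XG H] := IH p J F' XF'; try lia.
  exists G => // n e z e0; rewrite -H//; apply: (cv4_parts z e0 ((X_base XF).1 n) ((X_base XF').1 n) (dF n)) => w.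
  exact: phi_derive_t.
move=> XF /= sp jJ; case: p XF sp => [|p] XF sp; first by lia.
have [F' dF XF'] := X_dx i XF; have [||G XG H] := IH p J F' XF'; try lia.
exists G => // n e z e0; rewrite -H//; apply: (cv4_parts z e0 ((X_base XF).1 n) ((X_base XF').1 n) (dF n)) => w.
exact: phi_derive_x.
Qed.

Lemma dl_small (a : R) : 0 < a -> exists N, forall n, (N <= n)%N -> dl R n < a.
Proof.
move=> a0; exists (Num.bound a^-1) => n Nn; rewrite /dl -[ltRHS]invrK ltf_pV2 ?posrE ?invr_gt0//.
have /archi_boundP h : 0 <= a^-1 by rewrite invr_ge0 ltW.
by rewrite (lt_le_trans h)// ler_nat ltnW.
Qed.

Lemma inD_eventually e t : 0 < e -> e < t < T - e -> exists N, forall n, (N <= n)%N ->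
  forall tau, `|t - tau| <= e -> inD n tau.
Proof.
move=> e0 /andP[et tT]; have m0 : 0 < Num.min (t - e) (T - e - t) by rewrite lt_min; apply/andP; split; lra.
have [N hN] := dl_small m0; by exists N => n /hN; rewrite lt_min => /andP[? ?] tau; rewrite /inD ler_norml => /andP[? ?]; apply/andP; split; lra.
Qed.

Lemma sqnorm_lim (h : nat -> E3 R -> R) (g : E3 R -> R) (K : R) N :
  (forall n, measurable_fun (setT : set M3) (h n)) ->
  (forall n, (N <= n)%N -> (sqnorm (mu3 R) (h n) <= K%:E)%E) ->
  (forall x, h n x @[n --> \oo] --> g x) -> (sqnorm (mu3 R) g <= K%:E)%E.
Proof.
move=> mh hK hg; apply: (@fatou_le _ M3 R (mu3 R) (fun n x => h n x ^+ 2) (fun x => g x ^+ 2) K N).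
- by move=> n; exact: measurable_funX.
- by move=> n x; exact: sqr_ge0.
- exact: hK.
by move=> x; under eq_fun do rewrite expr2; rewrite expr2; apply: cvgM; exact: hg.
Qed.

Lemma cv4_L1_lim (F : fam) f e s j z : 0 < e -> (forall n, loc4 (F n)) -> loc4 f -> L1_lim F f ->
  cv4 e s j (F n) z @[n --> \oo] --> cv4 e s j f z.
Proof.
move=> e0 lF lf Ff; exact: (conv_L1_lim (@mio4 R) lF lf Ff (z := z) (phi_lipbnd e0 s j) (phi_supp e0 s j)).
Qed.

(** The derivatives on the kernel are moved onto F_n, where they are bounded in L^2. For e < t < T -
    e and n large the kernel sees only times in [inD n], and Fatou's lemma passes the bound to f. No
    derivative of f is used, and the bound does not depend on e. *)
Lemma transfer p J F f s j : X p J F -> loc4 f -> L1_lim F f -> (size s + 2 * j <= p)%N -> (j <= J)%N ->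
  exists2 M : R, 0 <= M & forall e t, 0 < e -> e < t < T - e ->
    (sqnorm (mu3 R) (fun x => cv4 e s j f (x, t)) <= (M ^+ 2)%:E)%E.
Proof.
move=> XF lf Ff sp jJ; have [G XG H] := X_kernel XF sp jJ.
have [cG [M M0 hM]] := X_base XG; exists M => // e t e0 et.
have [N hN] := inD_eventually e0 et.
have lF n : loc4 (F n) := loc4_continuous ((X_base XF).1 n).
apply: (sqnorm_lim (h := fun n x => cv4 e s j (F n) (x, t)) (N := N)).
- by move=> n; apply: continuous_measurable3; apply: slice_continuous_x; exact: cv4_continuous.
- move=> n Nn; rewrite (_ : (fun x => _) = (fun x => cv4 e [::] 0 (G n) (x, t))); last first.
    by apply/funext => x; exact: H.
  have := @cv4_sqnorm R (G n) e [::] 0 t (M ^+ 2) 1 e0 (loc4_continuous (cG n)) (sqr_ge0 _) ltr01.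
  rewrite expr1n mul1r; apply.
    by under eq_integral do rewrite ger0_norm ?phi_ge0//; rewrite phi_integral1.
  by move=> tau /(hN n Nn); exact: hM.
by move=> x; exact: cv4_L1_lim.
Qed.

End transfer.

(** * Removal of the pressure *)

(* A curl-free field [Q] in [L^2] is orthogonal to a divergence-free field [W], without any
   decomposition theorem: the pairing of [Q] with translates of [W] is constant along an axis and
   tends to [0]. Hence [W + Q] controls [W]. *)
Section projection.
Context (R : realType).
Local Notation M3 := (E3 (measurableTypeR R)).

Definition L2cont (f : E3 R -> R) : Prop :=
  continuous f /\ exists K : R, (sqnorm (mu3 R) f <= K%:E)%E.

Lemma L2cont_mul f g : L2cont f -> L2cont g -> (mu3 R).-integrable setT (EFin \o (fun x => f x * g x)).
Proof.
move=> [cf [A fA]] [cg [B gB]].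
exact: (L2_mul (continuous_measurable3 cf) (continuous_measurable3 cg) fA gB).1.
Qed.

Lemma sqnorm_shift (f : E3 R -> R) h : continuous f ->
  sqnorm (mu3 R) (fun x => f (x + h))%R = sqnorm (mu3 R) f.
Proof.
move=> cf; have [_ _ E] := scales_shift3r h.
rewrite /sqnorm (E (fun x => (f x ^+ 2)%:E)) ?mul1e//.
  by apply/measurable_EFinP/measurable_funX; exact: continuous_measurable3.
by move=> x; rewrite lee_fin sqr_ge0.
Qed.

Lemma L2cont_shift f h : L2cont f -> L2cont (fun x => f (x + h)).
Proof.
move=> [cf [A fA]]; split.
  apply: (continuous_compT (f := fun x : E3 R => x + h) _ cf) => x.
  by apply: cvgD; [exact: cvg_id|exact: cvg_cst].
by exists A; rewrite sqnorm_shift.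
Qed.

Lemma L2cont_ib f g f' g' v : L2cont f -> L2cont g -> L2cont f' -> L2cont g' ->
  (forall x, is_derive x v (f : E3 R -> R^o) (f' x)) ->
  (forall x, is_derive x v (g : E3 R -> R^o) (g' x)) ->
  \int[mu3 R]_x (f' x * g x) = - \int[mu3 R]_x (f x * g' x).
Proof.
move=> Lf Lg Lf' Lg' df dg.
have := @Rintegral_derive3 R v (fun x => f x * g x) (fun x => f' x * g x + f x * g' x).
rewrite RintegralD//; [|exact: L2cont_mul|exact: L2cont_mul].
move=> H; apply/eqP; rewrite -addr_eq0; apply/eqP; apply: H.
- by move=> x; exact: is_deriveM' (df x) (dg x) erefl.
- have cG : continuous (fun w : E3 R => f' w * g w + f w * g' w).
    by move=> y; apply: cvgD; apply: cvgM; [exact: Lf'.1|exact: Lg.1|exact: Lf.1|exact: Lg'.1].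
  move=> w t0; apply: (@continuous_comp _ _ _ (fun t : R => w + t *: v : E3 R)
    (fun w : E3 R => f' w * g w + f w * g' w)); last exact: cG.
  exact: line_continuous.
- exact: L2cont_mul.
by apply: integrableDfun; exact: L2cont_mul.
Qed.

Definition tail (n : R) : set (E3 R) := [set x : E3 R | n <= `|coord ord0 x|].

Lemma measurable_tail n : measurable (tail n : set M3).
Proof.
have cc : continuous (fun x : E3 R => `|coord ord0 x|).
  by move=> x; apply: cvg_norm; exact: coord_continuous.
have mcc := continuous_measurable3 cc.
have := mcc measurableT _ (measurable_itv `[n, +oo[); rewrite setTI; congr measurable.
by rewrite predeqE => x; split; rewrite /tail/= in_itv/= andbT.
Qed.

Lemma L2_tail (f : E3 R -> R) (a : R) : L2cont f -> 0 < a -> exists N : nat,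
  forall b, N%:R <= b -> (\int[mu3 R]_x (f x ^+ 2 * \1_(tail b) x)%:E <= a%:E)%E.
Proof.
move=> [cf [A fA]] a0; have mf := continuous_measurable3 cf.
have [if2 _] := sqnorm_integrable mf fA.
pose h (n : nat) x : R := f x ^+ 2 * \1_(tail n%:R) x.
have mhb b : measurable_fun (setT : set M3) (fun x => f x ^+ 2 * (\1_(tail b) x : R)).
  by apply: measurable_funM; [exact: measurable_funX|exact: measurable_indic (measurable_tail b)].
have h0 b x : 0 <= f x ^+ 2 * (\1_(tail b) x : R) by rewrite mulr_ge0 ?sqr_ge0// indicE.
have hc x : h n x @[n --> \oo] --> (0 : R).
  apply/cvgrPdist_le => e e0; exists (Num.bound `|coord ord0 x|) => // n /= bn.
  rewrite /h indicE memNset ?mulr0 ?subrr ?normr0 ?ltW//= /tail/=; apply/negP.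
  rewrite -ltNge (lt_le_trans (archi_boundP (normr_ge0 _)))//.
  by rewrite ler_nat.
have C := @dominated_cvg _ _ _ (mu3 R) _ measurableT (fun n => EFin \o h n) (cst 0%E) (EFin \o (fun x => f x ^+ 2)).
have {}C : (\int[mu3 R]_x (EFin \o h n) x)%E @[n --> \oo] --> (\int[mu3 R]_x (cst 0%E x : \bar R))%E.
  apply: C => //.
  - by move=> n; apply/measurable_EFinP; exact: mhb.
  - by move=> x _; apply: cvg_EFin; [exact: nearW|exact: hc].
  move=> n x _; rewrite /= lee_fin ger0_norm ?h0// /h indicE.
  by case: (_ \in _); rewrite ?mulr1 ?mulr0 ?sqr_ge0.
rewrite integral0 in C.
have /= [N _ HN] : \forall n \near \oo, (\int[mu3 R]_x (EFin \o h n) x <= a%:E)%E.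
  have := C; move/fine_cvgP => [Cf /cvgrPdist_le/(_ a a0) Ca]; near=> n.
  have fn : (\int[mu3 R]_x (EFin \o h n) x)%E \is a fin_num by near: n.
  rewrite -(fineK fn).
  have : `|0 - fine (\int[mu3 R]_x (EFin \o h n) x)%E| <= a by near: n.
  by rewrite sub0r normrN lee_fin; apply: le_trans; exact: ler_norm.
exists N => b Nb; apply: (le_trans _ (HN N (leqnn N))); apply: int_le => //; first exact: mhb.
move=> x; rewrite /h ler_wpM2l ?sqr_ge0// !indicE.
have [|//] := boolP (x \in tail b); rewrite inE /tail/= => bx.
by rewrite mem_set//= (le_trans Nb).
Unshelve. all: by end_near.
Qed.

(** At every x either the first coordinate of x + h e_0 or that of x has modulus at least h/2, so
    one of the two factors is always in its tail, where its L^2 mass is small. *)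
Lemma shift_decay (f g : E3 R -> R) (a : R) : L2cont f -> L2cont g -> 0 < a ->
  exists N : nat, forall h, N%:R <= h -> `|\int[mu3 R]_x (f (x + h *: basis3 R ord0) * g x)| <= a.
Proof.
move=> Lf Lg a0; have [cf [A fA]] := Lf; have [cg [B gB]] := Lg.
have A0 : 0 <= A by rewrite -lee_fin (le_trans (sqnorm_ge0 _ _) fA).
have B0 : 0 <= B by rewrite -lee_fin (le_trans (sqnorm_ge0 _ _) gB).
(* In the weighted mean the factor in its tail carries the weight 1/l and the other one l. Tails of
   mass l a / 2 contribute a/2 each and the remaining terms l (A + B) <= a; halving the sum gives
   a. *)
pose l := a / (A + B + 1); have AB : 0 < A + B + 1 by rewrite ltr_wpDl// addr_ge0.
have l0 : 0 < l by rewrite divr_gt0.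
have la : 0 < l * a / 2 by rewrite divr_gt0// mulr_gt0.
have [N1 H1] := L2_tail Lf la; have [N2 H2] := L2_tail Lg la.
exists (N1 + N2).*2 => h Nh; set v := basis3 R ord0.
have hN : N1%:R <= h / 2 /\ N2%:R <= h / 2.
  by move: Nh; rewrite -muln2 natrM natrD; have := ler0n R N1; have := ler0n R N2; lra.
have {}H1 := H1 _ hN.1; have {}H2 := H2 _ hN.2.
pose I (x : E3 R) : R := \1_(tail (h / 2)) x.
have I0 x : 0 <= I x by rewrite /I indicE.
have mI : measurable_fun (setT : set M3) I by exact: measurable_indic (measurable_tail _).
have [cfh _] := L2cont_shift (h *: v) Lf.
have [msh _ _] := scales_shift3r (h *: v).
have mfh := continuous_measurable3 cfh; have mg := continuous_measurable3 cg; have mf := continuous_measurable3 cf.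
have S (u : E3 R -> R) : measurable_fun (setT : set M3) u -> (forall x, 0 <= u x) ->
    (\int[mu3 R]_x (u (x + h *: v))%:E = \int[mu3 R]_x (u x)%:E)%E.
  move=> mu u0; have [_ _ E] := scales_shift3r (h *: v); rewrite (E (fun x => (u x)%:E)) ?mul1e//.
  exact/measurable_EFinP.
have ii := L2cont_mul (L2cont_shift (h *: v) Lf) Lg.
apply: (le_trans (le_normr_Rintegral _ ii)) => //.
rewrite -lee_fin (EFin_Rintegral (integrable_norm ii)).
pose a1 x := l^-1 * (f x ^+ 2 * I x); pose a2 x := l * f x ^+ 2.
pose a3 x := l * g x ^+ 2; pose a4 x := l^-1 * (g x ^+ 2 * I x).
have ma1 : measurable_fun (setT : set M3) a1 by do 2 apply: measurable_funM => //; exact: measurable_funX.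
have ma2 : measurable_fun (setT : set M3) a2 by apply: measurable_funM => //; exact: measurable_funX.
have ma3 : measurable_fun (setT : set M3) a3 by apply: measurable_funM => //; exact: measurable_funX.
have ma4 : measurable_fun (setT : set M3) a4 by do 2 apply: measurable_funM => //; exact: measurable_funX.
have lV : 0 <= l^-1 by rewrite invr_ge0 ltW.
have p1 x : 0 <= a1 x by rewrite mulr_ge0// mulr_ge0// sqr_ge0.
have p2 x : 0 <= a2 x by rewrite mulr_ge0 ?sqr_ge0// ltW.
have p3 x : 0 <= a3 x by rewrite mulr_ge0 ?sqr_ge0// ltW.
have p4 x : 0 <= a4 x by rewrite mulr_ge0// mulr_ge0// sqr_ge0.
have msa (u : E3 R -> R) : measurable_fun (setT : set M3) u -> measurable_fun (setT : set M3) (fun x => u (x + h *: v)).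
  by move=> mu; exact: measurableT_comp.
apply: (@le_trans _ _ (\int[mu3 R]_x (2^-1 * ((a1 (x + h *: v) + a2 (x + h *: v)) + (a3 x + a4 x)))%:E)%E).
  apply: int_le => //.
  - by case/integrableP : (integrable_norm ii) => /measurable_EFinP.
  - apply: measurable_funM => //; apply: measurable_funD; first by apply: measurable_funD; exact: msa.
    exact: measurable_funD.
  - by move=> x; exact: normr_ge0.
  move=> x /=; have l1 : 0 < l^-1 by rewrite invr_gt0.
  have ee : (f (x + h *: v) * g x) ^+ 2 <= f (x + h *: v) ^+ 2 * g x ^+ 2 by rewrite exprMn.
  have G1 := gm_le_am l0 (sqr_ge0 (f (x + h *: v))) (sqr_ge0 (g x)) ee.
  have G2 := gm_le_am l1 (sqr_ge0 (f (x + h *: v))) (sqr_ge0 (g x)) ee.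
  rewrite invrK in G2.
  have q1 := p1 (x + h *: v); have q2 := p2 (x + h *: v); have q3 := p3 x; have q4 := p4 x.
  have cx : coord ord0 (x + h *: v) = coord ord0 x + h by rewrite coord_line coord_basis eqxx mulr1.
  have [hx|hx] := leP (- (h / 2)) (coord ord0 x).
    have E1 : I (x + h *: v) = 1.
      by rewrite /I indicE mem_set// /tail/= cx (le_trans _ (ler_norm _))//; move: hx; clear; lra.
    move: G2 q2 q4; rewrite /a1 E1 mulr1 /a2 /a3; clear; lra.
  have E1 : I x = 1.
    by rewrite /I indicE mem_set// /tail/= -normrN (le_trans _ (ler_norm _))//; move: hx; clear; lra.
  move: G1 q1 q3; rewrite /a4 E1 mulr1 /a2 /a3; clear; lra.
have md1 : measurable_fun (setT : set M3) (fun x => a1 (x + h *: v) + a2 (x + h *: v)).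
  by apply: measurable_funD; exact: msa.
have md2 : measurable_fun (setT : set M3) (fun x => a3 x + a4 x) by exact: measurable_funD.
have pd1 x : 0 <= a1 (x + h *: v) + a2 (x + h *: v) by rewrite addr_ge0.
have pd2 x : 0 <= a3 x + a4 x by rewrite addr_ge0.
rewrite int_Z//; [|exact: measurable_funD|by move=> x; rewrite addr_ge0].
rewrite int_D// int_D//; [|exact: msa|exact: msa].
rewrite int_D// (S a1)// (S a2)//.
have e1 : (\int[mu3 R]_x (a1 x)%:E <= (a / 2)%:E)%E.
  rewrite int_Z//; [|by apply: measurable_funM => //; exact: measurable_funX|by move=> x; rewrite mulr_ge0 ?sqr_ge0].
  apply: (le_trans (lee_wpmul2l _ H1)); first by rewrite lee_fin.
  by rewrite -EFinM lee_fin -mulrA mulKf// lt0r_neq0.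
have e4 : (\int[mu3 R]_x (a4 x)%:E <= (a / 2)%:E)%E.
  rewrite int_Z//; [|by apply: measurable_funM => //; exact: measurable_funX|by move=> x; rewrite mulr_ge0 ?sqr_ge0].
  apply: (le_trans (lee_wpmul2l _ H2)); first by rewrite lee_fin.
  by rewrite -EFinM lee_fin -mulrA mulKf// lt0r_neq0.
have e2 : (\int[mu3 R]_x (a2 x)%:E <= (l * A)%:E)%E.
  rewrite int_Z//; [|exact: measurable_funX|exact: ltW|by move=> x; exact: sqr_ge0].
  by apply: (le_trans (lee_wpmul2l _ fA)); rewrite -?EFinM// lee_fin ltW.
have e3 : (\int[mu3 R]_x (a3 x)%:E <= (l * B)%:E)%E.
  rewrite int_Z//; [|exact: measurable_funX|exact: ltW|by move=> x; exact: sqr_ge0].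
  by apply: (le_trans (lee_wpmul2l _ gB)); rewrite -?EFinM// lee_fin ltW.
apply: (le_trans (lee_wpmul2l _ (leeD (leeD e1 e2) (leeD e3 e4)))); first by rewrite lee_fin invr_ge0.
rewrite -!EFinD -EFinM lee_fin.
have lE : l * (A + B + 1) = a by rewrite /l divfK// lt0r_neq0.
have : l * (A + B) <= a by rewrite -lE ler_wpM2l ?lerDl// ltW.
lra.
Qed.

Variables (W Q : 'I_3 -> E3 R -> R) (DW DQ : 'I_3 -> 'I_3 -> E3 R -> R).
Hypotheses (LW : forall i, L2cont (W i)) (LQ : forall i, L2cont (Q i)).
Hypotheses (LDW : forall i m, L2cont (DW i m)) (LDQ : forall i m, L2cont (DQ i m)).
Hypothesis dW : forall i m x, is_derive x (basis3 R m) (W i : E3 R -> R^o) (DW i m x).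
Hypothesis dQ : forall i m x, is_derive x (basis3 R m) (Q i : E3 R -> R^o) (DQ i m x).
Hypothesis divW : forall x, \sum_i DW i i x = 0.
Hypothesis curlQ : forall i m x, DQ i m x = DQ m i x.

Lemma shift_derive f f' v (h x : E3 R) : (forall x, is_derive x v (f : E3 R -> R^o) (f' x)) ->
  is_derive x v (fun y => f (y + h) : R^o) (f' (x + h)).
Proof.
move=> df; apply: is_derive_eps => e e0; have [r r0 H] := is_derive_epsP (df (x + h)) e0.
by exists r => // t _ tr; rewrite (addrAC x); exact: H.
Qed.

(* Three integrations by parts: sum_i int (d_m W_i)(x+h) Q_i = - sum_i int W_i(x+h) d_m Q_i
   = - sum_i int W_i(x+h) d_i Q_m = int (div W)(x+h) Q_m = 0. *)
Lemma shifted_pairing_derive (h : E3 R) m : \sum_i \int[mu3 R]_x (DW i m (x + h) * Q i x) = 0.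
Proof.
have dWh i k x : is_derive x (basis3 R k) (fun y => W i (y + h) : R^o) (DW i k (x + h)).
  by apply: shift_derive => y; exact: dW.
transitivity (\sum_i \int[mu3 R]_x (DW i i (x + h) * Q m x)).
  apply: eq_bigr => i _.
  rewrite (L2cont_ib (L2cont_shift h (LW i)) (LQ i) (L2cont_shift h (LDW i m)) (LDQ i m) (dWh i m) (dQ i m)).
  rewrite (L2cont_ib (L2cont_shift h (LW i)) (LQ m) (L2cont_shift h (LDW i i)) (LDQ m i) (dWh i i) (dQ m i)).
  by congr (- _); apply: eq_Rintegral => x _; rewrite curlQ.
have [_ <-] := Rintegral_sum3 (fun i => L2cont_mul (L2cont_shift h (LDW i i)) (LQ m)).
have -> : (fun x => \sum_i DW i i (x + h) * Q m x) = fun=> 0.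
  by apply/funext => x; rewrite -mulr_suml divW mul0r.
by rewrite Rintegral_cst// mul0r.
Qed.

Definition pairing (h : R) : R := \sum_i \int[mu3 R]_x (W i (x + h *: basis3 R ord0) * Q i x).

(** The fundamental theorem of calculus along the axis and Fubini write the difference as the time
    integral of the derivative of the pairing, which is [shifted_pairing_derive] for m = 0.
    Cauchy-Schwarz, uniform in the shift, provides the integrability for Fubini. *)
Lemma pairing_cst (h : R) : 0 < h -> pairing h = pairing 0.
Proof.
move=> h0; set v := basis3 R ord0.
have mI : measurable (`[0, h]%classic : set (measurableTypeR R)) by exact: measurable_itv.
pose k : R -> R := \1_(`[0, h]%classic : set R).
have mk : measurable_fun (setT : set (measurableTypeR R)) k by exact: measurable_indic.
have k0 t : 0 <= k t by rewrite /k indicE.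
have kI : (\int[mu1 R]_t (k t)%:E = h%:E)%E.
  rewrite integral_indic//= setIT; transitivity (@lebesgue_measure R `[0, h]%classic) => //.
  by rewrite lebesgue_measure_itv/= lte_fin h0 oppr0 adde0.
pose F i (z : M3 * measurableTypeR R) := DW i ord0 (z.1 + z.2 *: v) * Q i z.1 * k z.2.
have mF i : measurable_fun setT (F i).
  apply: measurable_funM; last exact: measurableT_comp.
  apply: measurable_funM; last by apply: measurableT_comp => //; exact: continuous_measurable3 (LQ i).1.
  by apply: (measurableT_comp (continuous_measurable3 (LDW i ord0).1)); exact: measurable_flow3.
have iF i : (sprod (mu3 R) (mu1 R)).-integrable setT (EFin \o F i).
  apply/integrableP; split; first exact/measurable_EFinP.
  rewrite (sprod_tonelli2 (mu3 R) (mu1 R) (f := fun z => `|(EFin \o F i) z|)%E)//; last first.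
    by apply: measurableT_comp => //; exact/measurable_EFinP.
  have [[cA [A hA]] [cB [B hB]]] := (LDW i ord0, LQ i).
  have AB t : (\int[mu3 R]_x `|DW i ord0 (x + t *: v) * Q i x|%:E <= (Num.sqrt (A * B))%:E)%E.
    have [c1 [A' hA']] := L2cont_shift (t *: v) (LDW i ord0).
    have hA2 : (sqnorm (mu3 R) (fun x => DW i ord0 (x + t *: v))%R <= A%:E)%E by rewrite sqnorm_shift.
    have [ii ie] := L2_mul (continuous_measurable3 c1) (continuous_measurable3 cB) hA2 hB.
    rewrite -(EFin_Rintegral (integrable_norm ii)) lee_fin -(@ler_sqr _ (\int[mu3 R]_x _)) ?nnegrE ?sqrtr_ge0//; last first.
      by apply: Rintegral_ge0 => x _; exact: normr_ge0.
    by rewrite sqr_sqrtr// (le_trans _ ie)// sqr_ge0.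
  apply: (@le_lt_trans _ _ (\int[mu1 R]_t (Num.sqrt (A * B) * k t)%:E)%E); last first.
    by rewrite int_Z// ?kI ?ltry// sqrtr_ge0.
  apply: ge0_le_integral => //.
  - by move=> t _; apply: integral_ge0 => x _.
  - apply: (measurable_integral2 (mu3 R) (f := fun z => `|(EFin \o F i) z|)%E) => //.
    by apply: measurableT_comp => //; exact/measurable_EFinP.
  - by apply/measurable_EFinP; exact: measurable_funM.
  move=> t _; rewrite /F /=; under eq_integral do rewrite normrM mulrC (ger0_norm (k0 _)).
  rewrite int_Z//; last first.
    apply: measurableT_comp => //; apply: measurable_funM; last exact: continuous_measurable3.
    exact: continuous_measurable3 (L2cont_shift (t *: v) (LDW i ord0)).1.
  by rewrite EFinM muleC; apply: lee_wpmul2r => //; rewrite lee_fin.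
have E1 i : \int[mu3 R]_x (W i (x + h *: v) * Q i x) - \int[mu3 R]_x (W i (x + 0 *: v) * Q i x) =
    fine (\int[sprod (mu3 R) (mu1 R)]_z (EFin \o F i) z)%E.
  rewrite -RintegralB//; [|exact: L2cont_mul (L2cont_shift _ (LW i)) (LQ i)|exact: L2cont_mul (L2cont_shift _ (LW i)) (LQ i)].
  rewrite -(integral12_prod_meas1 (iF i)) /Rintegral; congr fine; apply: eq_integral => x _.
  have dWx t : is_derive t (1 : R) (fun t => W i (x + t *: v) : R^o) (DW i ord0 (x + t *: v)).
    exact: (is_derive_line (W i) x v t (DW i ord0 (x + t *: v))).1 (dW i ord0 _).
  have cDx : continuous (fun t : R => DW i ord0 (x + t *: v)).
    move=> t0; apply: (@continuous_comp _ _ _ (fun t : R => x + t *: v : E3 R) (DW i ord0)).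
      exact: line_continuous.
    exact: (LDW i ord0).1.
  have [ix ex] := ftc_indic (ltW h0) dWx cDx.
  rewrite -mulrBl -ex /fubini_F /F /= mulrC EFinM EFin_Rintegral// -integralZl//=.
  by apply: eq_integral => t _; rewrite -EFinM; congr EFin; rewrite /k; ring.
apply/eqP; rewrite -subr_eq0 /pairing -sumrB; apply/eqP.
rewrite (eq_bigr _ (fun i _ => E1 i)); have [iS eS] := Rintegral_sum3 iF; rewrite -eS.
rewrite /Rintegral -(integral21_prod_meas1 iS) integral0_eq// => t _; rewrite /fubini_G /=.
have L i : (mu3 R).-integrable setT (EFin \o (fun x => F i (x, t))).
  apply: (integrable_ext _ (integrableZfun (k t) (L2cont_mul (L2cont_shift (t *: v) (LDW i ord0)) (LQ i)))) => x.
  by rewrite mulrC.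
have [iSt eSt] := Rintegral_sum3 L; rewrite -(EFin_Rintegral iSt) eSt; congr EFin.
transitivity (\sum_i k t * \int[mu3 R]_x (DW i ord0 (x + t *: v) * Q i x)).
  apply: eq_bigr => i _; rewrite -RintegralZl//; last exact: L2cont_mul (L2cont_shift (t *: v) (LDW i ord0)) (LQ i).
  by apply: eq_Rintegral => x _; rewrite mulrC.
by rewrite -mulr_sumr shifted_pairing_derive mulr0.
Qed.

Lemma projection_orthogonal : \sum_i \int[mu3 R]_x (W i x * Q i x) = 0.
Proof.
have P0 : pairing 0 = \sum_i \int[mu3 R]_x (W i x * Q i x).
  by apply: eq_bigr => i _; apply: eq_Rintegral => x _; rewrite scale0r addr0.
rewrite -P0; apply/eqP; rewrite -normr_eq0 eq_le normr_ge0 andbT; apply/ler_addgt0Pr => e e0; rewrite add0r.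
have e3 : 0 < e / 3 by rewrite divr_gt0.
have /choice[N hN] i := shift_decay (LW i) (LQ i) e3.
pose h : R := (\sum_i N i)%:R + 1.
have h0 : 0 < h by rewrite ltr_wpDl.
rewrite -(pairing_cst h0) /pairing (le_trans (ler_norm_sum _ _ _))//.
have H i : `|\int[mu3 R]_x (W i (x + h *: basis3 R ord0) * Q i x)| <= e / 3.
  apply: hN; rewrite /h (le_trans (_ : (N i)%:R <= (\sum_i N i)%:R)) ?lerDl// ler_nat.
  by rewrite (bigD1 i)//= leq_addr.
by rewrite (le_trans (le_sum3 H))// sumr_const card_ord -[_ *+ 3]mulr_natl; lra.
Qed.

(** Pythagoras for W + Q. Only the sum over the components of the cross terms vanishes, so each
    component of W is controlled by the sum of all bounds. *)
Lemma projection_bound (K : 'I_3 -> R) :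
  (forall i, (sqnorm (mu3 R) (fun x => W i x + Q i x)%R <= (K i)%:E)%E) ->
  forall i, (sqnorm (mu3 R) (W i) <= (\sum_i K i)%:E)%E.
Proof.
move=> hK i; have sqE j : (fun x => W j x * W j x) = (fun x => W j x ^+ 2) by apply/funext => x; rewrite expr2.
have iW j : (mu3 R).-integrable setT (EFin \o (fun x => W j x ^+ 2)) by rewrite -sqE; exact: L2cont_mul.
have iQ j : (mu3 R).-integrable setT (EFin \o (fun x => Q j x ^+ 2)).
  by apply: (integrable_ext _ (L2cont_mul (LQ j) (LQ j))) => x; rewrite expr2.
have iWQ j := L2cont_mul (LW j) (LQ j).
have E j : \int[mu3 R]_x ((W j x + Q j x) ^+ 2) =
    \int[mu3 R]_x (W j x ^+ 2) + 2 * \int[mu3 R]_x (W j x * Q j x) + \int[mu3 R]_x (Q j x ^+ 2).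
  rewrite -RintegralZl// -RintegralD//; last exact: integrableZfun.
  rewrite -RintegralD//; last by apply: integrableDfun => //; exact: integrableZfun.
  by apply: eq_Rintegral => x _; ring.
have le j : \int[mu3 R]_x ((W j x + Q j x) ^+ 2) <= K j.
  have mWQ : measurable_fun (setT : set M3) (fun x => W j x + Q j x).
    by apply: continuous_measurable3 => x; apply: cvgD; [exact: (LW j).1|exact: (LQ j).1].
  exact: (sqnorm_integrable mWQ (hK j)).2.
rewrite /sqnorm -(EFin_Rintegral (iW i)) lee_fin.
apply: (@le_trans _ _ (\sum_j \int[mu3 R]_x (W j x ^+ 2))).
  by apply: (le_sum3_term (a := fun j => \int[mu3 R]_x (W j x ^+ 2))) => j; apply: Rintegral_ge0 => x _; exact: sqr_ge0.
apply: le_trans (le_sum3 le); rewrite (eq_bigr _ (fun j _ => E j)) !big_split/= -mulr_sumr projection_orthogonal mulr0 addr0.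
by rewrite lerDl sumr_ge0// => j _; apply: Rintegral_ge0 => x _; exact: sqr_ge0.
Qed.

End projection.

(** * Bounded representatives *)

Section spatial_representatives.
Context (R : realType).
Local Notation M3 := (E3 (measurableTypeR R)).
Local Notation M4 := (E3t (measurableTypeR R)).

Lemma dl_gt0 n : 0 < dl R n. Proof. by rewrite /dl invr_gt0. Qed.

Lemma cvg_norm_le_from (u : nat -> R) (a C : R) N : u n @[n --> \oo] --> a ->
  (forall n, (N <= n)%N -> `|u n| <= C) -> `|a| <= C.
Proof.
move=> ua uC; apply/ler_addgt0Pr => e e0.
have /cvgrPdist_le/(_ e e0)[N1 _ /(_ (maxn N N1)) h] := ua.
have := uC (maxn N N1) (leq_maxl _ _); have /= := h (leq_maxr _ _) => h1 h2.
by rewrite -(subrK (u (maxn N N1)) a) (le_trans (ler_normD _ _))// addrC lerD.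
Qed.

Lemma sqrt_small (C a : R) : 0 <= C -> 0 < a -> exists2 r : R, 0 < r & forall d, d <= r -> C * Num.sqrt d <= a.
Proof.
move=> C0 a0; have C1 : 0 < C + 1 by rewrite ltr_wpDl.
exists ((a / (C + 1)) ^+ 2) => [|d dr]; first by rewrite exprn_gt0// divr_gt0.
have : Num.sqrt d <= a / (C + 1).
  by rewrite -[leRHS]ger0_norm -?sqrtr_sqr ?ler_wsqrtr// ltW// divr_gt0.
rewrite ler_pdivlMr// => h; apply: le_trans h; rewrite mulrC ler_wpM2l ?sqrtr_ge0//.
by rewrite lerDl.
Qed.

Definition slice (f : E3t R -> R) (t : R) : E3 R -> R := fun x => f (x, t).

(* [g] stands for the derivative [d_s f], recognised through mollification. *)
Definition mollified_deriv (s : seq 'I_3) (f g : E3 R -> R) : Prop :=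
  forall e s' x, 0 < e -> cv3 e (s ++ s') f x = cv3 e s' g x.

Definition slice_sobolev (l : nat) (K : R) (f : E3t R -> R) : Prop := forall t, loc3 (slice f t) /\
  forall s, (size s <= l)%N -> exists g : E3 R -> R, [/\ measurable_fun (setT : set M3) g,
    (sqnorm (mu3 R) g <= (K ^+ 2)%:E)%E & mollified_deriv s (slice f t) g].

Lemma slice_cv3_sqnorm l K f t e s : slice_sobolev l K f -> 0 < e -> (size s <= l)%N ->
  (sqnorm (mu3 R) (cv3 e s (slice f t)) <= (K ^+ 2)%:E)%E.
Proof.
move=> Hf e0 sl; have [lf /(_ s sl)[g [mg gK fg]]] := Hf t.
rewrite (_ : cv3 e s _ = cv3 e [::] g); last by apply/funext => x; rewrite -fg// cats0.
by apply: cv3_sqnorm => //; [exact: loc3_sqnorm gK|exact: sqr_ge0].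
Qed.

Lemma cv3_grad e s f t : 0 < e -> loc3 (slice f t) ->
  grad_cont (cv3 e s (slice f t)) (fun i => cv3 e (i :: s) (slice f t)).
Proof.
by move=> e0 lf; split; [move=> i; exact: cv3_continuous|move=> i x; exact: cv3_derive].
Qed.

Lemma measurable_cv3 e s f : 0 < e -> measurable_fun (setT : set M4) f ->
  measurable_fun (setT : set M4) (fun z => cv3 e s (slice f z.2) z.1).
Proof.
move=> e0 mf; apply: (measurable_Rintegral (mu3 R) (F := fun p : M4 * M3 => f (p.2, p.1.2) * eta e s (p.1.1 - p.2))).
apply: measurable_funM.
  apply: (measurableT_comp mf).
  exact: (measurable_fun_pair measurable_snd (measurableT_comp measurable_snd measurable_fst)).
have meta := continuous_measurable3 (lipbnd_continuous (eta_lipbnd e0 s)).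
apply: (measurableT_comp meta).
exact: (measurableT_comp (@measurable_sub3 R) (measurable_fun_pair (measurableT_comp measurable_fst measurable_fst) measurable_snd)).
Qed.

(** The derivatives d^s of the spatial mollifications are bounded and Hoelder-1/2 uniformly in n and
    t, because two more derivatives are bounded in L^2; hence they converge at every point. The
    limit is jointly measurable, being built from f alone, whereas weak derivatives chosen slice by
    slice need not be measurable in time. *)
Lemma spatial_rep l K f s : measurable_fun (setT : set M4) f -> 0 <= K -> slice_sobolev l K f -> (size s + 2 <= l)%N ->
  exists h : E3t R -> R, [/\ measurable_fun (setT : set M4) h, exists C : R, forall z, `|h z| <= C &
    forall t g, measurable_fun (setT : set M3) g -> loc3 g -> mollified_deriv s (slice f t) g ->
      {ae mu3 R, forall x, h (x, t) = g x}].
Proof.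
move=> mf K0 Hf sl; pose F n z := cv3 (dl R n) s (slice f z.2) z.1.
have mF n : measurable_fun (setT : set M4) (F n) by apply: measurable_cv3 => //; exact: dl_gt0.
have L1F t g : loc3 g -> mollified_deriv s (slice f t) g -> forall r a : R, 0 < a -> exists N, forall n, (N <= n)%N ->
    (\int[mu3 R]_x (`|F n (x, t) - g x| * \1_(tball (@io3 R) r) x)%:E <= a%:E)%E.
  move=> lg fg r a a0; have [e0 e00 H] := cv3_L1 r lg a0; have [N hN] := dl_small e00.
  exists N => n Nn; have FE x : F n (x, t) = cv3 (dl R n) [::] g x by rewrite /F -fg ?cats0//; exact: dl_gt0.
  have h := H (dl R n) _; rewrite dl_gt0 (ltW (hN n Nn)) in h; have {}h := h isT.
  apply: le_trans h; rewrite le_eqVlt; apply/orP; left; apply/eqP; apply: eq_integral => x _.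
  by rewrite FE.
have Fsq n t s' : (size s' <= l)%N -> (sqnorm (mu3 R) (cv3 (dl R n) s' (slice f t)) <= (K ^+ 2)%:E)%E.
  by move=> s'l; exact: slice_cv3_sqnorm Hf (dl_gt0 n) s'l.
have s0l : (size s <= l)%N by rewrite (leq_trans _ sl)// leq_addr.
have s1l (i : 'I_3) : (size (i :: s) <= l)%N by rewrite (leq_trans _ sl)//= -addn1 leq_add2l.
have s2l (i j : 'I_3) : (size (j :: i :: s) <= l)%N by rewrite (leq_trans _ sl)//= -addn2.
have gr n t s' := @cv3_grad (dl R n) s' f t (dl_gt0 n) (Hf t).1.
have Fc n t : continuous (cv3 (dl R n) s (slice f t)) by apply: cv3_continuous; [exact: dl_gt0|exact: (Hf t).1].
have FB n z : `|F n z| <= 42 * K * 1 + K / 1 ^+ 3.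
  case: z => x t; apply: (sobolev_sup (Fc n t) (gr n t s) (fun i => gr n t (i :: s)) _ _ K0) => //.
  - by move=> i; exact: Fsq.
  - by move=> i j; exact: Fsq.
  - exact: Fsq.
have FH n t x y : `|F n (x, t) - F n (y, t)| <= 105 * K * Num.sqrt `|x - y|.
  apply: (sobolev_hoelder (Fc n t) (gr n t s) (fun i => gr n t (i :: s)) _ _ K0) => //.
  - by move=> i; exact: Fsq.
  - by move=> i j; exact: Fsq.
have lF n t : loc3 (fun x => F n (x, t)).
  have mFx : measurable_fun (setT : set M3) (fun x => F n (x, t)) by exact: slice_measurable_x.
  exact: loc3_sqnorm mFx (Fsq n t s s0l).
have Fcv z : cvgn (fun n => F n z).
  case: z => x t; have [_ /(_ s s0l)[g [mg gK fg]]] := Hf t; have lg := loc3_sqnorm mg gK.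
  apply: (pointwise_limit (@mio3 R) (fun z w => erefl) (@scales_reflect3 R) (fun n => lF n t) lg (L1F t g lg fg) (x := x)).
    move=> e e0; exists (eta e [::]); split; [exact: eta_lipbnd|exact: eta_supp|exact: eta_ge0|exact: eta_integral1].
  move=> a a0; have [|r r0 hr] := @sqrt_small (105 * K) a _ a0; first by rewrite mulr_ge0.
  exists r => //; exists 0 => n w _ wr; rewrite (le_trans (FH _ _ _ _))// hr// distrC//.
exists (fun z => limn (fun n => F n z)); split.
- by apply: (measurable_fun_cvg mF) => z _; exact: Fcv.
- by exists (42 * K * 1 + K / 1 ^+ 3) => z; exact: (cvg_norm_le_from (N := 0) (Fcv z)) => n _.
move=> t g mg lg fg.
have mFx n : measurable_fun (setT : set M3) (fun x => F n (x, t)) by exact: slice_measurable_x.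
have := ae_limit (@mio3 R) mFx mg measurableT (L1F t g lg fg) (fun x _ => Fcv (x, t)).
by apply: ae_imp => x /(_ Logic.I).
Qed.

End spatial_representatives.

(** * Space-time mollification as a time average *)

Section cv4_of_slices.
Context (R : realType).
Local Notation M3 := (E3 (measurableTypeR R)).
Local Notation M4 := (E3t (measurableTypeR R)).

(** The kernel is a product, so Fubini lets identities and bounds known on every time slice pass to
    space-time mollifications. *)
Lemma cv4_slices e s j (f : E3t R -> R) x t : 0 < e -> loc4 f -> (forall tau, loc3 (slice f tau)) ->
  cv4 e s j f (x, t) = \int[mu1 R]_tau (cv3 e s (slice f tau) x * kern e j (t - tau)).
Proof.
move=> e0 lf lfs; have i4 := cv4_integrable s j (x, t) e0 lf.
rewrite /cv4 /conv /Rintegral -(integral21_prod_meas1 i4) /=; congr fine.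
apply: eq_integral => tau _; rewrite /fubini_G /=.
have i3 := cv3_integrable s x e0 (lfs tau).
have i3k := integrableZfun (kern e j (t - tau)) i3.
transitivity (\int[mu3 R]_y (kern e j (t - tau) * (slice f tau y * eta e s (x - y)))%:E)%E.
  by apply: eq_integral => y _; congr EFin; rewrite /phi /slice /=; ring.
by rewrite -(EFin_Rintegral i3k) RintegralZl// mulrC.
Qed.

Lemma cv4_slices_eq e s s' j (f g : E3t R -> R) z : 0 < e -> loc4 f -> loc4 g ->
  (forall tau, loc3 (slice f tau)) -> (forall tau, loc3 (slice g tau)) ->
  (forall tau x, cv3 e s (slice f tau) x = cv3 e s' (slice g tau) x) -> cv4 e s j f z = cv4 e s' j g z.
Proof.
case: z => x t e0 lf lg lfs lgs fg.
rewrite (@cv4_slices e s j f x t e0 lf lfs) (@cv4_slices e s' j g x t e0 lg lgs).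
by apply: eq_Rintegral => tau _; rewrite fg.
Qed.

Lemma integral_kern_reflect e t : 0 < e -> (\int[mu1 R]_tau `|kern e 0 (t - tau)|%:E = 1)%E.
Proof.
move=> e0; have [_ _ E] := scales_reflect1 t; rewrite (E (fun tau => `|kern e 0 tau|%:E)) ?mul1e.
- under eq_integral do rewrite ger0_norm ?kern_ge0//.
  by rewrite -(EFin_Rintegral (kern_integrable e0 0)) kern_integral1.
- apply/measurable_EFinP; apply: measurableT_comp => //.
  by apply: continuous_measurable1; exact: kern_continuous.
- by move=> tau; rewrite lee_fin.
Qed.

Lemma cv4_slices_sqnorm e s (f : E3t R -> R) t (K : R) : 0 < e -> loc4 f -> (forall tau, loc3 (slice f tau)) ->
  (forall tau, (sqnorm (mu3 R) (cv3 e s (slice f tau)) <= (K ^+ 2)%:E)%E) ->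
  (sqnorm (mu3 R) (fun x => cv4 e s 0 f (x, t)) <= (K ^+ 2)%:E)%E.
Proof.
move=> e0 lf lfs fK; have [mf _] := lf.
rewrite (_ : (fun x => _) = (fun x => \int[mu1 R]_tau (cv3 e s (slice f tau) x * kern e 0 (t - tau)))); last first.
  by apply/funext => x; exact: cv4_slices.
have mk : measurable_fun (setT : set (measurableTypeR R)) (fun tau => kern e 0 (t - tau)).
  have mk0 : measurable_fun (setT : set (measurableTypeR R)) (kern e 0).
    by apply: continuous_measurable1; exact: kern_continuous.
  by apply: (measurableT_comp mk0); case: (scales_reflect1 t).
have := @mixing_sqnorm _ _ M3 (measurableTypeR R) R (mu3 R) (mu1 R) (fun z => cv3 e s (slice f z.2) z.1)
  (fun tau => kern e 0 (t - tau)) 1 (K ^+ 2) (measurable_cv3 s e0 mf) mk _ ltr01 (sqr_ge0 K).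
rewrite expr1n mul1r; apply; last by move=> tau _; exact: fK.
by rewrite integral_kern_reflect.
Qed.

End cv4_of_slices.

Section clean_representatives.
Context (R : realType).
Local Notation M3 := (E3 (measurableTypeR R)).
Local Notation M4 := (E3t (measurableTypeR R)).

Lemma sqnorm_ae (f g : E3 R -> R) : measurable_fun (setT : set M3) f -> measurable_fun (setT : set M3) g ->
  {ae mu3 R, forall x, f x = g x} -> sqnorm (mu3 R) f = sqnorm (mu3 R) g.
Proof.
move=> mf mg fg; apply: ae_eq_integral => //.
- by apply/measurable_EFinP; exact: measurable_funX.
- by apply/measurable_EFinP; exact: measurable_funX.
by apply: ae_imp fg => x /= ->.
Qed.

Lemma spatial_rep_facts l K f s h t : slice_sobolev l K f -> (size s <= l)%N ->
  measurable_fun (setT : set M4) h ->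
  (forall t g, measurable_fun (setT : set M3) g -> loc3 g -> mollified_deriv s (slice f t) g ->
      {ae mu3 R, forall x, h (x, t) = g x}) ->
  [/\ (sqnorm (mu3 R) (slice h t) <= (K ^+ 2)%:E)%E, loc3 (slice h t) &
    forall e s' x, 0 < e -> cv3 e s' (slice h t) x = cv3 e (s ++ s') (slice f t) x].
Proof.
move=> Hf sl mh hg; have [lf /(_ s sl)[g [mg gK fg]]] := Hf t.
have lg := loc3_sqnorm mg gK; have ae := hg t g mg lg fg.
have mht : measurable_fun (setT : set M3) (slice h t) by exact: slice_measurable_x.
have hK : (sqnorm (mu3 R) (slice h t) <= (K ^+ 2)%:E)%E by rewrite (sqnorm_ae mht mg ae).
split => //; first exact: loc3_sqnorm hK.
by move=> e s' x e0; rewrite fg//; exact: cv3_ae.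
Qed.

End clean_representatives.

(** * An algebra of bounded families converging in L^1_loc *)

Section bounded_L1_limits.
Context (R : realType).
Local Notation M4 := (E3t (measurableTypeR R)).
Local Notation fam := (nat -> E3t R -> R).

(** Local L^1 convergence alone is not stable under products. With uniform bounds it is, and also
    under composition with functions that are Lipschitz on bounded intervals. *)
Definition L1b (F : fam) (f : E3t R -> R) : Prop :=
  [/\ forall n, measurable_fun (setT : set M4) (F n), measurable_fun (setT : set M4) f,
      exists2 C : R, 0 <= C & forall n z, `|F n z| <= C /\ `|f z| <= C & L1_lim F f].

Let ball r : set (E3t R) := [set x : E3t R | `|x| <= r].

Let mball r : measurable_fun (setT : set M4) (\1_(ball r) : E3t R -> R).
Proof. by apply: measurable_indic; exact: (measurable_tball (@mio4 R)). Qed.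

Lemma L1_lim_dom (F : fam) (f : E3t R -> R) (G H : fam) g h (A B : R) : 0 <= A -> 0 <= B -> L1b G g -> L1b H h ->
  (forall n, measurable_fun (setT : set M4) (F n)) -> measurable_fun (setT : set M4) f ->
  (forall n z, `|F n z - f z| <= A * `|G n z - g z| + B * `|H n z - h z|) -> L1_lim F f.
Proof.
move=> A0 B0 [mG mg _ LG] [mH mh _ LH] mF mf dom r a a0.
have A1 : 0 < A + 1 by rewrite ltr_wpDl.
have B1 : 0 < B + 1 by rewrite ltr_wpDl.
have [N1 H1] := LG r (a / 2 / (A + 1)) (divr_gt0 (divr_gt0 a0 (ltr0n _ 2)) A1).
have [N2 H2] := LH r (a / 2 / (B + 1)) (divr_gt0 (divr_gt0 a0 (ltr0n _ 2)) B1).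
exists (maxn N1 N2) => n; rewrite geq_max => /andP[n1 n2].
have mD (u w : E3t R -> R) : measurable_fun (setT : set M4) u -> measurable_fun (setT : set M4) w ->
    measurable_fun (setT : set M4) (fun z => `|u z - w z| * \1_(ball r) z).
  move=> mu mw; apply: measurable_funM => //.
  by apply: measurableT_comp => //; exact: measurable_funB.
have I0 z : 0 <= (\1_(ball r) z : R) by rewrite indicE.
have D0 (u w : E3t R -> R) z : 0 <= `|u z - w z| * \1_(ball r) z by rewrite mulr_ge0.
apply: (@le_trans _ _ (\int[mu4 R]_z (A * (`|G n z - g z| * \1_(ball r) z) + B * (`|H n z - h z| * \1_(ball r) z))%:E)%E).
  apply: int_le.
  - exact: mD.
  - by apply: measurable_funD; apply: measurable_funM => //; exact: mD.
  - by move=> z; exact: D0.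
  by move=> z; rewrite !mulrA -mulrDl ler_wpM2r.
rewrite int_D; last 4 first.
- by apply: measurable_funM => //; exact: mD.
- by apply: measurable_funM => //; exact: mD.
- by move=> z; rewrite mulr_ge0.
- by move=> z; rewrite mulr_ge0.
rewrite int_Z//; [|exact: mD]; rewrite int_Z//; [|exact: mD].
have K (c x : R) : 0 <= c -> c * (x / 2 / (c + 1)) <= x / 2 \/ x < 0.
  move=> c0; have [x0|x0] := leP 0 x; [left|by right].
  have c1 : 0 < c + 1 by rewrite ltr_wpDl.
  by rewrite mulrA ler_pdivrMr// mulrC ler_wpM2l ?lerDl// divr_ge0.
rewrite (splitr a) EFinD; apply: leeD.
  have A0' : (0 <= A%:E)%E by rewrite lee_fin.
  apply: (le_trans (lee_wpmul2l A0' (H1 n n1))); rewrite -EFinM lee_fin.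
  by case: (K A a A0) => //; rewrite ltNge (ltW a0).
have B0' : (0 <= B%:E)%E by rewrite lee_fin.
apply: (le_trans (lee_wpmul2l B0' (H2 n n2))); rewrite -EFinM lee_fin.
by case: (K B a B0) => //; rewrite ltNge (ltW a0).
Qed.

Lemma L1b_mul F f G g : L1b F f -> L1b G g -> L1b (fun n z => F n z * G n z) (fun z => f z * g z).
Proof.
move=> hF hG; have [mF mf [C C0 hC] _] := hF; have [mG mg [D D0 hD] _] := hG; split.
- by move=> n; exact: measurable_funM.
- exact: measurable_funM.
- exists (C * D) => [|n z]; first exact: mulr_ge0.
  have [c1 c2] := hC n z; have [d1 d2] := hD n z.
  by split; rewrite normrM ler_pM.
apply: (L1_lim_dom D0 C0 hF hG) => [n||n z]; [exact: measurable_funM|exact: measurable_funM|].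
have [c1 c2] := hC n z; have [d1 d2] := hD n z.
have -> : F n z * G n z - f z * g z = (F n z - f z) * G n z + f z * (G n z - g z) by ring.
rewrite (le_trans (ler_normD _ _))// !normrM [D * _]mulrC lerD//.
  by rewrite ler_wpM2l.
by rewrite ler_wpM2r.
Qed.

Lemma L1b_add F f G g : L1b F f -> L1b G g -> L1b (fun n z => F n z + G n z) (fun z => f z + g z).
Proof.
move=> hF hG; have [mF mf [C C0 hC] _] := hF; have [mG mg [D D0 hD] _] := hG; split.
- by move=> n; exact: measurable_funD.
- exact: measurable_funD.
- exists (C + D) => [|n z]; first exact: addr_ge0.
  have [c1 c2] := hC n z; have [d1 d2] := hD n z.
  by split; rewrite (le_trans (ler_normD _ _))// lerD.
apply: (L1_lim_dom ler01 ler01 hF hG) => [n||n z]; [exact: measurable_funD|exact: measurable_funD|].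
by rewrite !mul1r opprD addrACA; exact: ler_normD.
Qed.

Lemma L1b_cst c : L1b (fun _ _ => c) (fun=> c).
Proof.
split.
- by move=> n; exact: measurable_cst.
- exact: measurable_cst.
- by exists `|c|.
move=> r a a0; exists 0 => n _; rewrite integral0_eq ?lee_fin ?ltW// => z _.
by rewrite subrr normr0 mul0r.
Qed.

Lemma L1b_sum3 (F : 'I_3 -> fam) f : (forall i, L1b (F i) (f i)) ->
  L1b (fun n z => \sum_i F i n z) (fun z => \sum_i f i z).
Proof.
move=> h; have -> : (fun n z => \sum_i F i n z) = (fun n z => F (inord 0) n z + F (inord 1) n z + F (inord 2) n z).
  by apply/funext => n; apply/funext => z; rewrite sum3E.
have -> : (fun z => \sum_i f i z) = (fun z => f (inord 0) z + f (inord 1) z + f (inord 2) z).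
  by apply/funext => z; rewrite sum3E.
by apply: L1b_add => //; exact: L1b_add.
Qed.

Lemma half_derive_interior (g : R -> R) (s d : R) : 0 < s -> half_derive g s d ->
  is_derive s (1 : R) (g : R -> R^o) d.
Proof.
move=> s0 gd; apply: is_derive_eps => e e0; have [r r0 H] := gd e e0.
exists (Num.min r s); first by rewrite lt_min r0.
move=> h _; rewrite lt_min => /andP[hr hs].
have E : h *: (1 : R) = h by rewrite /GRing.scale/= mulr1.
by rewrite E; apply: H => //; move: hs; rewrite ltr_norml; lra.
Qed.

(** The derivative g' is bounded on [0, C] because it is itself differentiable. The mean value
    theorem sees only interior points, where one-sided derivatives are ordinary ones; continuity up
    to a = 0 comes from the even extension. *)
Lemma half_derive_lipschitz (g g' g2 : R -> R) (C : R) : (forall s, 0 <= s -> half_derive g s (g' s)) ->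
  (forall s, 0 <= s -> half_derive g' s (g2 s)) ->
  exists2 L : R, 0 <= L & forall a b, 0 <= a <= C -> 0 <= b <= C -> `|g a - g b| <= L * `|a - b|.
Proof.
move=> dg dg'; have [L L0 hL] := half_derive_bounded C dg'; exists L => // a b.
wlog ab : a b / a < b.
  move=> W ha hb; have [|ba|->] := ltgtP a b; first by move=> ?; exact: W.
    by rewrite distrC (distrC a); exact: W.
  by rewrite !subrr normr0 mulr0.
move=> /andP[a0 aC] /andP[b0 bC].
have cg : continuous (fun s : R => g `|s|).
  by apply: (half_derive_continuous dg) => [z|]; [exact: normr_ge0|exact: norm_continuous].
have cab : {within `[a, b], continuous g}.
  apply: (@subspace_eq_continuous _ _ _ (fun s : R => g `|s|)); last exact: continuous_subspaceT.
  by move=> s; rewrite inE/= in_itv/= => /andP[as_ _]; rewrite ger0_norm// (le_trans a0).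
have dab s : s \in `]a, b[%R -> is_derive s (1 : R) (g : R -> R^o) (g' s).
  by rewrite in_itv/= => /andP[as_ sb]; have s0 : 0 < s := le_lt_trans a0 as_; apply: half_derive_interior (dg _ (ltW s0)).
have [c /[!in_itv]/= /andP[ac cb] E] := MVT ab dab cab.
rewrite distrC E normrM (distrC a) ler_wpM2r// hL// (le_trans a0 (ltW ac))/=.
by rewrite (le_trans (ltW cb)).
Qed.

Lemma L1b_comp (g g' g2 : R -> R) Q q : (forall s, 0 <= s -> half_derive g s (g' s)) ->
  (forall s, 0 <= s -> half_derive g' s (g2 s)) -> (forall n z, 0 <= Q n z) -> (forall z, 0 <= q z) ->
  L1b Q q -> L1b (fun n z => g (Q n z)) (fun z => g (q z)).
Proof.
move=> dg dg' Q0 q0 hQ; have [mQ mq [C C0 hC] _] := hQ.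
have cg : continuous (fun s : R => g `|s|).
  by apply: (half_derive_continuous dg) => [z|]; [exact: normr_ge0|exact: norm_continuous].
have mg := continuous_measurable1 cg.
have mgQ n : measurable_fun (setT : set M4) (fun z => g (Q n z)).
  rewrite (_ : (fun z => _) = (fun z => g `|Q n z|)); first exact: (measurableT_comp mg (mQ n)).
  by apply/funext => z; rewrite ger0_norm.
have mgq : measurable_fun (setT : set M4) (fun z => g (q z)).
  rewrite (_ : (fun z => _) = (fun z => g `|q z|)); first exact: (measurableT_comp mg mq).
  by apply/funext => z; rewrite ger0_norm.
have [L L0 hL] := half_derive_lipschitz C dg dg'; have [M M0 hM] := half_derive_bounded C dg.
have Qr n z : 0 <= Q n z <= C by rewrite Q0/= (le_trans _ (hC n z).1)// ler_norm.
have qr z : 0 <= q z <= C by rewrite q0/= (le_trans _ (hC 0%N z).2)// ler_norm.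
split => //.
  by exists M => // n z; split; apply: hM.
apply: (L1_lim_dom L0 (lexx 0) hQ hQ) => // n z.
by rewrite mul0r addr0; exact: hL.
Qed.

Lemma L1b_mollify (f : E3t R -> R) (C : R) : measurable_fun (setT : set M4) f -> 0 <= C -> (forall z, `|f z| <= C) ->
  L1b (fun n => cv4 (dl R n) [::] 0 f) f.
Proof.
move=> mf C0 fC; have lf := loc4_bounded mf fC; split => //.
- by move=> n; apply: continuous_measurable4; apply: cv4_continuous => //; exact: dl_gt0.
- exists C => // n z; split => //; have d0 := dl_gt0 R n.
  have i4 := cv4_integrable [::] 0 z d0 lf.
  have [mk _] := lf.
  rewrite /cv4 /conv (le_trans (le_normr_Rintegral _ i4))// -lee_fin (EFin_Rintegral (integrable_norm i4)).
  have mp : measurable_fun (setT : set M4) (fun w => phi (dl R n) [::] 0 (z - w)).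
    exact: (measurable_reflect (@mio4 R) z (lipbnd_continuous (phi_lipbnd d0 [::] 0))).
  have Ip : (\int[mu4 R]_w (phi (dl R n) [::] 0 (z - w))%:E = 1)%E.
    have [_ _ E] := scales_reflect4 z; rewrite (E (fun w => (phi (dl R n) [::] 0 w)%:E)) ?mul1e ?phi_integral1//.
      by apply/measurable_EFinP; exact: continuous_measurable4 (lipbnd_continuous (phi_lipbnd d0 [::] 0)).
    by move=> w; rewrite lee_fin phi_ge0.
  apply: (@le_trans _ _ (\int[mu4 R]_w (C * phi (dl R n) [::] 0 (z - w))%:E)%E).
    apply: int_le.
    + by case/integrableP : (integrable_norm i4) => /measurable_EFinP.
    + exact: measurable_funM.
    + by move=> w /=.
    by move=> w /=; rewrite normrM (ger0_norm (phi_ge0 d0 _)) ler_wpM2r// phi_ge0.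
  by rewrite int_Z// ?Ip ?mule1// => w; exact: phi_ge0.
move=> r a a0; have [e0 e00 H] := cv4_L1 r lf a0; have [N hN] := dl_small e00.
by exists N => n Nn; apply: H; rewrite dl_gt0 ltW// hN.
Qed.

End bounded_L1_limits.

(** * The bootstrap in time *)

Section mollified_families.
Context (R : realType) (T : R).
Local Notation X := (X T).

Definition mollified_bound (f : E3t R -> R) (s : seq 'I_3) (j : nat) : Prop :=
  exists2 M : R, 0 <= M & forall e t, 0 < e -> e < t < T - e ->
    (sqnorm (mu3 R) (fun x => cv4 e s j f (x, t)) <= (M ^+ 2)%:E)%E.

Lemma X_mollified p J f s j : loc4 f ->
  (forall s' j', (size s' + 2 * j' <= p + (size s + 2 * j))%N -> (j' <= J + j)%N -> mollified_bound f s' j') ->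
  X p J (fun n => cv4 (dl R n) s j f).
Proof.
move=> lf; elim/ltn_ind: p J s j => p IH J s j H; apply: X_intro.
- split; first by move=> n; apply: cv4_continuous => //; exact: dl_gt0.
  have [||M M0 hM] := H s j; rewrite ?leq_addl//.
  by exists M => // n t nt; apply: hM => //; exact: dl_gt0.
- move=> p1 pE i; exists (fun n => cv4 (dl R n) (i :: s) j f).
    by move=> n z; apply: cv4_derive_x => //; exact: dl_gt0.
  apply: IH => [|s' j' h1 h2]; first by lia.
  by apply: H => //; move: h1; rewrite /=; lia.
move=> p2 J1 pE JE; exists (fun n => cv4 (dl R n) s j.+1 f).
  by move=> n z; apply: cv4_derive_t => //; exact: dl_gt0.
apply: IH => [|s' j' h1 h2]; first by lia.
by apply: H; lia.
Qed.

Lemma cv4C e i m s j (f : E3t R -> R) z : cv4 e (i :: m :: s) j f z = cv4 e (m :: i :: s) j f z.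
Proof. by apply: eq_Rintegral => w _; rewrite /phi etaC. Qed.

Definition L2slices (f : E3t R -> R) : Prop := measurable_fun (setT : set (E3t (measurableTypeR R))) f /\
  exists2 M : R, 0 <= M & forall t, (sqnorm (mu3 R) (slice f t) <= M%:E)%E.

Let msl (f : E3t R -> R) t : measurable_fun (setT : set (E3t (measurableTypeR R))) f ->
  measurable_fun (setT : set (E3 (measurableTypeR R))) (slice f t).
Proof. by move=> mf; exact: slice_measurable_x. Qed.

Lemma L2slices_add f h : L2slices f -> L2slices h -> L2slices (fun z => f z + h z).
Proof.
move=> [mf [A A0 fA]] [mh [B B0 hB]]; split; first exact: measurable_funD.
exists (2 * (A + B)) => [|t]; first by rewrite mulr_ge0// addr_ge0.
apply: (le_trans (sqnormD_le (mu3 R) (msl t mf) (msl t mh))).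
apply: (le_trans (lee_wpmul2l _ (leeD (fA t) (hB t)))); first by [].
by rewrite -EFinD -EFinM.
Qed.

Lemma L2slices_mul (f b : E3t R -> R) (B : R) : L2slices f -> measurable_fun (setT : set (E3t (measurableTypeR R))) b ->
  (forall z, `|b z| <= B) -> L2slices (fun z => f z * b z).
Proof.
move=> [mf [A A0 fA]] mb bB; split; first exact: measurable_funM.
exists (B ^+ 2 * A) => [|t]; first by rewrite mulr_ge0// sqr_ge0.
apply: (le_trans (sqnorm_mulr_le (mu3 R) (msl t mf) (msl t mb) (fun x => bB (x, t)))).
by apply: (le_trans (lee_wpmul2l _ (fA t))); rewrite -?EFinM// lee_fin sqr_ge0.
Qed.

Lemma L2slices_sum3 (f : 'I_3 -> E3t R -> R) : (forall i, L2slices (f i)) -> L2slices (fun z => \sum_i f i z).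
Proof.
move=> h; have -> : (fun z => \sum_i f i z) = (fun z => f (inord 0) z + f (inord 1) z + f (inord 2) z).
  by apply/funext => z; rewrite sum3E.
by apply: L2slices_add => //; exact: L2slices_add.
Qed.

Lemma phi_L1 e s j : 0 < e -> exists2 c : R, 0 < c & (\int[mu4 R]_w `|phi e s j w|%:E <= c%:E)%E.
Proof.
move=> e0; have l1 : loc4 (fun=> 1 : R) by apply: (loc4_bounded (C := 1)) => // z; rewrite normr1.
have [c [c0 hc _]] := phi_lipbnd e0 s j.
have mp : measurable_fun (setT : set (E3t (measurableTypeR R))) (phi e s j).
  exact: continuous_measurable4 (lipbnd_continuous (phi_lipbnd e0 s j)).
have sp (w : E3t R) : e < `|io4 w| -> phi e s j w = 0 by move=> ew; apply: phi_supp => //; exact: ltW.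
have ip : (mu4 R).-integrable setT (EFin \o (fun w => 1 * phi e s j w)) := locL1_mul l1 mp hc sp.
exists (\int[mu4 R]_w `|1 * phi e s j w| + 1); first by rewrite ltr_wpDl//; apply: Rintegral_ge0.
rewrite EFinD (EFin_Rintegral (integrable_norm ip)).
apply: (@le_trans _ _ (\int[mu4 R]_w `|1 * phi e s j w|%:E)%E); last by rewrite leeDl.
by under eq_integral do rewrite -[phi e s j _]mul1r.
Qed.

(** The bound degenerates as e tends to 0. It only gives the qualitative membership in L^2 that the
    projection argument asks for; the uniform bounds come from the force. *)
Lemma cv4_L2cont e s j t f : 0 < e -> loc4 f -> L2slices f -> L2cont (fun x => cv4 e s j f (x, t)).
Proof.
move=> e0 lf [mf [M M0 fM]]; split; first by apply: slice_continuous_x; exact: cv4_continuous.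
have [c c0 hc] := phi_L1 s j e0; exists (c ^+ 2 * M).
by apply: cv4_sqnorm => // tau _; exact: fM.
Qed.

Lemma L2cont_add (f h : E3 R -> R) : L2cont f -> L2cont h -> L2cont (fun x => f x + h x).
Proof.
move=> [cf [A fA]] [ch [B hB]]; split; first by move=> x; apply: cvgD; [exact: cf|exact: ch].
exists (2 * (A + B)).
apply: (le_trans (sqnormD_le (mu3 R) (continuous_measurable3 cf) (continuous_measurable3 ch))).
apply: (le_trans (lee_wpmul2l _ (leeD fA hB))); first by [].
by rewrite -EFinD -EFinM.
Qed.

Lemma L2cont_opp (f : E3 R -> R) : L2cont f -> L2cont (fun x => - f x).
Proof.
move=> [cf [A fA]]; split; first by move=> x; apply: cvgN; exact: cf.
by exists A; rewrite (_ : sqnorm _ _ = sqnorm (mu3 R) f)//; apply: eq_integral => x _; rewrite sqrrN.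
Qed.

Lemma sqnorm_add_le (f h : E3 R -> R) (A B : R) :
  measurable_fun (setT : set (E3 (measurableTypeR R))) f ->
  measurable_fun (setT : set (E3 (measurableTypeR R))) h ->
  (sqnorm (mu3 R) f <= A%:E)%E -> (sqnorm (mu3 R) h <= B%:E)%E ->
  (sqnorm (mu3 R) (fun x => f x + h x)%R <= (2 * (A + B))%:E)%E.
Proof.
move=> mf mh fA hB; apply: (le_trans (sqnormD_le (mu3 R) mf mh)).
apply: (le_trans (lee_wpmul2l _ (leeD fA hB))); first by [].
by rewrite -EFinD -EFinM.
Qed.

Lemma sqnorm_comb_le (f : 'I_3 -> E3 R -> R) (h : E3 R -> R) (a : 'I_3 -> R) (b : R) :
  (forall m, measurable_fun (setT : set (E3 (measurableTypeR R))) (f m)) ->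
  measurable_fun (setT : set (E3 (measurableTypeR R))) h ->
  (forall m, (sqnorm (mu3 R) (f m) <= (a m)%:E)%E) -> (sqnorm (mu3 R) h <= b%:E)%E ->
  (sqnorm (mu3 R) (fun x => \sum_m f m x - h x)%R <=
    (2 * (2 * (2 * (a (inord 0) + a (inord 1)) + a (inord 2)) + b))%:E)%E.
Proof.
move=> mf mh fa hb.
have -> : (fun x => \sum_m f m x - h x) =
    (fun x => (f (inord 0) x + f (inord 1) x + f (inord 2) x) + - h x) by apply/funext => x; rewrite sum3E.
have m01 := measurable_funD (mf (inord 0)) (mf (inord 1)).
apply: sqnorm_add_le; [exact: (measurable_funD m01 (mf (inord 2)))|exact: measurable_funN| |].
  apply: sqnorm_add_le; [exact: m01|exact: mf| |exact: fa].
  by apply: sqnorm_add_le; [exact: mf|exact: mf|exact: fa|exact: fa].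
by rewrite (_ : sqnorm _ _ = sqnorm (mu3 R) h)//; apply: eq_integral => x _; rewrite sqrrN.
Qed.

Lemma L2cont_comb (f : 'I_3 -> E3 R -> R) (h : E3 R -> R) : (forall m, L2cont (f m)) -> L2cont h ->
  L2cont (fun x => \sum_m f m x - h x).
Proof.
move=> Lf Lh; have -> : (fun x => \sum_m f m x - h x) =
    (fun x => (f (inord 0) x + f (inord 1) x + f (inord 2) x) + - h x) by apply/funext => x; rewrite sum3E.
apply: L2cont_add; last exact: L2cont_opp.
by apply: L2cont_add; [exact: L2cont_add|exact: Lf].
Qed.

Lemma is_derive_comb (f f' : 'I_3 -> E3 R -> R) (h h' : E3 R -> R) (x u : E3 R) :
  (forall m, is_derive x u (f m : E3 R -> R^o) (f' m x)) -> is_derive x u (h : E3 R -> R^o) (h' x) ->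
  is_derive x u (fun x => \sum_m f m x - h x : R^o) (\sum_m f' m x - h' x).
Proof.
move=> df dh; rewrite sum3E (_ : (fun x => \sum_m f m x - h x) =
    (fun x => (f (inord 0) x + f (inord 1) x + f (inord 2) x) - h x)); last by apply/funext => y; rewrite sum3E.
exact: (is_deriveB' (is_deriveD' (is_deriveD' (df _) (df _) erefl) (df _) erefl) dh erefl).
Qed.

End mollified_families.

(** * Induction on the number of time derivatives *)

Section regularity.
Context (R : realType) (T : R) (l : nat) (K : R) (g : nat -> R -> R).
Local Notation M3 := (E3 (measurableTypeR R)).
Local Notation M4 := (E3t (measurableTypeR R)).
Variables (v : 'I_3 -> E3t R -> R) (d : 'I_3 -> 'I_3 -> E3t R -> R).

Definition Dsym (i m : 'I_3) (z : E3t R) : R := 2^-1 * (d i m z + d m i z).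
Definition Dsq (z : E3t R) : R := \sum_i \sum_m Dsym i m z ^+ 2.
Definition stress (i m : 'I_3) (z : E3t R) : R := g 0%N (Dsq z) * Dsym i m z.
Definition convection (i : 'I_3) (z : E3t R) : R := \sum_m v m z * d i m z.
(* Up to a gradient, [force] is the mollified time derivative of [v]. *)
Definition force (e : R) (s : seq 'I_3) (j : nat) (i : 'I_3) (z : E3t R) : R :=
  \sum_m cv4 e (m :: s) j (stress i m) z - cv4 e s j (convection i) z.

Hypothesis l4 : (4 <= l)%N.
Hypothesis gd : forall k s, 0 <= s -> half_derive (g k) s (g k.+1 s).
Hypotheses (mv : forall i, measurable_fun (setT : set M4) (v i))
           (md : forall i m, measurable_fun (setT : set M4) (d i m)).
Variable C : R.
Hypotheses (C0 : 0 <= C) (bv : forall i z, `|v i z| <= C) (bd : forall i m z, `|d i m z| <= C).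
Hypotheses (sv : forall i t, (sqnorm (mu3 R) (slice (v i) t) <= (K ^+ 2)%:E)%E)
           (sd : forall i m t, (sqnorm (mu3 R) (slice (d i m) t) <= (K ^+ 2)%:E)%E).
Hypothesis mollv : forall i s e t, 0 < e -> (size s <= l)%N ->
  (sqnorm (mu3 R) (fun x => cv4 e s 0 (v i) (x, t)) <= (K ^+ 2)%:E)%E.
Hypothesis molld : forall i m e s j z, 0 < e -> cv4 e s j (d i m) z = cv4 e (m :: s) j (v i) z.
Hypothesis molldiv : forall e s j z, 0 < e -> \sum_i cv4 e (i :: s) j (v i) z = 0.
(** The curl of the mollified momentum equation, in which the pressure no longer occurs. *)
Hypothesis momentum : forall e s j i m z, 0 < e -> e < z.2 < T - e ->
  force e (m :: s) j i z - cv4 e (m :: s) j.+1 (v i) z = force e (i :: s) j m z - cv4 e (i :: s) j.+1 (v m) z.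

(** These families apply the nonlinearities after mollification: they are differentiable in the
    scale [X], and their L^1_loc limits are the stress and the convection term of v itself. *)
Let Vf i n := cv4 (dl R n) [::] 0 (v i).
Let Df i m n := cv4 (dl R n) [::] 0 (d i m).
Let DSf i m n z := 2^-1 * (Df i m n z + Df m i n z).
Let Qf n z := \sum_i \sum_m (DSf i m n z * DSf i m n z).
Let Af i m n z := g 0%N (Qf n z) * DSf i m n z.
Let Bf i n z := \sum_m Vf m n z * Df i m n z.

Let DsqE : Dsq = (fun z => \sum_i \sum_m (Dsym i m z * Dsym i m z)).
Proof. by apply/funext => z; apply: eq_bigr => i _; apply: eq_bigr => m _; rewrite expr2. Qed.

Let Qf0 n z : 0 <= Qf n z.
Proof. by apply: sumr_ge0 => i _; apply: sumr_ge0 => m _; rewrite -expr2 sqr_ge0. Qed.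

Let Dsq0 z : 0 <= Dsq z.
Proof. by apply: sumr_ge0 => i _; apply: sumr_ge0 => m _; rewrite sqr_ge0. Qed.

Let LD i m : L1b (Df i m) (d i m). Proof. exact: L1b_mollify C0 (bd i m). Qed.
Let LV i : L1b (Vf i) (v i). Proof. exact: L1b_mollify C0 (bv i). Qed.

Let LDS i m : L1b (DSf i m) (Dsym i m).
Proof. by apply: L1b_mul; [exact: L1b_cst|exact: L1b_add]. Qed.

Let LA i m : L1b (Af i m) (stress i m).
Proof.
apply: L1b_mul => //; apply: (L1b_comp (gd 0) (gd 1)) => //.
by rewrite DsqE; apply: L1b_sum3 => i'; apply: L1b_sum3 => m'; exact: L1b_mul.
Qed.

Let LB i : L1b (Bf i) (convection i).
Proof. by apply: L1b_sum3 => m; exact: L1b_mul. Qed.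

Let loc4_L1b (F : nat -> E3t R -> R) (f : E3t R -> R) : L1b F f -> loc4 f.
Proof. by case=> _ mf [c _ hc] _; apply: (loc4_bounded mf) => z; exact: (hc 0%N z).2. Qed.

Lemma loc4_stress i m : loc4 (stress i m). Proof. exact: loc4_L1b (LA i m). Qed.

Lemma loc4_convection i : loc4 (convection i). Proof. exact: loc4_L1b (LB i). Qed.

Definition stage J := forall i s j, (size s + 2 * j <= l)%N -> (j <= J)%N -> mollified_bound T (v i) s j.

Lemma stage0 : stage 0.
Proof.
move=> i s j; rewrite leqn0 => sj /eqP j0; rewrite j0 muln0 addn0 in sj *.
have K2 : K ^+ 2 = `|K| ^+ 2 by rewrite real_normK// num_real.
by exists `|K| => // e t e0 _; rewrite -K2; exact: mollv.
Qed.

Section step.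
Variable J : nat.
Hypothesis HJ : stage J.

Let XV i : X T l J (Vf i).
Proof. by apply: X_mollified; [exact: loc4_L1b (LV i)|move=> s j /=; rewrite !addn0; exact: HJ]. Qed.

Let XD i m : X T l.-1 J (Df i m).
Proof.
have -> : Df i m = fun n => cv4 (dl R n) [:: m] 0 (v i).
  by apply/funext => n; apply/funext => z; apply: molld; exact: dl_gt0.
apply: X_mollified; first exact: loc4_L1b (LV i).
by move=> s j /= h1 h2; apply: HJ; lia.
Qed.

Let XDS i m : X T l.-1 J (DSf i m).
Proof. exact: (X_scale 2^-1 (X_add (XD i m) (XD m i))). Qed.

Let XQ : X T l.-1 J Qf.
Proof.
by apply: X_sum3 => i; apply: X_sum3 => m; apply: (X_mul (XDS i m) (XDS i m)); lia.
Qed.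

(** The gradient has weight l - 1, and the composition rule asks for at least 3: this is where l >=
    4 is used. *)
Let XA i m : X T l.-1 J (Af i m).
Proof. by apply: (X_comp 0 gd Qf0 _ XQ) => //; lia. Qed.

Let XB i : X T l.-1 J (Bf i).
Proof. by apply: X_sum3 => m; apply: (X_mul (XV m) (XD i m)); lia. Qed.

(** The stress has weight l - 1 and its divergence takes one more derivative, which leaves l - 2.
    The time derivative of order j + 1, bounded through the force, adds 2 to the weight and brings
    the total back to l. The constant is independent of e. *)
Lemma force_bound i s j : (size s + 2 * j <= l - 2)%N -> (j <= J)%N ->
  exists2 M : R, 0 <= M & forall e t, 0 < e -> e < t < T - e ->
    (sqnorm (mu3 R) (fun x => force e s j i (x, t)) <= M%:E)%E.
Proof.
move=> sl jJ.
have /choice[MA hMA] m : exists M : R, 0 <= M /\ forall e t, 0 < e -> e < t < T - e ->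
    (sqnorm (mu3 R) (fun x => cv4 e (m :: s) j (stress i m) (x, t)) <= (M ^+ 2)%:E)%E.
  have [_ _ _ L] := LA i m.
  have [||M M0 hM] := transfer (XA i m) (loc4_L1b (LA i m)) L (s := m :: s) (j := j); rewrite //=; last by exists M.
  by lia.
have [_ _ _ LBi] := LB i.
have [||MB MB0 hMB] := transfer (XB i) (loc4_L1b (LB i)) LBi (s := s) (j := j) => //; first by lia.
have mc e m t f : 0 < e -> loc4 f -> measurable_fun (setT : set M3) (fun x => cv4 e m j f (x, t)).
  by move=> e0 lf; apply: continuous_measurable3; apply: slice_continuous_x; exact: cv4_continuous.
pose a m := MA m ^+ 2; pose b := MB ^+ 2.
exists (2 * (2 * (2 * (a (inord 0) + a (inord 1)) + a (inord 2)) + b)).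
  have a0 m : 0 <= a m := sqr_ge0 _; have b0 : 0 <= b := sqr_ge0 _.
  by have := a0 (inord 0); have := a0 (inord 1); have := a0 (inord 2); lra.
move=> e t e0 et.
exact: (sqnorm_comb_le (fun m => mc e (m :: s) t _ e0 (loc4_L1b (LA i m))) (mc e s t _ e0 (loc4_L1b (LB i)))
  (fun m => (hMA m).2 e t e0 et) (hMB e t e0 et)).
Qed.

Let L2v i : L2slices (v i).
Proof. by split => //; exists (K ^+ 2) => [|t]; [exact: sqr_ge0|exact: sv]. Qed.

Let L2d i m : L2slices (d i m).
Proof. by split => //; exists (K ^+ 2) => [|t]; [exact: sqr_ge0|exact: sd]. Qed.

Let L2A i m : L2slices (stress i m).
Proof.
have L2D : L2slices (Dsym i m).
  have -> : Dsym i m = (fun z => (d i m z + d m i z) * 2^-1) by apply/funext => z; rewrite mulrC.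
  apply: (@L2slices_mul R _ (fun=> 2^-1) `|2^-1| (L2slices_add (L2d i m) (L2d m i)) (measurable_cst _)) => _; exact: lexx.
have [_ mq [c c0 hc] _] : L1b (fun n z => g 0%N (Qf n z)) (fun z => g 0%N (Dsq z)).
  apply: (L1b_comp (gd 0) (gd 1)) => //.
  by rewrite DsqE; apply: L1b_sum3 => i'; apply: L1b_sum3 => m'; exact: L1b_mul.
have -> : stress i m = (fun z => Dsym i m z * g 0%N (Dsq z)) by apply/funext => z; rewrite mulrC.
by apply: (L2slices_mul L2D mq) => z; exact: (hc 0%N z).2.
Qed.

Let L2B i : L2slices (convection i).
Proof.
apply: L2slices_sum3 => m; have -> : (fun z => v m z * d i m z) = (fun z => d i m z * v m z).
  by apply/funext => z; rewrite mulrC.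
exact: (L2slices_mul (L2d i m) (mv m) (bv m)).
Qed.

Lemma stageS : stage J.+1.
Proof.
move=> i s [|j] sj jJ; first by apply: HJ.
have [h1 h2 h3] : [/\ (size s + 2 * j <= l - 2)%N, (j <= J)%N & (0 < l)%N] by split; lia.
have /choice[N hN] k : exists N : R, 0 <= N /\ forall e t, 0 < e -> e < t < T - e ->
    (sqnorm (mu3 R) (fun x => force e s j k (x, t)) <= N%:E)%E.
  by have [N N0 hN] := force_bound k h1 h2; exists N.
have S0 : 0 <= \sum_k N k by apply: sumr_ge0 => k _; exact: (hN k).1.
exists (Num.sqrt (\sum_k N k)) => [|e t e0 et]; first exact: sqrtr_ge0.
rewrite sqr_sqrtr//.
have lv k := loc4_L1b (LV k); have lA k m := loc4_L1b (LA k m); have lB k := loc4_L1b (LB k).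
have L2f s' k : L2cont (fun x => force e s' j k (x, t)).
  by apply: L2cont_comb => [m|]; exact: cv4_L2cont.
have L2w s' k : L2cont (fun x => cv4 e s' j.+1 (v k) (x, t)) by exact: cv4_L2cont.
(* [W] is a derivative of the mollified time derivative, and [Q] below, the force minus [W], stands
   for the corresponding derivative of the mollified pressure gradient. Thus W + Q is the force,
   whose bound passes to [W]. *)
pose W k x := cv4 e s j.+1 (v k) (x, t); pose DW k m x := cv4 e (m :: s) j.+1 (v k) (x, t).
pose Q k x := force e s j k (x, t) + - W k x; pose DQ k m x := force e (m :: s) j k (x, t) + - DW k m x.
have dW k m x : is_derive x (basis3 R m) (W k : E3 R -> R^o) (DW k m x).
  by apply: slice_derive_x; exact: cv4_derive_x.
have dF k m x : is_derive x (basis3 R m) (fun x => force e s j k (x, t) : R^o) (force e (m :: s) j k (x, t)).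
  have d1 n : is_derive x (basis3 R m) (fun x => cv4 e (n :: s) j (stress k n) (x, t) : R^o)
      (cv4 e (n :: m :: s) j (stress k n) (x, t)).
    by rewrite cv4C; apply: slice_derive_x; exact: cv4_derive_x.
  have d2 : is_derive x (basis3 R m) (fun x => cv4 e s j (convection k) (x, t) : R^o)
      (cv4 e (m :: s) j (convection k) (x, t)) by apply: slice_derive_x; exact: cv4_derive_x.
  apply: (@is_derive_comb R (fun n x => cv4 e (n :: s) j (stress k n) (x, t))
   (fun n x => cv4 e (n :: m :: s) j (stress k n) (x, t)) (fun x => cv4 e s j (convection k) (x, t))
   (fun x => cv4 e (m :: s) j (convection k) (x, t)) x (basis3 R m) d1 d2).
have dQ k m x : is_derive x (basis3 R m) (Q k : E3 R -> R^o) (DQ k m x) := is_deriveB' (dF k m x) (dW k m x) erefl.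
have LQ k : L2cont (Q k) by apply: L2cont_add => //; apply: L2cont_opp; exact: L2w.
have LDQ k m : L2cont (DQ k m) by apply: L2cont_add => //; apply: L2cont_opp; exact: L2w.
apply: (@projection_bound R W Q DW DQ (L2w s) LQ (fun k m => L2w (m :: s) k) LDQ dW dQ _ _ N _ i).
- by move=> x; exact: molldiv.
- by move=> k m x; exact: momentum.
move=> k; rewrite (_ : (fun x => _) = (fun x => force e s j k (x, t))); first exact: (hN k).2.
by apply/funext => x; rewrite addrC subrK.
Qed.

End step.

Lemma stage_all J : stage J.
Proof. by elim: J => [|J]; [exact: stage0|exact: stageS]. Qed.

End regularity.

(** * Passage to the limit *)

Section derivative_limits.
Context (R : realType).

(** By the mean value theorem and equicontinuity of F'_n at x along v, the difference quotients of
    F_n approximate F'_n(x) uniformly in n. For fixed h the quotients converge, so F'_n(x) is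
    Cauchy; letting n tend to infinity in the uniform estimate identifies the derivative of the
    limit. *)
Lemma derive_limit (V : normedModType R) (F F' : nat -> V -> R) (f : V -> R) (x v : V) (p : R) : 0 < p ->
  (forall n y, is_derive y v (F n : V -> R^o) (F' n y)) ->
  (forall a : R, 0 < a -> exists2 r : R, 0 < r & exists N, forall n h, (N <= n)%N -> `|h| <= r ->
     `|F' n (x + h *: v) - F' n x| <= a) ->
  (forall h : R, `|h| < p -> F n (x + h *: v) @[n --> \oo] --> f (x + h *: v)) ->
  cvgn (fun n => F' n x) /\ is_derive x v (f : V -> R^o) (limn (fun n => F' n x)).
Proof.
move=> p0 dF eF' Ff.
have K (a : R) : 0 < a -> exists2 r : R, 0 < r & exists N, forall n h, (N <= n)%N -> `|h| <= r ->
    `|F n (x + h *: v) - F n x - h * F' n x| <= a * `|h|.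
  move=> a0; have [r r0 [N H]] := eF' a a0; exists r => //; exists N => n h Nn hr.
  have d s : is_derive s (1 : R) (fun s : R => F n (x + s *: v) - s * F' n x : R^o) (F' n (x + s *: v) - F' n x).
    have d1 := (is_derive_line (F n) x v s _).1 (dF n (x + s *: v)).
    have d2 : is_derive s (1 : R) (fun s : R => s * F' n x : R^o) (F' n x).
      by apply: (is_deriveM' (is_derive_id _ _) (is_derive_cst' _ _ _)); ring.
    exact: (is_deriveB' d1 d2 erefl).
  have := MVT_bound d (a := 0) (b := h) (e := a); rewrite scale0r addr0 mul0r !subr0.
  rewrite addrAC; apply=> s; rewrite subr0 => sh; apply: H => //; exact: le_trans sh hr.
have Fx : F n x @[n --> \oo] --> f x.
  by have := Ff 0; rewrite normr0 scale0r addr0; exact.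
have c' : cvgn (fun n => F' n x).
  apply: cauchy_cvgn => e e0; have e2 : 0 < e / 2 by rewrite divr_gt0.
  have [r r0 [N H]] := K _ e2; pose h := Num.min r (p / 2).
  have h0 : 0 < h by rewrite lt_min r0 divr_gt0.
  have hp : `|h| < p.
    by rewrite gtr0_norm// gt_min orbC ltr_pdivrMr// ltr_pMr// ltr1n.
  have hr : `|h| <= r by rewrite gtr0_norm// ge_min lexx.
  have cq : h^-1 * (F n (x + h *: v) - F n x) @[n --> \oo] --> h^-1 * (f (x + h *: v) - f x).
    by apply: cvgMr; apply: cvgB => //; exact: Ff.
  have /cvgrPdist_le/(_ _ e2)[N2 _ H2] := cq.
  exists (h^-1 * (f (x + h *: v) - f x)), (maxn N N2) => n; rewrite geq_max => /andP[n1 n2].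
  rewrite (splitr e) -(subrK (h^-1 * (F n (x + h *: v) - F n x)) (h^-1 * (f (x + h *: v) - f x))) -addrA.
  rewrite (le_trans (ler_normD _ _))// lerD//; first exact: H2.
  have -> : h^-1 * (F n (x + h *: v) - F n x) - F' n x = h^-1 * (F n (x + h *: v) - F n x - h * F' n x).
    by rewrite [RHS]mulrBr mulrA mulVf ?gt_eqF// mul1r.
  rewrite normrM normfV mulrC ler_pdivrMr ?normr_gt0 ?gt_eqF//; exact: H.
split; first exact: c'.
apply: is_derive_eps => e e0; have [r r0 [N H]] := K _ e0.
exists (Num.min r p); first by rewrite lt_min r0.
move=> h _; rewrite lt_min => /andP[hr hp].
apply: (cvg_norm_le_from (N := N) (u := fun n => F n (x + h *: v) - F n x - h * F' n x)).
  apply: cvgB; last by apply: cvgMr.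
  by apply: cvgB => //; exact: Ff.
by move=> n Nn; apply: H => //; exact: ltW.
Qed.

End derivative_limits.

Section limit_regularity.
Context (R : realType) (T : R).
Local Notation M4 := (E3t (measurableTypeR R)).
Local Notation X := (X T).

Let slab_margin (z : E3t R) : slab T z -> exists2 e : R, 0 < e & e < z.2 < T - e.
Proof.
move=> /andP[z0 zT]; exists (Num.min z.2 (T - z.2) / 2); first by rewrite divr_gt0// lt_min z0 subr_gt0.
have h : Num.min z.2 (T - z.2) <= z.2 by rewrite ge_min lexx.
have h' : Num.min z.2 (T - z.2) <= T - z.2 by rewrite ge_min lexx orbT.
by move: z0 zT h h'; clear; move=> ? ? ? ?; apply/andP; split; lra.
Qed.

Lemma open_slab : open (slab T : set (E3t R)).
Proof.
rewrite (_ : slab T = snd @^-1` [set t : R | 0 < t < T]); last by [].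
apply: open_comp; first by move=> z _; exact: cvg_snd.
rewrite (_ : [set t : R | 0 < t < T] = [set t | 0 < t] `&` [set t | t < T]).
  by apply: openI; [exact: open_gt|exact: open_lt].
by apply/seteqP; split => t /=; [move=> /andP[]|move=> [-> ->]].
Qed.

Lemma X_eventually_inD (z : E3t R) : slab T z -> exists N, forall n, (N <= n)%N -> inD T n z.2.
Proof.
move=> /slab_margin[e e0 ez]; have [N H] := inD_eventually e0 ez.
by exists N => n Nn; apply: (H n Nn); rewrite subrr normr0 ltW.
Qed.

Lemma X_equicontinuous F z (a : R) : X 2 1 F -> slab T z -> 0 < a ->
  exists2 r : R, 0 < r & exists N, forall n w, (N <= n)%N -> `|z - w| <= r -> `|F n w - F n z| <= a.
Proof.
move=> XF /slab_margin[e e0 ez] a0; have [N H] := inD_eventually e0 ez.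
have [C C0 hC] := X_hoelder_x XF; have [D D0 hD] := X_hoelder_t XF.
have a2 : 0 < a / 2 by rewrite divr_gt0.
have [r1 r10 h1] := sqrt_small C0 a2; have [r2 r20 h2] := sqrt_small D0 a2.
exists (Num.min e (Num.min r1 (r2 ^+ 2))); first by rewrite !lt_min e0 r10 exprn_gt0.
exists N => n [y s] Nn; case: z ez H => x t /= ez H.
rewrite [`|_|]prod_normE ge_max/= !le_min => /andP[/and3P[_ xy _] /and3P[tse _ ts]].
have iD := H n Nn; have it : inD T n t by apply: iD; rewrite subrr normr0 ltW.
have is_ : inD T n s by exact: iD.
rewrite -(subrK (F n (y, t)) (F n (y, s))) -addrA (splitr a) (le_trans (ler_normD _ _))// lerD//.
  rewrite (le_trans (hD n y t s it is_))// h2// distrC.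
  by rewrite -(ger0_norm (ltW r20)) -(sqrtr_sqr r2) ler_wsqrtr.
by rewrite distrC (le_trans (hC n t x y it))// h1.
Qed.

Lemma X_limit_hoelder F h : X 2 1 F -> (forall z, slab T z -> F n z @[n --> \oo] --> h z) ->
  hoelder_xt 2^-1 T h.
Proof.
move=> XF Fh; have [B B0 hB] := X_bounded XF.
have [C C0 hC] := X_hoelder_x XF; have [D D0 hD] := X_hoelder_t XF.
exists (B + C + D); split => [z zS|[x t] [y s] zS wS].
  have [N H] := X_eventually_inD zS; apply: (cvg_norm_le_from (N := N) (Fh z zS)) => n Nn.
  by rewrite (le_trans (hB n z (H n Nn)))// -addrA lerDl addr_ge0.
have [N1 H1] := X_eventually_inD zS; have [N2 H2] := X_eventually_inD wS.
apply: (cvg_norm_le_from (N := maxn N1 N2) (cvgB (Fh _ zS) (Fh _ wS))) => n.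
rewrite geq_max => /andP[n1 n2]; have it := H1 n n1; have is_ := H2 n n2.
(* The time exponent [2^-1 / 2], read as a power of a power, becomes the iterated square root of the
   uniform bound. *)
rewrite powRrM !powR12_sqrt ?sqrtr_ge0//= -(subrK (F n (y, t)) (F n (x, t))) -addrA.
rewrite (le_trans (ler_normD _ _))// mulrDr lerD//.
  rewrite (le_trans (hC n t x y it))// ler_wpM2r ?sqrtr_ge0//.
  by rewrite -addrAC lerDr addr_ge0.
rewrite (le_trans (hD n y s t is_ it))// ler_wpM2r ?sqrtr_ge0//.
by rewrite lerDr addr_ge0.
Qed.

Variables (f : E3t R -> R) (C : R) (p : nat).
Hypotheses (mf : measurable_fun (setT : set M4) f) (C0 : 0 <= C) (fC : forall z, `|f z| <= C).
Let F s j n := cv4 (dl R n) s j f.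
Hypothesis XF : forall s j, (size s + 2 * j <= p)%N -> X 2 1 (F s j).
Let H s j z := limn (fun n => F s j n z).

Let lf : loc4 f. Proof. exact: loc4_bounded fC. Qed.

Let dirs s j : seq (E3t R) := map (dir_x R) s ++ nseq j (dir_t R).

Let derive_step (G G' : nat -> E3t R -> R) (z u : E3t R) : slab T z -> X 2 1 G' ->
  (forall n y, is_derive y u (G n : E3t R -> R^o) (G' n y)) ->
  (forall y, slab T y -> cvgn (fun n => G n y)) ->
  cvgn (fun n => G' n z) /\ is_derive z u ((fun y => limn (fun n => G n y)) : E3t R -> R^o) (limn (fun n => G' n z)).
Proof.
move=> zS XG' dG cG; have cl : continuous (fun h : R => z + h *: u) by exact: line_continuous.
have /nbhs_ballP[p0 /= p00 hp] : nbhs (0 : R) [set h | slab T (z + h *: u)].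
  apply: (cl 0); rewrite scale0r addr0; apply: open_nbhs_nbhs; split => //; exact: open_slab.
apply: (@derive_limit R _ G G' _ z u p0 p00 dG) => [a a0|h hh]; last first.
  by apply: cG; apply: hp; rewrite /ball/= sub0r normrN.
have [r r0 [N HN]] := X_equicontinuous XG' zS a0.
have u1 : 0 < `|u| + 1 by rewrite ltr_wpDl.
exists (r / (`|u| + 1)); first by rewrite divr_gt0.
exists N => n h Nn; rewrite ler_pdivlMr// => hr; apply: HN => //.
rewrite opprD addNKr normrN normrZ (le_trans _ hr)// ler_wpM2l// lerDl//.
Qed.

Let F0_cvg z : slab T z -> cvgn (fun n => F [::] 0 n z).
Proof.
move=> zS; have [_ _ _ L] := L1b_mollify mf C0 fC.
have lF n : loc4 (F [::] 0 n).
  have [mF _ [D D0 hD] _] := L1b_mollify mf C0 fC.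
  by apply: (loc4_bounded (mF n)) => w; exact: (hD n w).1.
apply: (pointwise_limit (@mio4 R) (fun z w => erefl) (@scales_reflect4 R) lF lf L (x := z)).
  move=> e e0; exists (phi e [::] 0); split; [exact: phi_lipbnd|exact: phi_supp|exact: phi_ge0|exact: phi_integral1].
by move=> a a0; apply: X_equicontinuous => //; exact: XF.
Qed.

(** L^1 convergence gives pointwise convergence of the mollifications themselves only. Derivatives
    inherit it one direction at a time, time before space, which is the order in which [pderiv]
    treats the list [dirs s j]. *)
Let F_cvg_t j : (2 * j <= p)%N -> forall z, slab T z -> cvgn (fun n => F [::] j n z).
Proof.
elim: j => [|j IH] jp z zS; first exact: F0_cvg.
have dF n y : is_derive y (dir_t R) (F [::] j n : E3t R -> R^o) (F [::] j.+1 n y).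
  by apply: cv4_derive_t => //; exact: dl_gt0.
by apply: (derive_step zS _ dF _).1 => [|y yS]; [exact: XF|apply: IH => //; lia].
Qed.

Let F_cvg s j : (size s + 2 * j <= p)%N -> forall z, slab T z -> cvgn (fun n => F s j n z).
Proof.
elim: s => [|i s IH] sp z zS; first exact: F_cvg_t.
have dF n y : is_derive y (dir_x R i) (F s j n : E3t R -> R^o) (F (i :: s) j n y).
  by apply: cv4_derive_x => //; exact: dl_gt0.
apply: (derive_step zS _ dF _).1 => [|y yS]; [exact: XF|apply: IH => //; move: sp => /=; lia].
Qed.

Let H_derive_t j z : (2 * j.+1 <= p)%N -> slab T z ->
  is_derive z (dir_t R) (H [::] j : E3t R -> R^o) (H [::] j.+1 z).
Proof.
move=> jp zS; have dF n y : is_derive y (dir_t R) (F [::] j n : E3t R -> R^o) (F [::] j.+1 n y).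
  by apply: cv4_derive_t => //; exact: dl_gt0.
apply: (derive_step zS _ dF _).2 => [|y yS]; [exact: XF|apply: F_cvg => //=; lia].
Qed.

Let H_derive_x i s j z : (size (i :: s) + 2 * j <= p)%N -> slab T z ->
  is_derive z (dir_x R i) (H s j : E3t R -> R^o) (H (i :: s) j z).
Proof.
move=> sp zS; have dF n y : is_derive y (dir_x R i) (F s j n : E3t R -> R^o) (F (i :: s) j n y).
  by apply: cv4_derive_x => //; exact: dl_gt0.
apply: (derive_step zS _ dF _).2 => [|y yS]; [exact: XF|apply: F_cvg => //; move: sp => /=; lia].
Qed.

Let slab_congr (g h : E3t R -> R) z u (d : R) : (forall y, slab T y -> g y = h y) -> slab T z ->
  is_derive z u (g : E3t R -> R^o) d -> is_derive z u (h : E3t R -> R^o) d.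
Proof.
move=> gh zS; apply: near_eq_is_derive'.
have := open_nbhs_nbhs (conj open_slab zS); apply: filterS => y; exact: gh.
Qed.

Let pderiv_tE j : (2 * j <= p)%N -> pderivable_on (slab T) (dirs [::] j) (H [::] 0) /\
  forall z, slab T z -> pderiv (dirs [::] j) (H [::] 0) z = H [::] j z.
Proof.
elim: j => [|j IH] jp; first by split.
have [|P E] := IH; first by rewrite (leq_trans _ jp)// leq_pmul2l.
have D z : slab T z -> is_derive z (dir_t R) (pderiv (nseq j (dir_t R)) (H [::] 0) : E3t R -> R^o) (H [::] j.+1 z).
  move=> zS; apply: (slab_congr _ zS (H_derive_t jp zS)) => y yS; exact/esym/E.
by split; [split; [exact: P|move=> z zS]; exact: (@ex_derive _ _ _ _ _ _ _ (D z zS))|move=> z zS; exact: (@derive_val _ _ _ _ _ _ _ (D z zS))].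
Qed.

Let pderivE s j : (size s + 2 * j <= p)%N -> pderivable_on (slab T) (dirs s j) (H [::] 0) /\
  forall z, slab T z -> pderiv (dirs s j) (H [::] 0) z = H s j z.
Proof.
elim: s => [|i s IH] sp; first exact: pderiv_tE.
have [|P E] := IH; first by rewrite (leq_trans _ sp)// leq_add2r leqnSn.
have D z : slab T z -> is_derive z (dir_x R i) (pderiv (dirs s j) (H [::] 0) : E3t R -> R^o) (H (i :: s) j z).
  move=> zS; apply: (slab_congr _ zS (H_derive_x sp zS)) => y yS; exact/esym/E.
by split; [split; [exact: P|move=> z zS]; exact: (@ex_derive _ _ _ _ _ _ _ (D z zS))|move=> z zS; exact: (@derive_val _ _ _ _ _ _ _ (D z zS))].
Qed.

Lemma measurable_slab : measurable (slab T : set M4).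
Proof.
rewrite (_ : slab T = setT `&` snd @^-1` `]0, T[%classic).
  by apply: measurable_snd => //; exact: measurable_itv.
by rewrite setTI; apply/seteqP; split => z /=; rewrite in_itv/=.
Qed.

Lemma limit_regularity : exists h : E3t R -> R, {ae mu4 R, forall z, slab T z -> h z = f z} /\
  forall s j, (size s + 2 * j <= p)%N ->
    pderivable_on (slab T) (map (dir_x R) s ++ nseq j (dir_t R)) h /\
    hoelder_xt 2^-1 T (pderiv (map (dir_x R) s ++ nseq j (dir_t R)) h).
Proof.
exists (H [::] 0); split.
  have [mF _ _ L] := L1b_mollify mf C0 fC.
  apply: (ae_limit (@mio4 R) mF mf measurable_slab L) => z zS; exact: F0_cvg.
move=> s j sp; have [P E] := pderivE sp; split => //.
by apply: (X_limit_hoelder (XF sp)) => z zS; rewrite E//; exact: F_cvg.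
Qed.

End limit_regularity.

(** * From solutions to mollified identities *)

Section almost_everywhere_equal_integrals.
Context d (T : measurableType d) (R : realType) (m : {measure set T -> \bar R}).
Import HBNNSimple.
Local Open Scope ereal_scope.

(** A simple minorant of f, set to 0 on N, becomes a minorant of g and keeps its integral. *)
Lemma nonneg_integral_ae (f g : T -> \bar R) (N : set T) : measurable N -> m N = 0 ->
  (forall x, 0 <= f x) -> (forall x, 0 <= g x) -> (forall x, ~ N x -> f x = g x) ->
  \int[m]_x f x <= \int[m]_x g x.
Proof.
move=> mN N0 f0 g0 fg; rewrite !ge0_integralTE//; apply: ge_ereal_sup => _ [h /= hf <-].
have mC : measurable (~` N) := measurableC mN.
apply: ereal_sup_ubound => /=; exists (proj_nnsfun h mC).
  move=> x; have -> : proj_nnsfun h mC x = (h \_ (~` N)) x by rewrite (mrestrict h mC).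
  rewrite /= patchE; case: ifPn => [|_]; last exact: g0.
  by rewrite inE => xN; rewrite -fg.
rewrite -!integralT_nnsfun; apply: ae_eq_integral => //.
- by apply/measurable_EFinP; exact: measurable_funPT.
- by apply/measurable_EFinP; exact: measurable_funPT.
exists N; split => // x /=; apply: contra_notP => xN _.
by rewrite /= mindicE mem_set// mulr1.
Qed.

(* No measurability is required: two functions that agree off a measurable null set have the same
   suprema of simple minorants. *)
Lemma integral_ae (D : set T) (f g : T -> \bar R) : {ae m, forall x, D x -> f x = g x} ->
  \int[m]_(x in D) f x = \int[m]_(x in D) g x.
Proof.
move=> [N [mN N0 fgN]]; rewrite integral_mkcond [RHS]integral_mkcond.
have {fgN} fg x : ~ N x -> (f \_ D) x = (g \_ D) x.
  move=> Nx; rewrite !patchE; case: ifPn => // /set_mem Dx; apply: contrapT => h.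
  by apply: Nx; apply: fgN => /= /(_ Dx).
rewrite integralE [RHS]integralE; congr (_ - _); apply/eqP; rewrite eq_le; apply/andP; split;
  apply: (nonneg_integral_ae mN N0) => x //.
- by move=> /fg E; rewrite funepos.unlock E.
- by move=> /fg E; rewrite funepos.unlock E.
- by move=> /fg E; rewrite funeneg.unlock E.
- by move=> /fg E; rewrite funeneg.unlock E.
Qed.

Lemma Rintegral_ae_any (D : set T) (f g : T -> R) : {ae m, forall x, D x -> f x = g x} ->
  (\int[m]_(x in D) f x = \int[m]_(x in D) g x)%R.
Proof. by move=> fg; congr fine; apply: integral_ae; apply: ae_imp fg => x /[apply] ->. Qed.

End almost_everywhere_equal_integrals.

Section viscosity.
Context (R : realType).

Lemma nonneg_derive_half_derive (f : R -> R) (s : R) : cvg (nonneg_quotient f s) ->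
  half_derive f s (nonneg_derive f s).
Proof.
move=> cf e e0.
have /cvgrPdist_le/(_ e e0) : (fun h => h^-1 * (f (s + h) - f s)) @ within [set h | 0 <= s + h] 0^' --> nonneg_derive f s.
  exact: cf.
rewrite near_withinE => /nbhs_ballP[r /= r0 hr]; exists r => // h sh hlr.
have [->|h0] := eqVneq h 0; first by rewrite addr0 subrr mul0r subr0 !normr0 mulr0.
have := hr h; rewrite /ball/= sub0r normrN => /(_ hlr h0 sh) H.
have -> : f (s + h) - f s - h * nonneg_derive f s = - (h * (nonneg_derive f s - h^-1 * (f (s + h) - f s))).
  by rewrite mulrBr mulrA mulfV// mul1r opprB.
by rewrite normrN normrM mulrC ler_wpM2r.
Qed.

Lemma viscosity_half_derive (G : R -> R) k s : admissible_viscosity G -> 0 <= s ->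
  half_derive (nonneg_derive_n k G) s (nonneg_derive_n k.+1 G s).
Proof. by move=> [_ cG _] s0; apply: nonneg_derive_half_derive; exact: cG. Qed.

End viscosity.

(** * Weak derivatives as mollification identities *)

Section weak_derivatives.
Context (R : realType).
Local Notation M3 := (E3 (measurableTypeR R)).

Lemma restrict_indic (T : Type) (f : T -> R) (D : set T) : f \_ D = (fun x => f x * \1_D x).
Proof.
by apply/funext => x; rewrite patchE indicE; case: ifP => _; rewrite (mulr1, mulr0).
Qed.

Lemma integrable_restrict d (T : measurableType d) (m : {measure set T -> \bar R}) (f : T -> R) (D : set T) :
  measurable D -> m.-integrable D (EFin \o f) -> m.-integrable setT (EFin \o (fun x => f x * \1_D x)).
Proof.
by move=> mD /(integrable_mkcond _ mD); rewrite restrict_EFin restrict_indic.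
Qed.

Lemma locally_integrable_loc3 (f : E3 R -> R) : locally_integrable3 f -> loc3 f.
Proof.
move=> lf; have H r : (mu3 R).-integrable setT (EFin \o (fun x => f x * \1_(tball (@io3 R) r) x)).
  apply: integrable_restrict; first exact: (measurable_tball (@mio3 R)).
  rewrite (_ : tball (@io3 R) r = [set y : E3 R | `|0 - y| <= r]); last first.
    by apply/seteqP; split => y /=; rewrite /tball/= sub0r normrN.
  by apply: lf; exact: ball3_compact.
split => //; apply: (measurable_fun_cvg (h := fun n x => f x * \1_(tball (@io3 R) n%:R) x)).
  by move=> n; have /integrableP[/measurable_EFinP] := H n%:R.
move=> x _; apply: cvg_near_cst; exists (Num.bound `|x|) => // n /= xn.
rewrite indicE mem_set ?mulr1// /tball/=.
by rewrite (le_trans (ltW (archi_boundP _)))// ler_nat.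
Qed.

(** The test function is the reflected mollifier y -> eta(x - y): the sign (-1)^|s| produced by the
    reflection cancels that of the weak formulation. *)
Lemma weak_mollified_deriv s (f g : E3 R -> R) : is_weak_deriv s f g -> mollified_deriv s f g.
Proof.
move=> [lf _ H] e s' x e0; have := H _ (eta_reflect_test e0 s' x).
have i3 := cv3_integrable (s ++ s') x e0 (locally_integrable_loc3 lf).
rewrite pderiv_eta_reflect leb3E => E; rewrite /cv3 /conv.
have sg : (-1) ^+ size s * (-1) ^+ size s = 1 :> R by rewrite -expr2 sqrr_sign.
rewrite -[LHS]mul1r -[RHS]mul1r -sg -!mulrA; congr (_ * _); rewrite -E -RintegralZl//.
by apply: eq_Rintegral => y _; rewrite mulrCA.
Qed.

Lemma sum_term_le (I : finType) (F : I -> \bar R) i : (forall i, (0 <= F i)%E) -> (F i <= \sum_i F i)%E.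
Proof. by move=> F0; rewrite (bigD1 i)//= leeDl// sume_ge0. Qed.

Lemma sobolev_weak_sqnorm l (w : 'I_3 -> E3 R -> R) (M : \bar R) i s : (size s <= l)%N ->
  (sobolev_field_sqnorm l w <= M)%E -> (sqnorm (mu3 R) (weak_deriv s (w i)) <= M)%E.
Proof.
move=> sl; apply: le_trans; have n0 (f : E3 R -> R) : (0 <= \int[leb3 R]_x ((f x) ^+ 2)%:E)%E.
  by apply: integral_ge0 => x _; rewrite lee_fin sqr_ge0.
have s0 (k : 'I_l.+1) j : (0 <= \sum_(s : k.-tuple 'I_3) \int[leb3 R]_x ((weak_deriv s (w j) x) ^+ 2)%:E)%E.
  by apply: sume_ge0 => t _; exact: n0.
apply: le_trans (sum_term_le (F := fun i => sobolev_sqnorm l (w i)) i _); last first.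
  by move=> j; apply: sume_ge0 => k _; exact: s0.
have sl1 : (size s < l.+1)%N by [].
apply: le_trans (sum_term_le (I := 'I_l.+1) (Ordinal sl1) (s0^~ i)).
exact: (sum_term_le (F := fun t : (size s).-tuple 'I_3 => (\int[leb3 R]_x ((weak_deriv t (w i) x) ^+ 2)%:E)%E) (in_tuple s)).
Qed.

End weak_derivatives.

Lemma ae_imp2 d (T : measurableType d) (R : realType) (m : {measure set T -> \bar R}) (P Q S : T -> Prop) :
  (forall x, P x -> Q x -> S x) -> {ae m, forall x, P x} -> {ae m, forall x, Q x} -> {ae m, forall x, S x}.
Proof. by move=> PQS; apply: filterS2. Qed.

Section slice_lemmas.
Context (R : realType).
Local Notation M3 := (E3 (measurableTypeR R)).
Local Notation M4 := (E3t (measurableTypeR R)).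

(** Joint measurability is what lets Tonelli collect null sets of the individual time slices into a
    null set of space-time. *)
Lemma ae_slices (f g : E3t R -> R) : measurable_fun (setT : set M4) f -> measurable_fun (setT : set M4) g ->
  (forall t, {ae mu3 R, forall x, f (x, t) = g (x, t)}) -> {ae mu4 R, forall z, f z = g z}.
Proof.
move=> mf mg fg; have mh : measurable_fun (setT : set M4) (fun z => `|f z - g z|).
  by apply: measurableT_comp => //; exact: measurable_funB.
have mh' : measurable_fun (setT : set M4) (EFin \o (fun z => `|f z - g z|)) by exact/measurable_EFinP.
have I0 : (\int[mu4 R]_z `|(EFin \o (fun z => `|f z - g z|)%R) z| = 0)%E.
  rewrite (sprod_tonelli2 (mu3 R) (mu1 R)); last 2 first.
  - exact: measurableT_comp.
  - by move=> z; exact: abse_ge0.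
  rewrite integral0_eq// => t _; rewrite (@integral_ae _ _ _ _ _ _ (cst 0%E)) ?integral0//.
  by apply: ae_imp (fg t) => x E _; rewrite /= E subrr !normr0.
have /(ae_eq_integral_abs _ measurableT mh') H := I0.
by apply: ae_imp H => z /= /(_ Logic.I)[] /eqP; rewrite normr_eq0 subr_eq0 => /eqP ->.
Qed.

Lemma ae_times (N : set R) : measurable (N : set (measurableTypeR R)) -> mu1 R N = 0%E ->
  {ae mu4 R, forall z, ~ N z.2}.
Proof.
move=> mN N0; exists (setT `*` N); split.
- exact: measurableX.
- have := product_measure1E (mu3 R) (mu1 R) measurableT mN; rewrite -[X in X = _]/(mu4 R _) => ->.
  by rewrite N0 mule0.
by move=> [x t] /=; case: (pselect (N t)) => // Nt H; split.
Qed.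

Lemma Rintegral_slab (T : R) (H : E3t R -> R) : (mu4 R).-integrable setT (EFin \o H) ->
  (forall z, ~ slab T z -> H z = 0) ->
  \int[@lebesgue_measure R]_(t in `]0, T[) \int[mu3 R]_x H (x, t) = \int[mu4 R]_z H z.
Proof.
move=> iH H0; rewrite Rintegral_mkcond /Rintegral -(integral21_prod_meas1 iH); congr fine.
apply: (integral_ae (m := mu1 R)); have := ae_integrable2 iH; apply: ae_imp => t it _.
rewrite patchE /fubini_G; case: ifPn => [_|]; first by rewrite -(EFin_Rintegral it).
rewrite notin_setE/= in_itv/= => tT; rewrite integral0_eq// => x _; rewrite /= H0//.
Qed.

Lemma cv3_0 e s (x : E3 R) : cv3 e s (fun=> 0) x = 0.
Proof. by rewrite /cv3 /conv /Rintegral integral0_eq// => y _; rewrite mul0r. Qed.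

End slice_lemmas.

(** * Mollified equations satisfied by the given solution *)

Section solution.
Context (R : realType) (G : R -> R) (l : nat) (T K : R) (N : set R).
Local Notation M1 := (measurableTypeR R).
Local Notation M3 := (E3 (measurableTypeR R)).
Local Notation M4 := (E3t (measurableTypeR R)).
Variables (u : 'I_3 -> E3t R -> R) (p : E3t R -> R).
Hypotheses (hG : admissible_viscosity G) (l4 : (4 <= l)%N).
Hypothesis measurable_u : forall i, measurable_fun (slab T : set M4) (u i).
Hypotheses (mN : measurable (N : set M1)) (N0 : mu1 R N = 0%E).
Hypothesis good : forall t, 0 < t < T -> ~ N t -> [/\ sobolev_field l (at_time u t),
  (sobolev_field_sqnorm l (at_time u t) <= (K ^+ 2)%:E)%E & divergence_free (at_time u t)].
Hypotheses (hp : pressure_function T p) (hm : momentum_equation G T u p).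

Let U : set M4 := slab T `&` (snd @^-1` (~` N)).

(** Setting u to 0 at exceptional times and outside (0, T) makes every slice, not almost every one,
    a Sobolev function with the same bound, so that no further null set of times has to be carried
    along. *)
Definition cleaned i : E3t R -> R := u i \_ U.
Local Notation w := cleaned.

Let mU : measurable U.
Proof.
apply: measurableI; first exact: measurable_slab.
by rewrite -[X in measurable X]setTI; apply: measurable_snd => //; exact: measurableC.
Qed.

Lemma measurable_cleaned i : measurable_fun (setT : set M4) (w i).
Proof.
have sub : U `<=` slab T by exact: subIsetl.
have mUi : measurable_fun U (u i) := measurable_funS (measurable_slab T) sub (measurable_u i).
exact: (measurable_restrictT (u i) mU).1 mUi.
Qed.

Lemma cleaned_good t i : 0 < t < T -> ~ N t -> slice (w i) t = at_time u t i.
Proof. by move=> tT Nt; apply/funext => x; rewrite /slice /w patchE mem_set. Qed.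

Lemma cleaned_bad t i : ~ (0 < t < T /\ ~ N t) -> slice (w i) t = fun=> 0.
Proof. by move=> tT; apply/funext => x; rewrite /slice /w patchE memNset. Qed.

Let weak t i s : 0 < t < T -> ~ N t -> (size s <= l)%N ->
  is_weak_deriv s (at_time u t i) (weak_deriv s (at_time u t i)).
Proof. by move=> tT Nt sl; have [/(_ i)[_ /(_ s sl)[]]] := good tT Nt. Qed.

Let loc3_weak t i s : 0 < t < T -> ~ N t -> (size s <= l)%N ->
  loc3 (at_time u t i) /\ loc3 (weak_deriv s (at_time u t i)).
Proof.
by move=> tT Nt sl; have [? ? _] := weak i tT Nt sl; split; exact: locally_integrable_loc3.
Qed.

Lemma cleaned_slices i : slice_sobolev l K (w i).
Proof.
move=> t; case: (pselect (0 < t < T /\ ~ N t)) => [[tT Nt]|bad]; last first.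
  have l0 : loc3 (fun=> 0 : R).
    by apply: (@loc3_sqnorm R _ 0) => //; rewrite /sqnorm integral0_eq// => x _; rewrite expr0n.
  rewrite (cleaned_bad i bad); split => // s _; exists (fun=> 0); split => //.
    by rewrite /sqnorm integral0_eq ?lee_fin ?sqr_ge0// => x _; rewrite expr0n.
  by move=> e s' x _; rewrite !cv3_0.
rewrite (cleaned_good i tT Nt); split; first exact: (loc3_weak i (s := [::]) tT Nt (leq0n l)).1.
move=> s sl; exists (weak_deriv s (at_time u t i)); split.
- by have [_ []] := loc3_weak i tT Nt sl.
- by have [_ sK _] := good tT Nt; exact: (sobolev_weak_sqnorm (w := at_time u t) i sl sK).
- exact/weak_mollified_deriv/weak.
Qed.

Variables (v : 'I_3 -> E3t R -> R) (d : 'I_3 -> 'I_3 -> E3t R -> R) (C : R).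
Hypotheses (mv : forall i, measurable_fun (setT : set M4) (v i))
           (md : forall i m, measurable_fun (setT : set M4) (d i m)).
Hypotheses (C0 : 0 <= C) (bv : forall i z, `|v i z| <= C) (bd : forall i m z, `|d i m z| <= C).
Hypothesis vw : forall i t g, measurable_fun (setT : set M3) g -> loc3 g ->
  mollified_deriv [::] (slice (w i) t) g -> {ae mu3 R, forall x, v i (x, t) = g x}.
Hypothesis dw : forall i m t g, measurable_fun (setT : set M3) g -> loc3 g ->
  mollified_deriv [:: m] (slice (w i) t) g -> {ae mu3 R, forall x, d i m (x, t) = g x}.

Let l1 : (1 <= l)%N. Proof. by rewrite (leq_trans _ l4). Qed.

Let lv i : loc4 (v i). Proof. exact: loc4_bounded (mv i) (bv i). Qed.
Let ld i m : loc4 (d i m). Proof. exact: loc4_bounded (md i m) (bd i m). Qed.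

Lemma rep_facts i t : [/\ (sqnorm (mu3 R) (slice (v i) t) <= (K ^+ 2)%:E)%E, loc3 (slice (v i) t) &
  forall e s x, 0 < e -> cv3 e s (slice (v i) t) x = cv3 e s (slice (w i) t) x].
Proof. exact: (@spatial_rep_facts R l K (w i) [::] (v i) t (cleaned_slices i) (leq0n l) (mv i) (fun t => @vw i t)). Qed.

Lemma rep_grad_facts i m t : [/\ (sqnorm (mu3 R) (slice (d i m) t) <= (K ^+ 2)%:E)%E, loc3 (slice (d i m) t) &
  forall e s x, 0 < e -> cv3 e s (slice (d i m) t) x = cv3 e (m :: s) (slice (w i) t) x].
Proof. exact: (@spatial_rep_facts R l K (w i) [:: m] (d i m) t (cleaned_slices i) l1 (md i m) (fun t => @dw i m t)). Qed.

Lemma rep_sqnorm i t : (sqnorm (mu3 R) (slice (v i) t) <= (K ^+ 2)%:E)%E.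
Proof. by have [] := rep_facts i t. Qed.

Lemma rep_grad_sqnorm i m t : (sqnorm (mu3 R) (slice (d i m) t) <= (K ^+ 2)%:E)%E.
Proof. by have [] := rep_grad_facts i m t. Qed.

Lemma rep_mollified_sqnorm i s e t : 0 < e -> (size s <= l)%N ->
  (sqnorm (mu3 R) (fun x => cv4 e s 0 (v i) (x, t)) <= (K ^+ 2)%:E)%E.
Proof.
move=> e0 sl; apply: cv4_slices_sqnorm => // [tau|tau]; have [_ lt E] := rep_facts i tau => //.
rewrite (_ : cv3 e s (slice (v i) tau) = cv3 e s (slice (w i) tau)); last by apply/funext => x; rewrite E.
exact: slice_cv3_sqnorm (cleaned_slices i) e0 sl.
Qed.

Lemma rep_grad_mollified i m e s j z : 0 < e -> cv4 e s j (d i m) z = cv4 e (m :: s) j (v i) z.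
Proof.
move=> e0; apply: (@cv4_slices_eq R e s (m :: s) j (d i m) (v i) z e0 (ld i m) (lv i)) => [tau|tau|tau x].
- by have [_ ] := rep_grad_facts i m tau.
- by have [_ ] := rep_facts i tau.
have [_ _ E1] := rep_grad_facts i m tau; have [_ _ E2] := rep_facts i tau.
by rewrite E1// E2.
Qed.

Lemma rep_good t : 0 < t < T -> ~ N t -> {ae mu3 R, forall x, forall i, v i (x, t) = u i (x, t)}.
Proof.
move=> tT Nt; apply: filter_forall => i.
have [lf _] := loc3_weak i tT Nt (s := [::]) (leq0n l); apply: (vw (i := i) (t := t) (g := fun x => u i (x, t))) => //.
- by case: lf.
- by move=> e s' x _; rewrite cleaned_good.
Qed.

Lemma rep_grad_good t : 0 < t < T -> ~ N t ->
  {ae mu3 R, forall x, forall i m, d i m (x, t) = weak_deriv [:: m] (at_time u t i) x}.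
Proof.
move=> tT Nt; apply: filter_forall => i; apply: filter_forall => m.
have [_ lf] := loc3_weak i tT Nt (s := [:: m]) l1; apply: dw => //; first by case: lf.
by rewrite cleaned_good//; exact/weak_mollified_deriv/weak.
Qed.

Lemma rep_div t : {ae mu3 R, forall x, \sum_i d i i (x, t) = 0}.
Proof.
case: (pselect (0 < t < T /\ ~ N t)) => [[tT Nt]|bad].
  have [_ _ dv] := good tT Nt; have dg := rep_grad_good tT Nt; apply: (ae_imp2 _ dv dg) => x {}dv H.
  by rewrite -[RHS]dv; apply: eq_bigr => i _.
have H i : {ae mu3 R, forall x, d i i (x, t) = 0}.
  have l0 : loc3 (fun=> 0 : R).
    by apply: (@loc3_sqnorm R _ 0) => //; rewrite /sqnorm integral0_eq// => x _; rewrite expr0n.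
  apply: (dw (g := fun=> 0)) => //.
  by rewrite cleaned_bad// => e s' x _; rewrite !cv3_0.
have Ha : {ae mu3 R, forall x, forall i, d i i (x, t) = 0} by apply: filter_forall.
by apply: ae_imp Ha => x E; rewrite big1.
Qed.

Lemma rep_div_mollified e s j z : 0 < e -> \sum_i cv4 e (i :: s) j (v i) z = 0.
Proof.
move=> e0; transitivity (\sum_i cv4 e s j (d i i) z); first by apply: eq_bigr => i _; rewrite rep_grad_mollified.
have mS : measurable_fun (setT : set M4) (fun z => \sum_i d i i z) by apply: measurable_sum.
transitivity (cv4 e s j (fun z => \sum_i d i i z) z).
  have [_ E] := Rintegral_sum3 (fun i => cv4_integrable s j z e0 (ld i i)).
  by rewrite -E; apply: eq_Rintegral => y _; rewrite mulr_suml.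
rewrite /cv4 /conv (@Rintegral_ae_any _ _ _ _ _ _ (fun=> 0)).
  by rewrite /Rintegral integral0_eq.
by have := ae_slices mS (@measurable_cst _ _ M4 M1 setT (0 : R)) rep_div; apply: ae_imp => y /= -> _; rewrite mul0r.
Qed.

Let g k := nonneg_derive_n k G.
Let gd k s : 0 <= s -> half_derive (g k) s (g k.+1 s). Proof. exact: viscosity_half_derive. Qed.

Section tested.
Variables (e : R) (z : E3t R).
Hypotheses (e0 : 0 < e) (ez : e < z.2 < T - e).
Let Kz : set (E3t R) := [set y | `|z - y| <= e].

Let Kslab : Kz `<=` slab T.
Proof.
move=> y /= h; have : `|(z - y).2| <= e by apply: le_trans h; rewrite [leRHS]prod_normE le_max lexx orbT.
by move: ez => /andP[? ?]; rewrite /= ler_norml => /andP[? ?]; apply/andP; split; lra.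
Qed.

Let mKz : measurable (Kz : set M4).
Proof.
have mn := measurable_reflect (@mio4 R) z (@norm_continuous _ (E3t R)).
have := mn measurableT _ (measurable_itv `]-oo, e]); rewrite setTI; congr measurable.
Qed.

Let phiK s j y : ~ Kz y -> phi e s j (z - y) = 0.
Proof. by move=> /negP; rewrite -ltNge => /ltW; exact: phi_supp. Qed.

(** The integrand of the weak equation without pressure, for the test function phi(z - .): the
    reflection changes the sign of every term in which a derivative falls on the test function. *)
Definition tested_flow s j i (y : E3t R) : R := v i y * phi e s j.+1 (z - y)
  - \sum_n stress g d i n y * phi e (n :: s) j (z - y) + convection v d i y * phi e s j (z - y).

(** The pressure is integrable only on compact subsets of the slab. The cutoff to the ball [Kz],
    outside which the kernel vanishes, makes this globally integrable without changing the
    product. *)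
Definition tested_pressure s j (y : E3t R) : R := (p y * \1_Kz y) * phi e s j (z - y).

Let tested_flow_integral s j i : (mu4 R).-integrable setT (EFin \o tested_flow s j i) /\
  \int[mu4 R]_y tested_flow s j i y = cv4 e s j.+1 (v i) z - force g v d e s j i z.
Proof.
have i1 := cv4_integrable s j.+1 z e0 (lv i).
have i2 n := cv4_integrable (n :: s) j z e0 (loc4_stress gd md C0 bd i n).
have i3 := cv4_integrable s j z e0 (loc4_convection mv md C0 bv bd i).
have [i2s E2] := Rintegral_sum3 i2; have i12 := integrableBfun i1 i2s.
split; first exact: (integrableDfun i12 i3).
rewrite /tested_flow RintegralD// RintegralB// E2 /force /cv4 /conv opprB addrA addrAC.
by rewrite -addrA [- _ + _]addrC addrA.
Qed.

Let tested_pressure_integrable s j : (mu4 R).-integrable setT (EFin \o tested_pressure s j).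
Proof.
have [c [_ hc _]] := phi_lipbnd e0 s j.
apply: (integrable_mul_bounded (M := c)) => [||y]; last exact: hc.
  apply: integrable_restrict mKz _; apply: hp => //; exact: ball4_compact.
exact: (measurable_reflect (@mio4 R) z (lipbnd_continuous (phi_lipbnd e0 s j))).
Qed.

Lemma tested_momentum s j i :
  \int[mu4 R]_y (tested_flow s j i y + tested_pressure (i :: s) j y) = 0.
Proof.
have iE := (tested_flow_integral s j i).1; have iP := tested_pressure_integrable (i :: s) j.
rewrite -(@Rintegral_slab R T _ (integrableDfun iE iP)); last first.
  move=> y yT; have yK : ~ Kz y by move=> /Kslab.
  rewrite /tested_flow /tested_pressure !phiK// !mulr0 !addr0 sub0r big1 ?oppr0// => n _.
  by rewrite phiK// mulr0.
rewrite -[RHS](hm i (phi_reflect_test e0 s j ez)).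
have NT : {ae mu1 R, forall t, ~ N t} by exists N; split => // t /= /contrapT.
(* The weak equation contains [weak_deriv] of each slice, chosen separately at every time. It is
   exchanged for the jointly measurable [d] by a rule that asks for no measurability of the
   integrands. *)
apply: (Rintegral_ae_any (m := mu1 R)); apply: ae_imp NT => t Nt tT'.
have tT : 0 < t < T by move: tT'; rewrite /= in_itv.
apply: Rintegral_ae_any; apply: (ae_imp2 _ (rep_good tT Nt) (rep_grad_good tT Nt)) => x vx dx _.
rewrite pderiv_phi_reflect_t// pderiv_phi_reflect_x// /tested_flow /tested_pressure.
have Ds a b : sym_grad (at_time u t) a b x = Dsym d a b (x, t) by rewrite /sym_grad /Dsym !dx.
have DQ : sym_grad_sq (at_time u t) x = Dsq d (x, t).
  by apply: eq_bigr => a _; apply: eq_bigr => b _; rewrite Ds.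
rewrite -vx mulrN opprK mulrN opprK; congr (_ + _ + _ + _).
- rewrite -sumrN; apply: eq_bigr => n _.
  by rewrite pderiv_phi_reflect_x// mulrN /stress Ds DQ.
- rewrite mulr_suml; apply: eq_bigr => n _; by rewrite -vx dx.
have [yK|yK] := pselect (Kz (x, t)); first by rewrite indicE mem_set// mulr1.
by rewrite phiK// !mulr0.
Qed.

(** Component i tested with the kernel differentiated along m, and component m with the kernel
    differentiated along i, involve the pressure against the same mixed derivative of the kernel.
    Subtraction removes it. *)
Lemma rep_momentum s j i m : force g v d e (m :: s) j i z - cv4 e (m :: s) j.+1 (v i) z =
  force g v d e (i :: s) j m z - cv4 e (i :: s) j.+1 (v m) z.
Proof.
have H a b : cv4 e (b :: s) j.+1 (v a) z - force g v d e (b :: s) j a z +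
    \int[mu4 R]_y tested_pressure (a :: b :: s) j y = 0.
  have [iE <-] := tested_flow_integral (b :: s) j a; have iP := tested_pressure_integrable (a :: b :: s) j.
  by rewrite -RintegralD//; exact: tested_momentum.
have PE : \int[mu4 R]_y tested_pressure (i :: m :: s) j y = \int[mu4 R]_y tested_pressure (m :: i :: s) j y.
  by apply: eq_Rintegral => y _; rewrite /tested_pressure /phi etaC.
by have := H i m; have := H m i; rewrite PE => h1 h2; lra.
Qed.

End tested.

End solution.

Section uniform_bounds.
Context (R : realType).

Lemma finite_bound (I : finType) (A : Type) (f : I -> A -> R) :
  (forall i, exists C : R, forall z, `|f i z| <= C) -> exists2 C : R, 0 <= C & forall i z, `|f i z| <= C.
Proof.
move=> /choice[c hc]; exists (\sum_i `|c i|) => [|i z]; first exact: sumr_ge0.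
rewrite (le_trans (hc i z))// (le_trans (ler_norm _))// (bigD1 i)//= lerDl; exact: sumr_ge0.
Qed.

End uniform_bounds.

Lemma exceptional_times (R : realType) (G : R -> R) (l : nat) (T : R) (u0 : 'I_3 -> E3 R -> R)
    (u : 'I_3 -> E3t R -> R) : cauchy_solution G l T u0 u ->
  exists N : set R, exists K : R, [/\ measurable (N : set (measurableTypeR R)), mu1 R N = 0%E, 0 <= K &
    forall t, 0 < t < T -> ~ N t -> [/\ sobolev_field l (at_time u t),
      (sobolev_field_sqnorm l (at_time u t) <= (K ^+ 2)%:E)%E & divergence_free (at_time u t)]].
Proof.
move=> hu; have [_ [M hM]] := solution_Linfty hu.
have [N [mN N0 PN]] := ae_imp2 (fun t a b => conj a b) hM (solution_div hu).
exists N, (Num.sqrt `|M|); split => // t tT Nt.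
have [h1 h2] : (0 < t < T -> sobolev_field l (at_time u t) /\ (sobolev_field_sqnorm l (at_time u t) <= M%:E)%E) /\
    (0 < t < T -> divergence_free (at_time u t)) by apply: contrapT => H; exact/Nt/PN.
have [s1 s2] := h1 tT; split => //; last exact: h2.
by apply: (le_trans s2); rewrite lee_fin sqr_sqrtr// ler_norm.
Qed.

Theorem corollary1p2 (R : realType) (G : R -> R) (l : nat) (T : R)
    (u0 : 'I_3 -> E3 R -> R) (u : 'I_3 -> E3t R -> R)
    (hG : admissible_viscosity G) (hl : (3 <= l)%N) (hl_even : ~~ odd l)
    (hu0 : sobolev_field l u0) (hdiv0 : divergence_free u0)
    (hT : 0 < T) (hu : cauchy_solution G l T u0 u) :
  field_in_parabolic_hoelder (l - 2)./2 2^-1 T u.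
Proof.
(* Parity excludes l = 3, so the gradient has weight l - 1 >= 3. *)
have l4 : (4 <= l)%N by move: hl hl_even; clear; case: l => [|[|[|[|l]]]].
have [mL _] := solution_Linfty hu; have [p hp hm] := solution_momentum hu.
have [N [K [mN N0 K0 good]]] := exceptional_times hu.
pose w := cleaned T N u.
have mw i : measurable_fun setT (w i) := measurable_cleaned mL mN i.
have sw i : slice_sobolev l K (w i) := cleaned_slices good i.
have l2 : (2 <= l)%N by rewrite (leq_trans _ l4).
have l3 : (3 <= l)%N := hl.
have /choice[v hv] i := @spatial_rep R l K (w i) [::] (mw i) K0 (sw i) l2.
have /choice[d' hd'] (im : 'I_3 * 'I_3) :=
  @spatial_rep R l K (w im.1) [:: im.2] (mw im.1) K0 (sw im.1) l3.
pose d i m := d' (i, m); have hd i m := hd' (i, m).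
have [C1 C10 b1] : exists2 C : R, 0 <= C & forall i z, `|v i z| <= C.
  by apply: finite_bound => i; have [_ ? _] := hv i.
have [C2 C20 b2] : exists2 C : R, 0 <= C & forall (im : 'I_3 * 'I_3) z, `|d im.1 im.2 z| <= C.
  by apply: (finite_bound (f := fun im : 'I_3 * 'I_3 => d im.1 im.2)) => im; have [_ ? _] := hd im.1 im.2.
pose C := C1 + C2; have C0 : 0 <= C by rewrite addr_ge0.
have bv i z : `|v i z| <= C by rewrite (le_trans (b1 i z))// lerDl.
have bd i m z : `|d i m z| <= C by rewrite (le_trans (b2 (i, m) z))// lerDr.
have mv i : measurable_fun setT (v i) by have [? _ _] := hv i.
have md i m : measurable_fun setT (d i m) by have [? _ _] := hd i m.
have vw i t g : measurable_fun setT g -> loc3 g -> mollified_deriv [::] (slice (w i) t) g ->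
    {ae mu3 R, forall x, v i (x, t) = g x} by have [_ _ H] := hv i; exact: H.
have dw i m t g : measurable_fun setT g -> loc3 g -> mollified_deriv [:: m] (slice (w i) t) g ->
    {ae mu3 R, forall x, d i m (x, t) = g x} by have [_ _ H] := hd i m; exact: H.
have st J : stage T l v J.
  apply: (stage_all l4 (fun k s => @viscosity_half_derive R G k s hG) mv md C0 bv bd) => [i t|i m t|i s e t|i m e s j z|e s j z|e s j i m z].
  - exact: (rep_sqnorm good mv vw).
  - exact: (rep_grad_sqnorm l4 good md dw).
  - exact: (rep_mollified_sqnorm good mv bv vw).
  - exact: (rep_grad_mollified l4 good mv md bv bd vw dw).
  - exact: (rep_div_mollified l4 good mv md bv bd vw dw).
  - move=> e0 ez; exact: (rep_momentum hG l4 mN N0 good hp hm mv md C0 bv bd vw dw e0 ez).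
have /choice[h hh] i : exists h : E3t R -> R, {ae mu4 R, forall z, slab T z -> h z = v i z} /\
  forall s j, (size s + 2 * j <= l - 2)%N ->
    pderivable_on (slab T) (map (dir_x R) s ++ nseq j (dir_t R)) h /\
    hoelder_xt 2^-1 T (pderiv (map (dir_x R) s ++ nseq j (dir_t R)) h).
  apply: (limit_regularity (mv i) C0 (bv i)) => s j sj.
  apply: X_mollified; first exact: loc4_bounded (mv i) (bv i).
  (* Hoelder continuity of a derivative of weight at most l - 2 takes two further space derivatives
     or one time derivative; the total weight stays within l, with at most 1 + j derivatives in
     time. *)
  move=> s' j' h1 h2; apply: (st (1 + j)%N) => //.
  by rewrite (leq_trans h1)// (leq_trans (leq_add (leqnn 2) sj))// subnKC.
exists h => i; have [hv_ hr] := hh i; split; last first.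
  move=> a b /andP[ba al] s; apply: hr; rewrite size_tuple -mulnDr subnK//.
  by rewrite (leq_trans (leq_mul (leqnn 2) al))// mul2n -[leqRHS]odd_double_half leq_addl.
(* The chain u = w = v = h holds almost everywhere in the slab: off the null set of times, by
   agreement on every slice, and by the L^1 limit, respectively. *)
have vw_ : {ae mu4 R, forall z, v i z = w i z}.
  apply: (ae_slices (mv i) (mw i)) => t; have [lw _] := sw i t; apply: (vw i t (slice (w i) t)) => //.
  by case: lw.
have NT := ae_times mN N0.
suff : {ae mu4 R, forall z, slab T z -> u i z = h i z} by [].
apply: (ae_imp2 _ hv_ (ae_imp2 (fun z a b => conj a b) vw_ NT)) => z hz [vz Nz] zT.
rewrite hz// vz /w /cleaned patchE mem_set//.
Qed.
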